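(* Let $m\ge2$ be even and let $v$ be a nonsplit finite place of $F$ such that $\pi_{h,v}$ is supercuspidal and $\pi_{h,v}\simeq\pi_{h,v}\otimes\chi_v$. For every $\delta\in\{\pm1\}$ and $S_v\in F_v^\times$, there is an isomorphism of $G_m(F_v)$-representations $$\mathrm{FJ}_{S_v}(\Theta_{m+1,v}^{\delta})\simeq\Theta_{m,v}^{\delta\chi_v(S_v)}.$$
   Context: $F$ is totally real, $E/F$ CM with conjugation $c$; $E_v=E\otimes_FF_v$ is a quadratic field extension of $F_v$, $\chi_v$ its quadratic character, $\psi_v$ the local component at $v$ of the standard additive character $\psi_{\mathbb Q}\circ\mathrm{Tr}_{F/\mathbb Q}$. $h$ is a normalized primitive Hilbert Hecke eigenform over $F$, $\pi_h=\bigotimes'\pi_{h,v}$ the associated automorphic representation of $\mathrm{GL}_2(\mathbb A_F)$, with central character $\omega_h$. $\chi_-$ and $\vartheta^+$ are unitary Hecke characters of $E$ with $\chi_-|_{\mathbb A_F^\times}=\chi_{E/F}$, $\vartheta^+|_{\mathbb A_F^\times}=\omega_h$; $\vartheta^-=\vartheta^+\chi_-^{-1}$; $\vartheta_n=\vartheta^+$ for $n$ odd and $\vartheta^-$ for $n$ even, with local components $\vartheta_{n,v}$. $\lambda^c(x)=\lambda(x^c)$; $A^*={}^tA^c$; $\mathrm{Her}_n(F_v)$ is the space of Hermitian matrices in $M_n(E_v)$. **Groups.** $G_n(F_v)=\{g\in\mathrm{GL}_{2n}(E_v):g^*J_ng=J_n\}$, $J_n=\begin{pmatrix}0&1_n\\-1_n&0\end{pmatrix}$;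 $m_n(A)=\mathrm{diag}(A,(A^* )^{-1})$, $n_n(Z)=\begin{pmatrix}1&Z\\0&1\end{pmatrix}$. In $G_{m+1}(F_v)$ (block sizes $1,m,1,m$) $$u(X,Y,t)=\begin{pmatrix}1&X&t+XY^*&Y\\0&1_m&Y^*&0\\0&0&1&0\\0&0&-X^*&1_m\end{pmatrix},$$ $U=U_{m+1,1}(F_v)=\{u(X,Y,t):X,Y\in M_{1,m}(E_v),t\in F_v\}$; $G_m(F_v)$ embeds in $G_{m+1}(F_v)$ by acting on the 2nd and 4th blocks. **Fourier–Jacobi module.** $\omega_{S_v}$ is the Weil representation of $U\rtimes G_m(F_v)$ on $\mathcal S(M_{1,m}(E_v))$ determined by $(\omega_{S_v}(u(X,Y,t))\Phi)(x)=\psi_v(S_vt+\mathrm{Tr}_{E_v/F_v}(S_v(x+X)Y^* ))\Phi(x+X)$ and $(\omega_{S_v}(m_m(A))\Phi)(x)=\chi_{-,v}(\det A)|\det A|_{E_v}^{1/2}\Phi(xA)$. For a smooth representation $\rho_v$ of $G_{m+1}(F_v)$, $\mathrm{FJ}_{S_v}(\rho_v)=(\rho_v\otimes\overline{\omega_{S_v}})_{U}$, the maximal quotient on which the diagonal action of $U$ is trivial; it is a $G_m(F_v)$-representation. **Theta lifts.** Choose a character $\theta_v\ne\theta_v^c$ of $E_v^\times$ (equivalently of $W_{E_v}$) such that the Langlands parameter of $\pi_{h,v}$ is $\mathrm{Ind}_{W_{E_v}}^{W_{F_v}}\theta_v$. Put $\gamma_v=\theta_v(\theta_v^c)^{-1}$;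 it is trivial on $F_v^\times$, and $\gamma_v^\natural$ is the character of $E_v^1=\ker N_{E_v/F_v}$ with $\gamma_v^\natural(x/x^c)=\gamma_v(x)$. For $n\in\{m,m+1\}$ put $\lambda_{n,v}=((\vartheta_{n,v})^c)^{-1}\theta_v^c$ (so $\lambda_{n,v}|_{F_v^\times}=\chi_v^n$). For a nondegenerate $n$-dimensional Hermitian space $V$ over $E_v$ with Gram matrix $A$ put $\epsilon_{n,v}(V)=\chi_v((-1)^{n(n-1)/2}\det A)$; $V_{n,v}^\delta$ is the space (unique up to isometry) with $\epsilon_{n,v}=\delta$. $W_{2n,v}$ is the skew-Hermitian space with Gram matrix $J_n$, so $\mathrm U(W_{2n,v})=G_n(F_v)$. $\Omega(V,W_{2n,v};\lambda_{n,v},\mathbf 1)$ is the Weil representation of $\mathrm U(V)\times G_n(F_v)$ for $\psi_v$ with splitting characters $(\chi_V,\chi_W)=(\lambda_{n,v},\mathbf1)$ (Gan–Ichino convention); on $\mathcal S(V^n)$ it is given by $(h\Phi)(x)=\Phi(h^{-1}x)$ for $h\in\mathrm U(V)$, $(m_n(A)\Phi)(x)=\lambda_{n,v}(\det A)|\det A|_{E_v}^{n/2}\Phi(xA)$, $(n_n(Z)\Phi)(x)=\psi_v(\mathrm{Tr}(Q(x)Z))\Phi(x)$, with $Q(x)=((x_i,x_j)_V)_{i,j}$ (form conjugate-linear in the first variable). Finally $$\Theta_{n,v}^\delta=\bigl(\Omega(V_{n,v}^\delta,W_{2n,v};\lambda_{n,v},\mathbf1)\otimes(\gamma_v^\natural\circ\det)^\vee\bigr)_{\mathrm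 U(V_{n,v}^\delta)},$$ the big theta lift of $\gamma_v^\natural\circ\det$ to $G_n(F_v)$. *)

(* Defs.v *)
From HB Require Import structures.
From mathcomp Require Import all_boot all_order all_algebra all_field.
From mathcomp Require Import all_classical all_reals all_analysis.
From mathcomp Require Import complex.

Set Implicit Arguments.
Unset Strict Implicit.
Unset Printing Implicit Defensive.

Import Order.TTheory GRing.Theory Num.Theory.

Local Open Scope classical_set_scope.
Local Open Scope complex_scope.
Local Open Scope ring_scope.

Definition cis (R : realType) (t : R) : R[i] := cos t +i* sin t.

Definition mx2 (T : pzRingType) (a b c d : T) : 'M[T]_2 :=
  \matrix_(i < 2, j < 2)
    if i == 0 then (if j == 0 then a else b) else (if j == 0 then c else d).

Section Representations.
Context {R : realType}.
Implicit Types V W T P : lmodType R[i].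

Definition lspan V (B : set V) : set V :=
  [set v | exists k (a : 'I_k -> R[i]) (u : 'I_k -> V),
     (forall j, B (u j)) /\ v = \sum_j a j *: u j].

Definition is_submodule V (W : set V) : Prop :=
  [/\ W 0, (forall u v, W u -> W v -> W (u + v))
    & forall a u, W u -> W (a *: u)].

(* Groups are sets of invertible matrices; [rho g] is only meaningful for
   [g] in the group [G]. *)
Definition is_rep (K : fieldType) (n : nat) (G : set 'M[K]_n)
    V (rho : 'M[K]_n -> V -> V) : Prop :=
  [/\ forall g, G g -> linear (rho g),
      forall v, rho 1%:M v = v
    & forall g h v, G g -> G h -> rho (g *m h) v = rho g (rho h v)].

Definition rep_iso (K : fieldType) (n : nat) (G : set 'M[K]_n)
    V W (rho : 'M[K]_n -> V -> V) (sigma : 'M[K]_n -> W -> W) : Prop :=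
  exists f : V -> W, [/\ linear f, bijective f
    & forall g v, G g -> f (rho g v) = sigma g (f v)].

(* [p] is the quotient map by the subspace spanned by [B]. *)
Definition is_quotient V W (B : set V) (p : V -> W) : Prop :=
  [/\ linear p, (forall w, exists v, p v = w)
    & forall v, p v = 0 <-> lspan B v].

Definition is_bilinear V W P (f : V -> W -> P) : Prop :=
  (forall w, linear (fun v => f v w)) /\ (forall v, linear (f v)).

Definition is_tensor V W T (b : V -> W -> T) : Prop :=
  is_bilinear b /\
  forall P (f : V -> W -> P), is_bilinear f ->
    exists2 g : T -> P,
      linear g /\ (forall v w, g (b v w) = f v w) &
      forall g' : T -> P, linear g' /\ (forall v w, g' (b v w) = f v w) ->
        g' =1 g.

End Representations.

Record vfield (R : realType) := VField {
  vsort :> fieldType;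
  vabs : vsort -> R }.

Section ValuedField.
Context {R : realType} (K : vfield R).
Local Notation C := R[i].

Definition uniformizer (p : K) : Prop :=
  [/\ 0 < vabs p, vabs p < 1 & forall x : K, vabs x < 1 -> vabs x <= vabs p].

Definition transversal (A : set K) (r : K -> K -> Prop) (s : seq K) : Prop :=
  [/\ uniq s, (forall u, u \in s -> A u)
    & forall x, A x -> exists! u, u \in s /\ r x u].

Definition residue_reps (s : seq K) : Prop :=
  transversal [set x | vabs x <= 1] (fun x y => vabs (x - y) < 1) s.

(* The normalized absolute value q^(-ord x); [vabs] itself extends the
   standard p-adic absolute value. *)
Definition nabs (x : K) : R :=
  xget 0 [set r | exists (p : K) (s : seq K) (n : int),
    [/\ uniformizer p, residue_reps s, vabs x = vabs p ^ n
      & r = ((size s)%:R : R) ^ (- n)]].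

(* Continuous homomorphisms from the unit group to nonzero complex numbers. *)
Definition quasichar (theta : K -> C) : Prop :=
  [/\ forall x, x != 0 -> theta x != 0,
      forall x y, x != 0 -> y != 0 -> theta (x * y) = theta x * theta y
    & exists2 e : R, 0 < e & forall x, vabs (x - 1) < e -> x != 0 -> theta x = 1].

Definition trivial_on_units (theta : K -> C) (r : R) : Prop :=
  forall u, vabs u = 1 -> vabs (u - 1) <= r -> theta u = 1.

(* [e] is Tate's local constant epsilon(1/2, theta, psi) for the self-dual
   measure, written as the Gauss sum
     q^(-a/2) \sum_(u in O^x / U^a) theta (u / c)^-1 psi (u / c),
   where a is the conductor exponent of theta, n the largest integer with psi
   trivial on the elements of order >= -n, and ord c = a + n. *)
Definition is_local_eps (theta psi : K -> C) (e : C) : Prop :=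
  exists (p : K) (s t : seq K) (a : nat) (n : int) (c : K),
  [/\ uniformizer p /\ residue_reps s,
      trivial_on_units theta (vabs p ^+ a) /\
        (forall b : nat, trivial_on_units theta (vabs p ^+ b) -> (a <= b)%N),
      (forall x, vabs x <= vabs p ^ (- n) -> psi x = 1) /\
        (exists2 x, vabs x <= vabs p ^ (- n - 1) & psi x != 1),
      vabs c = vabs p ^ (a%:Z + n) /\
        transversal [set u | vabs u = 1]
          (fun x y => vabs (x - y) <= vabs p ^+ a) t
    & e = ((Num.sqrt ((size s)%:R ^+ a))^-1)%:C *
          \sum_(u <- t) (theta (u / c))^-1 * psi (u / c)].

(* Locally constant, compactly supported functions on the unit group. *)
Definition mult_test (f : K -> C) : Prop :=
  (forall x, x != 0 -> exists2 e : R, 0 < e &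
     forall y, vabs (y - x) < e -> f y = f x) /\
  (exists a b : R, 0 < a /\
     forall x, x != 0 -> f x != 0 -> a <= vabs x /\ vabs x <= b).

(* Haar integrals on the unit group, up to a scalar. *)
Definition mult_haar (I : (K -> C) -> C) : Prop :=
  [/\ forall f g, mult_test f -> mult_test g ->
        I (fun x => f x + g x) = I f + I g,
      forall a f, mult_test f -> I (fun x => a * f x) = a * I f,
      forall f g, mult_test f -> mult_test g ->
        (forall x, x != 0 -> f x = g x) -> I f = I g
    & forall b f, b != 0 -> mult_test f -> I (fun x => f (b * x)) = I f].

End ValuedField.

Section Schwartz.
Context {R : realType} (K : vfield R) (r k : nat).
Local Notation fspace := ('M[K]_(r, k) -> (R[i] : lmodType R[i])).

Definition is_schwartz (f : fspace) : Prop :=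
  (forall x, exists2 e : R, 0 < e &
     forall y : 'M[K]_(r, k),
       (forall i j, vabs ((y - x) i j) < e) -> f y = f x) /\
  (exists B : R, forall x : 'M[K]_(r, k),
     f x != 0 -> forall i j, vabs (x i j) <= B).

Definition schwartz_pred : {pred fspace} := fun f => `[< is_schwartz f >].

Fact schwartz_submod_closed : submod_closed schwartz_pred.
Proof.
split.
  apply/asboolP; split; first by move=> x; exists 1.
  by exists 0 => x; rewrite eqxx.
move=> a f g /asboolP[fc [B fB]] /asboolP[gc [B' gB']]; apply/asboolP; split.
  move=> x; have [e e0 he] := fc x; have [e' e'0 he'] := gc x.
  exists (Num.min e e'); first by rewrite lt_min e0.
  move=> y hy.
  have Hf : f y = f x.
    by apply: he => i j; apply: lt_le_trans (hy i j) _; rewrite ge_min lexx.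
  have Hg : g y = g x.
    by apply: he' => i j; apply: lt_le_trans (hy i j) _; rewrite ge_min lexx orbT.
  by rewrite /GRing.add /GRing.scale /= Hf Hg.
exists (Num.max B B') => x hx i j; rewrite le_max.
have [f0|f0] := eqVneq (f x) 0; last by rewrite fB.
have [g0|g0] := eqVneq (g x) 0; last by rewrite gB' ?orbT.
by move: hx; rewrite [X in X != _](_ : _ = a *: f x + g x) // f0 g0 scaler0 addr0 eqxx.
Qed.

HB.instance Definition _ :=
  GRing.isSubmodClosed.Build R[i] fspace schwartz_pred schwartz_submod_closed.

Record schwartz := Schwartz {
  sfun :> 'M[K]_(r, k) -> (R[i] : lmodType R[i]);
  _ : sfun \in schwartz_pred }.

HB.instance Definition _ := [isSub for sfun].
HB.instance Definition _ := [Choice of schwartz by <:].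
HB.instance Definition _ := [SubChoice_isSubLmodule of schwartz by <:].

Fact sconj_subproof (f : schwartz) :
  ((fun x => (f x)^*) : fspace) \in schwartz_pred.
Proof.
case: f => f /= /asboolP[fc [B fB]]; apply/asboolP; split.
  move=> x; have [e e0 he] := fc x; exists e => // y hy.
  by rewrite he.
by exists B => x hx; apply: fB; apply: contra hx => /eqP ->; rewrite conjC0.
Qed.

Definition sconj (f : schwartz) : schwartz := Schwartz (sconj_subproof f).

End Schwartz.

(* One absolute value per finite place: the one with |p| = 1/p for the
   residue characteristic p. *)
Definition is_finplace (R : realType) (M : fieldType) (w : M -> R) : Prop :=
  [/\ forall x, w x = 0 <-> x = 0,
      forall x y, w (x * y) = w x * w y,
      forall x y, w (x + y) <= Num.max (w x) (w y)
    & exists2 p : nat, prime p & w p%:R = p%:R^-1].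

Record finplace (R : realType) (M : fieldType) := Finplace {
  place_abs :> M -> R;
  finplaceP : is_finplace place_abs }.

HB.instance Definition _ (R : realType) (M : fieldType) :=
  gen_eqMixin (finplace R M).
HB.instance Definition _ (R : realType) (M : fieldType) :=
  gen_choiceMixin (finplace R M).

Record completion (R : realType) (M : fieldType) (w : finplace R M) :=
  Completion {
    cfield :> vfield R;
    cinj : {rmorphism M -> cfield};
    cabs_eq0 : forall x : cfield, vabs x = 0 <-> x = 0;
    cabsM : forall x y : cfield, vabs (x * y) = vabs x * vabs y;
    cabsD : forall x y : cfield, vabs (x + y) <= Num.max (vabs x) (vabs y);
    cabs_inj : forall x : M, vabs (cinj x) = w x;
    cdense : forall (x : cfield) (e : R), 0 < e ->
      exists f : M, vabs (cinj f - x) < e;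
    ccomplete : forall u : nat -> cfield,
      (forall e : R, 0 < e -> exists N : nat, forall i j : nat,
         (N <= i)%N -> (N <= j)%N -> vabs (u i - u j) < e) ->
      exists l : cfield, forall e : R, 0 < e -> exists N : nat,
        forall i : nat, (N <= i)%N -> vabs (u i - l) < e }.

Notation completions R M := (forall w : finplace R M, completion w).

Section Places.
Context {R : realType} {M N : fieldType} (j : {rmorphism M -> N}).

Fact res_subproof (w : finplace R N) : is_finplace (fun x => w (j x)).
Proof.
case: (finplaceP w) => w0 wM wD [p pp wp]; split.
- move=> x; rewrite w0; split=> [/eqP|->]; last exact: rmorph0.
  by rewrite fmorph_eq0 => /eqP.
- by move=> x y; rewrite rmorphM wM.
- by move=> x y; rewrite rmorphD wD.
- by exists p => //; rewrite rmorph_nat.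
Qed.

Definition res (w : finplace R N) : finplace R M := Finplace (res_subproof w).

(* The continuous extension of [j] to completions. *)
Definition ext_map (v : finplace R M) (w : finplace R N)
    (Mv : completion v) (Nw : completion w) (x : Mv) : Nw :=
  xget 0 [set y | forall e : R, 0 < e -> exists f : M,
    vabs (cinj Mv f - x) < e /\ vabs (cinj Nw (j f) - y) < e].

End Places.

Section Ideles.
Context {R : realType} {M : fieldExtType rat} (Mv : completions R M).
Local Notation C := R[i].

(* The archimedean part lives in M \otimes Real, seen inside the product of
   copies of the complex numbers indexed by all complex embeddings. *)
Definition idele : Type :=
  ({rmorphism M -> C} -> C) * (forall w : finplace R M, Mv w).

Definition is_idele (z : idele) : Prop :=
  [/\ forall s, z.1 s != 0,
      forall s s' : {rmorphism M -> C},
        (forall x, s' x = (s x)^*) -> z.1 s' = (z.1 s)^*,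
      forall w, z.2 w != 0
    & finite_set [set w | vabs (z.2 w) != 1]].

Definition idele_mul (y z : idele) : idele :=
  (fun s => y.1 s * z.1 s, fun w => y.2 w * z.2 w).

Definition idele_prin (x : M) : idele :=
  (fun s : {rmorphism M -> C} => s x, fun w => cinj (Mv w) x).

Definition idele_at (w : finplace R M) (a : Mv w) : idele :=
  (fun=> 1, eqtype.dfwith (fun w' : finplace R M => 1 : Mv w') a).

Definition hecke_char (chi : idele -> C) : Prop :=
  [/\ forall z, is_idele z -> chi z != 0,
      forall y z, is_idele y -> is_idele z ->
        chi (idele_mul y z) = chi y * chi z,
      forall x : M, x != 0 -> chi (idele_prin x) = 1
    & forall e : R, 0 < e -> exists (d : R) (S : set (finplace R M)),
        [/\ 0 < d, finite_set S
          & forall z, is_idele z -> (forall s, `|z.1 s - 1| < d%:C) ->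
              (forall w, vabs (z.2 w) = 1) ->
              (forall w, S w -> vabs (z.2 w - 1) < d) ->
              `|chi z - 1| < e%:C]].

Definition unitary_char (chi : idele -> C) : Prop :=
  forall z, is_idele z -> `|chi z| = 1.

Definition loc_comp (chi : idele -> C) (w : finplace R M) : Mv w -> C :=
  fun a => chi (idele_at a).

End Ideles.

Definition idele_map (R : realType) (M N : fieldExtType rat)
    (j : {rmorphism M -> N}) (Mv : completions R M) (Nw : completions R N)
    (z : idele Mv) : idele Nw :=
  (fun s : {rmorphism N -> R[i]} => z.1 (s \o j : {rmorphism M -> R[i]}),
   fun w => ext_map j (Nw w) (z.2 (res j w))).

Definition totally_real (R : realType) (F : fieldExtType rat) : Prop :=
  forall (s : {rmorphism F -> R[i]}) (x : F), complex.Im (s x) = 0.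

(* E / F is a totally imaginary quadratic extension of a totally real field,
   with nontrivial automorphism [c]. *)
Definition CM_extension (R : realType) (F E : fieldExtType rat)
    (incl : {rmorphism F -> E}) (c : {rmorphism E -> E}) : Prop :=
  [/\ totally_real R F,
      \dim {: E} = (2 * \dim {: F})%N,
      forall s : {rmorphism E -> R[i]}, exists x, complex.Im (s x) != 0,
      forall x, c (incl x) = incl x
    & exists x, c x != x].

(* The quadratic character of the ideles of F attached to E / F by class field
   theory: its kernel is the index-two subgroup F^x N(A_E^x). *)
Definition quad_idele_char (R : realType) (F E : fieldExtType rat)
    (incl : {rmorphism F -> E}) (c : {rmorphism E -> E})
    (Fv : completions R F) (Ew : completions R E) (x : idele Fv) : R[i] :=
  if `[< exists (f : F) (y : idele Ew),
           [/\ f != 0, is_idele y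
             & idele_map incl Ew x =
               idele_mul (idele_prin Ew (incl f))
                         (idele_mul y (idele_map c Ew y))] >]
  then 1 else -1.

Section AdditiveCharacter.
Context {R : realType} {M : fieldType} (w : finplace R M) (K : completion w).

(* The closure of the rationals in [K], that is, the field of p-adic numbers. *)
Definition Qp_in : set K :=
  [set a | forall e : R, 0 < e -> exists r : rat, vabs (ratr r - a) < e].

(* [t] is the trace from [K] to the p-adic numbers of [x]. *)
Definition is_Qp_trace (x t : K) : Prop :=
  exists (n : nat) (b : 'I_n -> K) (T : 'M[K]_n),
  [/\ forall y, exists! a : 'rV[K]_n,
        (forall i, Qp_in (a 0 i)) /\ y = \sum_i a 0 i * b i,
      forall i k, Qp_in (T i k),
      forall i, x * b i = \sum_k T i k * b k
    & t = \tr T].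

(* x |-> exp(- 2 pi i {Tr x}), {.} being the p-adic fractional part; the sign
   is the one making the archimedean components exp(2 pi i x). *)
Definition std_char (x : K) : R[i] :=
  xget 1 [set z | exists (t : K) (r : rat) (p k : nat),
    [/\ is_Qp_trace x t,
        prime p /\ vabs (p%:R : K) < 1,
        r * p%:R ^+ k \is a Num.int,
        vabs (t - ratr r) <= 1
      & z = cis (- (2 * pi * ratr r))]].

End AdditiveCharacter.

Section HilbertForms.
Context {R : realType} {F : fieldExtType rat} (Fv : completions R F).
Context {d : nat} (tau : 'I_d -> {rmorphism F -> R}).
Local Notation C := R[i].

Definition all_real_embeddings : Prop :=
  (forall s : {rmorphism F -> R}, exists j, tau j =1 s) /\
  (forall j j', tau j =1 tau j' -> j = j').

Definition gl2_fin : Type := forall v : finplace R F, 'M[Fv v]_2.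
Definition gl2_ad : Type := ('I_d -> 'M[R]_2) * gl2_fin.

Definition is_gl2_integral (v : finplace R F) (x : 'M[Fv v]_2) : Prop :=
  (forall i k, vabs (x i k) <= 1) /\ vabs (\det x) = 1.

Definition is_gl2_fin (g : gl2_fin) : Prop :=
  (forall v, g v \in unitmx) /\ finite_set [set v | ~ is_gl2_integral (g v)].

Definition is_gl2_ad (g : gl2_ad) : Prop :=
  (forall j, g.1 j \in unitmx) /\ is_gl2_fin g.2.

Definition gl2_mul (g h : gl2_ad) : gl2_ad :=
  (fun j => g.1 j *m h.1 j, fun v => g.2 v *m h.2 v).

Definition gl2_prin (x : 'M[F]_2) : gl2_ad :=
  (fun j => map_mx (tau j) x, fun v => map_mx (cinj (Fv v)) x).

Definition gl2_at (v : finplace R F) (x : 'M[Fv v]_2) : gl2_ad :=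
  (fun=> 1%:M, eqtype.dfwith (fun v' : finplace R F => 1%:M : 'M[Fv v']_2) x).

Definition gl2_scalar (z : idele Fv) : gl2_ad :=
  (fun j => (complex.Re (z.1 (real_complex R \o tau j : {rmorphism F -> C})))%:M,
   fun v => (z.2 v)%:M).

Definition gl2_rot (t : 'I_d -> R) : gl2_ad :=
  (fun j => mx2 (cos (t j)) (sin (t j)) (- sin (t j)) (cos (t j)),
   fun=> 1%:M).

(* The compact open subgroup K_1(n), n = \prod_v v^(N v). *)
Definition K1_level (N : finplace R F -> nat) (g : gl2_ad) : Prop :=
  (forall j, g.1 j = 1%:M) /\
  forall v, is_gl2_integral (g.2 v) /\
    forall p : Fv v, uniformizer p ->
      vabs (g.2 v 1 0) <= vabs p ^+ N v /\
      vabs (g.2 v 1 1 - 1) <= vabs p ^+ N v.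

(* The function on the d-fold product of upper half planes attached to the
   finite component [gf]. *)
Definition uhp_fun (k : 'I_d -> nat) (phi : gl2_ad -> C) (gf : gl2_fin)
    (z : 'I_d -> C) : C :=
  (\prod_j ((Num.sqrt (complex.Im (z j)))^-1 ^+ k j)%:C) *
  phi (fun j => mx2 (complex.Im (z j)) (complex.Re (z j)) 0 1, gf).

Definition in_uhp (z : 'I_d -> C) : Prop := forall j, 0 < complex.Im (z j).

Definition holomorphic_uhp (f : ('I_d -> C) -> C) : Prop :=
  (forall z, in_uhp z -> forall e : R, 0 < e -> exists2 r : R, 0 < r &
     forall z', in_uhp z' -> (forall j, `|z' j - z j| < r%:C) ->
       `|f z' - f z| < e%:C) /\
  (forall z j, in_uhp z -> exists l : C,
     forall e : R, 0 < e -> exists2 r : R, 0 < r &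
       forall a : C, a != 0 -> `|a| < r%:C ->
         `|(f (dfwith z j (z j + a)) - f z) / a - l| < e%:C).

Definition vanishes_at_infinity (f : ('I_d -> C) -> C) : Prop :=
  forall e : R, 0 < e -> exists Y : R, forall z,
    in_uhp z -> (forall j, Y <= complex.Im (z j)) -> `|f z| < e%:C.

(* Holomorphic cusp forms of weight [k], level K_1(n) and central character
   [omega], in the unitary normalization; the cusps are the classes of finite
   components [gf]. *)
Definition hilbert_cuspform (N : finplace R F -> nat) (k : 'I_d -> nat)
    (omega : idele Fv -> C) (phi : gl2_ad -> C) : Prop :=
  [/\ (forall x g, x \in unitmx -> is_gl2_ad g ->
         phi (gl2_mul (gl2_prin x) g) = phi g),
      (forall g u, is_gl2_ad g -> K1_level N u -> phi (gl2_mul g u) = phi g),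
      (forall g t, is_gl2_ad g ->
         phi (gl2_mul g (gl2_rot t)) = cis (\sum_j (k j)%:R * t j) * phi g),
      (forall z g, is_idele z -> is_gl2_ad g ->
         phi (gl2_mul (gl2_scalar z) g) = omega z * phi g)
    & forall gf, is_gl2_fin gf ->
        holomorphic_uhp (uhp_fun k phi gf) /\
        vanishes_at_infinity (uhp_fun k phi gf)].

(* phi is an eigenform, with eigenvalues [a v], of the Hecke operators
   attached to diag(p_v, 1) for the places v not dividing the level. *)
Definition hecke_eigen (N : finplace R F -> nat) (a : finplace R F -> C)
    (phi : gl2_ad -> C) : Prop :=
  forall (v : finplace R F) (p : Fv v) (s : seq (Fv v)) (g : gl2_ad),
    N v = 0%N -> uniformizer p -> residue_reps s -> is_gl2_ad g ->
    \sum_(u <- s) phi (gl2_mul g (gl2_at (mx2 p u 0 1))) +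
      phi (gl2_mul g (gl2_at (mx2 1 0 0 p))) = a v * phi g.

(* Primitive eigenforms of exact level N: the system of eigenvalues does not
   occur at any proper divisor of the level.  The normalization of the first
   Fourier coefficient only fixes the scalar multiple of phi; it does not affect
   the automorphic representation generated by phi and is not imposed. *)
Definition primitive_eigenform (N : finplace R F -> nat) (k : 'I_d -> nat)
    (omega : idele Fv -> C) (phi : gl2_ad -> C) : Prop :=
  [/\ finite_set [set v | N v != 0%N] /\ (forall j, (0 < k j)%N),
      hecke_char omega /\
        (forall z, is_idele z -> (forall v, z.2 v = 1) ->
           (forall j, 0 < complex.Re
              (z.1 (real_complex R \o tau j : {rmorphism F -> C}))) ->
           omega z = 1),
      hilbert_cuspform N k omega phi,
      exists2 g, is_gl2_ad g & phi g != 0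
    & exists2 a : finplace R F -> C, hecke_eigen N a phi &
        forall (N' : finplace R F -> nat) (phi' : gl2_ad -> C),
          (forall v, (N' v <= N v)%N) -> N' <> N ->
          hilbert_cuspform N' k omega phi' -> hecke_eigen N a phi' ->
          forall g, is_gl2_ad g -> phi' g = 0].

(* [pi] is isomorphic to the local component at [v] of the automorphic
   representation generated by the primitive form [phi]: since [phi] is a pure
   tensor, this component is realized on the span of the right translates of
   [phi] under GL_2(F_v). *)
Definition local_component (phi : gl2_ad -> C) (v : finplace R F)
    (V : lmodType C) (pi : 'M[Fv v]_2 -> V -> V) : Prop :=
  is_rep [set x | x \in unitmx] pi /\
  exists (v0 : V) (j : V -> gl2_ad -> C),
  [/\ (forall a u u' g, is_gl2_ad g -> j (a *: u + u') g = a * j u g + j u' g),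
      (forall u, (forall g, is_gl2_ad g -> j u g = 0) -> u = 0),
      (forall x u g, x \in unitmx -> is_gl2_ad g ->
         j (pi x u) g = j u (gl2_mul g (gl2_at x))),
      (forall g, is_gl2_ad g -> j v0 g = phi g)
    & forall u, lspan [set pi x v0 | x in [set x | x \in unitmx]] u].

End HilbertForms.

Arguments gl2_ad {R F} Fv d.
Arguments gl2_fin {R F} Fv.
Arguments local_component {R F} Fv {d} phi v {V} pi.

Section Supercuspidal.
Context {R : realType} {K : vfield R} {V : lmodType R[i]}.
Variable pi : 'M[K]_2 -> V -> V.

Definition smooth_irreducible : Prop :=
  [/\ is_rep [set x | x \in unitmx] pi,
      forall v, exists2 e : R, 0 < e &
        forall x : 'M[K]_2, x \in unitmx ->
          (forall i j, vabs ((x - 1%:M) i j) < e) -> pi x v = v,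
      exists v : V, v != 0
    & forall W : set V, is_submodule W ->
        (forall x v, x \in unitmx -> W v -> W (pi x v)) ->
        (forall v, W v -> v = 0) \/ (forall v, W v)].

(* Irreducible with vanishing Jacquet module. *)
Definition supercuspidal : Prop :=
  smooth_irreducible /\
  forall v, lspan [set u | exists x v', u = pi (mx2 1 x 0 1) v' - v'] v.

Definition twist_by (chi : K -> R[i]) (x : 'M[K]_2) (v : V) : V :=
  chi (\det x) *: pi x v.

End Supercuspidal.

Record local_ext (R : realType) := LocalExt {
  lbase : vfield R;
  ltop : vfield R;
  lup : lbase -> ltop;
  lconj : ltop -> ltop;
  lpsi : lbase -> R[i] }.

Definition local_ext_at (R : realType) (F E : fieldExtType rat)
    (incl : {rmorphism F -> E}) (c : {rmorphism E -> E})
    (Fv : completions R F) (Ew : completions R E)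
    (v : finplace R F) (w : finplace R E) : local_ext R :=
  @LocalExt R (Fv v) (Ew w) (ext_map incl (Ew w)) (ext_map c (Ew w))
    (@std_char R F v (Fv v)).

Section Local.
Context {R : realType} (D : local_ext R).
Local Notation C := R[i].
Local Notation K := (lbase D).
Local Notation L := (ltop D).
Local Notation up := (@lup R D).
Local Notation cj := (@lconj R D).
Local Notation psi := (@lpsi R D).

Definition down (y : L) : K := xget 0 [set t | up t = y].
Definition trE (y : L) : K := down (y + cj y).
Definition normE (y : L) : K := down (y * cj y).

Definition quad_char (x : K) : C :=
  if `[< exists y : L, up x = y * cj y >] then 1 else -1.

Section GL2.
Context {V : lmodType C} (pi : 'M[K]_2 -> V -> V).

Definition whittaker (l : V -> C) : Prop :=
  (forall a u v, l (a *: u + v) = a * l u + l v) /\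
  (forall x v, l (pi (mx2 1 x 0 1) v) = psi x * l v).

(* The Langlands parameter of the supercuspidal [pi] is the representation
   induced from the character [theta] of the quadratic extension
   (theta != theta^c): the central character of [pi] is the determinant of the
   parameter, and for every twist by a quasi-character [eta] the local
   constants at s = 1/2 agree (this covers all s, as |.|^s is a
   quasi-character, and all the L-factors are 1).
   On the automorphic side epsilon is given by the functional equation of the
   zeta integrals of Whittaker functions; on the Galois side it is
   lambda(E/F, psi) epsilon(1/2, theta eta(N), psi(Tr)) by inductivity, with
   lambda(E/F, psi) = epsilon(1/2, chi_{E/F}, psi). *)
Definition parameter_is_induced (theta : L -> C) : Prop :=
  let omega x := quad_char x * theta (up x) in
  (forall x v, x != 0 -> pi x%:M v = omega x *: v) /\
  forall (eta : K -> C) (e1 e2 : C), quasichar eta ->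
    is_local_eps quad_char psi e1 ->
    is_local_eps (fun y => theta y * eta (normE y)) (fun y => psi (trE y)) e2 ->
    forall (l : V -> C) (I : (K -> C) -> C) (v : V),
      whittaker l -> mult_haar I ->
      I (fun a => l (pi (mx2 a 0 0 1 *m mx2 0 1 (-1) 0) v) *
                  (omega a * eta a)^-1) =
      e1 * e2 * I (fun a => l (pi (mx2 a 0 0 1) v) * eta a).

End GL2.

Definition hconj (r k : nat) (A : 'M[L]_(r, k)) : 'M[L]_(k, r) :=
  map_mx cj (A^T).

Definition hermitian (n : nat) (Z : 'M[L]_n) : Prop := hconj Z = Z.

Definition Jmx (n : nat) : 'M[L]_(n + n) := block_mx 0 1%:M (- 1%:M) 0.

Definition Ugrp (n : nat) : set 'M[L]_(n + n) :=
  [set g | hconj g *m Jmx n *m g = Jmx n].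
Arguments Ugrp n _ : clear implicits.

Definition siegel_m (n : nat) (A : 'M[L]_n) : 'M[L]_(n + n) :=
  block_mx A 0 0 (invmx (hconj A)).

Definition siegel_n (n : nat) (Z : 'M[L]_n) : 'M[L]_(n + n) :=
  block_mx 1%:M Z 0 1%:M.

Definition Vgrp (n : nat) (A : 'M[L]_n) : set 'M[L]_n :=
  [set h | h \in unitmx /\ hconj h *m A *m h = A].

(* A Gram matrix of the Hermitian space V_n^delta. *)
Definition gram_of_sign (n : nat) (delta : C) (A : 'M[L]_n) : Prop :=
  [/\ hermitian A, A \in unitmx
    & quad_char (down ((-1) ^+ 'C(n, 2) * \det A)) = delta].

Local Notation sqabs x := (Num.sqrt (@nabs R L x)).

(* The Schroedinger model on functions on V^n = M_n(E), of the Heisenberg group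
   of V \otimes W, whose elements are written (X, Y), X, Y in V^n; it is acted
   upon from the right by U(W). *)
Definition heisenberg (n : nat) (A X Y : 'M[L]_n) (f : 'M[L]_n -> C) :
    'M[L]_n -> C :=
  fun x => psi (trE (\tr (A *m x *m hconj Y)) +
                2%:R^-1 * trE (\tr (A *m X *m hconj Y))) * f (x + X).

(* The Weil representation of U(W_2n) on S(V^n), V with Gram matrix [A] and
   splitting character [lambda]: it intertwines the Heisenberg representation
   and is given by the usual formulas on the Siegel parabolic subgroup. *)
Definition weil_rep (n : nat) (A : 'M[L]_n) (lambda : L -> C)
    (Om : 'M[L]_(n + n) -> schwartz L n n -> schwartz L n n) : Prop :=
  [/\ is_rep (Ugrp n) Om,
      forall g (X Y X' Y' : 'M[L]_n) (Phi Phi' : schwartz L n n),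
        Ugrp n g -> row_mx X' Y' = row_mx X Y *m g ->
        Phi' =1 heisenberg A X' Y' Phi ->
        Om g Phi' =1 heisenberg A X Y (Om g Phi),
      forall (B : 'M[L]_n) (Phi : schwartz L n n) x, B \in unitmx ->
        Om (siegel_m B) Phi x =
        lambda (\det B) * (sqabs (\det B) ^+ n)%:C * Phi (x *m B)
    & forall (Z : 'M[L]_n) (Phi : schwartz L n n) x, hermitian Z ->
        Om (siegel_n Z) Phi x =
        psi (down (\tr (hconj x *m A *m x *m Z))) * Phi x].

(* The character of the norm-one group with value gamma x at x / x^c. *)
Definition natural_char (gamma : L -> C) (y : L) : C :=
  xget 1 [set z | exists2 x : L, x != 0 & y = x / cj x /\ z = gamma x].

Definition vartheta_char (n : nat) (thp chim : L -> C) (x : L) : C :=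
  if odd n then thp x else thp x * (chim x)^-1.

Definition lambda_char (n : nat) (thp chim theta : L -> C) (x : L) : C :=
  (vartheta_char n thp chim (cj x))^-1 * theta (cj x).

Definition gamma_char (theta : L -> C) (x : L) : C :=
  theta x * (theta (cj x))^-1.

(* [tau] is the big theta lift to U(W_2n) of the character nu(det) of U(V): the
   coinvariants under U(V) of Om \otimes (nu(det))^vee, where h in U(V) acts on
   S(V^n) by Phi(h^-1 x). *)
Definition is_theta_lift (n : nat) (A : 'M[L]_n) (lambda nu : L -> C)
    (Q : lmodType C) (tau : 'M[L]_(n + n) -> Q -> Q) : Prop :=
  exists (Om : 'M[L]_(n + n) -> schwartz L n n -> schwartz L n n)
         (p : schwartz L n n -> Q),
  [/\ weil_rep A lambda Om,
      is_quotient
        [set Psi : schwartz L n n | exists h (Phi : schwartz L n n), Vgrp A h /\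
           forall x, Psi x = (nu (\det h))^-1 * Phi (invmx h *m x) - Phi x] p
    & forall g Phi, Ugrp n g -> tau g (p Phi) = p (Om g Phi)].

Definition umx (m : nat) (X Y : 'rV[L]_m) (t : K) :
    'M[L]_((1 + m) + (1 + m)) :=
  block_mx (block_mx 1%:M X 0 1%:M)
           (block_mx ((up t)%:M + X *m hconj Y) Y (hconj Y) 0)
           0
           (block_mx 1%:M 0 (- hconj X) 1%:M).

Definition emb_mx (m : nat) (g : 'M[L]_(m + m)) : 'M[L]_((1 + m) + (1 + m)) :=
  block_mx (block_mx 1%:M 0 0 (ulsubmx g)) (block_mx 0 0 0 (ursubmx g))
           (block_mx 0 0 0 (dlsubmx g)) (block_mx 1%:M 0 0 (drsubmx g)).

Definition jacobi_group (m : nat) : set 'M[L]_((1 + m) + (1 + m)) :=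
  [set h | exists X Y t g, Ugrp m g /\ h = umx X Y t *m emb_mx g].
Arguments jacobi_group m _ : clear implicits.

Definition fj_weil_rep (m : nat) (S : K) (chi : L -> C)
    (om : 'M[L]_((1 + m) + (1 + m)) -> schwartz L 1 m -> schwartz L 1 m) :
    Prop :=
  [/\ is_rep (jacobi_group m) om,
      forall X Y t (Phi : schwartz L 1 m) x,
        om (umx X Y t) Phi x =
        psi (S * t + trE ((up S *: ((x + X) *m hconj Y)) 0 0)) * Phi (x + X)
    & forall (B : 'M[L]_m) (Phi : schwartz L 1 m) x, B \in unitmx ->
        om (emb_mx (siegel_m B)) Phi x =
        chi (\det B) * (sqabs (\det B))%:C * Phi (x *m B)].

(* [tau] is the G_m-representation (rho \otimes conj(om))_U on [Q]; the complex
   conjugate of [om] is realized on the same Schwartz space by conjugating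
   functions. *)
Definition is_fourier_jacobi (m : nat) (S : K) (chi : L -> C)
    (V : lmodType C) (rho : 'M[L]_((1 + m) + (1 + m)) -> V -> V)
    (Q : lmodType C) (tau : 'M[L]_(m + m) -> Q -> Q) : Prop :=
  exists (om : 'M[L]_((1 + m) + (1 + m)) -> schwartz L 1 m -> schwartz L 1 m)
         (T : lmodType C) (b : V -> schwartz L 1 m -> T) (p : T -> Q),
  let omc g Phi := sconj (om g (sconj Phi)) in
  [/\ fj_weil_rep S chi om,
      is_tensor b,
      is_quotient
        [set t | exists X Y s v Phi,
           t = b (rho (umx X Y s) v) (omc (umx X Y s) Phi) - b v Phi] p,
      is_rep (Ugrp m) tau
    & forall g v Phi, Ugrp m g ->
        tau g (p (b v Phi)) = p (b (rho (emb_mx g) v) (omc (emb_mx g) Phi))].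

End Local.

Arguments Ugrp {R} D n _.
Arguments jacobi_group {R} D m _.
Arguments quad_char {R} D _.
Arguments parameter_is_induced {R} D {V} pi theta.
Arguments gram_of_sign {R} D {n} delta A.
Arguments lambda_char {R} D n thp chim theta _.
Arguments gamma_char {R} D theta _.
Arguments natural_char {R} D gamma _.
Arguments is_theta_lift {R} D {n} A lambda nu {Q} tau.
Arguments is_fourier_jacobi {R} D {m} S chi {V} rho {Q} tau.

(* Main.v *)
(* By Witt's theorem the Gram matrix of V_{m+1} may be taken to be diag(S, A0),
   with e0 the first basis vector.  Write x in V^(1+m) as (x0 | x'), q for the
   Hermitian form and a(x) = S^-1 <x0, x'>.

   A U-invariant bilinear form in (Phi, phi) with Phi in S(V^(1+m)) and phi in
   S(E^m) is a linear form T in the function Phi (phi o a): the center of U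
   forces q(x0) = S and the elements u(0, Y, 0) force the argument of phi to be
   a(x).  Moreover T lives on {q(x0) = S} and is invariant under x' -> x' + x0 X.
   Integrating Phi (phi o a) along x' -> x' + x0 X at x0 = e0 gives a pairing with
   values in S(A0^m); it intertwines the Weil representations of U(W_2m): by
   uniqueness it does so up to a scalar for each group element, and this scalar
   is 1 on the generators m(B), n(Z), J.

   The hyperboloid X = {q = S} is a single U(V)-orbit with stabilizer U(A0) at
   e0.  Integrating the nu(det)-equivariant translates of this pairing, composed
   with the projection to Theta_m, over X gives the map FJ -> Theta_m.  The
   measure on X comes from a Haar measure on V restricted to |q/S - 1| < |2|^2,
   which is retracted to X by x -> x / sqrt(q(x)/S).  Since U(V) acts with open
   orbit maps on X, a (U(V), nu)-equivariant T is determined by its germ at e0,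
   where it is I_X times a functional that factors through Theta_m; this yields
   the inverse map. *)
Require Import Defs.
From HB Require Import structures.
From mathcomp Require Import all_boot all_order all_algebra all_field.
From mathcomp Require Import all_classical all_reals all_analysis.
From mathcomp Require Import complex.
From mathcomp Require Import ring lra.

Set Implicit Arguments.
Unset Strict Implicit.
Unset Printing Implicit Defensive.

Import Order.TTheory GRing.Theory Num.Theory numFieldNormedType.Exports.

Local Open Scope classical_set_scope.
Local Open Scope complex_scope.
Local Open Scope ring_scope.

(** * Nonarchimedean local fields and matrix norms *)

Section LocalField.
Context {R : realType}.

(** The analytic input is extracted from the given representations, since [std_char], [nabs] and
    [quad_char] are defined by choices that give no direct handle on it. The existence of a Weil
    representation forces [psi] to be additive, locally constant and nontrivial. The operator of [J]
    is a Fourier transform, so its value at 0 is a Haar functional; relations in the group then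
    yield moduli and the invariance under U(V). Multiplicativity of [quad_char], that is, index at
    most two of the norm group, is read off from the isomorphism of [pi] with its twist; it drives
    the classification of Hermitian forms. All modules are purely algebraic: functionals are
    controlled by their values on indicators of small balls, compactness makes radii uniform, and
    module-valued integrals go through the algebraic tensor product. Residue characteristic 2 is
    included, which is why square roots are taken within |2|^2 of 1. Open orbits require group
    elements near 1 that move e0 to a nearby point; a single reflection degenerates there, so a
    product of two is used. *)

Record local_field (K : vfield R) : Prop := LocalField {
  labs0 : forall x : K, vabs x = 0 <-> x = 0;
  labsM : forall x y : K, vabs (x * y) = vabs x * vabs y;
  labsD : forall x y : K, vabs (x + y) <= Num.max (vabs x) (vabs y);
  labs_ge0 : forall x : K, 0 <= vabs x;
  labs_complete : forall u : nat -> K,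
    (forall e : R, 0 < e -> exists N : nat, forall i j : nat,
       (N <= i)%N -> (N <= j)%N -> vabs (u i - u j) < e) ->
    exists l : K, forall e : R, 0 < e -> exists N : nat,
      forall i : nat, (N <= i)%N -> vabs (u i - l) < e;
  labs_cover : forall e : R, 0 < e -> exists s : seq K,
    forall x : K, vabs x <= 1 -> exists2 y, y \in s & vabs (x - y) < e;
  labs_small : exists p : nat, 0 < vabs (p%:R : K) /\ vabs (p%:R : K) < 1;
  lchar0 : forall n : nat, n.+1%:R != 0 :> K }.

Context {K : vfield R} (hK : local_field K).
Local Notation abs := (@vabs R K).

Lemma abs0 : abs 0 = 0. Proof. exact/(labs0 hK). Qed.

Lemma abs_eq0 x : (abs x == 0) = (x == 0).
Proof. by apply/eqP/eqP => /(labs0 hK). Qed.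

Lemma abs_gt0 x : (0 < abs x) = (x != 0).
Proof. by rewrite lt0r abs_eq0 labs_ge0 ?andbT. Qed.

Lemma abs1 : abs 1 = 1.
Proof.
have : abs 1 * abs 1 = abs 1 * 1 by rewrite -labsM // !mulr1.
by apply: mulfI; rewrite abs_eq0 oner_eq0.
Qed.

Lemma absN x : abs (- x) = abs x.
Proof.
have h1 : abs (-1) ^+ 2 = 1 by rewrite expr2 -labsM // mulrNN mulr1 abs1.
have h2 : abs (-1) = 1.
  by apply/eqP; rewrite -(@eqrXn2 _ 2) ?labs_ge0 ?ler01 // h1 expr1n.
by rewrite -mulN1r labsM // h2 mul1r.
Qed.

Lemma absB x y : abs (x - y) <= Num.max (abs x) (abs y).
Proof. by rewrite -(absN y) labsD. Qed.

Lemma absC x y : abs (x - y) = abs (y - x).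
Proof. by rewrite -absN opprB. Qed.

Lemma absV x : abs x^-1 = (abs x)^-1.
Proof.
have [->|x0] := eqVneq x 0; first by rewrite invr0 abs0 invr0.
have hx : abs x != 0 by rewrite abs_eq0.
by apply: (mulfI hx); rewrite -labsM // divff // divff // abs1.
Qed.

Lemma absX x n : abs (x ^+ n) = abs x ^+ n.
Proof. by elim: n => [|n IH]; rewrite ?expr0 ?abs1 // !exprS labsM // IH. Qed.

Lemma abs_nat_le1 n : abs n%:R <= 1.
Proof.
elim: n => [|n IH]; first by rewrite abs0 ler01.
rewrite -addn1 natrD; apply: le_trans (labsD hK _ _) _.
by rewrite ge_max IH abs1 lexx.
Qed.


Lemma abs_near_eq x y : abs (x - y) < abs y -> abs x = abs y.
Proof.
move=> h; apply/eqP; rewrite eq_le; apply/andP; split.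
  rewrite -[in X in X <= _](subrK y x); apply: le_trans (labsD hK _ _) _.
  by rewrite ge_max lexx ltW.
rewrite leNgt; apply/negP => h2.
have : abs y <= Num.max (abs x) (abs (x - y)).
  by rewrite -[in X in X <= _](subKr x y) absB.
by rewrite le_max leNgt h2 leNgt h.
Qed.

Lemma abs_small_ex : exists p : nat, (1 < p)%N /\ 0 < abs p%:R < 1.
Proof.
have [[|[|p]] [p0 p1]] := labs_small hK.
- by move: p0; rewrite abs0 ltxx.
- by move: p1; rewrite abs1 ltxx.
- by exists p.+2; rewrite p0 p1.
Qed.

Lemma expr_small (a e : R) : 0 <= a -> a < 1 -> 0 < e -> exists n, a ^+ n < e.
Proof.
move=> a0 a1 e0.
have /cvgrPdist_lt /(_ e e0) : (fun n => a ^+ n) @ \oo --> (0 : R).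
  by apply: cvg_expr; rewrite ger0_norm.
case=> N _ /(_ N (leqnn N)) /=; rewrite sub0r normrN ger0_norm ?exprn_ge0 //.
by exists N.
Qed.

Lemma abs_arb_small (e : R) : 0 < e -> exists2 x : K, x != 0 & abs x < e.
Proof.
have [p [p1 /andP[h0 h1]]] := abs_small_ex => e0.
have [n hn] := expr_small (ltW h0) h1 e0.
exists (p%:R ^+ n); last by rewrite absX.
by rewrite expf_neq0 // -abs_eq0 gt_eqF.
Qed.

Lemma abs_arb_large (B : R) : exists x : K, B < abs x.
Proof.
have b0 : 0 < (Num.max B 1)^-1 by rewrite invr_gt0 lt_max ltr01 orbT.
have [x x0 hx] := abs_arb_small b0; exists x^-1; rewrite absV.
have : Num.max B 1 < (abs x)^-1.
  by rewrite -[X in X < _]invrK ltf_pV2 ?posrE // abs_gt0.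
by rewrite gt_max => /andP[].
Qed.

Lemma cover_ball (B e : R) : 0 < e -> exists s : seq K,
  forall x : K, abs x <= B -> exists2 y, y \in s & abs (x - y) < e.
Proof.
move=> e0; have [z hz] := abs_arb_large (Num.max B 0).
move: hz; rewrite gt_max => /andP[zB z0].
have [s hs] := labs_cover hK (divr_gt0 e0 z0).
exists [seq z * y | y <- s] => x xB.
have zn0 : z != 0 by rewrite -abs_gt0.
have [|y ys hy] := hs (z^-1 * x).
  by rewrite labsM // absV mulrC ler_pdivrMr // mul1r (le_trans xB) // ltW.
exists (z * y); first exact: map_f.
rewrite -[x](mulVKf zn0) -mulrBr labsM //.
by rewrite mulrC -ltr_pdivlMr.
Qed.

Section Norm.
Context {r k : nat}.
Implicit Types x y z : 'M[K]_(r, k).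

Definition mnorm x : R := \big[Num.max/0]_(ij : 'I_r * 'I_k) abs (x ij.1 ij.2).

Lemma mnorm_ge0 x : 0 <= mnorm x.
Proof. exact: bigmax_ge_id. Qed.

Lemma mnorm_leP x (e : R) : 0 <= e ->
  (mnorm x <= e) <-> (forall i j, abs (x i j) <= e).
Proof.
move=> e0; split=> [/bigmax_leP[_ h] i j|h]; first exact: (h (i, j)).
by apply/bigmax_leP; split=> // -[i j] _; exact: h.
Qed.

Lemma mnorm_ltP x (e : R) : 0 < e ->
  (mnorm x < e) <-> (forall i j, abs (x i j) < e).
Proof.
move=> e0; split=> [/bigmax_ltP[_ h] i j|h]; first exact: (h (i, j)).
by apply/bigmax_ltP; split=> // -[i j] _; exact: h.
Qed.

Lemma mnorm_entry x i j : abs (x i j) <= mnorm x.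
Proof. by move: i j; apply/mnorm_leP => //; exact: mnorm_ge0. Qed.

Lemma mnorm0 : mnorm 0 = 0.
Proof.
apply/eqP; rewrite eq_le mnorm_ge0 andbT; apply/mnorm_leP => // i j.
by rewrite mxE abs0.
Qed.

Lemma mnormN x : mnorm (- x) = mnorm x.
Proof. by rewrite /mnorm; apply: eq_bigr => ij _; rewrite mxE absN. Qed.

Lemma mnormD x y : mnorm (x + y) <= Num.max (mnorm x) (mnorm y).
Proof.
apply/mnorm_leP => [|i j]; first by rewrite le_max mnorm_ge0.
rewrite mxE; apply: le_trans (labsD hK _ _) _.
by rewrite ge_max !le_max !mnorm_entry orbT.
Qed.

Lemma mnormB x y : mnorm (x - y) <= Num.max (mnorm x) (mnorm y).
Proof. by rewrite -(mnormN y) mnormD. Qed.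

Lemma mnormC x y : mnorm (x - y) = mnorm (y - x).
Proof. by rewrite -mnormN opprB. Qed.

Lemma mnorm_eq0 x : mnorm x = 0 -> x = 0.
Proof.
move=> h; apply/matrixP => i j; rewrite mxE; apply/eqP; rewrite -abs_eq0.
by rewrite eq_le labs_ge0 // andbT -h mnorm_entry.
Qed.

Lemma mnormD_lt x y (e : R) : mnorm x < e -> mnorm y < e -> mnorm (x + y) < e.
Proof. by move=> hx hy; apply: le_lt_trans (mnormD _ _) _; rewrite gt_max hx. Qed.

Lemma mnorm_trans y x z (e : R) :
  mnorm (x - y) < e -> mnorm (y - z) < e -> mnorm (x - z) < e.
Proof. by move=> h1 h2; rewrite -(subrKA y); exact: mnormD_lt. Qed.

Lemma mnorm_near_eq x y : mnorm (x - y) < mnorm y -> mnorm x = mnorm y.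
Proof.
move=> h; apply/eqP; rewrite eq_le; apply/andP; split.
  rewrite -[in X in X <= _](subrK y x); apply: le_trans (mnormD _ _) _.
  by rewrite ge_max lexx ltW.
rewrite leNgt; apply/negP => h2.
have : mnorm y <= Num.max (mnorm x) (mnorm (x - y)).
  by rewrite -[in X in X <= _](subKr x y) mnormB.
by rewrite le_max leNgt h2 leNgt h.
Qed.

Lemma mnormZ (a : K) x : mnorm (a *: x) <= abs a * mnorm x.
Proof.
apply/mnorm_leP => [|i j]; first by rewrite mulr_ge0 ?mnorm_ge0 ?labs_ge0.
by rewrite mxE labsM // ler_wpM2l ?labs_ge0 ?mnorm_entry.
Qed.

Lemma abs_sum_le (I : Type) (s : seq I) (P : pred I) (F : I -> K) (B : R) :
  0 <= B -> (forall i, P i -> abs (F i) <= B) -> abs (\sum_(i <- s | P i) F i) <= B.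
Proof.
move=> B0 h; elim/big_ind: _ => //; first by rewrite abs0.
move=> a b ha hb; apply: le_trans (labsD hK _ _) _; by rewrite ge_max ha.
Qed.

Lemma mcover (B e : R) : 0 < e -> exists s : seq 'M[K]_(r, k),
  forall x, mnorm x <= B -> exists2 y, y \in s & mnorm (x - y) < e.
Proof.
move=> e0; have [s hs] := cover_ball B e0.
pose g (f : {ffun 'I_r * 'I_k -> 'I_(size s)}) : 'M[K]_(r, k) :=
  \matrix_(i, j) s`_(f (i, j)).
exists [seq g f | f <- enum {ffun 'I_r * 'I_k -> 'I_(size s)}] => x xB.
have h ij : exists l : 'I_(size s), abs (x ij.1 ij.2 - s`_l) < e.
  have [y ys hy] := hs _ (le_trans (mnorm_entry x ij.1 ij.2) xB).
  have ys' := ys; move: ys'; rewrite -index_mem => ys'.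
  by exists (Ordinal ys'); rewrite nth_index.
have [f hf] := boolp.choice h.
exists (g [ffun ij => f ij]); first by apply: map_f; rewrite mem_enum.
by apply/mnorm_ltP => // i j; rewrite !mxE ffunE; exact: (hf (i, j)).
Qed.

Lemma mcomplete (u : nat -> 'M[K]_(r, k)) :
  (forall e : R, 0 < e -> exists N : nat, forall i j : nat,
     (N <= i)%N -> (N <= j)%N -> mnorm (u i - u j) < e) ->
  exists l, forall e : R, 0 < e -> exists N : nat,
    forall i : nat, (N <= i)%N -> mnorm (u i - l) < e.
Proof.
move=> hu.
have h (ij : 'I_r * 'I_k) : exists l : K, forall e : R, 0 < e -> exists N : nat,
    forall i : nat, (N <= i)%N -> abs (u i ij.1 ij.2 - l) < e.
  apply: (labs_complete hK) => e e0; have [N hN] := hu e e0.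
  exists N => i j hi hj; have := hN i j hi hj.
  by move=> /(mnorm_ltP _ e0) /(_ ij.1 ij.2); rewrite !mxE.
have [l hl] := boolp.choice h.
exists (\matrix_(i, j) l (i, j)) => e e0.
have h2 ij : exists N : nat, forall i : nat, (N <= i)%N ->
  abs (u i ij.1 ij.2 - l ij) < e by exact: hl.
have [N hN] := boolp.choice h2.
exists (\big[maxn/0%N]_(ij : 'I_r * 'I_k) N ij) => i hi; apply/mnorm_ltP => // a b.
rewrite !mxE; apply: (hN (a, b)); apply: leq_trans hi.
exact: (leq_bigmax (a, b)).
Qed.

End Norm.

Lemma mnormM r k l (x : 'M[K]_(r, k)) (y : 'M[K]_(k, l)) :
  mnorm (x *m y) <= mnorm x * mnorm y.
Proof.
apply/mnorm_leP => [|i j]; first by rewrite mulr_ge0 ?mnorm_ge0.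
rewrite mxE; apply: abs_sum_le => [|a _]; first by rewrite mulr_ge0 ?mnorm_ge0.
by rewrite labsM // ler_pM ?labs_ge0 ?mnorm_entry.
Qed.

Lemma mnorm_scalar (a : K) : mnorm (a%:M : 'M[K]_1) = abs a.
Proof.
apply/eqP; rewrite eq_le; apply/andP; split.
  by apply/mnorm_leP => [|i j]; rewrite ?labs_ge0 // !ord1 mxE eqxx.
by have := mnorm_entry (a%:M : 'M[K]_1) 0 0; rewrite mxE eqxx.
Qed.

Lemma mnorm1 n : mnorm (1%:M : 'M[K]_n) <= 1.
Proof.
apply/mnorm_leP => // i j; rewrite mxE.
by case: (i == j); rewrite ?abs1 ?abs0 ?ler01.
Qed.

Lemma mnorm_row_mx r k l (x : 'M[K]_(r, k)) (y : 'M[K]_(r, l)) :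
  mnorm (row_mx x y) = Num.max (mnorm x) (mnorm y).
Proof.
apply/eqP; rewrite eq_le ge_max; apply/andP; split.
  apply/mnorm_leP => [|i j]; first by rewrite le_max mnorm_ge0.
  by rewrite mxE; case: (fintype.split _) => a; rewrite le_max mnorm_entry ?orbT.
apply/andP; split; apply/mnorm_leP; rewrite ?mnorm_ge0 // => i j.
  by rewrite -(row_mxEl x y) mnorm_entry.
by rewrite -(row_mxEr x y) mnorm_entry.
Qed.

Lemma mnorm_col_mx r k l (x : 'M[K]_(r, k)) (y : 'M[K]_(l, k)) :
  mnorm (col_mx x y) = Num.max (mnorm x) (mnorm y).
Proof.
apply/eqP; rewrite eq_le ge_max; apply/andP; split.
  apply/mnorm_leP => [|i j]; first by rewrite le_max mnorm_ge0.
  by rewrite mxE; case: (fintype.split _) => a; rewrite le_max mnorm_entry ?orbT.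
apply/andP; split; apply/mnorm_leP; rewrite ?mnorm_ge0 // => i j.
  by rewrite -(col_mxEu x y) mnorm_entry.
by rewrite -(col_mxEd x y) mnorm_entry.
Qed.

End LocalField.

(** * Locally constant and continuous functions of matrices *)

Section Neighborhoods.
Context {R : realType} {K : vfield R} (hK : local_field K).

Section NearPoint.
Context {r k : nat}.
Implicit Types x y : 'M[K]_(r, k).

(** Neighbourhoods for the sup norm; the filter instance below makes [\near] available for matrices
    over a [vfield]. *)
Definition nb x : set_system 'M[K]_(r, k) :=
  [set P | exists2 e : R, 0 < e & forall y, mnorm (y - x) < e -> P y].

Global Instance nb_filter x : ProperFilter (nb x).
Proof.
split.
  by move=> [e e0 /(_ x)]; rewrite subrr mnorm0 //; exact.
split.
- by exists 1.
- move=> P Q [e e0 hP] [d d0 hQ]; exists (Num.min e d).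
    by rewrite lt_min e0.
  by move=> y; rewrite lt_min => /andP[/hP ? /hQ].
- by move=> P Q PQ [e e0 hP]; exists e => // y /hP /PQ.
Qed.

End NearPoint.

Section Compactness.
Context {r k : nat}.

(** Compactness of balls in the form used throughout: [P y s] is a property of the point [y] at
    scale [s], and thresholds for [s] that work locally are made uniform over a ball. Without a
    uniform threshold, total boundedness would give nested sets of diameter tending to 0 that have
    none; their limit point, which exists by completeness, contradicts the local threshold. *)
Lemma ball_compact (P : 'M[K]_(r, k) -> R -> Prop) :
  (forall x, exists2 e : R, 0 < e & forall y, mnorm (y - x) < e ->
     forall s, 0 < s -> s <= e -> P y s) ->
  forall B : R, exists2 e : R, 0 < e & forall y, mnorm y <= B ->
     forall s, 0 < s -> s <= e -> P y s.
Proof.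
move=> hP B.
pose good (S : set 'M[K]_(r, k)) := exists2 e : R, 0 < e & forall y, S y ->
     forall s, 0 < s -> s <= e -> P y s.
have good_seq (S : set 'M[K]_(r, k)) (d : R) (s : seq 'M[K]_(r, k)) :
    (forall c, c \in s -> good (S `&` [set y | mnorm (y - c) < d])) ->
    good (S `&` [set y | exists2 c, c \in s & mnorm (y - c) < d]).
  elim: s => [_|c s IH hs]; first by exists 1 => // y [_ [c]]; rewrite in_nil.
  have [|e e0 he] := IH; first by move=> z zs; apply: hs; rewrite in_cons zs orbT.
  have [e' e'0 he'] := hs c (mem_head _ _).
  exists (Num.min e e') => [|y [Sy [z]]]; first by rewrite lt_min e0.
  rewrite in_cons => /orP[/eqP ->|zs] yz t t0; rewrite le_min => /andP[te te'].
    exact: he'.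
  by apply: he => //; split=> //; exists z.
pose B0 : set 'M[K]_(r, k) := [set y | mnorm y <= B].
change (good B0); apply: contrapT => bad0.
(* Finitely many balls of radius 2^-n cover [S]; if each piece were good, the least of their
   thresholds would make [S] good. *)
have step (n : nat) (S : set 'M[K]_(r, k)) : exists c, S `<=` B0 -> ~ good S ->
    ~ good (S `&` [set y | mnorm (y - c) < 2^-1 ^+ n]).
  apply: contrapT => /forallNP h.
  have [] : S `<=` B0 /\ ~ good S.
    by have /not_implyP[? /not_implyP[? _]] := h 0.
  have e0 : 0 < (2^-1 : R) ^+ n by rewrite exprn_gt0 // invr_gt0.
  have [s hs] := @mcover R K hK r k B _ e0.
  move=> SB badS; apply: badS.
  have [c cs|e he H] := @good_seq S (2^-1 ^+ n) s.
    by have /not_implyP[_ /not_implyP[_ /contrapT]] := h c.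
  exists e => // y Sy; apply: H; split=> //; exact: hs (SB _ Sy).
have [g hg] : exists g : nat -> set 'M[K]_(r, k) -> 'M[K]_(r, k), forall n S,
    S `<=` B0 -> ~ good S ->
    ~ good (S `&` [set y | mnorm (y - g n S) < 2^-1 ^+ n]).
  have h n : exists gn : set 'M[K]_(r, k) -> 'M[K]_(r, k), forall S,
    S `<=` B0 -> ~ good S ->
    ~ good (S `&` [set y | mnorm (y - gn S) < 2^-1 ^+ n]).
    by have [gn] := boolp.choice (step n); exists gn.
  by have [g] := boolp.choice h; exists g.
pose fix Sn n : set 'M[K]_(r, k) := if n is n'.+1 then
  Sn n' `&` [set y | mnorm (y - g n' (Sn n')) < 2^-1 ^+ n'] else B0.
have SnB n : Sn n `<=` B0 by elim: n => //= n IH y [/IH].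
have badn n : ~ good (Sn n) by elim: n => //= n IH; exact: hg.
have Snm n m : (n <= m)%N -> Sn m `<=` Sn n.
  by elim: m => [|m IH]; rewrite leq_eqVlt => /predU1P[->//|] // /IH h y [/h].
have [u hu] : exists u : nat -> 'M[K]_(r, k), forall n, Sn n (u n).
  have h n : exists x, Sn n x.
    by apply: contrapT => /forallNP h; apply: (badn n); exists 1 => // y /h.
  by have [u] := boolp.choice h; exists u.
have half_lt (e : R) : 0 < e -> exists N, (2^-1 : R) ^+ N < e.
  by apply: expr_small; lra.
have close N i y : (N < i)%N -> Sn N.+1 y -> mnorm (u i - y) < 2^-1 ^+ N.
  move=> Ni [_ h1]; have [_ h2] := Snm _ _ Ni _ (hu i).
  by apply: (mnorm_trans hK) h2 _; rewrite mnormC.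
have [e e0|x hx] := @mcomplete R K hK r k u.
  have [N hN] := half_lt e e0; exists N.+1 => i j Ni Nj.
  by apply: lt_trans hN; apply: close => //; exact: Snm (hu j).
have [e e0 he] := hP x; have [N hN] := half_lt e e0.
have [N' hN'] := hx e e0.
apply: (badn N.+1); exists e => // y Sy; apply: he.
pose i := maxn N.+1 N'.
apply: (mnorm_trans hK (y := u i)); last by apply: hN'; rewrite leq_maxr.
by rewrite mnormC //; apply: lt_trans hN; apply: close => //; rewrite leq_maxl.
Qed.

End Compactness.

Definition locally_const r k (T : Type) (f : 'M[K]_(r, k) -> T) :=
  forall x, \forall y \near nb x, f y = f x.

Definition cts r k r' k' (f : 'M[K]_(r, k) -> 'M[K]_(r', k')) :=
  forall x (e : R), 0 < e -> \forall y \near nb x, mnorm (f y - f x) < e.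

Definition norm_bounded r k r' k' (f : 'M[K]_(r, k) -> 'M[K]_(r', k')) :=
  forall B : R, exists B' : R, forall x, mnorm x <= B -> mnorm (f x) <= B'.

(** Properness in elementary terms; with continuity it makes the pullback along [f] preserve
    Schwartz functions. *)
Definition norm_proper r k r' k' (f : 'M[K]_(r, k) -> 'M[K]_(r', k')) :=
  forall B : R, exists B' : R, forall x, mnorm (f x) <= B -> mnorm x <= B'.

Lemma lc_comp r k r' k' T (f : 'M[K]_(r, k) -> 'M[K]_(r', k'))
    (g : 'M[K]_(r', k') -> T) :
  locally_const g -> cts f -> locally_const (g \o f).
Proof.
move=> hg hf x; have [e e0 he] := hg (f x).
by apply: filterS (hf x e e0) => y; exact: he.
Qed.

Lemma lc_post r k T T' (f : 'M[K]_(r, k) -> T) (g : T -> T') :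
  locally_const f -> locally_const (g \o f).
Proof. by move=> hf x; apply: filterS (hf x) => y /= ->. Qed.

Lemma lc_post2 r k T1 T2 T' (f : 'M[K]_(r, k) -> T1) (f' : 'M[K]_(r, k) -> T2)
    (g : T1 -> T2 -> T') :
  locally_const f -> locally_const f' -> locally_const (fun x => g (f x) (f' x)).
Proof.
by move=> hf hf' x; apply: filterS2 (hf x) (hf' x) => y /= -> ->.
Qed.

Lemma lc_ball r k (c : 'M[K]_(r, k)) (e : R) : 0 < e ->
  locally_const (fun x => mnorm (x - c) < e).
Proof.
move=> e0 x; exists e => // y hy; apply/idP/idP => h.
  by apply: (mnorm_trans hK) h; rewrite mnormC.
exact: (mnorm_trans hK) hy h.
Qed.

Lemma cts_lip r k r' k' (f : 'M[K]_(r, k) -> 'M[K]_(r', k')) (C : R) :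
  (forall x y, mnorm (f x - f y) <= C * mnorm (x - y)) -> cts f.
Proof.
move=> h x e e0; have C0 : 0 < Num.max C 1 by rewrite lt_max ltr01 orbT.
exists (e / Num.max C 1) => [|y hy]; first exact: divr_gt0.
apply: le_lt_trans (h y x) _; apply: le_lt_trans (_ : _ <= Num.max C 1 * mnorm (y - x)) _.
  by rewrite ler_wpM2r ?mnorm_ge0 // le_max lexx.
by rewrite mulrC -ltr_pdivlMr.
Qed.

Lemma cts_cst r k r' k' (c : 'M[K]_(r', k')) : cts (fun _ : 'M[K]_(r, k) => c).
Proof. by move=> x e e0; apply: nearW => y; rewrite subrr mnorm0. Qed.

Lemma cts_id r k : cts (@id 'M[K]_(r, k)).
Proof. by move=> x e e0; exists e. Qed.

Lemma ctsD r k r' k' (f g : 'M[K]_(r, k) -> 'M[K]_(r', k')) :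
  cts f -> cts g -> cts (fun x => f x + g x).
Proof.
move=> hf hg x e e0; apply: filterS2 (hf x e e0) (hg x e e0) => y h1 h2.
by rewrite opprD addrACA; exact: mnormD_lt.
Qed.

Lemma ctsN r k r' k' (f : 'M[K]_(r, k) -> 'M[K]_(r', k')) :
  cts f -> cts (fun x => - f x).
Proof.
by move=> hf x e e0; apply: filterS (hf x e e0) => y; rewrite -opprD mnormN.
Qed.

Lemma near_bounded r k r' k' (f : 'M[K]_(r, k) -> 'M[K]_(r', k')) x :
  cts f -> \forall y \near nb x, mnorm (f y) <= Num.max 1 (mnorm (f x)).
Proof.
move=> hf; apply: filterS (hf x 1 ltr01) => y h.
rewrite -[f y](subrK (f x)); apply: le_trans (mnormD hK _ _) _.
by rewrite ge_max !le_max lexx orbT ltW.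
Qed.

Lemma ctsM r k r' l k' (f : 'M[K]_(r, k) -> 'M[K]_(r', l))
    (g : 'M[K]_(r, k) -> 'M[K]_(l, k')) :
  cts f -> cts g -> cts (fun x => f x *m g x).
Proof.
move=> hf hg x e e0.
pose Bf := Num.max 1 (mnorm (f x)); pose Bg := Num.max 1 (mnorm (g x)).
have Bf0 : 0 < Bf by rewrite lt_max ltr01.
have Bg0 : 0 < Bg by rewrite lt_max ltr01.
have h1 := hf x (e / Bg) (divr_gt0 e0 Bg0).
have h2 := hg x (e / Bf) (divr_gt0 e0 Bf0).
have h3 := near_bounded x hf; near=> y.
have -> : f y *m g y - f x *m g x = f y *m (g y - g x) + (f y - f x) *m g x.
  by rewrite mulmxBr mulmxBl addrA subrK.
apply: mnormD_lt => //; apply: le_lt_trans (mnormM hK _ _) _.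
  apply: le_lt_trans (_ : _ <= Bf * mnorm (g y - g x)) _.
    by rewrite ler_wpM2r ?mnorm_ge0 //; near: y.
  by rewrite mulrC -ltr_pdivlMr //; near: y.
apply: le_lt_trans (_ : _ <= mnorm (f y - f x) * Bg) _.
  by rewrite ler_wpM2l ?mnorm_ge0 // le_max lexx orbT.
by rewrite -ltr_pdivlMr //; near: y.
Unshelve. all: by end_near. Qed.

Lemma cts_comp r k r' k' r2 k2 (f : 'M[K]_(r, k) -> 'M[K]_(r', k'))
    (g : 'M[K]_(r', k') -> 'M[K]_(r2, k2)) :
  cts g -> cts f -> cts (g \o f).
Proof.
move=> hg hf x e e0; have [d d0 hd] := hg (f x) e e0.
by apply: filterS (hf x d d0) => y; exact: hd.
Qed.

Lemma cts_row_mx r k r' k1 k2 (f : 'M[K]_(r, k) -> 'M[K]_(r', k1))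
    (g : 'M[K]_(r, k) -> 'M[K]_(r', k2)) :
  cts f -> cts g -> cts (fun x => row_mx (f x) (g x)).
Proof.
move=> hf hg x e e0; apply: filterS2 (hf x e e0) (hg x e e0) => y h1 h2.
by rewrite opp_row_mx add_row_mx mnorm_row_mx // gt_max h1.
Qed.

Lemma cts_col_mx r k r1 r2 k' (f : 'M[K]_(r, k) -> 'M[K]_(r1, k'))
    (g : 'M[K]_(r, k) -> 'M[K]_(r2, k')) :
  cts f -> cts g -> cts (fun x => col_mx (f x) (g x)).
Proof.
move=> hf hg x e e0; apply: filterS2 (hf x e e0) (hg x e e0) => y h1 h2.
by rewrite opp_col_mx add_col_mx mnorm_col_mx // gt_max h1.
Qed.

Lemma mnorm_lsubmx r k1 k2 (x : 'M[K]_(r, k1 + k2)) : mnorm (lsubmx x) <= mnorm x.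
Proof. by rewrite -[in X in _ <= X](hsubmxK x) mnorm_row_mx // le_max lexx. Qed.

Lemma mnorm_rsubmx r k1 k2 (x : 'M[K]_(r, k1 + k2)) : mnorm (rsubmx x) <= mnorm x.
Proof. by rewrite -[in X in _ <= X](hsubmxK x) mnorm_row_mx // le_max lexx orbT. Qed.

Lemma mnorm_usubmx r1 r2 k (x : 'M[K]_(r1 + r2, k)) : mnorm (usubmx x) <= mnorm x.
Proof. by rewrite -[in X in _ <= X](vsubmxK x) mnorm_col_mx // le_max lexx. Qed.

Lemma mnorm_dsubmx r1 r2 k (x : 'M[K]_(r1 + r2, k)) : mnorm (dsubmx x) <= mnorm x.
Proof. by rewrite -[in X in _ <= X](vsubmxK x) mnorm_col_mx // le_max lexx orbT. Qed.

Lemma cts_lsubmx r k1 k2 : cts (@lsubmx K r k1 k2).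
Proof. by apply: (@cts_lip _ _ _ _ _ 1) => x y; rewrite mul1r -linearB mnorm_lsubmx. Qed.

Lemma cts_rsubmx r k1 k2 : cts (@rsubmx K r k1 k2).
Proof. by apply: (@cts_lip _ _ _ _ _ 1) => x y; rewrite mul1r -linearB mnorm_rsubmx. Qed.

Lemma cts_usubmx r1 r2 k : cts (@usubmx K r1 r2 k).
Proof. by apply: (@cts_lip _ _ _ _ _ 1) => x y; rewrite mul1r -linearB mnorm_usubmx. Qed.

Lemma cts_dsubmx r1 r2 k : cts (@dsubmx K r1 r2 k).
Proof. by apply: (@cts_lip _ _ _ _ _ 1) => x y; rewrite mul1r -linearB mnorm_dsubmx. Qed.

End Neighborhoods.

(** * Schwartz functions *)

Section LinearMaps.
Context {C : nzRingType} {V W : lmodType C}.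
Variables (T : V -> W) (hT : linear T).

Lemma linD u v : T (u + v) = T u + T v.
Proof. by rewrite -[u]scale1r hT !scale1r. Qed.

Lemma lin0 : T 0 = 0.
Proof. by apply: (@addrI _ (T 0)); rewrite -linD !addr0. Qed.

Lemma linZ a u : T (a *: u) = a *: T u.
Proof. by rewrite -[a *: u]addr0 hT lin0 addr0. Qed.

Lemma linN u : T (- u) = - T u.
Proof. by rewrite -scaleN1r linZ scaleN1r. Qed.

Lemma linB u v : T (u - v) = T u - T v.
Proof. by rewrite linD linN. Qed.

Lemma lin_sum (I : Type) (s : seq I) (P : pred I) (F : I -> V) :
  T (\sum_(i <- s | P i) F i) = \sum_(i <- s | P i) T (F i).
Proof. by elim/big_rec2: _ => [|i x y _ <-]; rewrite ?lin0 ?linD. Qed.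

End LinearMaps.

Section Schwartz.
Context {R : realType} {K : vfield R} (hK : local_field K).
Local Notation C := R[i].

Section OneSpace.
Context {r k : nat}.
Local Notation M := 'M[K]_(r, k).
Local Notation SS := (schwartz K r k).

Definition schv (P : lmodType C) (g : M -> P) : Prop :=
  locally_const g /\ exists B : R, forall x, g x != 0 -> mnorm x <= B.

Lemma is_schwartzP (f : M -> C) : is_schwartz f <-> @schv C^o f.
Proof.
split=> -[fc [B fB]]; split.
- move=> x; have [e e0 he] := fc x; exists e => // y /(mnorm_ltP _ e0).
  exact: he.
- exists (Num.max B 0) => x fx; apply/mnorm_leP.
    by rewrite le_max lexx orbT.
  by move=> i j; rewrite le_max fB.
- move=> x; have [e e0 he] := fc x; exists e => // y hy.
  by apply: he; apply/mnorm_ltP.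
- by exists B => x fx i j; apply: le_trans (fB x fx); exact: mnorm_entry.
Qed.

Lemma schwartz_schv (phi : SS) : @schv C^o phi.
Proof. by case: phi => f /= /asboolP /is_schwartzP. Qed.

(** A total packaging that lets operators on Schwartz functions be written as plain formulas; the
    default value 0 never occurs once the corresponding [E] lemma has been applied. *)
Definition toS (f : M -> C) : SS :=
  if pselect (is_schwartz f) is left H then Schwartz (asboolT H) else 0.

Lemma toSE (f : M -> C) : @schv C^o f -> toS f =1 f.
Proof. by rewrite /toS => /is_schwartzP h; case: pselect. Qed.

Lemma schwartzP (phi psi : SS) : phi =1 psi -> phi = psi.
Proof. by move=> h; apply: val_inj => /=; apply: funext. Qed.

Lemma schwD (phi psi : SS) x : (phi + psi) x = phi x + psi x. Proof. by []. Qed.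
Lemma schwZ a (phi : SS) x : (a *: phi) x = a * phi x. Proof. by []. Qed.
Lemma schw0 x : (0 : SS) x = 0. Proof. by []. Qed.
Lemma schwN (phi : SS) x : (- phi) x = - phi x. Proof. by []. Qed.

Lemma schw_sum (I : Type) (s : seq I) (P : pred I) (F : I -> SS) x :
  (\sum_(i <- s | P i) F i) x = \sum_(i <- s | P i) F i x.
Proof. by elim/big_rec2: _ => // i y z _ <-. Qed.

Lemma schv_supp (P : lmodType C) (g : M -> P) : schv g ->
  exists2 B : R, 0 < B & forall x, g x != 0 -> mnorm x <= B.
Proof.
case=> _ [B hB]; exists (Num.max B 1); first by rewrite lt_max ltr01 orbT.
by move=> x /hB; rewrite le_max => ->.
Qed.

Lemma schv_unif (P : lmodType C) (g : M -> P) : schv g ->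
  exists2 e : R, 0 < e & forall x y, mnorm (y - x) < e -> g y = g x.
Proof.
move=> hg; have [B B0 hB] := schv_supp hg.
have [|e e0 he] := @ball_compact R K hK r k
  (fun y s => forall z, mnorm (z - y) < s -> g z = g y) _ B.
  move=> x; have [e e0 he] := hg.1 x; exists e => // y hy s s0 se z hz.
  rewrite (he y hy); apply: he; apply: (mnorm_trans hK (y := y)) => //.
  exact: lt_le_trans hz se.
exists e => // x y hxy.
have [xB|xB] := leP (mnorm x) B; first exact: (he x xB e).
have [yB|yB] := leP (mnorm y) B.
  by rewrite (he y yB e e0) // (mnormC hK).
have z u : B < mnorm u -> g u = 0.
  by move=> uB; apply/eqP; apply: contraTT uB => /hB; rewrite leNgt.
by rewrite !z.
Qed.

Lemma schv_lcZ (P : lmodType C) (m : M -> C) (g : M -> P) :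
  locally_const m -> schv g -> schv (fun x => m x *: g x).
Proof.
move=> hm [hg [B hB]]; split; first exact: lc_post2.
by exists B => x; apply: contraNT => /(contraNN (hB x))/negPn/eqP ->; rewrite scaler0.
Qed.

Lemma schv_lcM (m f : M -> C) :
  locally_const m -> @schv C^o f -> @schv C^o (fun x => m x * f x).
Proof. exact: schv_lcZ. Qed.

Definition ballf (c : M) (e : R) : M -> C := fun x => (mnorm (x - c) < e)%R%:R.

Lemma schv_ballf c (e : R) : 0 < e -> @schv C^o (ballf c e).
Proof.
move=> e0; split; first exact: (lc_post hK (fun b : bool => b%:R) (lc_ball hK c e0)).
exists (Num.max e (mnorm c)) => x; rewrite /ballf; case: ltP => [h _|_]; last first.
  by rewrite mulr0n eqxx.
rewrite -[x](subrK c); apply: le_trans (mnormD hK _ _) _.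
by rewrite ge_max !le_max lexx orbT (ltW h).
Qed.

Definition sbump c (e : R) : SS := toS (ballf c e).

Lemma sbumpE c (e : R) x : 0 < e -> sbump c e x = (mnorm (x - c) < e)%R%:R.
Proof. by move=> e0; rewrite toSE //; exact: schv_ballf. Qed.

Lemma sbump_center c (e : R) : 0 < e -> sbump c e c = 1.
Proof. by move=> e0; rewrite sbumpE // subrr mnorm0 // e0. Qed.

Lemma sbump_eq c c' (e : R) : 0 < e -> mnorm (c' - c) < e -> sbump c e = sbump c' e.
Proof.
move=> e0 h; apply: schwartzP => x; rewrite !sbumpE //; congr (_%:R); congr nat_of_bool.
apply/idP/idP => hx; apply: (mnorm_trans hK hx); by rewrite // (mnormC hK).
Qed.

(** By the ultrametric inequality a net thinned out to pairwise distance at least [e] has disjoint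
    balls of radius [e]; this makes decompositions into indicators exact. *)
Lemma sep_reps (s : seq M) (e : R) : 0 < e -> exists s' : seq M,
  [/\ uniq s', (forall x y, x \in s' -> y \in s' -> mnorm (x - y) < e -> x = y)
    & forall x, x \in s -> exists2 y, y \in s' & mnorm (x - y) < e].
Proof.
move=> e0; elim: s => [|x s [s' [us sep cov]]]; first by exists [::].
have [[y ys hy]|h] := pselect (exists2 y, y \in s' & mnorm (x - y) < e).
  exists s'; split=> // z; rewrite in_cons => /orP[/eqP ->|/cov //]; by exists y.
have far y : y \in s' -> ~ mnorm (x - y) < e by move=> ys hy; apply: h; exists y.
exists (x :: s'); split.
- rewrite /= us andbT; apply/negP => /far; apply; by rewrite subrr (mnorm0 hK).
- move=> y z; rewrite !in_cons => /orP[/eqP ->|ys] /orP[/eqP ->|zs] //.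
  + by move/(far _ zs).
  + by rewrite (mnormC hK) => /(far _ ys).
  + exact: sep.
- move=> z; rewrite in_cons => /orP[/eqP ->|/cov [y ys hy]].
    by exists x; rewrite ?mem_head // subrr mnorm0.
  by exists y; rewrite // in_cons ys orbT.
Qed.

(** Uniform local constancy allows any scale below its radius. All small [s] are offered, not just
    one, so that several functions can be decomposed at a common scale. *)
Lemma schv_decomp (P : lmodType C) (g : M -> P) : schv g ->
  exists2 e : R, 0 < e & forall s, 0 < s -> s <= e -> exists xs : seq M,
    forall x, g x = \sum_(c <- xs) sbump c s x *: g c.
Proof.
move=> hg; have [B B0 hB] := schv_supp hg; have [e e0 he] := schv_unif hg.
exists e => // s s0 se; have [s1 hs1] := @mcover R K hK r k B s s0.
have [xs [uxs sep cov]] := sep_reps s1 s0; exists xs => x.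
have [[c cs hc]|h] := pselect (exists2 c, c \in xs & mnorm (x - c) < s).
  rewrite (bigD1_seq c) //= sbumpE // hc scale1r big_seq_cond big1 ?addr0.
    by apply: he; exact: lt_le_trans hc se.
  move=> c' /andP[c's nc]; rewrite sbumpE //; case: ltP => [hc'|]; last by rewrite scale0r.
  case/eqP: nc; apply: sep => //; apply: (mnorm_trans hK (y := x)) => //.
  by rewrite (mnormC hK).
rewrite big_seq big1 => [|c cs]; last first.
  by rewrite sbumpE //; case: ltP => [hc|]; rewrite ?scale0r //; case: h; exists c.
apply/eqP; apply: contrapT => /negP /hB xB; apply: h.
have [y ys hy] := hs1 x xB; have [c cs hc] := cov y ys.
by exists c => //; exact: (mnorm_trans hK hy hc).
Qed.

Lemma schwartz_decomp (phi : SS) :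
  exists2 e : R, 0 < e & forall s, 0 < s -> s <= e -> exists xs : seq M,
    phi = \sum_(c <- xs) phi c *: sbump c s.
Proof.
have [e e0 he] := schv_decomp (schwartz_schv phi); exists e => // s s0 se.
have [xs hxs] := he s s0 se; exists xs; apply: schwartzP => x.
by rewrite hxs schw_sum; apply: eq_bigr => c _; rewrite schwZ mulrC.
Qed.

Lemma schwartz_decomp2 (phi psi : SS) :
  exists s : R, [/\ 0 < s, exists xs : seq M, phi = \sum_(c <- xs) phi c *: sbump c s
    & exists xs : seq M, psi = \sum_(c <- xs) psi c *: sbump c s].
Proof.
have [e e0 he] := schwartz_decomp phi; have [d d0 hd] := schwartz_decomp psi.
exists (Num.min e d); have m0 : 0 < Num.min e d by rewrite lt_min e0.
by split=> //; [apply: he|apply: hd]; rewrite // ge_min lexx ?orbT.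
Qed.

(** Distributions are local: compactness of the support gives one radius below which all indicators
    centered in the support are killed, and [phi] is a combination of such indicators. *)
Lemma linear_local (P : lmodType C) (T : SS -> P) (phi : SS) : linear T ->
  (forall x, phi x != 0 -> exists2 e : R, 0 < e & forall y, mnorm (y - x) < e ->
     forall s, 0 < s -> s <= e -> T (sbump y s) = 0) ->
  T phi = 0.
Proof.
move=> hT h; have [e e0 he] := schwartz_decomp phi.
have [B B0 hB] := schv_supp (schwartz_schv phi).
have [|d d0 hd] := @ball_compact R K hK r k
  (fun y s => phi y != 0 -> T (sbump y s) = 0) _ B.
  move=> x; have [px|px] := eqVneq (phi x) 0; last first.
    by have [d d0 hd] := h x px; exists d => // y hy s s0 sd _; exact: hd.
  have [d d0 hd] := (schwartz_schv phi).1 x; exists d => // y hy s s0 sd.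
  by rewrite (hd y hy) px eqxx.
have m0 : 0 < Num.min e d by rewrite lt_min e0.
have [|xs hxs] := he (Num.min e d) m0; first by rewrite ge_min lexx.
rewrite [in T _]hxs (lin_sum hT) big1 // => c _; rewrite (linZ hT).
have [->|pc] := eqVneq (phi c) 0; first by rewrite scale0r.
by rewrite hd ?scaler0 ?hB // ge_min lexx orbT.
Qed.

(** Two functionals supported on [X] whose values on small balls centered in [X] and [D] do not
    depend on the center are proportional over [D]. With [X] and [D] everything this is uniqueness
    of Haar measure; with [X] the hyperboloid and [D] a ball around e0 it produces germs. The
    cross-multiplied conclusion avoids dividing by values of [I]. *)
Lemma invariant_dist_unique (P : lmodType C) (T : SS -> P) (I : SS -> C)
    (X D : set M) (rho : R) :
  linear T -> linear (I : SS -> C^o) -> 0 < rho ->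
  (forall a : SS, (forall x, X x -> a x = 0) -> T a = 0 /\ I a = 0) ->
  (forall x x' s, X x -> D x -> X x' -> D x' -> 0 < s -> s <= rho ->
     T (sbump x s) = T (sbump x' s) /\ I (sbump x s) = I (sbump x' s)) ->
  forall a a' : SS, (forall x, a x != 0 -> D x) -> (forall x, a' x != 0 -> D x) ->
  I a' *: T a = I a *: T a'.
Proof.
move=> hT hI rho0 supp inv a a' aD a'D.
have [e e0 he] := schwartz_decomp a; have [d d0 hd] := schwartz_decomp a'.
have [u u0 hu] := schv_unif (schwartz_schv a).
have [u' u'0 hu'] := schv_unif (schwartz_schv a').
pose s := Num.min rho (Num.min (Num.min e d) (Num.min u u')).
have s0 : 0 < s by rewrite !lt_min rho0 e0 d0 u0.
have srho : s <= rho by rewrite ge_min lexx.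
have [|xs hxs] := he s s0; first by rewrite !ge_min lexx !orbT.
have [|ys hys] := hd s s0; first by rewrite !ge_min lexx !orbT.
have [[x0 [Xx0 Dx0]]|none] := pselect (exists x, X x /\ D x); last first.
  have z (b : SS) : (forall x, b x != 0 -> D x) -> T b = 0 /\ I b = 0.
    move=> bD; apply: supp => x Xx; apply/eqP; apply: contrapT => /negP /bD Dx.
    by apply: none; exists x.
  by rewrite (z a aD).1 (z a' a'D).1 !scaler0.
have key (b : SS) (zs : seq M) : (forall x, b x != 0 -> D x) ->
    (forall x y, mnorm (y - x) < s -> b y = b x) ->
    b = \sum_(c <- zs) b c *: sbump c s -> exists t : C,
    T b = t *: T (sbump x0 s) /\ I b = t * I (sbump x0 s).
  move=> bD bu bE.
  (* The centers of the decomposition need not lie on [X]. A ball meeting [X] is recentered at a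
     point of [X]; on a ball missing [X] both functionals vanish. *)
  pose t c := if `[< exists2 y, X y & mnorm (y - c) < s >] then b c else 0.
  have h c : T (b c *: sbump c s) = t c *: T (sbump x0 s) /\
      I (b c *: sbump c s) = t c * I (sbump x0 s).
    rewrite (linZ hT) (linZ hI) /t; case: asboolP => [[y Xy yc]|no]; last first.
      have [|-> ->] := supp (sbump c s).
        by move=> x Xx; rewrite sbumpE //; case: ltP => // xc; case: no; exists x.
      by rewrite !scaler0 scale0r mul0r.
    have [->|bc] := eqVneq (b c) 0; first by rewrite !scale0r mul0r.
    rewrite (sbump_eq s0 yc).
    have Dy : D y by apply: bD; rewrite (bu c y).
    by have [-> ->] := inv y x0 s Xy Dy Xx0 Dx0 s0 srho.
  exists (\sum_(c <- zs) t c).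
  rewrite [in T b]bE [in I b]bE (lin_sum hT) (lin_sum hI) scaler_suml mulr_suml.
  by split; apply: eq_bigr => c _; have [] := h c.
have [|t [-> ->]] := key a xs aD _ hxs.
  by move=> x y xy; apply: hu; apply: lt_le_trans xy _; rewrite !ge_min lexx !orbT.
have [|t' [-> ->]] := key a' ys a'D _ hys.
  by move=> x y xy; apply: hu'; apply: lt_le_trans xy _; rewrite !ge_min lexx !orbT.
by rewrite !scalerA mulrAC [in RHS]mulrAC (mulrC t).
Qed.

End OneSpace.
End Schwartz.

(** * Haar functionals and vector-valued integrals *)

Section Integration.
Context {R : realType} {K : vfield R} (hK : local_field K).
Local Notation C := R[i].
Local Notation SS r k := (schwartz K r k).

Lemma schv_comp (P : lmodType C) r k r' k' (g : 'M[K]_(r', k') -> P)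
    (f : 'M[K]_(r, k) -> 'M[K]_(r', k')) :
  cts f -> norm_proper f -> schv g -> schv (g \o f).
Proof.
move=> hf pf [gc [B gB]]; split; first exact: lc_comp.
by have [B' hB'] := pf B; exists B' => x /gB /hB'.
Qed.

Lemma proper_inv r k r' k' (f : 'M[K]_(r, k) -> 'M[K]_(r', k')) f' :
  cancel f f' -> norm_bounded f' -> norm_proper f.
Proof. by move=> fK bf B; have [B' h] := bf B; exists B' => x /h; rewrite fK. Qed.

Lemma bounded_lip r k r' k' (f : 'M[K]_(r, k) -> 'M[K]_(r', k')) (A : R) :
  (forall x, mnorm (f x) <= A * mnorm x) -> norm_bounded f.
Proof.
move=> h B; exists (Num.max A 0 * B) => x xB; apply: le_trans (h x) _.
apply: le_trans (_ : _ <= Num.max A 0 * mnorm x) _.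
  by rewrite ler_wpM2r ?mnorm_ge0 // le_max lexx.
by rewrite ler_wpM2l // le_max lexx orbT.
Qed.

Lemma bounded_mulr r k k' (A : 'M[K]_(k, k')) : norm_bounded (fun x : 'M[K]_(r, k) => x *m A).
Proof. by apply: (@bounded_lip _ _ _ _ _ (mnorm A)) => x; rewrite mulrC mnormM. Qed.

Lemma bounded_mull r k k' (A : 'M[K]_(k', r)) : norm_bounded (fun x : 'M[K]_(r, k) => A *m x).
Proof. by apply: (@bounded_lip _ _ _ _ _ (mnorm A)) => x; rewrite mnormM. Qed.

Lemma boundedD r k r' k' (f g : 'M[K]_(r, k) -> 'M[K]_(r', k')) :
  norm_bounded f -> norm_bounded g -> norm_bounded (fun x => f x + g x).
Proof.
move=> hf hg B; have [B1 h1] := hf B; have [B2 h2] := hg B.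
exists (Num.max B1 B2) => x xB; apply: le_trans (mnormD hK _ _) _.
by rewrite ge_max !le_max h1 // h2 // orbT.
Qed.

Lemma norm_bounded_cst r k r' k' (c : 'M[K]_(r', k')) : norm_bounded (fun _ : 'M[K]_(r, k) => c).
Proof. by move=> B; exists (mnorm c). Qed.

Lemma bounded_id r k : norm_bounded (@id 'M[K]_(r, k)).
Proof. by move=> B; exists B. Qed.

Lemma boundedM r k r' l k' (f : 'M[K]_(r, k) -> 'M[K]_(r', l))
    (g : 'M[K]_(r, k) -> 'M[K]_(l, k')) :
  norm_bounded f -> norm_bounded g -> norm_bounded (fun x => f x *m g x).
Proof.
move=> hf hg B; have [B1 h1] := hf B; have [B2 h2] := hg B.
exists (B1 * B2) => x xB; apply: le_trans (mnormM hK _ _) _.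
by rewrite ler_pM ?mnorm_ge0 ?h1 ?h2.
Qed.

Lemma bounded_comp r k r' k' r2 k2 (f : 'M[K]_(r, k) -> 'M[K]_(r', k'))
    (g : 'M[K]_(r', k') -> 'M[K]_(r2, k2)) : norm_bounded g -> norm_bounded f -> norm_bounded (g \o f).
Proof.
move=> hg hf B; have [B1 h1] := hf B; have [B2 h2] := hg B1.
by exists B2 => x /h1 /h2.
Qed.

Lemma bounded_lsubmx r k1 k2 : norm_bounded (@lsubmx K r k1 k2).
Proof. by move=> B; exists B => x; apply: le_trans; exact: mnorm_lsubmx. Qed.

Lemma bounded_rsubmx r k1 k2 : norm_bounded (@rsubmx K r k1 k2).
Proof. by move=> B; exists B => x; apply: le_trans; exact: mnorm_rsubmx. Qed.

Definition scomp r k r' k' (f : 'M[K]_(r, k) -> 'M[K]_(r', k')) (phi : SS r' k') : SS r k :=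
  toS (phi \o f).

Lemma scompE r k r' k' (f : 'M[K]_(r, k) -> 'M[K]_(r', k')) phi x :
  cts f -> norm_proper f -> scomp f phi x = phi (f x).
Proof. by move=> hf pf; rewrite toSE //; apply: schv_comp => //; exact: schwartz_schv. Qed.

Lemma scomp_linear r k r' k' (f : 'M[K]_(r, k) -> 'M[K]_(r', k')) :
  cts f -> norm_proper f -> linear (scomp f).
Proof. by move=> hf pf a u v; apply: schwartzP => x; rewrite schwD schwZ !scompE. Qed.

Definition smul r k (m : 'M[K]_(r, k) -> C) (phi : SS r k) : SS r k :=
  toS (fun x => m x * phi x).

Lemma smulE r k (m : 'M[K]_(r, k) -> C) phi x :
  locally_const m -> smul m phi x = m x * phi x.
Proof. by move=> hm; rewrite toSE //; apply: schv_lcM => //; exact: schwartz_schv. Qed.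

Lemma smul_linear r k (m : 'M[K]_(r, k) -> C) : locally_const m -> linear (smul m).
Proof.
move=> hm a u v; apply: schwartzP => x.
by rewrite schwD schwZ !smulE // schwD schwZ mulrDr mulrCA.
Qed.

Lemma schv_prod r k r1 k1 r2 k2 (f : 'M[K]_(r, k) -> 'M[K]_(r1, k1))
    (g : 'M[K]_(r, k) -> 'M[K]_(r2, k2)) (phi : SS r1 k1) (psi : SS r2 k2) :
  cts f -> cts g ->
  (forall B : R, exists B' : R, forall x, mnorm (f x) <= B -> mnorm (g x) <= B ->
     mnorm x <= B') ->
  @schv _ _ _ _ C^o (fun x => phi (f x) * psi (g x)).
Proof.
move=> hf hg pr; split.
  apply: (lc_post2 hK (fun u v : C => u * v)); apply: lc_comp => //.
    exact: (schwartz_schv phi).1.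
  exact: (schwartz_schv psi).1.
have [B1 _ h1] := schv_supp (schwartz_schv phi).
have [B2 _ h2] := schv_supp (schwartz_schv psi).
have [B' hB'] := pr (Num.max B1 B2); exists B' => x; rewrite mulf_eq0 negb_or.
by case/andP => /h1 b1 /h2 b2; apply: hB'; rewrite le_max ?b1 // b2 orbT.
Qed.

Definition rtens r k1 k2 (phi : SS r k1) (psi : SS r k2) : SS r (k1 + k2) :=
  toS (fun x => phi (lsubmx x) * psi (rsubmx x)).

Lemma rtensE r k1 k2 (phi : SS r k1) (psi : SS r k2) x :
  rtens phi psi x = phi (lsubmx x) * psi (rsubmx x).
Proof.
rewrite toSE //; apply: schv_prod; [exact: cts_lsubmx|exact: cts_rsubmx|].
move=> B; exists B => {}x h1 h2.
by rewrite -[x]hsubmxK mnorm_row_mx // ge_max h1.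
Qed.

Definition ctens r1 r2 k (phi : SS r1 k) (psi : SS r2 k) : SS (r1 + r2) k :=
  toS (fun x => phi (usubmx x) * psi (dsubmx x)).

Lemma ctensE r1 r2 k (phi : SS r1 k) (psi : SS r2 k) x :
  ctens phi psi x = phi (usubmx x) * psi (dsubmx x).
Proof.
rewrite toSE //; apply: schv_prod; [exact: cts_usubmx|exact: cts_dsubmx|].
move=> B; exists B => {}x h1 h2.
by rewrite -[x]vsubmxK mnorm_col_mx // ge_max h1.
Qed.

Lemma cts_addr r k (a : 'M[K]_(r, k)) : cts (fun x => x + a).
Proof. by apply: ctsD => //; [exact: cts_id|exact: cts_cst]. Qed.

Lemma proper_addr r k (a : 'M[K]_(r, k)) : norm_proper (fun x => x + a).
Proof.
apply: (@proper_inv _ _ _ _ _ (fun x => x - a)) => [x|]; first by rewrite addrK.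
by apply: boundedD; [exact: bounded_id|exact: norm_bounded_cst].
Qed.

Definition sshift r k (a : 'M[K]_(r, k)) (phi : SS r k) : SS r k :=
  scomp (fun x => x + a) phi.

Lemma sshiftE r k (a : 'M[K]_(r, k)) phi x : sshift a phi x = phi (x + a).
Proof. by rewrite scompE //; [exact: cts_addr|exact: proper_addr]. Qed.

Lemma sshift_sbump r k (a c : 'M[K]_(r, k)) (e : R) : 0 < e ->
  sshift a (sbump c e) = sbump (c - a) e.
Proof.
by move=> e0; apply: schwartzP => x; rewrite sshiftE !sbumpE // opprB addrA addrAC.
Qed.

Section Haar.
Context {r k : nat}.
Local Notation M := 'M[K]_(r, k).

(** A purely linear notion, so that values of Fourier transforms qualify; positivity up to one
    global factor is recovered in [haar_pos]. *)
Definition haar (I : SS r k -> C) : Prop :=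
  [/\ linear (I : SS r k -> C^o), forall a phi, I (sshift a phi) = I phi
    & exists phi, I phi != 0].

Lemma haar_unique (P : lmodType C) (I : SS r k -> C) (T : SS r k -> P) :
  haar I -> linear T -> (forall a phi, T (sshift a phi) = T phi) ->
  forall phi psi, I psi *: T phi = I phi *: T psi.
Proof.
move=> [hI inv _] hT invT phi psi.
apply: (@invariant_dist_unique R K hK r k P T I setT setT 1) => //.
- move=> a h; have -> : a = 0 by apply: schwartzP => x; rewrite h.
  by rewrite (lin0 hT) (lin0 hI).
- move=> x x' s _ _ _ _ s0 _.
  have -> : sbump x s = sshift (x' - x) (sbump x' s) by rewrite sshift_sbump // subKr.
  by rewrite inv invT.
Qed.

Lemma haar_decomp (I : SS r k -> C) (phi : SS r k) (xs : seq M) (s : R) : haar I ->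
  0 < s -> phi = \sum_(c <- xs) phi c *: sbump c s ->
  I phi = (\sum_(c <- xs) phi c) * I (sbump 0 s).
Proof.
move=> [hI inv _] s0 phiE; rewrite [in LHS]phiE (lin_sum hI) mulr_suml.
apply: eq_bigr => c _; rewrite (linZ hI); congr (_ * _).
by rewrite -[in RHS](inv (- c)) sshift_sbump // sub0r opprK.
Qed.

Lemma decomp_pos (phi : SS r k) (xs : seq M) (s : R) : 0 < s ->
  phi = \sum_(c <- xs) phi c *: sbump c s ->
  (forall x, 0 <= phi x) -> phi != 0 -> 0 < \sum_(c <- xs) phi c.
Proof.
move=> s0 phiE pos nz; rewrite lt0r sumr_ge0 // andbT.
apply: contra_neq nz => z0; rewrite phiE big_seq big1 // => c cs.
suff -> : phi c = 0 by rewrite scale0r.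
apply/eqP; rewrite eq_le pos andbT -z0 (big_rem c) //= lerDl sumr_ge0 //.
Qed.

(** At a common scale [s], invariance turns each integral into the sum of the sampled values times
    the integral of a single ball of radius [s]. The sums are positive, and the last factor is
    nonzero since otherwise [I] would vanish identically. *)
Lemma haar_pos (I : SS r k -> C) (phi psi : SS r k) : haar I ->
  (forall x, 0 <= phi x) -> (forall x, 0 <= psi x) -> phi != 0 -> psi != 0 ->
  I psi != 0 /\ exists2 c : C, 0 < c & I phi = c * I psi.
Proof.
move=> hI phi0 psi0 phin psin.
have nz (s : R) : 0 < s -> I (sbump 0 s) != 0.
  move=> s0; have [lI _ [om om0]] := hI; apply: contra_neq om0 => b0.
  have [t [t0 [xs hxs] [ys hys]]] := schwartz_decomp2 hK om (sbump 0 s).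
  rewrite (haar_decomp hI t0 hxs).
  have := b0; rewrite (haar_decomp hI t0 hys) => /eqP; rewrite mulf_eq0.
  rewrite gt_eqF /= => [/eqP ->|]; first by rewrite mulr0.
  apply: (decomp_pos t0 hys) => [x|]; first by rewrite sbumpE // ler0n.
  apply: contra_neq (oner_neq0 C) => z0.
  by rewrite -(@sbump_center R K hK r k 0 s s0) z0.
have [s [s0 [xs hxs] [ys hys]]] := schwartz_decomp2 hK phi psi.
have px := decomp_pos s0 hxs phi0 phin; have py := decomp_pos s0 hys psi0 psin.
rewrite (haar_decomp hI s0 hxs) (haar_decomp hI s0 hys); split.
  by rewrite mulf_neq0 ?nz // gt_eqF.
exists ((\sum_(c <- xs) phi c) / (\sum_(c <- ys) psi c)); first exact: divr_gt0.
by rewrite mulrA divfK // gt_eqF.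
Qed.

Lemma sbump_ge0 (c : M) (s : R) x : 0 < s -> 0 <= sbump c s x.
Proof. by move=> s0; rewrite sbumpE // ler0n. Qed.

Lemma sbump_neq0 (c : M) (s : R) : 0 < s -> sbump c s != 0.
Proof.
move=> s0; apply: contra_neq (oner_neq0 C) => z0.
by rewrite -(@sbump_center R K hK r k c s s0) z0.
Qed.

Lemma haar_bump_neq0 (I : SS r k -> C) c (s : R) : haar I -> 0 < s -> I (sbump c s) != 0.
Proof.
move=> hI s0; have [] // := @haar_pos I (sbump c s) (sbump c s) hI.
all: by [move=> x; exact: sbump_ge0|exact: sbump_neq0].
Qed.

(** The modulus of an additive automorphism. Its positivity is what later allows an equation such as
    c ^+ n = 1 to be solved by c = 1. *)
Lemma haar_comp (I : SS r k -> C) (f f' : M -> M) : haar I ->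
  cts f -> norm_proper f -> cancel f' f -> (forall x y, f (x + y) = f x + f y) ->
  exists2 c : C, 0 < c & forall phi, I (scomp f phi) = c * I phi.
Proof.
move=> hI cf pf fK fD; have [lI inv _] := hI.
have f0 : f 0 = 0 by apply: (@addrI _ (f 0)); rewrite -fD !addr0.
have lf : linear (fun phi => I (scomp f phi) : C^o).
  by move=> a u v; rewrite (scomp_linear cf pf) lI.
have invf a phi : I (scomp f (sshift a phi)) = I (scomp f phi).
  rewrite -[RHS](inv (f' a)); congr (I _); apply: schwartzP => x.
  by rewrite sshiftE (scompE phi) // (scompE (sshift a phi)) // sshiftE fD fK.
pose b : SS r k := sbump 0 1.
have b0 : I b != 0 by exact: haar_bump_neq0.
have [||||_ [c c0 hc]] := @haar_pos I (scomp f b) b hI.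
- by move=> x; rewrite scompE // sbump_ge0.
- by move=> x; rewrite sbump_ge0.
- apply: contra_neq (oner_neq0 C) => z0.
  have : scomp f b 0 = 0 by rewrite z0.
  by rewrite scompE // f0 sbump_center.
- exact: sbump_neq0.
exists c => // phi.
have h : I b * I (scomp f phi) = I phi * I (scomp f b).
  exact: (@haar_unique C^o I _ hI lf invf phi b).
by apply: (mulfI b0); rewrite h hc mulrCA [RHS]mulrCA (mulrC (I phi)).
Qed.

End Haar.

Section VectorIntegral.
Context {r k : nat}.
Local Notation M := 'M[K]_(r, k).

(* The algebraic tensor product of Schwartz functions with [P] embeds into the
   [P]-valued functions. *)
Lemma tensor_eq0 (P P' : lmodType C) (T : SS r k -> P -> P')
    (s : seq (SS r k * P)) :
  (forall v, linear (T^~ v)) -> (forall phi, linear (T phi)) ->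
  (forall x, \sum_(z <- s) z.1 x *: z.2 = 0) -> \sum_(z <- s) T z.1 z.2 = 0.
Proof.
move=> Tl Tr; have [n] := ubnP (size s).
elim: n s => // n IH [|[phi v] s] sn h; first by rewrite big_nil.
have {}h x : phi x *: v + \sum_(z <- s) z.1 x *: z.2 = 0.
  by have := h x; rewrite big_cons.
rewrite big_cons /=.
have [[x px]|phi0] := pselect (exists x, phi x != 0); last first.
  have z0 : phi = 0.
    apply: schwartzP => x; apply/eqP; apply: contrapT => /negP px.
    by apply: phi0; exists x.
  rewrite z0 (lin0 (Tl v)) add0r; apply: IH => // x.
  by have := h x; rewrite z0 scale0r add0r.
(* Elimination: the relation at [x] expresses [v] by the other vectors. Substituting it modifies the
   remaining functions by multiples of [phi] and shortens the relation by one term. *)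
have vE : v = - \sum_(z <- s) ((phi x)^-1 * z.1 x) *: z.2.
  have /eqP := h x; rewrite addr_eq0 => /eqP hv.
  rewrite -[LHS](scalerK px) hv scalerN scaler_sumr; congr (- _).
  by apply: eq_bigr => z _; rewrite scalerA.
pose F (z : SS r k * P) : SS r k := z.1 - ((phi x)^-1 * z.1 x) *: phi.
have FE z y : F z y = z.1 y - ((phi x)^-1 * z.1 x) * phi y.
  by rewrite schwD schwN schwZ.
have FD z : F z = z.1 - ((phi x)^-1 * z.1 x) *: phi by [].
clearbody F; pose s' := [seq (F z, z.2) | z <- s].
have := IH s'; rewrite size_map => /(_ sn).
rewrite !big_map => h'.
have : \sum_(z <- s) T (F z) z.2 = 0.
  rewrite h' // => y; rewrite big_map /=.
  rewrite -[RHS](h y) vE scalerN scaler_sumr -sumrN -big_split /=.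
  apply: eq_bigr => z _.
  by rewrite FE scalerBl scalerA addrC [phi y * _]mulrC.
move=> h2; rewrite -[RHS]h2 vE (linN (Tr phi)) (lin_sum (Tr phi)) -sumrN -big_split /=.
apply: eq_bigr => z _.
by rewrite FD (linB (Tl z.2)) (linZ (Tl z.2)) (linZ (Tr phi)) addrC.
Qed.

Variables (I : SS r k -> C).
Hypothesis hI : linear (I : SS r k -> C^o).

Definition tens_rep (P : lmodType C) (g : M -> P) (s : seq (SS r k * P)) : Prop :=
  forall x, g x = \sum_(z <- s) z.1 x *: z.2.

(** The integral of a [P]-valued function, computed on any representative in the tensor product of
    Schwartz functions with [P]. It asks for no topology on [P]; independence of the representative
    is [tensor_eq0]. *)
Definition vint (P : lmodType C) (g : M -> P) : P :=
  xget 0 [set v | exists2 s, tens_rep g s & v = \sum_(z <- s) I z.1 *: z.2].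

Lemma tens_rep_exists (P : lmodType C) (g : M -> P) :
  schv g -> exists s, tens_rep g s.
Proof.
move=> hg; have [e e0 he] := schv_decomp hK hg.
have [xs hxs] := he e e0 (lexx _).
by exists [seq (sbump c e, g c) | c <- xs] => x; rewrite big_map hxs.
Qed.

Lemma vintE (P : lmodType C) (g : M -> P) s :
  tens_rep g s -> vint g = \sum_(z <- s) I z.1 *: z.2.
Proof.
move=> gs; rewrite /vint; case: xgetP => [v _ [s' gs' ->]|none]; last first.
  by have /(_ (\sum_(z <- s) I z.1 *: z.2)) [] := none; exists s.
apply/eqP; rewrite -subr_eq0; apply/eqP.
have := @tensor_eq0 P P (fun phi v => I phi *: v)
  (s' ++ [seq (z.1, - z.2) | z <- s]).
rewrite big_cat big_map /= => h; rewrite -[RHS]h.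
- congr (_ + _); rewrite -sumrN; apply: eq_bigr => z _; by rewrite scalerN.
- by move=> v' a u w; rewrite hI scalerDl scalerA.
- by move=> phi a u w; rewrite scalerDr !scalerA mulrC.
- move=> x; rewrite big_cat big_map /= -gs'; apply/eqP; rewrite addr_eq0 gs.
  by rewrite -sumrN; apply/eqP; apply: eq_bigr => z _; rewrite scalerN opprK.
Qed.

Lemma vint_lin (P : lmodType C) (a : C) (g h : M -> P) : schv g -> schv h ->
  vint (fun x => a *: g x + h x) = a *: vint g + vint h.
Proof.
move=> /tens_rep_exists[s gs] /tens_rep_exists[t ht].
rewrite (vintE gs) (vintE ht).
rewrite (@vintE _ _ ([seq (z.1, a *: z.2) | z <- s] ++ t)) => [|x].
  rewrite big_cat big_map /= scaler_sumr; congr (_ + _).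
  by apply: eq_bigr => z _; rewrite !scalerA mulrC.
rewrite big_cat big_map /= gs ht scaler_sumr; congr (_ + _).
by apply: eq_bigr => z _; rewrite !scalerA mulrC.
Qed.

Lemma vint_post (P P' : lmodType C) (L : P -> P') (g : M -> P) :
  linear L -> schv g -> vint (L \o g) = L (vint g).
Proof.
move=> hL /tens_rep_exists[s gs]; rewrite (vintE gs) (lin_sum hL).
rewrite (@vintE _ _ [seq (z.1, L z.2) | z <- s]) => [|x].
  by rewrite big_map; apply: eq_bigr => z _; rewrite (linZ hL).
rewrite big_map /= gs (lin_sum hL).
by apply: eq_bigr => z _; rewrite (linZ hL).
Qed.

Lemma vint_tensor (P : lmodType C) (phi : SS r k) (v : P) (g : M -> P) :
  (forall x, g x = phi x *: v) -> vint g = I phi *: v.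
Proof.
move=> gE; rewrite (@vintE _ _ [:: (phi, v)]) => [|x]; by rewrite big_seq1 ?gE.
Qed.

Lemma vint_comp (P : lmodType C) (c : C) (f : M -> M) (g : M -> P) :
  cts f -> norm_proper f -> (forall phi, I (scomp f phi) = c * I phi) -> schv g ->
  vint (g \o f) = c *: vint g.
Proof.
move=> cf pf hc /tens_rep_exists[s gs]; rewrite (vintE gs).
rewrite (@vintE _ _ [seq (scomp f z.1, z.2) | z <- s]) => [|x].
  rewrite big_map scaler_sumr; apply: eq_bigr => z _; by rewrite hc scalerA.
by rewrite big_map /= gs; apply: eq_bigr => z _; rewrite scompE.
Qed.

End VectorIntegral.
End Integration.

(** * Bilinear forms supported on a graph *)

Section Bilinear.
Context {R : realType} {K : vfield R} (hK : local_field K).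
Local Notation C := R[i].
Local Notation SS r k := (schwartz K r k).
Context {r k r' k' : nat} {P : lmodType C}.
Variable beta : SS r k -> SS r' k' -> P.
Hypotheses (betal : forall phi, linear (beta^~ phi)) (betar : forall Phi, linear (beta Phi)).

(** The two-variable form of [linear_local]. Compactness of the support of [phi] first gives a
    radius [t] uniform in the second variable; [phi] is then decomposed at that scale and locality
    is applied in the first variable. *)
Lemma pure_support (Phi : SS r k) (phi : SS r' k') :
  (forall x a, Phi x != 0 -> phi a != 0 -> exists2 e : R, 0 < e &
     forall y b, mnorm (y - x) < e -> mnorm (b - a) < e ->
     forall s t, 0 < s -> s <= e -> 0 < t -> t <= e ->
       beta (sbump y s) (sbump b t) = 0) ->
  beta Phi phi = 0.
Proof.
move=> h; apply: (linear_local hK (betal phi)) => x Px.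
have [B _ hB] := schv_supp (schwartz_schv phi).
have [|d d0 hd] := @ball_compact R K hK r' k' (fun b t => phi b != 0 ->
  forall y, mnorm (y - x) < t -> forall s, 0 < s -> s <= t ->
  beta (sbump y s) (sbump b t) = 0) _ B.
  move=> a; have [pa|pa] := eqVneq (phi a) 0.
    have [e e0 he] := (schwartz_schv phi).1 a; exists e => // b hb t t0 te.
    by rewrite he // pa eqxx.
  have [e e0 he] := h x a Px pa; exists e => // b hb t t0 te _ y hy s s0 st.
  by apply: he => //; [exact: lt_le_trans hy te|exact: le_trans st te].
have [e e0 he] := schwartz_decomp hK phi.
pose t := Num.min d e; have t0 : 0 < t by rewrite lt_min d0.
have [|xs hxs] := he t t0; first by rewrite ge_min lexx orbT.
exists t => // y hy s s0 st.
rewrite hxs (lin_sum (betar _)) big1 // => c _; rewrite (linZ (betar _)).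
have [->|pc] := eqVneq (phi c) 0; first by rewrite scale0r.
by rewrite (hd c) ?scaler0 ?hB // ge_min lexx.
Qed.

(** Small indicators are eigenvectors of locally constant multipliers, so invariance with an
    eigenvalue other than 1 forces the value 0. *)
Lemma multiplier_vanish (m1 : 'M[K]_(r, k) -> C) (m2 : 'M[K]_(r', k') -> C) x a :
  locally_const m1 -> locally_const m2 -> m1 x * m2 a != 1 ->
  (forall Phi phi, beta (smul m1 Phi) (smul m2 phi) = beta Phi phi) ->
  exists2 e : R, 0 < e &
     forall y b, mnorm (y - x) < e -> mnorm (b - a) < e ->
     forall s t, 0 < s -> s <= e -> 0 < t -> t <= e ->
       beta (sbump y s) (sbump b t) = 0.
Proof.
move=> hm1 hm2 ne inv; have [e e0 he] := hm1 x; have [d d0 hd] := hm2 a.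
have m0 : 0 < Num.min e d by rewrite lt_min e0.
exists (Num.min e d) => // y b.
rewrite !lt_min => /andP[ye yd] /andP[be bd] s t s0; rewrite le_min => /andP[se sd] t0.
rewrite le_min => /andP[te td].
have b1 : smul m1 (sbump y s) = m1 x *: sbump y s.
  apply: schwartzP => z; rewrite (smulE hK) // schwZ (sbumpE hK) //.
  case: ltP => [hz|]; last by rewrite !mulr0.
  by rewrite he //; apply: (mnorm_trans hK (y := y)) => //; exact: lt_le_trans hz se.
have b2 : smul m2 (sbump b t) = m2 a *: sbump b t.
  apply: schwartzP => z; rewrite (smulE hK) // schwZ (sbumpE hK) //.
  case: ltP => [hz|]; last by rewrite !mulr0.
  by rewrite hd //; apply: (mnorm_trans hK (y := b)) => //; exact: lt_le_trans hz td.
have := inv (sbump y s) (sbump b t).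
rewrite b1 b2 (linZ (betal _)) (linZ (betar _)) scalerA.
set v := beta _ _ => h; apply/eqP; apply: contraNT ne => v0.
apply/eqP; move/eqP: h; rewrite -subr_eq0 -{2}[v]scale1r -scalerBl scaler_eq0.
by rewrite (negPf v0) orbF subr_eq0 => /eqP.
Qed.

Variables (a : 'M[K]_(r, k) -> 'M[K]_(r', k')) (Z : set 'M[K]_(r, k)).
Hypotheses (acts : cts a) (abnd : norm_bounded a).
Hypothesis supp : forall (Phi : SS r k) (phi : SS r' k'), (forall x, Z x -> Phi x * phi (a x) = 0) ->
  beta Phi phi = 0.

(** On the graph of [a] the second argument is a function of the first. Since [a] is bounded on the
    support of [Phi], the indicator of a large ball plays the role of the constant 1 there, and
    [T Phi] is the stable value of [beta Phi (sbump 0 B)]. *)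
Lemma graph_reduction : exists T : SS r k -> P,
  [/\ linear T, forall (Phi : SS r k) (phi : SS r' k'), beta Phi phi = T (smul (phi \o a) Phi),
      forall Phi : SS r k, (forall x, Z x -> Phi x = 0) -> T Phi = 0
    & forall Phi, exists2 B0 : R, 0 < B0 &
        forall B, B0 <= B -> T Phi = beta Phi (sbump 0 B)].
Proof.
have lca (phi : SS r' k') : locally_const (phi \o a).
  by apply: (lc_comp hK) => //; exact: (schwartz_schv phi).1.
have bnd (Phi : SS r k) : exists B : R, 0 < B /\ forall x, Phi x != 0 -> mnorm (a x) < B.
  have [B _ hB] := schv_supp (schwartz_schv Phi); have [B' hB'] := abnd B.
  exists (Num.max B' 0 + 1); split=> [|x /hB /hB' h].
    by rewrite ltr_wpDl // le_max lexx orbT.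
  by apply: le_lt_trans h _; apply: ltr_pwDr; rewrite // le_max lexx.
have [Rf hRf] := boolp.choice bnd.
have indep (Phi : SS r k) B B' : 0 < B -> 0 < B' ->
    (forall x, Phi x != 0 -> mnorm (a x) < B) ->
    (forall x, Phi x != 0 -> mnorm (a x) < B') ->
    beta Phi (sbump 0 B) = beta Phi (sbump 0 B').
  move=> B0 B'0 hB hB'; apply/eqP; rewrite -subr_eq0 -(linB (betar Phi)).
  apply/eqP/supp => x _; have [->|px] := eqVneq (Phi x) 0; first by rewrite mul0r.
  by rewrite schwD schwN !(sbumpE hK) // !subr0 hB // hB' // subrr mulr0.
exists (fun Phi => beta Phi (sbump 0 (Rf Phi))); split.
- move=> t u v.
  pose B := Num.max (Rf (t *: u + v)) (Num.max (Rf u) (Rf v)).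
  have B0 : 0 < B by rewrite lt_max (hRf _).1.
  rewrite !(indep _ (Rf _) B) ?(hRf _).1 //.
  + by rewrite betal.
  + exact: (hRf v).2.
  + by move=> x /(hRf v).2 h; rewrite !lt_max h !orbT.
  + exact: (hRf u).2.
  + by move=> x /(hRf u).2 h; rewrite !lt_max h !orbT.
  + exact: (hRf _).2.
  + by move=> x /(hRf _).2 h; rewrite lt_max h.
- move=> Phi phi; set Psi := smul _ _.
  have [B1 B10 hB1] := schv_supp (schwartz_schv phi).
  pose B := Num.max (Rf Psi) (B1 + 1).
  have B0 : 0 < B by rewrite lt_max (hRf _).1.
  rewrite (indep _ (Rf _) B) ?(hRf _).1 //; first last.
  + by move=> x /(hRf _).2 h; rewrite lt_max h.
  + exact: (hRf _).2.
  have [e e0 he] := schwartz_decomp hK phi.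
  pose t := Num.min e B; have t0 : 0 < t by rewrite lt_min e0.
  have [|xs hxs] := he t t0; first by rewrite ge_min lexx.
  have PsiE : Psi = \sum_(c <- xs) phi c *: smul (sbump c t \o a) Phi.
    apply: schwartzP => x; rewrite (smulE hK) //= schw_sum [in LHS]hxs schw_sum.
    rewrite mulr_suml; apply: eq_bigr => c _.
    by rewrite !schwZ (smulE hK) // mulrA.
  rewrite PsiE [in LHS]hxs (lin_sum (betar _)) (lin_sum (betal _)).
  apply: eq_bigr => c _; rewrite (linZ (betar _)) (linZ (betal _)).
  have [->|pc] := eqVneq (phi c) 0; first by rewrite !scale0r.
  (* Two uses of the support condition: the indicator is copied into the first argument, which
     changes nothing on the graph, and then the second argument is enlarged to the ball of radius
     [B], which contains the ball around [c]. *)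
  congr (_ *: _); apply: (@eq_trans _ _ (beta (smul (sbump c t \o a) Phi) (sbump c t))).
    apply/eqP; rewrite -subr_eq0 -(linB (betal _)); apply/eqP/supp => x _.
    rewrite schwD schwN (smulE hK) //= (sbumpE hK) //.
    by case: ltP; rewrite ?mulr0 // mul1r subrr mul0r.
  apply/eqP; rewrite -subr_eq0 -(linB (betar _)); apply/eqP/supp => x _.
  rewrite schwD schwN (smulE hK) //= !(sbumpE hK) // subr0.
  case: ltP => [hc|]; last by rewrite mul0r mul0r.
  suff -> : mnorm (a x) < B by rewrite subrr mulr0.
  rewrite -[a x](subrK c); apply: le_lt_trans (mnormD hK _ _) _; rewrite gt_max.
  apply/andP; split; first by apply: lt_le_trans hc _; rewrite ge_min lexx orbT.
  by rewrite lt_max orbC (le_lt_trans (hB1 c pc)) // ltrDl.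
- move=> Phi hPhi; apply: supp => x /hPhi ->; by rewrite mul0r.
- move=> Phi; exists (Rf Phi); first exact: (hRf _).1.
  move=> B hB; apply: indep; rewrite ?(hRf _).1 //.
  + exact: lt_le_trans (hRf _).1 hB.
  + exact: (hRf _).2.
  + by move=> x /(hRf _).2 h; exact: lt_le_trans h hB.
Qed.

End Bilinear.

(** * Quadratic extensions and Hermitian forms *)

Section Contraction.
Context {R : realType} {K : vfield R} (hK : local_field K).

Lemma contraction_fix (f : K -> K) (rho q : R) : 0 <= rho -> 0 <= q -> q < 1 ->
  (forall x, vabs x <= rho -> vabs (f x) <= rho) ->
  (forall x y, vabs x <= rho -> vabs y <= rho ->
     vabs (f x - f y) <= q * vabs (x - y)) ->
  exists2 x, vabs x <= rho & f x = x.
Proof.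
move=> rho0 q0 q1 fball flip.
pose u n := iter n f 0.
have ub n : vabs (u n) <= rho by elim: n => [|n IH]; rewrite /u /= ?abs0 ?fball.
have ustep n : vabs (u n.+1 - u n) <= q ^+ n * rho.
  elim: n => [|n IH]; first by rewrite expr0 mul1r subr0 ub.
  apply: le_trans (flip (u n.+1) (u n) (ub _) (ub _)) _.
  by rewrite exprS -mulrA ler_wpM2l.
have udist N n : vabs (u (N + n)%N - u N) <= q ^+ N * rho.
  elim: n => [|n IH]; first by rewrite addn0 subrr abs0 // mulr_ge0 // exprn_ge0.
  rewrite -(subrKA (u (N + n)%N)); apply: le_trans (labsD hK _ _) _.
  rewrite ge_max IH andbT addnS; apply: le_trans (ustep _) _.
  by rewrite ler_wpM2r // exprD ler_piMr ?exprn_ge0 // exprn_ile1 // ltW.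
have small (e : R) : 0 < e -> exists N, q ^+ N * rho < e.
  move=> e0; have r1 : 0 < rho + 1 by rewrite ltr_wpDl.
  have [N hN] := expr_small q0 q1 (divr_gt0 e0 r1); exists N.
  apply: le_lt_trans (_ : _ <= q ^+ N * (rho + 1)) _.
    by rewrite ler_wpM2l ?exprn_ge0 // lerDl.
  by rewrite -ltr_pdivlMr.
have [|x hx] := labs_complete hK (u := u).
  move=> e e0; have [N hN] := small e e0; exists N => i j Ni Nj.
  rewrite -(subrKA (u N)); apply: le_lt_trans (labsD hK _ _) _.
  rewrite gt_max (absC hK (u N)) -(subnKC Ni) -(subnKC Nj).
  by rewrite !(le_lt_trans (udist _ _)).
have xb : vabs x <= rho.
  rewrite leNgt; apply/negP => rx.
  have [N hN] := hx (vabs x) (le_lt_trans rho0 rx).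
  have := abs_near_eq hK (hN N (leqnn N)).
  by move=> h; have := ub N; rewrite h leNgt rx.
exists x => //; apply/eqP; rewrite -subr_eq0 -(abs_eq0 hK).
apply: contraT => ne; have e0 : 0 < vabs (f x - x) by rewrite lt0r ne labs_ge0.
have [N hN] := hx _ e0.
suff : vabs (f x - x) < vabs (f x - x) by rewrite ltxx.
rewrite -{1}(subrKA (u N.+1)); apply: le_lt_trans (labsD hK _ _) _.
rewrite gt_max (hN N.+1) // andbT.
apply: le_lt_trans (flip _ _ xb (ub N)) _.
apply: le_lt_trans (_ : _ <= vabs (x - u N)) _.
  by rewrite ler_piMl ?labs_ge0 // ltW.
by rewrite (absC hK) hN.
Qed.

Lemma abs2_gt0 : 0 < vabs (2 : K).
Proof. by rewrite (abs_gt0 hK); exact: (lchar0 hK 1). Qed.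

(** Writing t = 1 + x and d = s - 1, the equation is x = (d - x^2) / 2. On the ball of radius |d| /
    |2| < |2| this is a contraction with ratio |d| / |2|^2, in every residue characteristic. *)
Lemma sqrt_near1 (s : K) : vabs (s - 1) < vabs (2 : K) ^+ 2 ->
  exists2 t, t ^+ 2 = s & vabs (t - 1) < vabs (2 : K).
Proof.
move=> hs; have a2 := abs2_gt0; set b := vabs (2 : K) in hs a2 *.
have n2 : (2 : K) != 0 by rewrite -(abs_gt0 hK).
pose d := s - 1; pose rho := vabs d / b.
have rhob : rho < b by rewrite ltr_pdivrMr // -expr2.
have rho0 : 0 <= rho by rewrite divr_ge0 ?labs_ge0 // ltW.
have [||||x xr fx] := @contraction_fix (fun u => (d - u ^+ 2) / 2) rho (rho / b) rho0.
- by rewrite divr_ge0 // ltW.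
- by rewrite ltr_pdivrMr // mul1r.
- move=> x xr; rewrite (labsM hK) (absV hK) -/b ler_pdivrMr //.
  apply: le_trans (absB hK _ _) _; rewrite ge_max (absX hK) divfK ?gt_eqF // lexx /=.
  rewrite /rho; apply: le_trans (_ : _ <= rho * b) _; last by rewrite divfK // gt_eqF.
  by rewrite expr2 ler_pM ?labs_ge0 // (le_trans xr) // ltW.
- move=> x y xr yr.
  have -> : (d - x ^+ 2) / 2 - (d - y ^+ 2) / 2 = (x + y) * 2^-1 * (y - x).
    rewrite -mulrBl mulrAC; congr (_ * _); ring.
  rewrite !(labsM hK) (absV hK) -/b (absC hK y x) ler_wpM2r ?labs_ge0 //.
  rewrite ler_wpM2r ?invr_ge0 ?(ltW a2) //.
  by apply: le_trans (labsD hK _ _) _; rewrite ge_max xr.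
exists (1 + x); last by rewrite addrC addKr (le_lt_trans xr).
have h : d = 2 * x + x ^+ 2.
  by rewrite -[in 2 * x]fx mulrC divfK // subrK.
by rewrite -[RHS](subrK 1) -/d h; ring.
Qed.

Lemma sqrt_near1_sum (t t' : K) : vabs (t - 1) < vabs (2 : K) ->
  vabs (t' - 1) < vabs (2 : K) -> vabs (t + t') = vabs (2 : K).
Proof.
move=> h h'; apply: (abs_near_eq hK).
have -> : t + t' - 2 = (t - 1) + (t' - 1) by ring.
by apply: le_lt_trans (labsD hK _ _) _; rewrite gt_max h.
Qed.

(** Factor the difference of squares: t + t' is so close to 2 that it has the same absolute value.
    This gives both uniqueness and continuity of the root near 1. *)
Lemma sqrt_near1_dist (t t' : K) : vabs (t - 1) < vabs (2 : K) ->
  vabs (t' - 1) < vabs (2 : K) -> vabs (t - t') = vabs (t ^+ 2 - t' ^+ 2) / vabs (2 : K).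
Proof.
move=> h h'; rewrite subr_sqr (labsM hK) (sqrt_near1_sum h h') mulfK //.
by rewrite gt_eqF // abs2_gt0.
Qed.

Lemma sqrt_near1_unique (t t' : K) : vabs (t - 1) < vabs (2 : K) ->
  vabs (t' - 1) < vabs (2 : K) -> t ^+ 2 = t' ^+ 2 -> t = t'.
Proof.
move=> h h' tt; apply/eqP; rewrite -subr_eq0 -(abs_eq0 hK).
by rewrite sqrt_near1_dist // tt subrr (abs0 hK) mul0r.
Qed.

End Contraction.

Section QuadExt.
Context {R : realType} (D : local_ext R).
Local Notation K := (lbase D).
Local Notation L := (ltop D).
Local Notation up := (@lup R D).
Local Notation cj := (@lconj R D).
Local Notation psi := (@lpsi R D).
Local Notation down := (@Defs.down R D).

(** The local facts about E_w / F_v on which the rest depends. As [quad_char] is defined by norms,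
    [quadM] expresses that the norm group has index at most two. *)
Record quad_ext : Prop := QuadExt {
  qe_local : local_field L;
  cjD : {morph cj : x y / x + y};
  cjM : {morph cj : x y / x * y};
  cj1 : cj 1 = 1;
  cjK : involutive cj;
  cj_abs : forall x, vabs (cj x) = vabs x;
  cj_nontriv : exists x, cj x != x;
  upD : {morph up : x y / x + y};
  upM : {morph up : x y / x * y};
  up1 : up 1 = 1;
  up_fixed : forall y, cj y = y <-> exists x, up x = y;
  psi_norm : forall t, `|psi t| = 1;
  quadM : forall x y, x != 0 -> y != 0 ->
    quad_char D (x * y) = quad_char D x * quad_char D y }.

Hypothesis hD : quad_ext.
Let hL := qe_local hD.

Lemma cj0 : cj 0 = 0.
Proof. by apply: (@addrI _ (cj 0)); rewrite -cjD // !addr0. Qed.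

Lemma cjN x : cj (- x) = - cj x.
Proof. by apply/eqP; rewrite -addr_eq0 -cjD // addNr cj0. Qed.

Lemma up0 : up 0 = 0.
Proof. by apply: (@addrI _ (up 0)); rewrite -upD // !addr0. Qed.

Lemma upN x : up (- x) = - up x.
Proof. by apply/eqP; rewrite -addr_eq0 -upD // addNr up0. Qed.

Fact cj_zmod : zmod_morphism cj.
Proof. by move=> x y; rewrite cjD // cjN. Qed.

Fact up_zmod : zmod_morphism up.
Proof. by move=> x y; rewrite upD // upN. Qed.

Definition cjR : {rmorphism L -> L} := HB.pack_for {rmorphism L -> L} cj
  (GRing.isZmodMorphism.Build L L cj cj_zmod)
  (GRing.isMonoidMorphism.Build L L cj (cj1 hD, cjM hD)).

Definition upR : {rmorphism K -> L} := HB.pack_for {rmorphism K -> L} up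
  (GRing.isZmodMorphism.Build K L up up_zmod)
  (GRing.isMonoidMorphism.Build K L up (up1 hD, upM hD)).

Lemma cjV x : cj x^-1 = (cj x)^-1. Proof. exact: (fmorphV cjR). Qed.
Lemma cjX x n : cj (x ^+ n) = cj x ^+ n. Proof. exact: (rmorphXn cjR). Qed.
Lemma cj_nat n : cj n%:R = n%:R. Proof. exact: (rmorph_nat cjR). Qed.
Lemma cj_eq0 x : (cj x == 0) = (x == 0). Proof. exact: (fmorph_eq0 cjR). Qed.
Lemma up_inj : injective up. Proof. exact: (fmorph_inj upR). Qed.
Lemma up_eq0 x : (up x == 0) = (x == 0). Proof. exact: (fmorph_eq0 upR). Qed.
Lemma cj_up x : cj (up x) = up x. Proof. by apply/(up_fixed hD); exists x. Qed.

Lemma down_up t : down (up t) = t.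
Proof.
rewrite /Defs.down; case: xgetP => [s _ /= /up_inj //|none].
by case: (none t).
Qed.

Lemma up_down y : cj y = y -> up (down y) = y.
Proof. by move=> /(up_fixed hD)[x <-]; rewrite down_up. Qed.

Section HConj.
Implicit Types (r k l n : nat).

Lemma hconjE r k (A : 'M[L]_(r, k)) : hconj A = map_mx cjR A^T. Proof. by []. Qed.

Lemma hconjM r k l (A : 'M[L]_(r, k)) (B : 'M[L]_(k, l)) :
  hconj (A *m B) = hconj B *m hconj A.
Proof. by rewrite !hconjE trmx_mul map_mxM. Qed.

Lemma hconjD r k (A B : 'M[L]_(r, k)) : hconj (A + B) = hconj A + hconj B.
Proof. by rewrite !hconjE linearD map_mxD. Qed.

Lemma hconjN r k (A : 'M[L]_(r, k)) : hconj (- A) = - hconj A.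
Proof. by rewrite !hconjE linearN map_mxN. Qed.

Lemma hconj0 r k : hconj (0 : 'M[L]_(r, k)) = 0.
Proof. by rewrite !hconjE linear0 map_mx0. Qed.

Lemma hconjZ r k a (A : 'M[L]_(r, k)) : hconj (a *: A) = cj a *: hconj A.
Proof. by rewrite !hconjE linearZ map_mxZ. Qed.

Lemma hconjK r k (A : 'M[L]_(r, k)) : hconj (hconj A) = A.
Proof. by apply/matrixP => i j; rewrite !mxE cjK. Qed.

Lemma hconj_scalar n a : hconj (a%:M : 'M[L]_n) = (cj a)%:M.
Proof. by rewrite hconjE tr_scalar_mx map_scalar_mx. Qed.

Lemma hconj1 n : hconj (1%:M : 'M[L]_n) = 1%:M.
Proof. by rewrite hconj_scalar cj1. Qed.

Lemma hconj_block r1 r2 k1 k2 (A : 'M[L]_(r1, k1)) (B : 'M[L]_(r1, k2))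
    (A' : 'M[L]_(r2, k1)) (B' : 'M[L]_(r2, k2)) :
  hconj (block_mx A B A' B') = block_mx (hconj A) (hconj A') (hconj B) (hconj B').
Proof. by rewrite hconjE tr_block_mx map_block_mx. Qed.

Lemma hconj_row_mx r k1 k2 (A : 'M[L]_(r, k1)) (B : 'M[L]_(r, k2)) :
  hconj (row_mx A B) = col_mx (hconj A) (hconj B).
Proof. by rewrite hconjE tr_row_mx map_col_mx. Qed.

Lemma hconj_col_mx r1 r2 k (A : 'M[L]_(r1, k)) (B : 'M[L]_(r2, k)) :
  hconj (col_mx A B) = row_mx (hconj A) (hconj B).
Proof. by rewrite hconjE tr_col_mx map_row_mx. Qed.

Lemma det_hconj n (A : 'M[L]_n) : \det (hconj A) = cj (\det A).
Proof. by rewrite hconjE (det_map_mx cjR) det_tr. Qed.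

Lemma tr_hconj n (A : 'M[L]_n) : \tr (hconj A) = cj (\tr A).
Proof. by rewrite hconjE (trace_map_mx cjR) mxtrace_tr. Qed.

Lemma unitmx_hconj n (A : 'M[L]_n) : (hconj A \in unitmx) = (A \in unitmx).
Proof. by rewrite !unitmxE det_hconj !unitfE cj_eq0. Qed.

Lemma hconj_inv n (A : 'M[L]_n) : hconj (invmx A) = invmx (hconj A).
Proof. by rewrite !hconjE trmx_inv map_invmx. Qed.

Lemma mnorm_hconj r k (A : 'M[L]_(r, k)) : mnorm (hconj A) = mnorm A.
Proof.
apply/eqP; rewrite eq_le; apply/andP; split.
  by apply/mnorm_leP => [|i j]; rewrite ?mnorm_ge0 // !mxE cj_abs // mnorm_entry.
apply/mnorm_leP => [|i j]; first exact: mnorm_ge0.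
by have := mnorm_entry (hconj A) j i; rewrite !mxE cj_abs.
Qed.

Lemma cts_hconj r k : cts (@hconj R D r k).
Proof.
by apply: (@cts_lip _ _ _ _ _ _ _ 1) => x y; rewrite mul1r -hconjN -hconjD mnorm_hconj.
Qed.

Lemma bounded_hconj r k : norm_bounded (@hconj R D r k).
Proof. by move=> B; exists B => x; rewrite mnorm_hconj. Qed.

End HConj.
End QuadExt.

(** * Norms and the classification of Hermitian forms *)

Section Hermitian.
Context {R : realType} (D : local_ext R).
Local Notation C := R[i].
Local Notation K := (lbase D).
Local Notation L := (ltop D).
Local Notation up := (@lup R D).
Local Notation cj := (@lconj R D).
Local Notation down := (@Defs.down R D).
Local Notation hermitian := (@Defs.hermitian R D _).
Hypothesis hD : quad_ext D.
Let hL := qe_local hD.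

Definition is_norm (y : L) : Prop := exists2 z, z != 0 & y = z * cj z.

Lemma is_norm_neq0 y : is_norm y -> y != 0.
Proof. by case=> z z0 ->; rewrite mulf_neq0 ?cj_eq0. Qed.

Lemma is_norm_fixed y : is_norm y -> cj y = y.
Proof. by case=> z z0 ->; rewrite cjM // cjK // mulrC. Qed.

Lemma is_normM y y' : is_norm y -> is_norm y' -> is_norm (y * y').
Proof.
move=> [z z0 ->] [z' z'0 ->]; exists (z * z'); first exact: mulf_neq0.
by rewrite cjM // mulrACA.
Qed.

Lemma is_normV y : is_norm y -> is_norm y^-1.
Proof.
by move=> [z z0 ->]; exists z^-1; rewrite ?invr_eq0 // cjV // invfM.
Qed.

Lemma is_norm_sqr y : y != 0 -> cj y = y -> is_norm (y ^+ 2).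
Proof. by move=> y0 cy; exists y; rewrite // cy. Qed.

Lemma quad_char_norm (x : K) : x != 0 ->
  quad_char D x = if `[< is_norm (up x) >] then 1 else -1.
Proof.
move=> x0; rewrite /quad_char; congr (if _ then _ else _).
apply: asbool_equiv_eq; split=> [[y hy]|[z z0 hz]]; last by exists z.
by exists y => //; apply: contra_neq x0 => y0; apply: (up_inj hD); rewrite hy y0 mul0r up0.
Qed.

Lemma quad_char1 (x : K) : x != 0 -> quad_char D x = 1 <-> is_norm (up x).
Proof.
move=> x0; rewrite quad_char_norm //; case: asboolP => // h; split=> // /eqP.
by rewrite eq_sym -addr_eq0 -[1 + 1]/(2%:R) pnatr_eq0.
Qed.

Lemma quad_char_sqr1 (x : K) : quad_char D x * quad_char D x = 1.
Proof. by rewrite /quad_char; case: ifP; rewrite ?mul1r // mulrNN mul1r. Qed.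

Lemma norm_index2 y y' : y != 0 -> y' != 0 -> cj y = y -> cj y' = y' ->
  ~ is_norm y -> ~ is_norm y' -> is_norm (y * y').
Proof.
move=> y0 y'0 cy cy' ny ny'.
have x0 : down y != 0 by rewrite -(up_eq0 hD) up_down.
have x'0 : down y' != 0 by rewrite -(up_eq0 hD) up_down.
have : quad_char D (down y * down y') = 1.
  rewrite (quadM hD) // !quad_char_norm // !(up_down hD) //.
  by case: asboolP => //; case: asboolP => // _ _; rewrite mulrNN mulr1.
by move/quad_char1; rewrite upM // !(up_down hD) //; apply; rewrite mulf_neq0.
Qed.

(** The square root near 1 is unique, hence fixed by conjugation, and the square of a fixed element
    is its norm. *)
Lemma norm_near1 s : cj s = s -> vabs (s - 1) < vabs (2 : L) ^+ 2 -> is_norm s.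
Proof.
move=> cs hs; have [t ts ht] := sqrt_near1 hL hs.
have ct : cj t = t.
  apply: (sqrt_near1_unique hL) => //; last by rewrite -cjX // ts cs.
  by rewrite -{1}(cj1 hD) -(cjN hD) -cjD // (cj_abs hD).
rewrite -ts; apply: is_norm_sqr => //; apply: contraTneq hs => t0.
rewrite -ts t0 expr0n /= sub0r (absN hL) (abs1 hL) -leNgt.
by rewrite exprn_ile1 // ?labs_ge0 // (abs_nat_le1 hL).
Qed.

(** It is enough to find one sum of two norms that is neither 0 nor a norm: its quotient with [c] is
    a norm by the index-two property, and scaling transports the decomposition to [c]. *)
Lemma nonnorm_sum c : cj c = c -> c != 0 -> ~ is_norm c ->
  exists y y', [/\ is_norm y, is_norm y' & c = y + y'].
Proof.
move=> cc c0 nc.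
suff [y [y' [ny ny' ny0 nyy']]] : exists y y',
    [/\ is_norm y, is_norm y', y + y' != 0 & ~ is_norm (y + y')].
  have cyy : cj (y + y') = y + y' by rewrite cjD // !is_norm_fixed.
  have h : is_norm (c * (y + y')^-1).
    have -> : c * (y + y')^-1 = (c * (y + y')) * ((y + y') ^+ 2)^-1.
      by rewrite expr2 invfM mulrA mulfK.
    apply: is_normM; first exact: norm_index2.
    by apply: is_normV; exact: is_norm_sqr.
  exists (c * (y + y')^-1 * y), (c * (y + y')^-1 * y'); split.
  - exact: is_normM.
  - exact: is_normM.
  - by rewrite -mulrDr divfK.
(* Otherwise nonzero sums of norms are norms. Then every positive integer is a norm, then -1 is, and
   finally [c], a difference of two squares of fixed elements, would be one. *)
apply: contrapT => none.
have sumN y y' : is_norm y -> is_norm y' -> y + y' != 0 -> is_norm (y + y').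
  by move=> ny ny' s0; apply: contrapT => h; apply: none; exists y, y'.
have n1 : is_norm 1 by exists 1; rewrite ?oner_eq0 // cj1 // mulr1.
have nat_norm n : is_norm n.+1%:R.
  elim: n => [|n IH]; first by rewrite mulr1n.
  by rewrite -addn1 natrD; apply: sumN => //; rewrite -natrD addn1; exact: (lchar0 hL).
(* For large [n] the element 1 - p^(n+1) is a norm because it is close to 1, and the positive
   integer p^(n+1) - 1 is one as well; their quotient is -1. *)
have nm1 : is_norm (-1).
  have [p [p1 /andP[a0 a1]]] := abs_small_ex hL.
  have [n hn] := expr_small (ltW a0) a1 (exprn_gt0 2 (abs2_gt0 hL)).
  have pn : (1 < p ^ n.+1)%N by rewrite -{1}(exp1n n.+1) ltn_exp2r.
  have h1 : is_norm ((p ^ n.+1).-1%:R).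
    by case: (p ^ n.+1)%N pn => [|[|k]] // _; exact: nat_norm.
  have h2 : is_norm (1 - p%:R ^+ n.+1).
    apply: norm_near1; first by rewrite cjD // cjN // cj1 // cjX // cj_nat.
    rewrite addrC addKr (absN hL) (absX hL); apply: le_lt_trans hn.
    by rewrite exprS ler_piMl ?exprn_ge0 // ?labs_ge0 // ltW.
  have -> : -1 = (p ^ n.+1).-1%:R * (1 - p%:R ^+ n.+1)^-1 :> L.
    have e : (p ^ n.+1).-1%:R = - (1 - p%:R ^+ n.+1) :> L.
      by rewrite -natrX opprB -subn1 natrB // ltnW.
    by rewrite e mulNr divff // is_norm_neq0.
  by apply: is_normM => //; exact: is_normV.
apply: nc; have n2 : (2 : L) != 0 by exact: (lchar0 hL 1).
pose y := (c + 1) / 2; pose y' := (c - 1) / 2.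
have cy : cj y = y by rewrite cjM // cjV // cj_nat // cjD // cc cj1.
have cy' : cj y' = y' by rewrite cjM // cjV // cj_nat // cjD // cjN // cc cj1.
have cE : c = y ^+ 2 + (-1) * y' ^+ 2 by rewrite /y /y'; field.
have [y0|y0] := eqVneq y 0.
  rewrite cE y0 expr0n add0r; apply: is_normM => //; apply: is_norm_sqr => //.
  by apply: contra_neq c0 => y'0; rewrite cE y0 y'0 !expr0n mulr0 addr0.
have [y'0|y'0] := eqVneq y' 0.
  by rewrite cE y'0 expr0n mulr0 addr0; exact: is_norm_sqr.
rewrite cE; apply: sumN; [exact: is_norm_sqr| |by rewrite -cE].
by apply: is_normM => //; exact: is_norm_sqr.
Qed.

(** If s a or s b is a norm, one variable suffices. Otherwise a b is a norm by the index-two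
    property, and writing the non-norm s a as a sum of two norms solves the equation. *)
Lemma binary_universal a b s : a != 0 -> b != 0 -> s != 0 ->
  cj a = a -> cj b = b -> cj s = s ->
  exists x y, s = a * (x * cj x) + b * (y * cj y).
Proof.
move=> a0 b0 s0 ca cb cs.
have div_norm c : c != 0 -> cj c = c -> is_norm (s * c) -> exists x, s = c * (x * cj x).
  move=> c0 cc [z z0 hz]; exists (z / c); rewrite cjM // cjV // cc mulrACA -hz.
  by field; rewrite ?c0.
have [na|na] := pselect (is_norm (s * a)).
  by have [x ->] := div_norm a a0 ca na; exists x, 0; rewrite mul0r mulr0 addr0.
have [nb|nb] := pselect (is_norm (s * b)).
  by have [x ->] := div_norm b b0 cb nb; exists 0, x; rewrite mul0r mulr0 add0r.
have [|||y [y' [[x x0 ->] [x' x'0 ->] sE]]] := @nonnorm_sum (s * a).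
- by rewrite cjM // cs ca.
- exact: mulf_neq0.
- exact: na.
have [z z0 hz] : is_norm (a * b).
  have : is_norm ((s * a) * (s * b)).
    by apply: norm_index2 => //; rewrite ?mulf_neq0 // cjM // ?cs ?ca ?cb.
  move=> h; have -> : a * b = (s * a) * (s * b) * (s ^+ 2)^-1 by field.
  by apply: is_normM => //; apply: is_normV; exact: is_norm_sqr.
exists (x / a), (x' / z); rewrite !(cjM hD) !(cjV hD) ca.
have cz0 : cj z != 0 by rewrite cj_eq0.
have -> : b = z * cj z / a by rewrite -hz mulrC mulKf.
have -> : s = (x * cj x + x' * cj x') / a by rewrite -sE mulfK.
by field; rewrite a0 z0 cz0.
Qed.

(** If all x had value 0, polarization would make the form antisymmetric; as it is also Hermitian, a
    nonzero value normalized to 1 would give 1 = -1. *)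
Lemma herm_rank1 n (A : 'M[L]_n) : hermitian A -> A != 0 ->
  exists x : 'M[L]_(n, 1), hconj x *m A *m x != 0.
Proof.
move=> hA; apply: contraNP => none.
have q0 (x : 'M[L]_(n, 1)) : hconj x *m A *m x = 0.
  by apply/eqP; apply: contrapT => /negP h; apply: none; exists x.
have skew (x y : 'M[L]_(n, 1)) : hconj x *m A *m y = - (hconj y *m A *m x).
  have := q0 (x + y); rewrite hconjD // mulmxDl mulmxDl !mulmxDr !q0 add0r addr0.
  by move/eqP; rewrite addr_eq0 => /eqP.
have herm (x y : 'M[L]_(n, 1)) :
    (hconj y *m A *m x) 0 0 = cj ((hconj x *m A *m y) 0 0).
  have <- : hconj (hconj x *m A *m y) = hconj y *m A *m x.
    by rewrite !hconjM // hconjK // hA mulmxA.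
  by rewrite !mxE.
have z (x y : 'M[L]_(n, 1)) : (hconj x *m A *m y) 0 0 = 0.
  apply/eqP; apply: contraT => ne; set a := (_ 0 0) in ne.
  have := skew x (a^-1 *: y); have := herm x (a^-1 *: y).
  have sc c (M : 'M[L]_1) : (c *: M) 0 0 = c * M 0 0 by rewrite mxE.
  have ng (M : 'M[L]_1) : (- M) 0 0 = - M 0 0 by rewrite mxE.
  rewrite -scalemxAr => h1 /matrixP /(_ 0 0); rewrite ng h1 !sc -/a mulVf //.
  move/eqP; rewrite cj1 // -addr_eq0 -[1 + 1]/(2%:R) => /eqP e.
  by have := lchar0 hL 1; rewrite e eqxx.
apply/eqP/matrixP => i j; rewrite !mxE.
have := z (delta_mx i 0) (delta_mx j 0).
suff -> : hconj (delta_mx i 0 : 'M[L]_(n, 1)) = delta_mx 0 i.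
  by rewrite -rowE -colE !mxE.
apply/matrixP => u v; rewrite !mxE andbC.
by case: (_ && _); [exact: cj1|exact: cj0].
Qed.

Lemma first_column n (x : 'M[L]_(1 + n, 1)) : x != 0 ->
  exists2 k : 'M[L]_(1 + n), k \in unitmx & k *m col_mx 1%:M 0 = x.
Proof.
move=> x0; have r1 : \rank x = 1%N.
  by apply/eqP; rewrite eqn_leq rank_leq_col lt0n mxrank_eq0.
have pid : pid_mx 1 = col_mx 1%:M 0 :> 'M[L]_(1 + n, 1).
  apply/matrixP => i j; rewrite !mxE ord1; case: splitP => [a ->|a ia].
    by rewrite !ord1 mxE eqxx.
  by rewrite !mxE ia.
have re := row_ebase_unit x; rewrite [row_ebase x]mx11_scalar in re.
have c0 : row_ebase x 0 0 != 0.
  by move: re; rewrite unitmxE det_scalar1 unitfE.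
exists (row_ebase x 0 0 *: col_ebase x).
  by rewrite unitmxZ ?unitfE // col_ebase_unit.
rewrite -scalemxAl -[RHS]mulmx_ebase r1 pid [in RHS](mx11_scalar (row_ebase x)).
by rewrite mul_mx_scalar.
Qed.

(** Gram-Schmidt in block form: [k1] makes [x] the first basis vector, and the unipotent [k2] clears
    the off-diagonal blocks, which is possible because [s] is invertible. *)
Lemma herm_split n (A : 'M[L]_(1 + n)) (x : 'M[L]_(1 + n, 1)) (s : L) :
  hermitian A -> s != 0 -> hconj x *m A *m x = s%:M ->
  exists k A', [/\ k \in unitmx, k *m col_mx 1%:M 0 = x
    & hconj k *m A *m k = block_mx s%:M 0 0 A'].
Proof.
move=> hA s0 hx.
have x0 : x != 0.
  apply: contra_neq s0 => x0; move: hx; rewrite x0 mulmx0 => /matrixP /(_ 0 0).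
  by rewrite !mxE eqxx mulr1n => <-.
have [k1 uk1 k1x] := first_column x0.
pose B := hconj k1 *m A *m k1.
have hB : hconj B = B by rewrite !hconjM // hconjK // hA mulmxA.
have Bul : ulsubmx B = s%:M.
  have : hconj (col_mx 1%:M 0 : 'M[L]_(1 + n, 1)) *m B *m col_mx 1%:M 0 = s%:M.
    by rewrite -hx -k1x hconjM // !mulmxA.
  rewrite hconj_col_mx // hconj1 // hconj0 // -[B in X in X -> _]submxK mul_row_block.
  by rewrite mul_row_col !mul1mx !mul0mx !mulmx0 !addr0 mulmx1.
have Bdl : dlsubmx B = hconj (ursubmx B).
  have := hB; rewrite -{1 2}[B]submxK hconj_block // => /eq_block_mx[_ _ -> _].
  by [].
pose v := ursubmx B.
pose k2 : 'M[L]_(1 + n) := block_mx 1%:M (- (s^-1 *: v)) 0 1%:M.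
have cs : cj s = s.
  have := hB; rewrite -{1 2}[B]submxK hconj_block // => /eq_block_mx[].
  rewrite Bul hconj_scalar // => /matrixP /(_ 0 0); by rewrite !mxE eqxx !mulr1n.
exists (k1 *m k2), (drsubmx B - s^-1 *: (hconj v *m v)); split.
- by rewrite unitmx_mul uk1 unitmxE det_ublock !det1 mulr1 unitr1.
- by rewrite -mulmxA mul_block_col !mul1mx !mulmx0 !mul0mx !addr0.
rewrite hconjM // -!mulmxA (mulmxA A) (mulmxA (hconj k1)) (mulmxA (hconj k1)) -/B.
rewrite -[B]submxK Bul Bdl -/v /k2 hconj_block // !hconj1 // hconj0 // hconjN // hconjZ //.
rewrite !mulmx_block !mul1mx !mul0mx !mulmx1 !mulmx0 !addr0 cjV // cs.
rewrite !mulNmx !mulmxN -!scalemxAl -!scalemxAr mul_scalar_mx mul_mx_scalar.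
rewrite block_mxKdr !scalerA mulVf // !scale1r !addNr mulmx0 scaler0 oppr0 add0r.
by congr block_mx; rewrite addrC.
Qed.

(** A nondegenerate form of dimension at least two contains a diagonal binary form, and binary forms
    are universal. *)
Lemma herm_represents n (A : 'M[L]_(1 + (1 + n))) (s : L) : hermitian A ->
  A \in unitmx -> cj s = s -> s != 0 ->
  exists x : 'M[L]_(1 + (1 + n), 1), hconj x *m A *m x = s%:M.
Proof.
move=> hA uA cs s0.
have fixed (k : nat) (B : 'M[L]_k) (x : 'M[L]_(k, 1)) : hermitian B ->
    exists2 a : L, cj a = a & hconj x *m B *m x = a%:M.
  move=> hB; exists ((hconj x *m B *m x) 0 0); last exact: mx11_scalar.
  have {2}-> : hconj x *m B *m x = hconj (hconj x *m B *m x).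
    by rewrite !hconjM // hconjK // hB mulmxA.
  by rewrite [in RHS]mxE [in RHS]mxE.
have An0 : A != 0.
  by apply: contraTneq uA => ->; rewrite unitmxE det0 // unitr0.
have [x hx] := herm_rank1 hA An0; have [a ca aE] := fixed _ _ x hA.
have a0 : a != 0 by apply: contra_neq hx => a0; rewrite aE a0 raddf0.
have [k [A' [uk _ kE]]] := herm_split hA a0 aE.
have hk : hermitian (hconj k *m A *m k).
  by rewrite /Defs.hermitian !hconjM // hconjK // hA mulmxA.
have uk' : hconj k *m A *m k \in unitmx by rewrite !unitmx_mul unitmx_hconj // uk uA.
have hA' : hermitian A'.
  by move: hk; rewrite kE /Defs.hermitian hconj_block // => /eq_block_mx[].
have A'0 : A' != 0.
  apply: contraTneq uk' => A'0; rewrite kE A'0 unitmxE det_ublock det0 // mulr0.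
  by rewrite unitr0.
have [y hy] := herm_rank1 hA' A'0; have [b cb bE] := fixed _ _ y hA'.
have b0 : b != 0 by apply: contra_neq hy => b0; rewrite bE b0 raddf0.
have [t [u ->]] := binary_universal a0 b0 s0 ca cb cs.
exists (k *m col_mx t%:M (u *: y)).
rewrite hconjM // -!mulmxA (mulmxA A) (mulmxA (hconj k)) (mulmxA (hconj k)) kE.
rewrite hconj_col_mx // hconj_scalar // hconjZ // mul_block_col !mul0mx addr0 add0r.
rewrite mul_row_col -!scalemxAr -!scalemxAl !mulmxA bE.
rewrite -!scalar_mxM !scale_scalar_mx -raddfD /=; congr (_%:M).
by ring.
Qed.

(** Dimension and determinant modulo norms classify: in dimension at least two both forms represent
    1, and splitting that vector off preserves the hypothesis on determinants. *)
Lemma herm_classify n (A B : 'M[L]_(1 + n)) : hermitian A -> hermitian B ->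
  A \in unitmx -> B \in unitmx ->
  (exists z, \det A = \det B * (z * cj z)) ->
  exists2 k, k \in unitmx & hconj k *m A *m k = B.
Proof.
elim: n A B => [|n IH] A B hA hB uA uB [z hz].
  have a0 : \det A != 0 by rewrite -unitfE -unitmxE.
  have z0 : z != 0 by apply: contra_neq a0 => z0; rewrite hz z0 mul0r mulr0.
  have cz0 : cj z != 0 by rewrite cj_eq0.
  exists (z^-1)%:M; first by rewrite unitmxE det_scalar1 unitfE invr_eq0.
  have AE : A = (\det A)%:M by rewrite {2}(mx11_scalar A) det_scalar1 -mx11_scalar.
  have BE : B = (\det B)%:M by rewrite {2}(mx11_scalar B) det_scalar1 -mx11_scalar.
  rewrite AE hz [RHS]BE hconj_scalar // -!scalar_mxM cjV //; congr (_%:M).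
  by field; rewrite z0.
have split1 (M : 'M[L]_(1 + (1 + n))) : hermitian M -> M \in unitmx ->
    exists k M', [/\ k \in unitmx, hconj k *m M *m k = block_mx 1%:M 0 0 M',
      hermitian M', M' \in unitmx & \det M' = \det M * (\det k * cj (\det k))].
  move=> hM uM; have [x hx] := herm_represents hM uM (cj1 hD) (oner_neq0 _).
  have [k [M' [uk _ kE]]] := herm_split hM (oner_neq0 _) hx.
  have dE : \det M' = \det M * (\det k * cj (\det k)).
    have := congr1 determinant kE; rewrite det_ublock det1 mul1r => <-.
    by rewrite !det_mulmx det_hconj //; ring.
  exists k, M'; split=> //.
    have : hconj (hconj k *m M *m k) = hconj k *m M *m k.
      by rewrite !hconjM // hconjK // hM mulmxA.
    by rewrite kE hconj_block // => /eq_block_mx[].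
  rewrite unitmxE dE unitrM -unitmxE uM /= unitrM -unitmxE uk /=.
  by rewrite -det_hconj // -unitmxE unitmx_hconj.
have [k1 [A' [uk1 k1E hA' uA' dA']]] := split1 A hA uA.
have [k2 [B' [uk2 k2E hB' uB' dB']]] := split1 B hB uB.
have [|k' uk' k'E] := IH A' B' hA' hB' uA' uB'.
  have d20 : \det k2 != 0 by rewrite -unitfE -unitmxE.
  exists (z * \det k1 / \det k2); rewrite dA' dB' hz !(cjM hD) cjV //.
  by field; rewrite (cj_eq0 hD) d20.
pose kk : 'M[L]_(1 + (1 + n)) := block_mx 1%:M 0 0 k'.
exists (k1 *m kk *m invmx k2).
  by rewrite !unitmx_mul uk1 unitmx_inv uk2 unitmxE det_ublock det1 mul1r -unitmxE uk'.
have kkE : hconj kk *m (hconj k1 *m A *m k1) *m kk = hconj k2 *m B *m k2.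
  rewrite k1E k2E /kk hconj_block // hconj1 // !hconj0 // !mulmx_block.
  by rewrite !mul1mx !mul0mx !mulmx0 !addr0 !add0r !mul1mx !mul0mx k'E.
rewrite !hconjM // hconj_inv // -!mulmxA.
have -> : hconj kk *m (hconj k1 *m (A *m (k1 *m (kk *m invmx k2)))) =
  hconj k2 *m B *m k2 *m invmx k2 by rewrite -kkE !mulmxA.
by rewrite mulmxK // mulKmx // unitmx_hconj.
Qed.

(** The signs in the two discriminants cancel, because ['C(1 + m, 2) + 'C(m, 2)] has the parity of
    [m]. Since [delta] squares to 1, the product of [\det A1], [\det A0] and [up S] is then a
    norm. *)
Lemma gram_equiv m (delta : C) (S : K) (A1 : 'M[L]_(1 + m)) (A0 : 'M[L]_m) :
  ~~ odd m -> delta = 1 \/ delta = -1 -> S != 0 ->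
  gram_of_sign D delta A1 -> gram_of_sign D (delta * quad_char D S) A0 ->
  exists2 k, k \in unitmx & hconj k *m A1 *m k = block_mx (up S)%:M 0 0 A0.
Proof.
move=> hm hdelta S0 [hA1 uA1 q1] [hA0 uA0 q0].
have fdet n (A : 'M[L]_n) : hermitian A -> cj (\det A) = \det A.
  by move=> hA; rewrite -det_hconj // hA.
have uS0 : up S != 0 by rewrite (up_eq0 hD).
have d1 : \det A1 != 0 by rewrite -unitfE -unitmxE.
have d0 : \det A0 != 0 by rewrite -unitfE -unitmxE.
have fsgn (n : nat) : cj ((-1) ^+ n) = (-1) ^+ n by rewrite cjX // cjN // cj1.
apply: herm_classify => //.
- by rewrite /Defs.hermitian hconj_block // !hconj0 // hconj_scalar // cj_up // hA0.
- by rewrite unitmxE det_ublock det_scalar1 unitrM !unitfE uS0.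
rewrite det_ublock det_scalar1.
set e1 := (-1) ^+ 'C(1 + m, 2) * \det A1 in q1.
set e0 := (-1) ^+ 'C(m, 2) * \det A0 in q0.
have e10 : e1 != 0 by rewrite mulf_neq0 // signr_eq0.
have e00 : e0 != 0 by rewrite mulf_neq0 // signr_eq0.
have c1 : cj e1 = e1 by rewrite cjM // fsgn fdet.
have c0 : cj e0 = e0 by rewrite cjM // fsgn fdet.
have x1 : down e1 != 0 by rewrite -(up_eq0 hD) up_down.
have x0 : down e0 != 0 by rewrite -(up_eq0 hD) up_down.
have : quad_char D (down e1 * down e0 * S) = 1.
  rewrite !(quadM hD) ?mulf_neq0 // q1 q0 mulrA -mulrA quad_char_sqr1 mulr1.
  by case: hdelta => ->; rewrite ?mulr1 // mulrNN mulr1.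
move/quad_char1; rewrite !(upM hD) !(up_down hD) // => /(_ _)[|z z0 hz].
  by rewrite !mulf_neq0.
have sE : e1 * e0 = \det A1 * \det A0.
  rewrite /e1 /e0 mulrACA -exprD.
  have -> : ('C(1 + m, 2) + 'C(m, 2))%N = ('C(m, 2).*2 + m)%N.
    by rewrite add1n binS bin1 -addnn addnAC.
  by rewrite -signr_odd oddD odd_double (negPf hm) expr0 mul1r.
rewrite sE in hz; exists (z / (up S * \det A0)).
rewrite cjM // cjV // cjM // cj_up // fdet //.
have -> : \det A1 = z * cj z / (up S * \det A0).
  by rewrite -hz; field; rewrite d0 uS0.
by field; rewrite uS0 d0.
Qed.

End Hermitian.

(** * Quasi-split unitary groups and the Jacobi group *)

Section UnitaryGroups.
Context {R : realType} (D : local_ext R).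
Local Notation L := (ltop D).
Local Notation hermitian := (@Defs.hermitian R D _).
Hypothesis hD : quad_ext D.
Let hL := qe_local hD.

Section OneGroup.
Context {n : nat}.
Implicit Types g h : 'M[L]_(n + n).

Lemma Jmx_sqr : Jmx D n *m Jmx D n = - 1%:M.
Proof.
rewrite mulmx_block !(mul0mx, mulmx0, mul1mx, mulmx1, addr0, add0r, mulNmx, mulmxN, oppr0, opprK).
by rewrite (scalar_mx_block n n) opp_block_mx oppr0.
Qed.

Lemma hconj_Jmx : hconj (Jmx D n) = - Jmx D n.
Proof.
rewrite hconj_block // hconjN // !hconj1 // !hconj0 // opp_block_mx !oppr0.
by rewrite opprK.
Qed.

Lemma Ugrp1 : Ugrp D n 1%:M.
Proof. by rewrite /Ugrp /= hconj1 // mul1mx mulmx1. Qed.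

Lemma UgrpM g h : Ugrp D n g -> Ugrp D n h -> Ugrp D n (g *m h).
Proof.
rewrite /Ugrp /= => hg hh; rewrite hconjM // -!mulmxA (mulmxA (Jmx D n)).
by rewrite (mulmxA (hconj g)) (mulmxA (hconj g)) hg mulmxA.
Qed.

Lemma Ugrp_left_inv g : Ugrp D n g -> - (Jmx D n *m hconj g *m Jmx D n) *m g = 1%:M.
Proof.
by rewrite /Ugrp /= => hg; rewrite mulNmx -!mulmxA (mulmxA (hconj g)) hg Jmx_sqr opprK.
Qed.

Lemma Ugrp_unit g : Ugrp D n g -> g \in unitmx.
Proof. by move/Ugrp_left_inv/mulmx1_unit => []. Qed.

Lemma Ugrp_inv g : Ugrp D n g -> Ugrp D n (invmx g).
Proof.
move=> hg; have ug := Ugrp_unit hg; rewrite /Ugrp /= hconj_inv //.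
have uhg : hconj g \in unitmx by rewrite unitmx_hconj.
by rewrite -[Jmx D n in LHS]hg -!mulmxA mulmxV // mulmx1 mulKmx.
Qed.

Lemma Ugrp_J : Ugrp D n (Jmx D n).
Proof. by rewrite /Ugrp /= hconj_Jmx mulNmx Jmx_sqr opprK mul1mx. Qed.

Lemma Ugrp_siegel_m (B : 'M[L]_n) : B \in unitmx -> Ugrp D n (siegel_m B).
Proof.
move=> uB; have uhB : hconj B \in unitmx by rewrite unitmx_hconj.
rewrite /Ugrp /= /siegel_m hconj_block // !hconj0 // hconj_inv // hconjK //.
rewrite !mulmx_block !(mul0mx, mulmx0, mul1mx, mulmx1, addr0, add0r, mulNmx, mulmxN, oppr0, opprK).
by rewrite mulVmx // mulmxV.
Qed.

Lemma Ugrp_siegel_n (Z : 'M[L]_n) : hermitian Z -> Ugrp D n (siegel_n Z).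
Proof.
move=> hZ; rewrite /Ugrp /= /siegel_n hconj_block // !hconj0 // !hconj1 // hZ.
rewrite !mulmx_block !(mul0mx, mulmx0, mul1mx, mulmx1, addr0, add0r, mulNmx, mulmxN, oppr0, opprK).
by rewrite addNr.
Qed.

Lemma siegel_nD (Z Z' : 'M[L]_n) : siegel_n (Z + Z') = siegel_n Z *m siegel_n Z'.
Proof.
by rewrite /siegel_n mulmx_block !(mul0mx, mulmx0, mul1mx, mulmx1, addr0, add0r, mulNmx, mulmxN, oppr0, opprK) addrC.
Qed.

Lemma siegel_mM (B B' : 'M[L]_n) : B \in unitmx -> B' \in unitmx ->
  siegel_m (B *m B') = siegel_m B *m siegel_m B'.
Proof.
move=> uB uB'; rewrite /siegel_m mulmx_block !(mul0mx, mulmx0, mul1mx, mulmx1, addr0, add0r, mulNmx, mulmxN, oppr0, opprK).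
congr block_mx; rewrite hconjM //.
have [u u'] : hconj B \in unitmx /\ hconj B' \in unitmx by rewrite !unitmx_hconj.
have : (hconj B' *m hconj B) *m (invmx (hconj B) *m invmx (hconj B')) = 1%:M.
  by rewrite -!mulmxA (mulmxA (hconj B)) mulmxV // mul1mx mulmxV.
move=> h; rewrite -[RHS]mul1mx -(mulVmx (_ : hconj B' *m hconj B \in unitmx)).
  by rewrite -!mulmxA in h *; rewrite h mulmx1.
by rewrite unitmx_mul u u'.
Qed.

Lemma siegel_m1 : siegel_m (1%:M : 'M[L]_n) = 1%:M.
Proof. by rewrite /siegel_m hconj1 // invmx1 (scalar_mx_block n n). Qed.

Lemma siegel_conj (B Z : 'M[L]_n) : B \in unitmx ->
  siegel_m B *m siegel_n Z = siegel_n (B *m Z *m hconj B) *m siegel_m B.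
Proof.
move=> uB; rewrite /siegel_m /siegel_n !mulmx_block.
rewrite !(mul0mx, mulmx0, mul1mx, mulmx1, addr0, add0r, mulNmx, mulmxN, oppr0, opprK).
by rewrite -!mulmxA mulmxV ?mulmx1 // unitmx_hconj.
Qed.

Lemma Jmx_conj (Z : 'M[L]_n) :
  Jmx D n *m siegel_n Z *m (- Jmx D n) = block_mx 1%:M 0 (- Z) 1%:M.
Proof.
rewrite /siegel_n /Jmx opp_block_mx !mulmx_block opprK oppr0.
by rewrite !(mul0mx, mulmx0, mul1mx, mulmx1, addr0, add0r, mulNmx, mulmxN, oppr0, opprK).
Qed.

Lemma Jmx_siegel_m (B : 'M[L]_n) : B \in unitmx ->
  Jmx D n *m siegel_m B = siegel_m (invmx (hconj B)) *m Jmx D n.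
Proof.
move=> uB; rewrite /siegel_m /Jmx hconj_inv // hconjK // invmxK !mulmx_block.
by rewrite !(mul0mx, mulmx0, mul1mx, mulmx1, addr0, add0r, mulNmx, mulmxN, oppr0, opprK).
Qed.

Section Generation.
Variable E : set 'M[L]_(n + n).
Hypotheses (EM : forall g h, Ugrp D n g -> Ugrp D n h -> E g -> E h -> E (g *m h))
  (Em : forall B : 'M[L]_n, B \in unitmx -> E (siegel_m B))
  (En : forall Z : 'M[L]_n, hermitian Z -> E (siegel_n Z)) (EJ : E (Jmx D n)).

Let ENJ : E (- Jmx D n) /\ Ugrp D n (- Jmx D n).
Proof.
have u1 : - 1%:M \in @unitmx L n by rewrite -scaleN1r unitmxZ ?unitmx1 // unitrN1.
have -> : - Jmx D n = siegel_m (- 1%:M) *m Jmx D n.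
  rewrite /siegel_m hconjN // hconj1 //.
  have -> : invmx (- 1%:M : 'M[L]_n) = - 1%:M.
    by apply: (can_inj (mulKmx u1)); rewrite mulmxV // mulNmx mulmxN opprK mulmx1.
  by rewrite /Jmx opp_block_mx mulmx_block !(mul0mx, mulmx0, mul1mx, mulmx1, addr0, add0r, mulNmx, mulmxN, oppr0, opprK).
have Um := Ugrp_siegel_m u1; split; last exact: UgrpM Um Ugrp_J.
exact: EM Um Ugrp_J (Em u1) EJ.
Qed.

Let E_upper g : Ugrp D n g -> dlsubmx g = 0 -> E g.
Proof.
move=> hg g21; rewrite -[g]submxK g21 in hg *.
set a := ulsubmx g in hg *; set b := ursubmx g in hg *; set d := drsubmx g in hg *.
move: (hg); rewrite /Ugrp /= hconj_block // hconj0 // !mulmx_block.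
rewrite !(mul0mx, mulmx0, mul1mx, mulmx1, addr0, add0r, mulNmx, mulmxN, oppr0, opprK).
case/eq_block_mx => _ ad _ bd.
have [ua ud] := mulmx1_unit ad.
have ua' : a \in unitmx by rewrite -(unitmx_hconj hD).
have dE : d = invmx (hconj a) by rewrite -[d](mulKmx ua) ad mulmx1.
have hZ : hermitian (b *m hconj a).
  rewrite /Defs.hermitian hconjM // hconjK //.
  move/eqP: bd; rewrite addrC subr_eq0 => /eqP bd.
  have hda : hconj d *m a = 1%:M.
    by have := congr1 (@hconj _ D _ _) ad; rewrite hconjM // hconjK // hconj1.
  have hda' : a *m hconj d = 1%:M by exact: mulmx1C.
  have adC : d *m hconj a = 1%:M by exact: mulmx1C.
  rewrite -[hconj b]mulmx1 -adC (mulmxA (hconj b)) bd -!mulmxA (mulmxA a) hda'.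
  by rewrite mul1mx.
have -> : block_mx a b 0 d = siegel_n (b *m hconj a) *m siegel_m a.
  rewrite /siegel_n /siegel_m mulmx_block !(mul0mx, mulmx0, mul1mx, mulmx1, addr0, add0r, mulNmx, mulmxN, oppr0, opprK) -dE.
  by rewrite -mulmxA ad mulmx1.
apply: EM; [exact: Ugrp_siegel_n|exact: Ugrp_siegel_m|exact: En|exact: Em].
Qed.

(** The big Bruhat cell: for invertible c the element n(a c^-1) is unitary, and removing it together
    with J leaves an element of the Siegel parabolic subgroup. *)
Let E_big g : Ugrp D n g -> dlsubmx g \in unitmx -> E g.
Proof.
move=> hg uc.
set a := ulsubmx g; set b := ursubmx g; set c := dlsubmx g in uc *; set d := drsubmx g.
have gE : g = block_mx a b c d by rewrite submxK.
have hac : hconj a *m c = hconj c *m a.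
  move: hg; rewrite gE /Ugrp /= hconj_block // !mulmx_block.
  rewrite !(mul0mx, mulmx0, mul1mx, mulmx1, addr0, add0r, mulNmx, mulmxN, oppr0, opprK).
  case/eq_block_mx => /eqP; rewrite addrC subr_eq0 => /eqP <- //.
have uhc : hconj c \in unitmx by rewrite unitmx_hconj.
have hZ : hermitian (a *m invmx c).
  rewrite /Defs.hermitian hconjM // hconj_inv //.
  by rewrite -[hconj a](mulmxK uc) hac -!mulmxA mulKmx.
have hZN : hermitian (- (a *m invmx c)) by rewrite /Defs.hermitian hconjN // hZ.
have [_ UNJ] := ENJ.
pose g1 := - Jmx D n *m (siegel_n (- (a *m invmx c)) *m g).
have hg1 : Ugrp D n g1 by do !apply: UgrpM => //; exact: Ugrp_siegel_n.
have g1E : E g1.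
  apply: E_upper => //; rewrite /g1 gE /siegel_n /Jmx opp_block_mx !mulmx_block.
  rewrite block_mxKdl !mul1mx opprK !oppr0 !(mul0mx, mulmx0, mul1mx, mulmx1, addr0, add0r, mulNmx, mulmxN, oppr0, opprK).
  by rewrite -mulmxA mulVmx // mulmx1 addrN.
have -> : g = siegel_n (a *m invmx c) *m (Jmx D n *m g1).
  rewrite /g1 (mulmxA (Jmx D n)) mulmxN Jmx_sqr opprK mul1mx mulmxA -siegel_nD addrN.
  by rewrite /siegel_n -(scalar_mx_block n n) mul1mx.
apply: EM; [exact: Ugrp_siegel_n|exact: UgrpM Ugrp_J hg1|exact: En|].
by apply: EM => //; exact: Ugrp_J.
Qed.

(** Siegel elements on both sides bring the upper left block to an idempotent [e]; a lower unipotent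
    element then moves [g1] into the big cell. As [E] is only known to be closed under products,
    every inverse that occurs is written as a product of generators. *)
Lemma Ugrp_generated g : Ugrp D n g -> E g.
Proof.
move=> hg; have [ENJ1 UNJ] := ENJ.
pose a := ulsubmx g; pose r := \rank a.
pose e : 'M[L]_n := pid_mx r.
pose P := invmx (col_ebase a); pose Q := invmx (row_ebase a).
have uP : P \in unitmx by rewrite unitmx_inv col_ebase_unit.
have uQ : Q \in unitmx by rewrite unitmx_inv row_ebase_unit.
pose g1 := siegel_m P *m g *m siegel_m Q.
have hg1 : Ugrp D n g1.
  exact: UgrpM (UgrpM (Ugrp_siegel_m uP) hg) (Ugrp_siegel_m uQ).
suff Eg1 : E g1.
  have uPi : invmx P \in unitmx by rewrite unitmx_inv.
  have uQi : invmx Q \in unitmx by rewrite unitmx_inv.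
  have -> : g = siegel_m (invmx P) *m (g1 *m siegel_m (invmx Q)).
    rewrite /g1 -!mulmxA -siegel_mM // mulmxV // siegel_m1 mulmx1.
    by rewrite mulmxA -siegel_mM // mulVmx // siegel_m1 mul1mx.
  have UQ := Ugrp_siegel_m uQi.
  exact: EM (Ugrp_siegel_m uPi) (UgrpM hg1 UQ) (Em uPi) (EM hg1 UQ Eg1 (Em uQi)).
have a1 : ulsubmx g1 = e.
  rewrite /g1 -[g]submxK /siegel_m !mulmx_block block_mxKul !(mul0mx, mulmx0, mul1mx, mulmx1, addr0, add0r, mulNmx, mulmxN, oppr0, opprK).
  rewrite -/a -[a](mulmx_ebase a) /P /Q -!mulmxA mulmxV ?row_ebase_unit // mulmx1.
  by rewrite mulKmx // col_ebase_unit.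
set c := dlsubmx g1.
have ee : e *m e = e by rewrite pid_mx_id // rank_leq_col.
have he : hconj e = e.
  rewrite hconjE /e tr_pid_mx; apply/matrixP => i j; rewrite !mxE.
  by case: (_ && _); rewrite ?rmorph1 ?rmorph0.
have hec : e *m c = hconj c *m e.
  move: hg1; rewrite -[g1]submxK a1 -/c /Ugrp /= hconj_block // !mulmx_block he.
  rewrite !(mul0mx, mulmx0, mul1mx, mulmx1, addr0, add0r, mulNmx, mulmxN, oppr0, opprK).
  by case/eq_block_mx => /eqP; rewrite addrC subr_eq0 => /eqP <-.
have ece : e *m c *m e = e *m c by rewrite {1}hec -mulmxA ee -hec.
(* With this choice the new lower left block is e + (1 - e) c. A vector killed by it is killed by e
   and by c, hence by the whole left block column of [g1], and so it is 0. *)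
pose Z := e - e *m c.
have hZ : hermitian Z by rewrite /Defs.hermitian /Z hconjD // hconjN // hconjM // he -hec.
have hZN : hermitian (- Z) by rewrite /Defs.hermitian hconjN // hZ.
pose low := Jmx D n *m siegel_n (- Z) *m (- Jmx D n).
have lowE : low = block_mx 1%:M 0 Z 1%:M by rewrite /low Jmx_conj opprK.
have UJn : Ugrp D n (Jmx D n *m siegel_n (- Z)).
  exact: UgrpM Ugrp_J (Ugrp_siegel_n hZN).
have UJn' : Ugrp D n (Jmx D n *m siegel_n Z) by exact: UgrpM Ugrp_J (Ugrp_siegel_n hZ).
have Ulow : Ugrp D n low by exact: UgrpM UJn UNJ.
pose low' := Jmx D n *m siegel_n Z *m (- Jmx D n).
have Ulow' : Ugrp D n low' by exact: UgrpM UJn' UNJ.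
have -> : g1 = low' *m (low *m g1).
  rewrite mulmxA lowE /low' Jmx_conj mulmx_block !(mul0mx, mulmx0, mul1mx, mulmx1, addr0, add0r, mulNmx, mulmxN, oppr0, opprK).
  by rewrite addNr -(scalar_mx_block n n) mul1mx.
have Elow' : E low'.
  exact: EM UJn' UNJ (EM Ugrp_J (Ugrp_siegel_n hZ) EJ (En hZ)) ENJ1.
apply: (EM Ulow' (UgrpM Ulow hg1) Elow').
apply: E_big (UgrpM Ulow hg1) _.
rewrite lowE -[g1]submxK a1 -/c mulmx_block block_mxKdl mul1mx.
have -> : Z *m e + c = e + (1%:M - e) *m c.
  by rewrite /Z mulmxBl ee ece mulmxBl mul1mx addrAC -addrA.
rewrite -unitmx_tr -row_free_unit -kermx_eq0; apply/eqP/row_matrixP => i.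
rewrite row0; set v := row i _.
have : v *m (e + (1%:M - e) *m c)^T = 0 by rewrite /v -row_mul mulmx_ker row0.
move/(congr1 trmx); rewrite trmx_mul trmxK trmx0; set w := v^T => hw.
have ew : e *m w = 0.
  have := congr1 (mulmx e) hw; rewrite mulmx0 mulmxA mulmxDr ee mulmxA mulmxBr mulmx1 ee.
  by rewrite subrr mul0mx addr0.
have ecw : e *m c *m w = 0 by rewrite -ece -(mulmxA (e *m c) e w) ew mulmx0.
have cw : c *m w = 0.
  by have := hw; rewrite (mulmxDl e) ew add0r mulmxBl mul1mx mulmxBl ecw subr0.
have gw : g1 *m col_mx w 0 = 0.
  by rewrite -[g1]submxK a1 -/c mul_block_col !(mul0mx, mulmx0, mul1mx, mulmx1, addr0, add0r, mulNmx, mulmxN, oppr0, opprK) ew cw col_mx0.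
have := congr1 (mulmx (invmx g1)) gw; rewrite mulKmx ?Ugrp_unit // mulmx0 -col_mx0.
by case/eq_col_mx => w0 _; rewrite -[v]trmxK -/w w0 trmx0.
Qed.

End Generation.
End OneGroup.
End UnitaryGroups.

Ltac block_simp := repeat (progress (rewrite ?mulmx_block ?add_block_mx ?opp_block_mx
  ?(mul0mx, mulmx0, mul1mx, mulmx1, addr0, add0r, mulNmx, mulmxN, oppr0, opprK))).

Lemma subr_swap (V : zmodType) (a b c d : V) : a - b = c - d -> d - b = c - a.
Proof.
by move/eqP; rewrite subr_eq => /eqP ->; rewrite opprD opprB addrA addrCA subrr addr0.
Qed.

Section Embedding.
Context {R : realType} (D : local_ext R).
Local Notation K := (lbase D).
Local Notation L := (ltop D).
Local Notation up := (@lup R D).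
Local Notation cj := (@lconj R D).
Local Notation down := (@Defs.down R D).
Local Notation hermitian := (@Defs.hermitian R D _).
Hypothesis hD : quad_ext D.
Let hL := qe_local hD.
Context {m : nat}.
Implicit Types (g h : 'M[L]_(m + m)) (X Y : 'M[L]_(1, m)) (t : K).

Lemma emb_mxM g h : emb_mx (g *m h) = emb_mx g *m emb_mx h.
Proof.
rewrite -[g]submxK -[h]submxK mulmx_block /emb_mx !block_mxKul !block_mxKur.
rewrite !block_mxKdl !block_mxKdr !mulmx_block !add_block_mx.
by rewrite !(mul0mx, mulmx0, mul1mx, mulmx1, addr0, add0r).
Qed.

Lemma emb_mx1 : emb_mx (1%:M : 'M[L]_(m + m)) = 1%:M.
Proof.
rewrite /emb_mx (scalar_mx_block m m) block_mxKul block_mxKur block_mxKdl block_mxKdr.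
by rewrite block_mx0 -!(scalar_mx_block 1 m) -(scalar_mx_block (1 + m) (1 + m)).
Qed.

Lemma Ugrp_block g : Ugrp D m g ->
  [/\ hconj (ulsubmx g) *m dlsubmx g = hconj (dlsubmx g) *m ulsubmx g,
      hconj (ulsubmx g) *m drsubmx g - hconj (dlsubmx g) *m ursubmx g = 1%:M,
      hconj (ursubmx g) *m dlsubmx g - hconj (drsubmx g) *m ulsubmx g = - 1%:M
    & hconj (ursubmx g) *m drsubmx g = hconj (drsubmx g) *m ursubmx g].
Proof.
rewrite /Ugrp /= -{1 2}[g]submxK hconj_block // !mulmx_block.
rewrite !(mul0mx, mulmx0, mul1mx, mulmx1, addr0, add0r, mulNmx, mulmxN, oppr0).
case/eq_block_mx => h1 h2 h3 h4; split.
- by move/eqP: h1; rewrite addrC subr_eq0 => /eqP.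
- by rewrite addrC.
- by rewrite addrC.
- by move/eqP: h4; rewrite addrC subr_eq0 => /eqP.
Qed.

Lemma Ugrp_emb g : Ugrp D m g -> Ugrp D (1 + m) (emb_mx g).
Proof.
move/Ugrp_block => [h1 h2 h3 h4].
rewrite /Ugrp /= /emb_mx /Jmx !hconj_block // !hconj1 // !hconj0 //.
rewrite (scalar_mx_block 1 m); block_simp.
by rewrite h1 h4 !addNr ![- _ + _]addrC h2 h3 !block_mx0.
Qed.

Definition uni_m X : 'M[L]_(1 + m) := block_mx 1%:M X 0 1%:M.
Definition uni_n X Y t : 'M[L]_(1 + m) :=
  block_mx ((up t)%:M + X *m hconj Y + Y *m hconj X) Y (hconj Y) 0.

Lemma uni_m_unit X : uni_m X \in unitmx.
Proof. by rewrite unitmxE det_ublock !det1 mulr1 unitr1. Qed.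

Lemma uni_n_herm X Y t : hermitian (uni_n X Y t).
Proof.
rewrite /Defs.hermitian hconj_block // hconj0 // hconjK // !hconjD // !hconjM //.
by rewrite !hconjK // hconj_scalar // cj_up // addrAC.
Qed.

(** U lies in the Siegel parabolic subgroup, so the explicit formulas of a Weil representation
    determine its action. *)
Lemma umxE X Y t : umx X Y t = siegel_n (uni_n X Y t) *m siegel_m (uni_m X).
Proof.
rewrite /umx /siegel_n /siegel_m mulmx_block.
have -> : invmx (hconj (uni_m X)) = block_mx 1%:M 0 (- hconj X) 1%:M.
  have u : hconj (uni_m X) \in unitmx by rewrite unitmx_hconj // uni_m_unit.
  apply: (can_inj (mulKmx u)); rewrite mulmxV // hconj_block // !hconj1 // hconj0 //.
  rewrite mulmx_block !(mul0mx, mulmx0, mul1mx, mulmx1, addr0, add0r) addrN.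
  by rewrite -(scalar_mx_block 1 m).
rewrite !(mul0mx, mulmx0, mul1mx, addr0, add0r) /uni_n mulmx_block.
by rewrite !(mul0mx, mulmx0, mul1mx, mulmx1, addr0, add0r) mulmxN addrK.
Qed.

Lemma Ugrp_umx X Y t : Ugrp D (1 + m) (umx X Y t).
Proof.
rewrite umxE; apply: UgrpM => //; first exact/Ugrp_siegel_n/uni_n_herm.
exact/Ugrp_siegel_m/uni_m_unit.
Qed.

Lemma umx0 : umx 0 0 0 = 1%:M :> 'M[L]_((1 + m) + (1 + m)).
Proof.
rewrite /umx up0 // raddf0 !hconj0 // mulmx0 addr0 oppr0 block_mx0.
by rewrite -!(scalar_mx_block 1 m) -(scalar_mx_block (1 + m) (1 + m)).
Qed.

Lemma umx_jacobi X Y t : jacobi_group D m (umx X Y t).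
Proof. by exists X, Y, t, 1%:M; rewrite emb_mx1 mulmx1; split=> //; exact: Ugrp1. Qed.

Lemma emb_jacobi g : Ugrp D m g -> jacobi_group D m (emb_mx g).
Proof. by move=> hg; exists 0, 0, 0, g; rewrite umx0 mul1mx. Qed.

Lemma Ugrp_hconj g : Ugrp D m g -> Ugrp D m (hconj g).
Proof.
move=> hg; have /mulmx1C := Ugrp_left_inv hg.
rewrite /Ugrp /= hconjK // => h.
have : g *m - (Jmx D m *m hconj g *m Jmx D m) *m Jmx D m = Jmx D m by rewrite h mul1mx.
by rewrite mulmxN mulNmx -!mulmxA Jmx_sqr !mulmxN opprK !mulmx1 mulmxA.
Qed.

Lemma symplectic_inv g X Y X' Y' : Ugrp D m g -> row_mx X' Y' = row_mx X Y *m g ->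
  X' *m hconj Y' - Y' *m hconj X' = X *m hconj Y - Y *m hconj X.
Proof.
move=> /Ugrp_hconj hg XYE.
have e (A B : 'M[L]_(1, m)) : A *m hconj B - B *m hconj A =
    row_mx A B *m Jmx D m *m hconj (row_mx A B).
  rewrite hconj_row_mx // mul_row_block; block_simp.
  by rewrite mul_row_col mulNmx addrC.
rewrite !e XYE hconjM // -!mulmxA; congr (_ *m _).
by move: hg; rewrite /Ugrp /= hconjK // !mulmxA => ->.
Qed.

(* The symplectic invariant of the Heisenberg group: the part of [X Y^*] that
   is not fixed by U_m is Hermitian and is absorbed in the center. *)
Lemma emb_umx g X Y X' Y' t : Ugrp D m g -> row_mx X' Y' = row_mx X Y *m g ->
  exists2 t', (up t')%:M + X' *m hconj Y' = (up t)%:M + X *m hconj Y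
    & umx X Y t *m emb_mx g = emb_mx g *m umx X' Y' t'.
Proof.
move=> hg XYE; have inv := symplectic_inv hg XYE.
have [] := Ugrp_block (Ugrp_hconj hg).
have -> : ulsubmx (hconj g) = hconj (ulsubmx g) by apply/matrixP => i j; rewrite !mxE.
have -> : ursubmx (hconj g) = hconj (dlsubmx g) by apply/matrixP => i j; rewrite !mxE.
have -> : dlsubmx (hconj g) = hconj (ursubmx g) by apply/matrixP => i j; rewrite !mxE.
have -> : drsubmx (hconj g) = hconj (drsubmx g) by apply/matrixP => i j; rewrite !mxE.
rewrite !hconjK //.
move: XYE; rewrite -{1}[g]submxK mul_row_block => /eq_row_mx[X'E Y'E].
set a := ulsubmx g in X'E Y'E *; set b := ursubmx g in X'E Y'E *.
set c := dlsubmx g in X'E Y'E *; set d := drsubmx g in X'E Y'E *.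
move=> h1 h2 h3 h4.
have aX : a *m hconj Y' - b *m hconj X' = hconj Y.
  rewrite X'E Y'E !hconjD // !hconjM // !mulmxDr !mulmxA h1 opprD addrACA subrr add0r.
  by rewrite -mulmxBl h2 mul1mx.
have cX : c *m hconj Y' - d *m hconj X' = - hconj X.
  rewrite X'E Y'E !hconjD // !hconjM // !mulmxDr !mulmxA h4 opprD addrACA subrr addr0.
  by rewrite -mulmxBl h3 mulNmx mul1mx.
pose z := (up t)%:M + X *m hconj Y - X' *m hconj Y'.
have zh : hconj z = z.
  rewrite /z hconjD // hconjD // hconjN // !hconjM // !hconjK // hconj_scalar // cj_up //.
  by rewrite -!addrA; congr (_ + _); exact: subr_swap inv.
have cz : cj (z 0 0) = z 0 0 by rewrite -{2}zh !mxE.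
have ht' : (up (down (z 0 0)))%:M + X' *m hconj Y' = (up t)%:M + X *m hconj Y.
  by rewrite (up_down hD cz) -mx11_scalar subrK.
exists (down (z 0 0)); first exact: ht'.
rewrite /umx /emb_mx -/a -/b -/c -/d; block_simp.
by rewrite ht' -aX -X'E -Y'E cX.
Qed.

End Embedding.

(** * Weil representations *)

Section AdditiveCharacterL.
Context {R : realType} (D : local_ext R).
Local Notation C := R[i].
Local Notation K := (lbase D).
Local Notation L := (ltop D).
Local Notation up := (@lup R D).
Local Notation cj := (@lconj R D).
Local Notation psi := (@lpsi R D).
Local Notation down := (@Defs.down R D).
Local Notation hermitian := (@Defs.hermitian R D _).
Hypothesis hD : quad_ext D.
Let hL := qe_local hD.

Definition psiE (y : L) : C := psi (trE y).

Lemma up_trE (y : L) : up (trE y) = y + cj y.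
Proof. by rewrite /trE (up_down hD) // cjD // cjK // addrC. Qed.

Lemma trED (x y : L) : trE (x + y) = trE x + trE y.
Proof. by apply: (up_inj hD); rewrite upD // !up_trE cjD // addrACA. Qed.

Lemma trE_up (t : K) (y : L) : trE (up t * y) = t * trE y.
Proof. by apply: (up_inj hD); rewrite upM // !up_trE cjM // cj_up // mulrDr. Qed.

Lemma down_trE (y : L) : cj y = y -> down y = trE (2^-1 * y).
Proof.
move=> cy; apply: (up_inj hD); rewrite up_trE (up_down hD) // cjM // cjV // cj_nat // cy.
by field; exact: (lchar0 hL 1).
Qed.

Section FromWeil.
Context {n : nat} (A : 'M[L]_n) (lambda : L -> C).
Variable Om : 'M[L]_(n + n) -> schwartz L n n -> schwartz L n n.
Hypotheses (n0 : (0 < n)%N) (hA : hermitian A) (uA : A \in unitmx)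
  (hOm : weil_rep A lambda Om).

Let natL k : (0 < k)%N -> k%:R != 0 :> L.
Proof. by case: k => // k _; exact: (lchar0 hL k). Qed.

(** Chosen so that n(Z s) multiplies a function by [psi (s * normE t)] at the scalar matrix t; the
    division by n compensates the trace of the identity. *)
Let Z (s : K) : 'M[L]_n := (up s / n%:R) *: invmx A.

Let Z_herm s : hermitian (Z s).
Proof.
rewrite /Defs.hermitian /Z hconjZ // hconj_inv // hA cjM // cjV // cj_up //.
by rewrite cj_nat.
Qed.

Let Z_trace s t : \tr (hconj t%:M *m A *m t%:M *m Z s) = up s * (t * cj t).
Proof.
rewrite hconj_scalar // mul_scalar_mx mul_mx_scalar /Z -!scalemxAl -!scalemxAr.
rewrite mulmxV // !mxtraceZ mxtrace1.
have := natL n0; move: (n%:R) => k k0; by field.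
Qed.

(** The elements n(Z s) add in s, and the scalars [psi s] by which they act at the identity matrix
    multiply because [Om] is a representation. *)
Lemma psiD : {morph psi : s t / s + t >-> s * t}.
Proof.
move=> s t; have [[lin rep1 repM] _ _ hn] := hOm.
pose Phi : schwartz L n n := sbump 1%:M 1.
have P1 : Phi 1%:M = 1 by rewrite sbump_center.
have ZD : Z (s + t) = Z s + Z t by rewrite /Z upD // mulrDl scalerDl.
have h u Psi : Om (siegel_n (Z u)) Psi 1%:M = psi u * Psi 1%:M.
  by rewrite hn // Z_trace cj1 // !mulr1 down_up.
have := h (s + t) Phi; rewrite ZD siegel_nD repM; try exact: Ugrp_siegel_n.
by rewrite !h P1 !mulr1.
Qed.

Lemma psi_neq0 t : psi t != 0.
Proof. by rewrite -normr_gt0 psi_norm // ltr01. Qed.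

Lemma psi0 : psi 0 = 1.
Proof. by apply: (mulfI (psi_neq0 0)); rewrite -psiD addr0 mulr1. Qed.

(** The image of an indicator under n(Z 1) is again Schwartz; along scalar matrices this makes t ->
    psi(t^2) locally constant. Local constancy at 0 and at 1, combined through (1 + s/2)^2 = 1 + s +
    (s/2)^2, gives the claim for psi itself. *)
Lemma psi_lc : exists2 e : R, 0 < e & forall s, vabs (up s) < e -> psi s = 1.
Proof.
have [_ _ _ hn] := hOm.
have key (t0 : K) : exists2 e : R, 0 < e & forall s, vabs (up s) < e ->
    psi ((t0 + s) ^+ 2) = psi (t0 ^+ 2).
  pose Phi : schwartz L n n := sbump (up t0)%:M 1.
  have [e e0 he] := (schwartz_schv (Om (siegel_n (Z 1)) Phi)).1 (up t0)%:M.
  exists (Num.min e 1) => [|s]; first by rewrite lt_min e0 ltr01.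
  rewrite lt_min => /andP[se s1].
  have h t : Om (siegel_n (Z 1)) Phi (up t)%:M = psi (t ^+ 2) * Phi (up t)%:M.
    rewrite hn // Z_trace up1 // mul1r cj_up // -upM // down_up // expr2 //.
  have close : mnorm ((up (t0 + s))%:M - (up t0)%:M : 'M[L]_n) <= vabs (up s).
    rewrite -raddfB upD // addrC addKr; apply/mnorm_leP => [|i j]; rewrite ?labs_ge0 //.
    by rewrite !mxE; case: (i == j); rewrite ?mulr1n ?mulr0n ?(abs0 hL) ?labs_ge0.
  have := he _ (le_lt_trans close se); rewrite !h.
  have -> : Phi (up t0)%:M = 1 by rewrite sbump_center.
  by rewrite sbumpE // (le_lt_trans close s1) !mulr1.
have [e e0 he] := key 0; have [d d0 hd] := key 1.
have a2 := abs2_gt0 hL; have n2 : (2 : L) != 0 by rewrite -(abs_gt0 hL).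
have u2 : up 2 = 2 by exact: (rmorph_nat (upR hD)).
exists (Num.min e d * vabs (2 : L)) => [|s]; first by rewrite mulr_gt0 // lt_min e0.
rewrite -ltr_pdivrMr // lt_min -(absV hL) -(labsM hL) => /andP[se sd].
have k2 : (2 : K) != 0 by rewrite -(up_eq0 hD) u2.
have us : up (s / 2) = up s / 2.
  by rewrite upM //; congr (_ * _); rewrite -[in RHS]u2; exact: (fmorphV (upR hD)).
have h1 : psi ((s / 2) ^+ 2) = 1.
  by have := he (s / 2); rewrite us add0r expr0n psi0; apply.
have := hd (s / 2); rewrite us => /(_ sd).
have -> : (1 + s / 2) ^+ 2 = 1 ^+ 2 + (s + (s / 2) ^+ 2) by field.
rewrite !psiD h1 mulr1 => h2; apply: (mulfI (psi_neq0 (1 ^+ 2))).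
by rewrite h2 mulr1.
Qed.

(** For trivial psi the Heisenberg relation would make every [Om J Phi] invariant under all
    translations, hence 0 by bounded support, whereas J acts invertibly. *)
Lemma psi_nontriv : exists t, psi t != 1.
Proof.
apply: contrapT => /forallNP h.
have p1 t : psi t = 1 by apply/eqP; apply: contrapT => /negP; exact: h.
have [[lin rep1 repM] hs _ _] := hOm.
pose J := Jmx D n.
have hJ : Ugrp D n J by exact: Ugrp_J.
have triv (Phi : schwartz L n n) : Om J Phi = 0.
  have inv (X : 'M[L]_n) : Om J Phi =1 heisenberg A X 0 (Om J Phi).
    apply: (hs J X 0 0 X Phi Phi) => //.
      by rewrite /J /Jmx mul_row_block; block_simp.
    by move=> x; rewrite /heisenberg p1 mul1r addr0.
  apply: schwartzP => x; rewrite [RHS]schw0.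
  apply/eqP; apply: contraT => nz; have [B hB] := (schwartz_schv (Om J Phi)).2.
  have [y hy] := abs_arb_large hL (Num.max B (mnorm x)).
  pose X : 'M[L]_n := y%:M - x.
  have : Om J Phi y%:M != 0.
    have := inv X x; rewrite /heisenberg p1 mul1r /X addrC subrK => <- //.
  move/hB; apply: contraTT => _; rewrite -ltNge.
  apply: lt_le_trans (_ : _ < vabs y) _; first by move: hy; rewrite gt_max => /andP[].
  have := mnorm_entry (y%:M : 'M[L]_n) (Ordinal n0) (Ordinal n0).
  by rewrite mxE eqxx.
pose Phi : schwartz L n n := sbump 0 1.
have : Phi = 0.
  rewrite -[Phi]rep1 -(mulVmx (Ugrp_unit hJ)) repM //; last exact: Ugrp_inv.
  by rewrite triv (lin0 (lin _ (Ugrp_inv hD hJ))).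
by move/eqP; apply/negP; exact: sbump_neq0.
Qed.

End FromWeil.

(** What is used about psi beyond its absolute value; [weil_good_char] derives it from a Weil
    representation rather than from the p-adic definition of [std_char]. *)
Record good_char : Prop := GoodChar {
  gcD : {morph psi : s t / s + t >-> s * t};
  gc_lc : exists2 e : R, 0 < e & forall s, vabs (up s) < e -> psi s = 1;
  gc_nontriv : exists t, psi t != 1 }.

Lemma weil_good_char n (A : 'M[L]_n) lambda Om : (0 < n)%N -> hermitian A ->
  A \in unitmx -> weil_rep A lambda Om -> good_char.
Proof.
move=> n0 hA uA hOm; split; [exact: psiD hOm|exact: psi_lc hOm|exact: psi_nontriv hOm].
Qed.

Hypothesis hpsi : good_char.

Lemma psiED x y : psiE (x + y) = psiE x * psiE y.
Proof. by rewrite /psiE trED gcD. Qed.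

Lemma psiE_neq0 x : psiE x != 0.
Proof. by rewrite -normr_gt0 psi_norm // ltr01. Qed.

Lemma psiE0 : psiE 0 = 1.
Proof. by apply: (mulfI (psiE_neq0 0)); rewrite -psiED addr0 mulr1. Qed.

Lemma psiEN x : psiE (- x) = (psiE x)^-1.
Proof.
apply: (mulfI (psiE_neq0 x)); rewrite -psiED addrN psiE0 divff //; exact: psiE_neq0.
Qed.

Lemma psiE_conj x : (psiE x)^* = psiE (- x).
Proof. by rewrite psiEN invC_norm psi_norm // expr1n invr1 mul1r. Qed.

Lemma psi_down y : cj y = y -> psi (down y) = psiE (2^-1 * y).
Proof. by move=> cy; rewrite down_trE. Qed.

Lemma psiE_lc : exists2 e : R, 0 < e & forall y, vabs y < e -> psiE y = 1.
Proof.
have [e e0 he] := gc_lc hpsi; exists e => // y ye; apply: he; rewrite up_trE.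
by apply: le_lt_trans (labsD hL _ _) _; rewrite gt_max cj_abs // ye.
Qed.

Lemma psiE_nd y : y != 0 -> exists z, psiE (y * z) != 1.
Proof.
move=> y0; have [t ht] := gc_nontriv hpsi; exists (y^-1 * (2^-1 * up t)).
by rewrite mulVKf // -psi_down ?cj_up // down_up.
Qed.

Lemma abs_trace n (x : 'M[L]_n) : vabs (\tr x) <= mnorm x.
Proof.
apply: (@abs_sum_le _ _ hL); [exact: mnorm_ge0|move=> i _; exact: mnorm_entry].
Qed.

Lemma psiE_trace_lc r k n (f : 'M[L]_(r, k) -> 'M[L]_n) : cts f ->
  locally_const (fun x => psiE (\tr (f x))).
Proof.
move=> hf x; have [e e0 he] := psiE_lc; have FF := nb_filter hL x; apply: filterS (hf x e e0) => y hy.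
rewrite -[f y](subrK (f x)) raddfD psiED he ?mul1r //.
exact: le_lt_trans (abs_trace _) hy.
Qed.

Lemma psiE_trace_nd r k (y : 'M[L]_(r, k)) : y != 0 ->
  exists z : 'M[L]_(k, r), psiE (\tr (y *m z)) != 1.
Proof.
move=> y0; have [[i j] yij] : exists ij, y ij.1 ij.2 != 0.
  apply: contrapT => /forallNP h; move: y0 => /eqP; apply; apply/matrixP => i j.
  by rewrite mxE; apply/eqP; apply: contrapT => /negP; exact: (h (i, j)).
have [z hz] := psiE_nd yij; exists (z *: delta_mx j i).
rewrite -scalemxAr mxtraceZ mxtrace_mulC.
have -> : \tr (delta_mx j i *m y) = y i j.
  rewrite /mxtrace (bigD1 j) //= big1 ?addr0 => [|l /negPf lj]; rewrite mxE.
    rewrite (bigD1 i) //= big1 ?addr0 => [|l /negPf li]; rewrite mxE ?eqxx ?mul1r //.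
    by rewrite li andbF mul0r.
  by rewrite big1 // => u _; rewrite mxE lj mul0r.
by rewrite mulrC.
Qed.

End AdditiveCharacterL.

Section WeilRep.
Context {R : realType} (D : local_ext R).
Local Notation C := R[i].
Local Notation L := (ltop D).
Local Notation up := (@lup R D).
Local Notation psi := (@lpsi R D).
Local Notation hermitian := (@Defs.hermitian R D _).
Hypothesis hD : quad_ext D.
Let hL := qe_local hD.
Hypothesis hpsi : good_char D.
Local Notation psiE := (@psiE R D).

Lemma cts_mull r k l (A : 'M[L]_(l, r)) : cts (fun x : 'M[L]_(r, k) => A *m x).
Proof. by apply: ctsM => //; [exact: cts_cst|exact: cts_id]. Qed.

Lemma cts_mulr r k l (A : 'M[L]_(k, l)) : cts (fun x : 'M[L]_(r, k) => x *m A).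
Proof. by apply: ctsM => //; [exact: cts_id|exact: cts_cst]. Qed.

Lemma proper_mull r k (A : 'M[L]_r) : A \in unitmx ->
  norm_proper (fun x : 'M[L]_(r, k) => A *m x).
Proof.
move=> uA; apply: (@proper_inv _ _ _ _ _ _ _ (fun x => invmx A *m x)).
  by move=> x; rewrite mulKmx.
exact: bounded_mull.
Qed.

Lemma proper_mulr r k (A : 'M[L]_k) : A \in unitmx ->
  norm_proper (fun x : 'M[L]_(r, k) => x *m A).
Proof.
move=> uA; apply: (@proper_inv _ _ _ _ _ _ _ (fun x => x *m invmx A)).
  by move=> x; rewrite mulmxK.
exact: bounded_mulr.
Qed.

Definition lmul r k (A : 'M[L]_r) (phi : schwartz L r k) : schwartz L r k :=
  scomp (fun x => A *m x) phi.

Lemma lmulE r k (A : 'M[L]_r) (phi : schwartz L r k) x : A \in unitmx ->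
  lmul A phi x = phi (A *m x).
Proof. by move=> uA; rewrite (scompE hL) //; [exact: cts_mull|exact: proper_mull]. Qed.

Lemma lmul_linear r k (A : 'M[L]_r) : A \in unitmx -> linear (@lmul r k A).
Proof. by move=> uA; apply: (scomp_linear hL); [exact: cts_mull|exact: proper_mull]. Qed.

Lemma Vgrp_inv n (A h : 'M[L]_n) : Vgrp A h -> Vgrp A (invmx h).
Proof.
move=> [uh hh]; split; first by rewrite unitmx_inv.
by rewrite hconj_inv // -[A in LHS]hh -!mulmxA mulmxV // mulmx1 mulKmx ?unitmx_hconj.
Qed.

Lemma up_half : up 2^-1 = 2^-1.
Proof.
have u2 : up 2 = 2 by exact: (rmorph_nat (upR hD)).
by rewrite -[in RHS]u2; exact: (fmorphV (upR hD)).
Qed.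

Lemma lc_trace r k n (a : 'M[L]_(n, r)) (b : 'M[L]_(k, n)) :
  locally_const (fun x : 'M[L]_(r, k) => psiE (\tr (a *m x *m b))).
Proof.
apply: (psiE_trace_lc hD hpsi); apply: (ctsM hL); last exact: cts_cst.
exact: cts_mull.
Qed.

Section OneRep.
Context {n : nat} (A : 'M[L]_n) (lambda : L -> C).

Lemma heisE (X Y x : 'M[L]_n) (f : 'M[L]_n -> C) :
  heisenberg A X Y f x =
  psiE (\tr (A *m x *m hconj Y)) * psiE (2^-1 * \tr (A *m X *m hconj Y)) * f (x + X).
Proof.
rewrite /heisenberg -psiED //; congr (psi _ * _); rewrite trED //; congr (_ + _).
by rewrite -trE_up // up_half.
Qed.

Definition sheis (X Y : 'M[L]_n) (Phi : schwartz L n n) : schwartz L n n :=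
  toS (heisenberg A X Y Phi).

Lemma sheisE X Y Phi x : sheis X Y Phi x =
  psiE (\tr (A *m x *m hconj Y)) * psiE (2^-1 * \tr (A *m X *m hconj Y)) * Phi (x + X).
Proof.
rewrite toSE ?heisE //.
rewrite (_ : heisenberg A X Y Phi = fun x =>
  psiE (\tr (A *m x *m hconj Y)) * psiE (2^-1 * \tr (A *m X *m hconj Y)) * sshift X Phi x).
  apply: (schv_lcM hL); last exact: schwartz_schv.
  exact: (lc_post hL (fun c => c * _) (lc_trace _ _)).
by apply: funext => y; rewrite heisE sshiftE.
Qed.

Lemma sheis_l X Phi : sheis X 0 Phi = sshift X Phi.
Proof.
apply: schwartzP => x; rewrite sheisE sshiftE // hconj0 // !mulmx0 !raddf0.
by rewrite mulr0 psiE0 // !mul1r.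
Qed.

Lemma sheis_r Y Phi x : sheis 0 Y Phi x = psiE (\tr (A *m x *m hconj Y)) * Phi x.
Proof. by rewrite sheisE mulmx0 mul0mx raddf0 mulr0 psiE0 // mulr1 addr0. Qed.

Variable Om : 'M[L]_(n + n) -> schwartz L n n -> schwartz L n n.
Hypothesis hOm : weil_rep A lambda Om.

Lemma weil_linear g : Ugrp D n g -> linear (Om g).
Proof. by have [[h _ _] _ _ _] := hOm; exact: h. Qed.

Lemma weil1 Phi : Om 1%:M Phi = Phi.
Proof. by have [[_ h _] _ _ _] := hOm. Qed.

Lemma weilM g h Phi : Ugrp D n g -> Ugrp D n h -> Om (g *m h) Phi = Om g (Om h Phi).
Proof. by have [[_ _ H] _ _ _] := hOm; exact: H. Qed.

Lemma weilK g Phi : Ugrp D n g -> Om (invmx g) (Om g Phi) = Phi.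
Proof.
by move=> hg; rewrite -weilM ?mulVmx ?weil1 ?Ugrp_unit //; exact: Ugrp_inv.
Qed.

Lemma weilVK g Phi : Ugrp D n g -> Om g (Om (invmx g) Phi) = Phi.
Proof.
by move=> hg; rewrite -weilM ?mulmxV ?weil1 ?Ugrp_unit //; exact: Ugrp_inv.
Qed.

Lemma weil_heis g (X Y X' Y' : 'M[L]_n) Phi : Ugrp D n g ->
  row_mx X' Y' = row_mx X Y *m g -> Om g (sheis X' Y' Phi) = sheis X Y (Om g Phi).
Proof.
have [_ H _ _] := hOm => hg XY; apply: schwartzP => x.
rewrite (H g X Y X' Y' Phi) //; first by rewrite heisE sheisE.
by move=> z; rewrite heisE sheisE.
Qed.

Lemma weil_m (B : 'M[L]_n) Phi x : B \in unitmx -> Om (siegel_m B) Phi x =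
  lambda (\det B) * (Num.sqrt (@nabs R L (\det B)) ^+ n)%:C * Phi (x *m B).
Proof. by have [_ _ H _] := hOm; exact: H. Qed.

(** The constant combines the values of [lambda] and of [nabs] at 1; it is determined by the
    identity [siegel_m 1%:M], which acts trivially. *)
Lemma weil_m1 (B : 'M[L]_n) Phi x : B \in unitmx -> \det B = 1 ->
  Om (siegel_m B) Phi x = Phi (x *m B).
Proof.
move=> uB dB; rewrite weil_m // dB.
have := weil_m (sbump 0 1) 0 (unitmx1 L n).
rewrite siegel_m1 // weil1 det1 mul0mx sbump_center // mulr1 => <-.
by rewrite mul1r.
Qed.

Lemma weil_n (Z : 'M[L]_n) Phi x : hermitian A -> hermitian Z ->
  Om (siegel_n Z) Phi x = psiE (2^-1 * \tr (hconj x *m A *m x *m Z)) * Phi x.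
Proof.
have [_ _ _ H] := hOm => hA hZ; rewrite H // psi_down //.
have e : hconj (hconj x *m A *m x *m Z) = Z *m (hconj x *m A *m x).
  by rewrite !hconjM // hconjK // hA hZ !mulmxA.
by rewrite -tr_hconj // e mxtrace_mulC.
Qed.

Lemma weil_J_heis X Y Phi :
  Om (Jmx D n) (sheis (- Y) X Phi) = sheis X Y (Om (Jmx D n) Phi).
Proof.
apply: weil_heis; first exact: Ugrp_J.
by rewrite /Jmx mul_row_block; block_simp.
Qed.

(** J acts as a Fourier transform, and the value of a Fourier transform at 0 is the integral. *)
Definition weil_haar (Phi : schwartz L n n) : C := Om (Jmx D n) Phi 0.

Lemma weil_J_fourier Phi y : Om (Jmx D n) Phi y = weil_haar (sheis 0 y Phi).
Proof.
rewrite /weil_haar -[X in sheis X _]oppr0 weil_J_heis sheis_l sshiftE //.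
by rewrite add0r.
Qed.

Lemma weil_haar_haar : haar weil_haar.
Proof.
have UJ := Ugrp_J hD (n := n); split.
- by move=> a u v; rewrite /weil_haar (weil_linear UJ) schwD schwZ.
- move=> a Phi; rewrite /weil_haar -sheis_l -[a]opprK weil_J_heis sheis_r.
  by rewrite mulmx0 mul0mx raddf0 psiE0 // mul1r.
apply: contrapT => /forallNP h.
have z Phi : weil_haar Phi = 0 by apply/eqP; apply: contrapT => /negP; exact: h.
have : (sbump 0 1 : schwartz L n n) = 0.
  rewrite -[LHS](weilK _ UJ).
  have -> : Om (Jmx D n) (sbump 0 1) = 0.
    by apply: schwartzP => y; rewrite weil_J_fourier z schw0.
  by rewrite (lin0 (weil_linear (Ugrp_inv hD UJ))).
by move/eqP; apply/negP; exact: sbump_neq0.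
Qed.

End OneRep.

Lemma weil_transport n (A : 'M[L]_n) lambda Om (k : 'M[L]_n) : k \in unitmx ->
  hermitian A -> weil_rep A lambda Om ->
  weil_rep (hconj k *m A *m k) lambda
    (fun g Phi => lmul k (Om g (lmul (invmx k) Phi))).
Proof.
move=> uk hA hOm; have uki : invmx k \in unitmx by rewrite unitmx_inv.
have KK Phi : lmul (invmx k) (lmul k Phi) = Phi.
  by apply: schwartzP => x; rewrite !lmulE // mulKVmx.
have KK' Phi : lmul k (lmul (invmx k) Phi) = Phi.
  by apply: schwartzP => x; rewrite !lmulE // mulKmx.
have trE2 (x Y : 'M[L]_n) : \tr (hconj k *m A *m k *m x *m hconj Y) =
    \tr (A *m (k *m x) *m hconj (k *m Y)).
  by rewrite -!mulmxA mxtrace_mulC hconjM // -!mulmxA.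
split; first split.
- move=> g hg a u v.
  by rewrite (lmul_linear uki) (weil_linear hOm hg) (lmul_linear uk).
- by move=> v; rewrite (weil1 hOm) KK'.
- by move=> g h v hg hh; rewrite (weilM hOm) // KK.
- move=> g X Y X' Y' Phi Phi' hg XY PhiE x.
  have -> : lmul (invmx k) Phi' = sheis A (k *m X') (k *m Y') (lmul (invmx k) Phi).
    apply: schwartzP => z; rewrite lmulE // PhiE heisE sheisE !trE2 !mulKVmx //.
    by rewrite lmulE // mulmxDr mulKmx.
  rewrite lmulE // (weil_heis hOm (X := k *m X) (Y := k *m Y)) //; last first.
    by rewrite -!mul_mx_row XY mulmxA.
  by rewrite sheisE heisE !trE2 lmulE // mulmxDr.
- move=> B Phi x uB; rewrite lmulE // (weil_m hOm) // lmulE //.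
  by rewrite -[k *m x *m B]mulmxA mulKmx.
- move=> Z Phi x hZ; have [_ _ _ H] := hOm.
  by rewrite lmulE // H // lmulE // mulKmx // hconjM // !mulmxA.
Qed.

(** The braid relation of SL_2. J occurs twice on one side and once on the other, so a nonzero
    scalar by which only J is changed must be 1. *)
Lemma Jmx_siegel_braid n : Jmx D n *m siegel_n (- 1%:M) *m Jmx D n =
  siegel_n 1%:M *m Jmx D n *m siegel_n 1%:M.
Proof. by rewrite /siegel_n /Jmx; block_simp; rewrite ?addrN ?addNr. Qed.

Lemma hermitian1 n : hermitian (1%:M : 'M[L]_n).
Proof. by rewrite /Defs.hermitian hconj1. Qed.

(** Conjugating [Om] by [h] gives a Weil representation for the same Gram matrix. It agrees with
    [Om] on n(Z), while on J it differs by the inverse of the modulus of [h]; the braid relation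
    forces this scalar to be 1. *)
Lemma weil_haar_inv n (A : 'M[L]_n) lambda Om h Phi : hermitian A ->
  weil_rep A lambda Om -> Vgrp A h -> weil_haar Om (lmul h Phi) = weil_haar Om Phi.
Proof.
move=> hA hOm [uh hh].
have uhi : invmx h \in unitmx by rewrite unitmx_inv.
have hI := weil_haar_haar hOm.
have [c c0 hc] : exists2 c : C, 0 < c &
    forall Phi, weil_haar Om (lmul h Phi) = c * weil_haar Om Phi.
  apply: (haar_comp hL (f' := fun x => invmx h *m x) hI).
  - exact: cts_mull.
  - exact: proper_mull.
  - by move=> x; rewrite mulKVmx.
  - by move=> x y; rewrite mulmxDr.
pose c' := c^-1; have cn : c != 0 by rewrite gt_eqF.
have hc' Psi : weil_haar Om (lmul (invmx h) Psi) = c' * weil_haar Om Psi.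
  apply: (mulfI cn); rewrite mulVKf // -hc; congr (weil_haar _ _).
  by apply: schwartzP => x; rewrite !lmulE // mulKmx.
pose Om' g Psi := lmul h (Om g (lmul (invmx h) Psi)).
have hOm' : weil_rep A lambda Om' by rewrite -[A]hh; exact: weil_transport.
have UJ := Ugrp_J hD (n := n).
have OJ Psi : Om' (Jmx D n) Psi = c' *: Om (Jmx D n) Psi.
  apply: schwartzP => y; rewrite schwZ (weil_J_fourier hOm') (weil_J_fourier hOm) -hc'.
  by rewrite /weil_haar /Om' lmulE // mulmx0.
have h1 := @hermitian1 n; have h1N : hermitian (- 1%:M : 'M[L]_n).
  by rewrite /Defs.hermitian hconjN // hconj1.
have On Z Psi : hermitian Z -> Om' (siegel_n Z) Psi = Om (siegel_n Z) Psi.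
  by move=> hZ; apply: schwartzP => x; rewrite (weil_n hOm') // (weil_n hOm).
have U1 := Ugrp_siegel_n hD h1; have U2 := Ugrp_siegel_n hD h1N.
have e1 Psi : Om' (Jmx D n *m siegel_n (- 1%:M) *m Jmx D n) Psi =
    c' *: (c' *: Om (Jmx D n *m siegel_n (- 1%:M) *m Jmx D n) Psi).
  rewrite (weilM hOm') //; last exact: UgrpM.
  rewrite (weilM hOm') // OJ On // OJ (linZ (weil_linear hOm U2)).
  rewrite (linZ (weil_linear hOm UJ)) (weilM hOm) //; last exact: UgrpM.
  by rewrite (weilM hOm).
have e2 Psi : Om' (Jmx D n *m siegel_n (- 1%:M) *m Jmx D n) Psi =
    c' *: Om (Jmx D n *m siegel_n (- 1%:M) *m Jmx D n) Psi.
  rewrite Jmx_siegel_braid (weilM hOm') //; last exact: UgrpM.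
  rewrite (weilM hOm') // On // OJ On // (linZ (weil_linear hOm U1)).
  by rewrite (weilM hOm) ?(weilM hOm) //; exact: UgrpM.
have Ug : Ugrp D n (Jmx D n *m siegel_n (- 1%:M) *m Jmx D n).
  by apply: UgrpM => //; exact: UgrpM.
pose b : schwartz L n n := sbump 0 1; pose Psi := Om (invmx (Jmx D n *m siegel_n (- 1%:M) *m Jmx D n)) b.
have := e1 Psi; rewrite e2 (weilVK hOm) // => /(congr1 (fun f : schwartz L n n => f 0)).
rewrite !schwZ sbump_center // !mulr1 => cc.
have c'1 : c' = 1 by apply: (@mulfI _ c'); rewrite ?mulr1 -?cc // invr_eq0.
by rewrite hc -[c]invrK -/c' c'1 invr1 mul1r.
Qed.

Section ColumnMeasure.
Context {n : nat}.

Lemma cts_col (j : 'I_n) : cts (@col L n n j).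
Proof.
apply: (@cts_lip _ _ _ _ _ _ _ 1) => x y; rewrite mul1r -linearB.
by apply/mnorm_leP => [|a b]; [exact: mnorm_ge0|rewrite mxE mnorm_entry].
Qed.

Lemma lc_prod r k (I : Type) (s : seq I) (f : I -> 'M[L]_(r, k) -> C) :
  (forall j, locally_const (f j)) -> locally_const (fun x => \prod_(j <- s) f j x).
Proof.
move=> hf; elim: s => [|j s IH].
  by rewrite (_ : (fun x => _) = fun=> 1) => [x|]; [exists 1|apply: funext => x; rewrite big_nil].
rewrite (_ : (fun x => _) = fun x => f j x * \prod_(i <- s) f i x).
  exact: (lc_post2 hL (fun u v : C => u * v) (hf j) IH).
by apply: funext => x; rewrite big_cons.
Qed.

Lemma schv_cols (phi : 'I_n -> schwartz L n 1) :
  @schv _ _ _ _ C^o (fun x : 'M[L]_n => \prod_j phi j (col j x)).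
Proof.
split.
  apply: lc_prod => j; apply: (lc_comp hL (schwartz_schv (phi j)).1); exact: cts_col.
have h j := schv_supp (schwartz_schv (phi j)).
have h' j : exists B : R, 0 < B /\ forall x, phi j x != 0 -> mnorm x <= B.
  by have [B] := h j; exists B.
have [B hB] := boolp.choice h'.
exists (\big[Num.max/0]_j B j) => x /prodf_neq0 nz; apply/mnorm_leP => [|i j].
  exact: bigmax_ge_id.
apply: le_trans (le_bigmax_cond _ _ (_ : predT j)) => //.
apply: le_trans ((hB j).2 _ (nz j isT)).
by have := mnorm_entry (col j x) i 0; rewrite mxE.
Qed.

Definition scols (phi : 'I_n -> schwartz L n 1) : schwartz L n n :=
  toS (fun x => \prod_j phi j (col j x)).

Lemma scolsE phi x : scols phi x = \prod_j phi j (col j x).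
Proof. by rewrite toSE //; exact: schv_cols. Qed.

(** On V^n the modulus of [h] is the n-th power of its modulus c on one column, so c^n = 1, and c =
    1 because c is positive. *)
Lemma column_haar_inv (l : schwartz L n n -> C) (I : schwartz L n 1 -> C) h :
  haar l -> haar I -> h \in unitmx -> (0 < n)%N ->
  (forall Phi, l (lmul h Phi) = l Phi) -> forall phi, I (lmul h phi) = I phi.
Proof.
move=> hl hI uh n0 inv.
have [c c0 hc] : exists2 c : C, 0 < c & forall phi, I (lmul h phi) = c * I phi.
  apply: (haar_comp hL (f' := fun x => invmx h *m x) hI).
  - exact: cts_mull.
  - exact: proper_mull.
  - by move=> x; rewrite mulKVmx.
  - by move=> x y; rewrite mulmxDr.
pose b : schwartz L n 1 := sbump 0 1.
(* The first [k] columns have been moved by [h]; raising [k] by one multiplies the integral by c, by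
   uniqueness of Haar measure in a single column. *)
pose F (k : nat) (j : 'I_n) : schwartz L n 1 := if (j < k)%N then lmul h b else b.
have Ib : I b != 0 by exact: haar_bump_neq0.
have step (j : 'I_n) : l (scols (F j.+1)) = c * l (scols (F j)).
  pose G phi i : schwartz L n 1 := if i == j then phi else F j i.
  pose T phi := l (scols (G phi)).
  have GE phi x : scols (G phi) x = phi (col j x) * \prod_(i | i != j) F j i (col i x).
    rewrite scolsE (bigD1 j) //= /G eqxx; congr (_ * _).
    by apply: eq_bigr => i /negPf ->.
  have [ll linv _] := hl.
  have lT : linear (T : _ -> C^o).
    move=> a u v; rewrite /T -ll; congr (l _); apply: schwartzP => x.
    by rewrite schwD schwZ !GE schwD schwZ mulrDl mulrA.
  have invT a phi : T (sshift a phi) = T phi.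
    rewrite /T -[RHS](linv (a *m delta_mx 0 j)); congr (l _); apply: schwartzP => x.
    rewrite sshiftE // !GE sshiftE //; congr (phi _ * _).
      rewrite linearD /=; congr (_ + _); apply/matrixP => u v; rewrite !mxE big_ord1.
      by rewrite !mxE !eqxx mulr1 ord1.
    apply: eq_bigr => i /negPf ij; congr (F j i _); rewrite linearD /=.
    rewrite -[LHS]addr0; congr (_ + _); apply/matrixP => u v; rewrite !mxE big_ord1.
    by rewrite !mxE ij andbF mulr0.
  have e : I b * T (lmul h b) = I (lmul h b) * T b.
    exact: (@haar_unique _ _ hL _ _ C^o I T hI lT invT (lmul h b) b).
  have e1 : scols (F j.+1) = scols (G (lmul h b)).
    apply: schwartzP => x; rewrite !scolsE; apply: eq_bigr => i _; congr (Defs.sfun _ _).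
    rewrite /F /G ltnS leq_eqVlt; have [->|ne] := eqVneq i j; first by rewrite eqxx.
    by rewrite -[(i == j :> nat)]/(i == j) (negPf ne).
  have e2 : scols (F j) = scols (G b).
    apply: schwartzP => x; rewrite !scolsE; apply: eq_bigr => i _; congr (Defs.sfun _ _).
    by rewrite /F /G; have [->|] := eqVneq i j; rewrite ?ltnn.
  by apply: (mulfI Ib); rewrite e1 e2 -/(T _) -/(T _) e hc mulrCA mulrA.
have pw k : (k <= n)%N -> l (scols (F k)) = c ^+ k * l (scols (F 0)).
  elim: k => [|k IH] kn; first by rewrite expr0 mul1r.
  by rewrite (step (Ordinal kn)) /= IH ?(ltnW kn) // exprS mulrA.
have en : scols (F n) = lmul h (scols (F 0)).
  apply: schwartzP => x; rewrite lmulE // !scolsE; apply: eq_bigr => j _.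
  by rewrite /F ltn_ord ltn0 lmulE // colE mulmxA -colE.
have nz : l (scols (F 0)) != 0.
  have [] // := @haar_pos _ _ hL _ _ l (scols (F 0)) (scols (F 0)) hl.
  - by move=> x; rewrite scolsE; apply: prodr_ge0 => j _; exact: sbump_ge0.
  - by move=> x; rewrite scolsE; apply: prodr_ge0 => j _; exact: sbump_ge0.
  - apply: contra_neq (oner_neq0 C) => z; have : scols (F 0) 0 = 0 by rewrite z.
    rewrite scolsE (eq_bigr (fun=> 1)) ?big1 // => j _.
    by rewrite /F ltn0 (_ : col j 0 = 0) ?sbump_center //; apply/matrixP => u v; rewrite !mxE.
  apply: contra_neq (oner_neq0 C) => z; have : scols (F 0) 0 = 0 by rewrite z.
  rewrite scolsE (eq_bigr (fun=> 1)) ?big1 // => j _.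
  by rewrite /F ltn0 (_ : col j 0 = 0) ?sbump_center //; apply/matrixP => u v; rewrite !mxE.
have cn : c ^+ n = 1.
  have := pw n (leqnn n); rewrite en inv -{1}[l _]mul1r => /(mulIf nz).
  by [].
have c1 : c = 1.
  by apply/eqP; rewrite -(@pexpr_eq1 _ c n) ?ltW // cn.
by move=> phi; rewrite hc c1 mul1r.
Qed.

End ColumnMeasure.

Lemma haar_exists_col n (l : schwartz L (1 + n) (1 + n) -> C) : haar l ->
  exists I : schwartz L (1 + n) 1 -> C, haar I.
Proof.
move=> hl; have [ll linv _] := hl.
pose b : schwartz L (1 + n) n := sbump 0 1.
exists (fun phi => l (rtens phi b)); split.
- move=> a u v; rewrite -ll; congr (l _); apply: schwartzP => x.
  by rewrite schwD schwZ !rtensE // schwD schwZ mulrDl mulrA.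
- move=> a phi; rewrite -[RHS](linv (row_mx a 0)); congr (l _); apply: schwartzP => x.
  by rewrite sshiftE // !rtensE // sshiftE // !linearD /= row_mxKl row_mxKr addr0.
pose b1 : schwartz L (1 + n) 1 := sbump 0 1; exists b1.
have [] // := @haar_pos _ _ hL _ _ l (rtens b1 b) (rtens b1 b) hl.
- by move=> x; rewrite rtensE // mulr_ge0 // sbump_ge0.
- by move=> x; rewrite rtensE // mulr_ge0 // sbump_ge0.
- apply: contra_neq (oner_neq0 C) => z.
  have : rtens b1 b 0 = 0 by rewrite z.
  by rewrite rtensE // !linear0 !sbump_center // mulr1.
apply: contra_neq (oner_neq0 C) => z.
have : rtens b1 b 0 = 0 by rewrite z.
by rewrite rtensE // !linear0 !sbump_center // mulr1.
Qed.

End WeilRep.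

(** * The Weil representation of the Jacobi group *)

Section FourierJacobiWeil.
Context {R : realType} (D : local_ext R).
Local Notation C := R[i].
Local Notation K := (lbase D).
Local Notation L := (ltop D).
Local Notation up := (@lup R D).
Local Notation cj := (@lconj R D).
Local Notation psi := (@lpsi R D).
Local Notation down := (@Defs.down R D).
Local Notation hermitian := (@Defs.hermitian R D _).
Hypothesis hD : quad_ext D.
Let hL := qe_local hD.
Hypothesis hpsi : good_char D.
Local Notation psiE := (@psiE R D).
Local Notation s_abs x := ((Num.sqrt (@nabs R L x))%:C : C).

Context {m : nat} (S : K) (chi : L -> C).
Hypotheses (m0 : (0 < m)%N) (S0 : S != 0)
  (chiM : forall x y, x != 0 -> y != 0 -> chi (x * y) = chi x * chi y)
  (chi_unit : forall x, x != 0 -> `|chi x| = 1)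
  (chi_norm : forall x, x != 0 -> chi (x * cj x) = 1).
Local Notation mat := 'M[L]_((1 + m) + (1 + m)).
Local Notation S1m := (schwartz L 1 m).
Variable om : mat -> S1m -> S1m.
Hypothesis hom : fj_weil_rep S chi om.

Lemma fj_linear g : jacobi_group D m g -> linear (om g).
Proof. by have [[h _ _] _ _] := hom; exact: h. Qed.

Lemma fj1 phi : om 1%:M phi = phi.
Proof. by have [[_ h _] _ _] := hom. Qed.

Lemma fjM g h phi : jacobi_group D m g -> jacobi_group D m h ->
  om (g *m h) phi = om g (om h phi).
Proof. by have [[_ _ H] _ _] := hom; exact: H. Qed.

Lemma fj_u X Y t phi x : om (umx X Y t) phi x =
  psi (S * t + trE ((up S *: ((x + X) *m hconj Y)) 0 0)) * phi (x + X).
Proof. by have [_ H _] := hom. Qed.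

Lemma fj_m (B : 'M[L]_m) phi x : B \in unitmx ->
  om (emb_mx (siegel_m B)) phi x = chi (\det B) * s_abs (\det B) * phi (x *m B).
Proof. by have [_ _ H] := hom; exact: H. Qed.

Lemma fj_emb_u g X Y X' Y' t t' phi : Ugrp D m g ->
  row_mx X' Y' = row_mx X Y *m g ->
  (up t')%:M + X' *m hconj Y' = (up t)%:M + X *m hconj Y ->
  om (emb_mx g) (om (umx X' Y' t') phi) = om (umx X Y t) (om (emb_mx g) phi).
Proof.
move=> hg XY tt; have [t1 h1 h2] := emb_umx hD t hg XY.
have -> : t' = t1.
  move: h1; rewrite -tt => /addIr /matrixP /(_ 0 0); rewrite !mxE eqxx !mulr1n.
  by move/(up_inj hD).
by rewrite -!fjM -?h2 //; try exact: umx_jacobi; exact: emb_jacobi.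
Qed.

Let J := emb_mx (Jmx D m).
Let UJ : Ugrp D m (Jmx D m) := Ugrp_J hD.
Let JJ : jacobi_group D m J := emb_jacobi hD UJ.

Lemma fj_emb_inv g phi : Ugrp D m g -> om (emb_mx (invmx g)) (om (emb_mx g) phi) = phi.
Proof.
move=> hg; have hg' := Ugrp_inv hD hg.
by rewrite -fjM -?emb_mxM ?mulVmx ?(Ugrp_unit hg) // ?emb_mx1 ?fj1 //; exact: emb_jacobi.
Qed.

(** The Fourier transform at 0, now on the row space on which the Jacobi group acts; this is the
    integral in the slice pairing. *)
Definition fj_haar (phi : S1m) : C := om J phi 0.

Lemma fj_shift X phi : om (umx X 0 0) phi = sshift X phi.
Proof.
apply: schwartzP => x; rewrite fj_u sshiftE // hconj0 // mulmx0 scaler0 mxE mulr0 add0r.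
by rewrite -[psi _]/(psiE 0) psiE0 // mul1r.
Qed.

Lemma fj_haar_haar : haar fj_haar.
Proof.
split.
- by move=> a u v; rewrite /fj_haar (fj_linear JJ) schwD schwZ.
- move=> a phi; rewrite /fj_haar -fj_shift /J.
  rewrite (@fj_emb_u _ 0 (- a) a 0 0 0) //.
  + by rewrite fj_u addr0 mul0mx scaler0 mxE mulr0 add0r -[psi _]/(psiE 0) psiE0 // mul1r.
  + by rewrite /Jmx mul_row_block; block_simp.
  + by rewrite hconj0 // mulmx0 mul0mx.
apply: contrapT => /forallNP h.
have z phi : fj_haar phi = 0 by apply/eqP; apply: contrapT => /negP; exact: h.
have oz phi : om J phi = 0.
  apply: schwartzP => x; rewrite schw0.
  have -> : om J phi x = sshift x (om J phi) 0 by rewrite sshiftE // add0r.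
  rewrite -fj_shift /J -(@fj_emb_u _ x 0 0 x 0 0) //; first exact: z.
  + by rewrite /Jmx mul_row_block; block_simp.
  + by rewrite hconj0 // mulmx0 mul0mx.
have : (sbump 0 1 : S1m) = 0.
  rewrite -[LHS](fj_emb_inv _ UJ) -/J oz.
  by rewrite (lin0 (fj_linear (emb_jacobi hD (Ugrp_inv hD UJ)))).
by move/eqP; apply/negP; exact: sbump_neq0.
Qed.

Let nabs_cj x : @nabs R L (cj x) = nabs x.
Proof.
rewrite /nabs; congr xget; apply/seteqP; split=> r [p [s [n [h1 h2 h3 h4]]]];
  by exists p, s, n; split=> //; move: h3; rewrite cj_abs.
Qed.

(** Since [nabs] is defined by a choice, the relation is obtained by letting diag(d, 1, ..., 1) and
    its inverse act on an indicator and evaluating at 0, where the values of [chi] cancel. *)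
Lemma s_abs_inv d : d != 0 -> s_abs d * s_abs d^-1 = 1.
Proof.
move=> d0.
pose B : 'M[L]_m := diag_mx (\row_j if j == Ordinal m0 then d else 1).
have dB : \det B = d.
  rewrite det_diag (bigD1 (Ordinal m0)) //= mxE eqxx big1 ?mulr1 // => j /negPf nj.
  by rewrite mxE nj.
have uB : B \in unitmx by rewrite unitmxE dB unitfE.
have uB' : invmx B \in unitmx by rewrite unitmx_inv.
have := fj_emb_inv (sbump 0 1) (Ugrp_siegel_m hD uB).
have -> : invmx (siegel_m B) = siegel_m (invmx B).
  apply: (can_inj (mulKmx (Ugrp_unit (Ugrp_siegel_m hD uB)))).
  by rewrite mulmxV ?(Ugrp_unit (Ugrp_siegel_m hD uB)) // -siegel_mM // mulmxV // siegel_m1.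
move/(congr1 (fun f : S1m => f 0)); rewrite !fj_m // !mul0mx sbump_center // mulr1.
rewrite det_inv dB mulrACA -chiM ?invr_eq0 // mulVf // mulrC => h.
have c1 : chi 1 = 1.
  have := chiM (oner_neq0 L) (oner_neq0 L); rewrite mulr1 => e.
  have n0 : chi 1 != 0 by rewrite -normr_eq0 chi_unit ?oner_eq0.
  by apply: (mulfI n0); rewrite -e mulr1.
by move: h; rewrite c1 mulr1 mulrC.
Qed.

Definition rmul r k (B : 'M[L]_k) (phi : schwartz L r k) : schwartz L r k :=
  scomp (fun x => x *m B) phi.

Lemma rmulE r k (B : 'M[L]_k) (phi : schwartz L r k) x : B \in unitmx ->
  rmul B phi x = phi (x *m B).
Proof. by move=> uB; rewrite (scompE hL) //; [exact: cts_mulr|exact: proper_mulr]. Qed.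

(** The modulus of x -> x B is read off by evaluating at 0 the relation J m(B) = m(B') J, with B'
    the inverse of the conjugate transpose of B. The values of [chi] agree on both sides because
    [chi] is trivial on norms. *)
Lemma fj_haar_mod (B : 'M[L]_m) phi : B \in unitmx ->
  s_abs (\det B) ^+ 2 * fj_haar (rmul B phi) = fj_haar phi.
Proof.
move=> uB; have d0 : \det B != 0 by rewrite -unitfE -unitmxE.
have UB := Ugrp_siegel_m hD uB.
have uB' : invmx (hconj B) \in unitmx by rewrite unitmx_inv unitmx_hconj.
have UB' := Ugrp_siegel_m hD uB'.
have : om J (om (emb_mx (siegel_m B)) phi) =
    om (emb_mx (siegel_m (invmx (hconj B)))) (om J phi).
  rewrite -!fjM //; try exact: emb_jacobi.
  by rewrite /J -!emb_mxM Jmx_siegel_m.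
have -> : om (emb_mx (siegel_m B)) phi = (chi (\det B) * s_abs (\det B)) *: rmul B phi.
  by apply: schwartzP => x; rewrite fj_m // schwZ rmulE.
rewrite (linZ (fj_linear JJ)) => /(congr1 (fun f : S1m => f 0)).
rewrite schwZ fj_m // mul0mx det_inv det_hconj // -/(fj_haar _) -/(fj_haar _).
move: d0; move: (\det B) => d d0; have cd0 : cj d != 0 by rewrite cj_eq0.
have -> : chi (cj d)^-1 = chi d.
  have n0 : chi (cj d) != 0 by rewrite -normr_eq0 chi_unit ?oner_eq0.
  apply: (mulfI n0); rewrite -chiM ?invr_eq0 // mulfV // mulrC -chiM // chi_norm //.
  have := chi_norm (oner_neq0 L); by rewrite cj1 // mulr1.
have -> : s_abs (cj d)^-1 = s_abs d^-1 by rewrite -cjV // nabs_cj.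
rewrite -!mulrA => /(mulfI (_ : chi d != 0)).
rewrite -normr_eq0 chi_unit ?oner_eq0 // => /(_ isT) e.
by rewrite e mulrA s_abs_inv // mul1r.
Qed.

Definition conj_act g phi : S1m := sconj (om g (sconj phi)).

Lemma omcE g phi x : conj_act g phi x = (om g (sconj phi) x)^*. Proof. by []. Qed.

Lemma sconjE (phi : S1m) x : sconj phi x = (phi x)^*. Proof. by []. Qed.

Lemma sconjK (phi : S1m) : sconj (sconj phi) = phi.
Proof. by apply: schwartzP => x; rewrite !sconjE conjCK. Qed.

Lemma omc_linear g : jacobi_group D m g -> linear (conj_act g).
Proof.
move=> hg a u v; apply: schwartzP => x; rewrite schwD schwZ !omcE.
have -> : sconj (a *: u + v) = a^* *: sconj u + sconj v.
  by apply: schwartzP => y; rewrite schwD schwZ !sconjE schwD schwZ rmorphD rmorphM.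
by rewrite (fj_linear hg) schwD schwZ rmorphD rmorphM /= conjCK.
Qed.

Lemma omcM g h phi : jacobi_group D m g -> jacobi_group D m h ->
  conj_act (g *m h) phi = conj_act g (conj_act h phi).
Proof. by move=> hg hh; rewrite /conj_act sconjK fjM. Qed.

Lemma omc_u X Y t phi x : conj_act (umx X Y t) phi x =
  psi (- (S * t + trE ((up S *: ((x + X) *m hconj Y)) 0 0))) * phi (x + X).
Proof.
rewrite omcE fj_u rmorphM /= ?sconjE conjCK; congr (_ * _).
set u := (_ + _); have -> : u = trE (2^-1 * up u) by rewrite -down_trE ?cj_up // down_up.
rewrite -/(psiE _) psiE_conj // /psiE; congr psi; apply: (up_inj hD).
by rewrite upN // !up_trE // cjN // opprD.
Qed.

Lemma omc_shift X phi : conj_act (umx X 0 0) phi = sshift X phi.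
Proof.
apply: schwartzP => x; rewrite omcE fj_shift !sshiftE // ?sconjE conjCK //.
Qed.

Lemma omc_m (B : 'M[L]_m) phi x : B \in unitmx ->
  conj_act (emb_mx (siegel_m B)) phi x = (chi (\det B))^* * s_abs (\det B) * phi (x *m B).
Proof.
move=> uB; rewrite omcE fj_m // !rmorphM /= ?sconjE conjCK; congr (_ * _ * _).
by rewrite conj_Creal // ger0_real // ler0c sqrtr_ge0.
Qed.

(** * The U-invariant bilinear forms *)

Section Reduction.
Variables (A : 'M[L]_(1 + m)) (lambda : L -> C).
Variable Om : mat -> schwartz L (1 + m) (1 + m) -> schwartz L (1 + m) (1 + m).
Hypotheses (hA : hermitian A) (hOm : weil_rep A lambda Om).
Local Notation SM := (schwartz L (1 + m) (1 + m)).
Implicit Types (x : 'M[L]_(1 + m)) (Phi : SM).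

Definition qform x : L := (hconj (lsubmx x) *m A *m lsubmx x) 0 0.
Definition afun x : 'M[L]_(1, m) :=
  (up S)^-1 *: (hconj (lsubmx x) *m A *m rsubmx x).

Lemma qform_fixed x : cj (qform x) = qform x.
Proof.
have -> : cj (qform x) = (hconj (hconj (lsubmx x) *m A *m lsubmx x)) 0 0.
  by rewrite [RHS]mxE [in RHS]mxE.
by rewrite !hconjM // hconjK // hA mulmxA.
Qed.

Lemma gram_block x : hconj x *m A *m x =
  block_mx (qform x)%:M (up S *: afun x) (hconj (up S *: afun x))
    (hconj (rsubmx x) *m A *m rsubmx x).
Proof.
have uS : up S != 0 by rewrite up_eq0.
rewrite -[in LHS](hsubmxK x) hconj_row_mx // mul_col_mx mul_col_row.
congr block_mx; first exact: mx11_scalar.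
  by rewrite /afun scalerA mulfV // scale1r.
by rewrite /afun scalerA mulfV // scale1r !hconjM // hconjK // hA mulmxA.
Qed.

Lemma gram_trace_fixed x M : hermitian M ->
  cj (\tr (hconj x *m A *m x *m M)) = \tr (hconj x *m A *m x *m M).
Proof.
move=> hM; rewrite -tr_hconj // [in LHS]hconjM // hM !hconjM // hconjK // hA.
by rewrite mxtrace_mulC !mulmxA.
Qed.

Lemma umx_trace x X Y t : down (\tr (hconj x *m A *m x *m uni_n X Y t)) =
  down (qform x) * t + trE (qform x * (X *m hconj Y) 0 0) +
  trE ((up S *: (afun x *m hconj Y)) 0 0).
Proof.
apply: (up_inj hD); rewrite !upD // upM // !up_trE // (up_down hD (qform_fixed x)).
have tr11 (M : 'M[L]_1) : \tr M = M 0 0 by rewrite /mxtrace big_ord1.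
have e (M : 'M[L]_(1, m)) : \tr (hconj M *m Y) = cj ((M *m hconj Y) 0 0).
  by rewrite -tr11 -tr_hconj // hconjM // hconjK // mxtrace_mulC.
rewrite up_down // ?gram_trace_fixed //; last exact: uni_n_herm.
rewrite gram_block /uni_n mulmx_block mxtrace_block mulmx0 addr0 mxtraceD mul_scalar_mx.
rewrite mxtraceZ e -!scalemxAl !mxtraceD mxtrace_scalar mulr1n !tr11.
have eYX : (Y *m hconj X) 0 0 = cj ((X *m hconj Y) 0 0).
  have -> : cj ((X *m hconj Y) 0 0) = (hconj (X *m hconj Y)) 0 0 by rewrite [RHS]mxE [in RHS]mxE.
  by rewrite hconjM // hconjK.
by rewrite eYX (cjM hD (qform x)) qform_fixed; ring.
Qed.


Lemma gc0 : psi 0 = 1.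
Proof.
have n0 : psi 0 != 0 by rewrite -normr_gt0 psi_norm // ltr01.
by apply: (mulfI n0); rewrite -(gcD hpsi) addr0 mulr1.
Qed.

Lemma uni_m_sub X x : lsubmx (x *m uni_m X) = lsubmx x /\
  rsubmx (x *m uni_m X) = rsubmx x + lsubmx x *m X.
Proof.
rewrite -{1 3}[x]hsubmxK mul_row_block row_mxKl row_mxKr.
by rewrite mulmx1 mulmx0 addr0 mulmx1 addrC.
Qed.

Lemma afun_um X x : qform x = up S -> afun (x *m uni_m X) = afun x + X.
Proof.
move=> qx; have uS : up S != 0 by rewrite up_eq0.
rewrite /afun (uni_m_sub X x).1 (uni_m_sub X x).2 mulmxDr scalerDr; congr (_ + _).
rewrite mulmxA (mx11_scalar (_ *m lsubmx x)) -/(qform x) qx mul_scalar_mx scalerA.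
by rewrite mulVf // scale1r.
Qed.

Lemma weil_u X Y t Phi x : Om (umx X Y t) Phi x =
  psi (down (\tr (hconj x *m A *m x *m uni_n X Y t))) * Phi (x *m uni_m X).
Proof.
have hn := uni_n_herm hD X Y t; have um := uni_m_unit X.
rewrite umxE // (weilM hOm); [|exact: Ugrp_siegel_n|exact: Ugrp_siegel_m].
have [_ _ _ H] := hOm; rewrite H // (weil_m1 hD hOm) //.
by rewrite det_ublock !det1 mulr1.
Qed.

(** On the hyperboloid and at the argument [afun x] the phases of [Om] and of the conjugate of [om]
    are inverse to each other; this is what singles out the graph. *)
Lemma umx_act X Y t Phi phi x : qform x = up S ->
  Om (umx X Y t) Phi x * conj_act (umx X Y t) phi (afun x) =
  Phi (x *m uni_m X) * phi (afun x + X).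
Proof.
move=> qx; rewrite weil_u omc_u umx_trace qx down_up // mulrACA -(gcD hpsi).
set u := (u in psi (_ - u)); suff -> : S * t + trE (up S * (X *m hconj Y) 0 0) +
  trE ((up S *: (afun x *m hconj Y)) 0 0) = u by rewrite subrr gc0 mul1r.
rewrite /u -addrA; congr (_ + _); rewrite -trED //; congr trE.
by rewrite mulmxDl scalerDr [RHS]mxE addrC [(up S *: (X *m hconj Y)) 0 0]mxE.
Qed.

Lemma cts_gram (M : 'M[L]_(1 + m)) : cts (fun x : 'M[L]_(1 + m) => 2^-1 *: (hconj x *m A *m x *m M)).
Proof.
rewrite (_ : (fun x => _) = fun x : 'M[L]_(1 + m) => hconj x *m (2^-1 *: A) *m x *m M).
  apply: (ctsM hL); last exact: cts_cst.
  apply: (ctsM hL); last exact: cts_id.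
  by apply: (ctsM hL); [exact: cts_hconj|exact: cts_cst].
by apply: funext => x; rewrite -scalemxAr -!scalemxAl.
Qed.

Lemma cts_afun : cts afun.
Proof.
rewrite (_ : afun = fun x => hconj (lsubmx x) *m ((up S)^-1 *: A) *m rsubmx x).
  apply: (ctsM hL); last exact: cts_rsubmx.
  apply: (ctsM hL); last exact: cts_cst.
  exact: (cts_comp hL (cts_hconj hD (r := 1 + m) (k := 1)) (@cts_lsubmx _ _ (1 + m) 1 m)).
by apply: funext => x; rewrite /afun -scalemxAr -scalemxAl.
Qed.

Lemma bounded_afun : norm_bounded afun.
Proof.
rewrite (_ : afun = fun x => hconj (lsubmx x) *m ((up S)^-1 *: A) *m rsubmx x).
  apply: (boundedM hL); last exact: bounded_rsubmx.
  apply: (boundedM hL); last exact: (@norm_bounded_cst _ _ (1 + m) (1 + m)).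
  exact: (bounded_comp (@bounded_hconj _ _ hD (1 + m) 1) (@bounded_lsubmx _ _ (1 + m) 1 m)).
by apply: funext => x; rewrite /afun -scalemxAr -scalemxAl.
Qed.

Section BilinearInvariant.
Context {P : lmodType C} (beta : SM -> S1m -> P).
Hypotheses (betal : forall phi, linear (beta^~ phi)) (betar : forall Phi, linear (beta Phi)).
Hypothesis inv : forall X Y t Phi phi,
  beta (Om (umx X Y t) Phi) (conj_act (umx X Y t) phi) = beta Phi phi.

(** The elements u(0, Y, t) act by multipliers only. The parameter t detects [qform x - up S] and Y
    detects [afun x - b], so off the graph some product of multipliers differs from 1. *)
Lemma U_support x (b : 'M[L]_(1, m)) : ~ (qform x = up S /\ b = afun x) ->
  exists2 e : R, 0 < e &
     forall y c, mnorm (y - x) < e -> mnorm (c - b) < e ->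
     forall s t, 0 < s -> s <= e -> 0 < t -> t <= e ->
       beta (sbump y s) (sbump c t) = 0.
Proof.
move=> nZ.
pose m1 Y t x := psi (down (\tr (hconj x *m A *m x *m uni_n 0 Y t))).
pose m2 (Y b : 'M[L]_(1, m)) t := psi (- (S * t + trE ((up S *: (b *m hconj Y)) 0 0))).
have lc1 Y t : locally_const (m1 Y t).
  rewrite (_ : m1 Y t = fun x => psiE (\tr (2^-1 *: (hconj x *m A *m x *m uni_n 0 Y t)))).
    by apply: (psiE_trace_lc hD hpsi); exact: cts_gram.
  apply: funext => z; rewrite /m1 psi_down ?mxtraceZ //.
  by apply: gram_trace_fixed; exact: uni_n_herm.
have lc2 Y t : locally_const (fun b => m2 Y b t).
  rewrite (_ : (fun b => m2 Y b t) = fun b : 'M[L]_(1, m) =>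
      psi (- (S * t)) * psiE (\tr ((- up S)%:M *m b *m hconj Y))).
    exact: (lc_post hL (fun c => _ * c) (lc_trace hD hpsi _ _)).
  apply: funext => c; rewrite /m2 opprD (gcD hpsi); congr (_ * _).
  rewrite /psiE; congr psi.
  have -> : \tr ((- up S)%:M *m c *m hconj Y) = - (up S *: (c *m hconj Y)) 0 0.
    by rewrite mul_scalar_mx scaleNr mulNmx -scalemxAl /mxtrace big_ord1 mxE.
  by apply: (up_inj hD); rewrite upN // !up_trE // cjN // opprD.
have um0 : uni_m 0 = 1%:M :> 'M[L]_(1 + m) by rewrite /uni_m -(scalar_mx_block 1 m).
have inv' Y t Phi phi : beta (smul (m1 Y t) Phi) (smul (fun b => m2 Y b t) phi) = beta Phi phi.
  rewrite -[RHS](inv 0 Y t); congr (beta _ _); apply: schwartzP => z.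
    by rewrite (smulE hL) // weil_u um0 mulmx1.
  by rewrite (smulE hL) // omc_u addr0.
suff [Y [t ne]] : exists Y t, m1 Y t x * m2 Y b t != 1.
  exact: (multiplier_vanish hL betal betar (lc1 Y t) (lc2 Y t) ne (inv' Y t)).
have mE Y t : m1 Y t x * m2 Y b t =
    psi ((down (qform x) - S) * t + trE ((up S *: ((afun x - b) *m hconj Y)) 0 0)).
  rewrite /m1 /m2 umx_trace mul0mx mxE mulr0 -(gcD hpsi); congr psi.
  have tr0 : trE (0 : L) = 0 by apply: (up_inj hD); rewrite up_trE // cj0 // addr0 up0.
  rewrite tr0 addr0 opprD addrACA mulrBl; congr (_ + _).
  apply: (up_inj hD); rewrite upD // upN // !up_trE // opprD addrACA -cjN // -cjD //.
  by rewrite mulmxBl scalerBr [(_ - _ : 'M[L]_1) 0 0]mxE [(- _ : 'M[L]_1) 0 0]mxE.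
have [qx|qx] := eqVneq (qform x) (up S); last first.
  have [t0 ht0] := gc_nontriv hpsi.
  have d0 : down (qform x) - S != 0.
    rewrite subr_eq0; apply: contra_neq qx => <-; by rewrite up_down // qform_fixed.
  exists 0, (t0 / (down (qform x) - S)); rewrite mE mulrC divfK //.
  rewrite hconj0 // mulmx0 scaler0 mxE.
  have -> : trE (0 : L) = 0 by apply: (up_inj hD); rewrite up_trE // cj0 // addr0 up0.
  by rewrite addr0.
have yn : up S *: (afun x - b) != 0.
  rewrite scaler_eq0 up_eq0 // negb_or S0 subr_eq0 /=.
  by apply/eqP => ab; apply: nZ.
have [z hz] := psiE_trace_nd hD hpsi yn; exists (hconj z), 0.
rewrite mE qx down_up // subrr mul0r add0r hconjK // scalemxAl.
by move: hz; rewrite /mxtrace big_ord1.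
Qed.

Lemma U_reduction : exists T : SM -> P,
  [/\ linear T, forall Phi phi, beta Phi phi = T (smul (phi \o afun) Phi),
      forall Phi, (forall x, qform x = up S -> Phi x = 0) -> T Phi = 0,
      forall X Phi, T (rmul (uni_m X) Phi) = T Phi
    & forall Phi, exists2 B0 : R, 0 < B0 &
        forall B, B0 <= B -> T Phi = beta Phi (sbump 0 B)].
Proof.
have [|T [lT TE supT TB]] := @graph_reduction _ _ hL _ _ _ _ P beta betal betar
  afun [set x | qform x = up S] cts_afun bounded_afun.
  move=> Phi phi hZ; apply: (pure_support hL betal betar) => x b Px pb.
  apply: U_support => -[qx bE]; have := hZ x qx; rewrite -bE => /eqP.
  by rewrite mulf_eq0 (negPf Px) (negPf pb).
exists T; split=> // X Phi.
have [B1 B10 h1] := TB Phi; have [B2 B20 h2] := TB (rmul (uni_m X) Phi).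
(* The radius also exceeds the norm of [X], so that translation by [X] maps the ball in the second
   argument onto itself. *)
pose B := Num.max (Num.max B1 B2) (mnorm X + 1).
have B0 : 0 < B by rewrite !lt_max B10.
rewrite (h1 B); last by rewrite !le_max lexx.
rewrite (h2 B); last by rewrite !le_max lexx orbT.
rewrite -[RHS](inv X 0 0); congr (beta _ _).
  apply: schwartzP => x; rewrite rmulE ?uni_m_unit // weil_u.
  rewrite (_ : uni_n X 0 0 = 0) ?mulmx0 ?raddf0; last first.
    by rewrite /uni_n up0 // raddf0 hconj0 // mulmx0 mul0mx !addr0 block_mx0.
  by rewrite -(up0 hD) down_up // gc0 mul1r.
rewrite omc_shift sshift_sbump // sub0r; apply: sbump_eq => //.
by rewrite subr0 mnormN // /B lt_max ltrDl ltr01 orbT.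
Qed.

End BilinearInvariant.
End Reduction.

End FourierJacobiWeil.

(** * The slice pairing and its equivariance *)

Section Slices.
Context {R : realType} (D : local_ext R).
Local Notation C := R[i].
Local Notation K := (lbase D).
Local Notation L := (ltop D).
Local Notation up := (@lup R D).
Local Notation hermitian := (@Defs.hermitian R D _).
Hypothesis hD : quad_ext D.
Let hL := qe_local hD.
Hypothesis hpsi : good_char D.
Local Notation psiE := (@psiE R D).

Context {m : nat} (S : K) (A0 : 'M[L]_m).
Hypotheses (S0 : S != 0) (hA0 : hermitian A0) (uA0 : A0 \in unitmx).
Local Notation S1m := (schwartz L 1 m).
Local Notation SM := (schwartz L (1 + m) (1 + m)).
Local Notation S0m := (schwartz L m m).

Definition gramS : 'M[L]_(1 + m) := block_mx (up S)%:M 0 0 A0.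
Definition base_col : 'M[L]_(1 + m, 1) := col_mx 1%:M 0.
(** Coordinates on the slice x0 = e0: [a] is the row of components along e0, equal to [afun], and
    [y] collects the components in the space of [A0]. *)
Definition zeta (a : 'M[L]_(1, m)) (y : 'M[L]_m) : 'M[L]_(1 + m) :=
  row_mx base_col (col_mx a y).

Lemma gramS_herm : hermitian gramS.
Proof. by rewrite /Defs.hermitian hconj_block // !hconj0 // hconj_scalar // cj_up // hA0. Qed.

Lemma gramS_unit : gramS \in unitmx.
Proof. by rewrite unitmxE det_ublock det_scalar1 unitrM -unitmxE uA0 unitfE up_eq0 // S0. Qed.

Lemma hconj_e0 : hconj base_col = row_mx 1%:M 0.
Proof. by rewrite hconj_col_mx // hconj1 // hconj0. Qed.

Lemma qform_e0 x : lsubmx x = base_col -> qform gramS x = up S.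
Proof.
move=> x0; rewrite /qform x0 hconj_e0 mul_row_block mul_row_col.
by rewrite !(mul0mx, mulmx0, mul1mx, mulmx1, addr0, add0r) mxE eqxx.
Qed.

Lemma afun_e0 x : lsubmx x = base_col -> afun S gramS x = usubmx (rsubmx x).
Proof.
move=> x0; rewrite /afun x0 hconj_e0 mul_row_block.
rewrite !(mul0mx, mulmx0, mul1mx, mulmx1, addr0, add0r).
rewrite -{1}[rsubmx x]vsubmxK mul_row_col mul0mx addr0 mul_scalar_mx scalerA mulVf.
  by rewrite scale1r.
by rewrite up_eq0.
Qed.

Lemma lsub_zeta a y : lsubmx (zeta a y) = base_col. Proof. exact: row_mxKl. Qed.

Lemma qform_zeta a y : qform gramS (zeta a y) = up S.
Proof. by rewrite qform_e0 ?lsub_zeta. Qed.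

Lemma afun_zeta a y : afun S gramS (zeta a y) = a.
Proof. by rewrite afun_e0 ?lsub_zeta // row_mxKr col_mxKu. Qed.

Lemma zeta_um a y X : zeta a y *m uni_m X = zeta (a + X) y.
Proof.
rewrite mul_row_block !(mul0mx, mulmx0, mul1mx, mulmx1, addr0, add0r) /zeta; congr row_mx.
by rewrite mul_col_mx mul1mx mul0mx add_col_mx add0r addrC.
Qed.

Lemma cts_zeta y : cts (zeta^~ y).
Proof.
apply: (cts_row_mx hL); first exact: cts_cst.
by apply: (cts_col_mx hL); [exact: cts_id|exact: cts_cst].
Qed.

Lemma proper_zeta y : norm_proper (zeta^~ y).
Proof.
move=> B; exists B => a; rewrite /zeta mnorm_row_mx // ge_max => /andP[_].
by rewrite mnorm_col_mx // ge_max => /andP[].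
Qed.

Lemma zeta_dist a y y' : mnorm (zeta a y' - zeta a y) = mnorm (y' - y).
Proof.
rewrite /zeta opp_row_mx add_row_mx subrr opp_col_mx add_col_mx subrr.
by rewrite mnorm_row_mx // mnorm_col_mx // !(mnorm0 hL) !maxEle !mnorm_ge0.
Qed.

Definition emb0 (y : 'M[L]_m) : 'M[L]_(1 + m) := block_mx 0 0 0 y.

Lemma zeta_emb0 a y X : zeta a y + emb0 X = zeta a (y + X).
Proof.
rewrite /zeta /emb0 /base_col -!block_mxEh add_block_mx !addr0; congr block_mx.
Qed.

Lemma tr_gramS (x : 'M[L]_(1 + m)) (Y : 'M[L]_m) :
  \tr (gramS *m x *m hconj (emb0 Y)) = \tr (A0 *m dsubmx (rsubmx x) *m hconj Y).
Proof.
rewrite -{1}[x]submxK /emb0 hconj_block // !hconj0 // !mulmx_block mxtrace_block.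
block_simp; rewrite raddf0 add0r; congr (\tr (A0 *m _ *m hconj Y)).
by apply/matrixP => i j; rewrite !mxE.
Qed.

Variable I : S1m -> C.
Hypothesis hI : haar I.
Let lI : linear (I : S1m -> C^o) := let: And3 h _ _ := hI in h.

Lemma schv_Bi (Phi : SM) : @schv _ _ _ _ C^o (fun y => I (scomp (zeta^~ y) Phi)).
Proof.
have [e e00 he] := schv_unif hL (schwartz_schv Phi); split.
  move=> y; exists e => // y' hy; congr (I _); apply: schwartzP => a.
  rewrite !(scompE hL) //; try exact: cts_zeta; try exact: proper_zeta.
  by apply: he; rewrite zeta_dist.
have [B hB] := (schwartz_schv Phi).2; exists B => y nz.
have [a ha] : exists a, Phi (zeta a y) != 0.
  apply: contrapT => /forallNP h; move: nz => /eqP; apply.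
  rewrite (_ : scomp _ _ = 0) ?(lin0 lI) //; apply: schwartzP => a.
  rewrite (scompE hL); [|exact: cts_zeta|exact: proper_zeta].
  by rewrite schw0; apply/eqP; apply: contrapT => /negP; exact: h.
apply: le_trans (hB _ ha); rewrite /zeta mnorm_row_mx // mnorm_col_mx //.
by rewrite !le_max lexx !orbT.
Qed.

Definition Bi (Phi : SM) : S0m := toS (fun y => I (scomp (zeta^~ y) Phi)).

Lemma BiE Phi y : Bi Phi y = I (scomp (zeta^~ y) Phi).
Proof. by rewrite toSE //; exact: schv_Bi. Qed.

Lemma slice_linear y : linear (scomp (zeta^~ y)).
Proof. by apply: (scomp_linear hL); [exact: cts_zeta|exact: proper_zeta]. Qed.

Lemma sliceE (Phi : SM) y a : scomp (zeta^~ y) Phi a = Phi (zeta a y).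
Proof. by rewrite (scompE hL) //; [exact: cts_zeta|exact: proper_zeta]. Qed.

Lemma Bi_linear : linear Bi.
Proof.
by move=> a u v; apply: schwartzP => y; rewrite schwD schwZ !BiE slice_linear lI.
Qed.

Lemma Bi_ext (Phi Psi : SM) : (forall a y, Phi (zeta a y) = Psi (zeta a y)) -> Bi Phi = Bi Psi.
Proof.
move=> h; apply: schwartzP => y; rewrite !BiE; congr (I _); apply: schwartzP => a.
by rewrite !sliceE.
Qed.

Lemma Bi_um X Phi : Bi (rmul (uni_m X) Phi) = Bi Phi.
Proof.
have [_ inv _] := hI; apply: schwartzP => y; rewrite !BiE -[RHS](inv X); congr (I _).
by apply: schwartzP => a; rewrite sshiftE // !sliceE rmulE ?uni_m_unit // zeta_um.
Qed.

Lemma Bi_heis X Y Phi : Bi (sheis gramS (emb0 X) (emb0 Y) Phi) = sheis A0 X Y (Bi Phi).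
Proof.
apply: schwartzP => y; rewrite sheisE // !BiE.
set c := psiE _ * psiE _; rewrite -[RHS]/(c *: (I _ : C^o)) -(linZ lI); congr (I _).
apply: schwartzP => a; rewrite schwZ !sliceE sheisE // zeta_emb0 !tr_gramS.
by rewrite /emb0 block_mxEh !row_mxKr !col_mxKd.
Qed.

End Slices.

Section LinearSupport.
Context {R : realType} {K : vfield R} (hK : local_field K).
Local Notation C := R[i].

(** The one-variable companion of [multiplier_vanish]: small indicators near [x] are eigenvectors of
    an invariant multiplier with eigenvalue other than 1. *)
Lemma linear_support r k (P : lmodType C) (T : schwartz K r k -> P)
    (Z : set 'M[K]_(r, k)) : linear T ->
  (forall x, ~ Z x -> exists m : 'M[K]_(r, k) -> C,
     [/\ locally_const m, m x != 1 & forall Phi, T (smul m Phi) = T Phi]) ->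
  forall Phi : schwartz K r k, (forall x, Z x -> Phi x = 0) -> T Phi = 0.
Proof.
move=> lT hZ Phi h0; apply: (linear_local hK lT) => x Px.
have [|m [hm mx inv]] := hZ x; first by move=> /h0 /eqP; rewrite (negPf Px).
have [e e0 he] := hm x; exists e => // y hy s s0 se.
have b1 : smul m (sbump y s) = m x *: sbump y s.
  apply: schwartzP => z; rewrite (smulE hK) // schwZ (sbumpE hK) //.
  case: ltP => [hz|]; last by rewrite !mulr0.
  by rewrite he //; apply: (mnorm_trans hK (y := y)) => //; exact: lt_le_trans hz se.
have := inv (sbump y s); rewrite b1 (linZ lT); set v := T _ => h.
apply/eqP; apply: contraNT mx => v0.
apply/eqP; move/eqP: h; rewrite -subr_eq0 -{2}[v]scale1r -scalerBl scaler_eq0.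
by rewrite (negPf v0) orbF subr_eq0 => /eqP.
Qed.

End LinearSupport.

Section Equivariance.
Context {R : realType} (D : local_ext R).
Local Notation C := R[i].
Local Notation K := (lbase D).
Local Notation L := (ltop D).
Local Notation up := (@lup R D).
Local Notation cj := (@lconj R D).
Local Notation hermitian := (@Defs.hermitian R D _).
Hypothesis hD : quad_ext D.
Let hL := qe_local hD.
Hypothesis hpsi : good_char D.
Local Notation psiE := (@psiE R D).

Context {m : nat} (S : K) (A0 : 'M[L]_m) (chi lambda1 lambda0 : L -> C).
Hypotheses (m0 : (0 < m)%N) (S0 : S != 0) (hA0 : hermitian A0) (uA0 : A0 \in unitmx)
  (chiM : forall x y, x != 0 -> y != 0 -> chi (x * y) = chi x * chi y)
  (chi_unit : forall x, x != 0 -> `|chi x| = 1)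
  (chi_norm : forall x, x != 0 -> chi (x * cj x) = 1)
  (lambdaE : forall x, x != 0 -> lambda1 x * (chi x)^* = lambda0 x).
Local Notation S1m := (schwartz L 1 m).
Local Notation SM := (schwartz L (1 + m) (1 + m)).
Local Notation S0m := (schwartz L m m).
Local Notation A := (gramS S A0).
Local Notation mat := 'M[L]_((1 + m) + (1 + m)).
Variable om : mat -> S1m -> S1m.
Hypothesis hom : fj_weil_rep S chi om.
Variable Om : mat -> SM -> SM.
Hypothesis hOm : weil_rep A lambda1 Om.
Variable Om0 : 'M[L]_(m + m) -> S0m -> S0m.
Hypothesis hOm0 : weil_rep A0 lambda0 Om0.
Let hI := fj_haar_haar hD hpsi hom.
Let hA : hermitian A := gramS_herm hD S hA0.
Let uA : A \in unitmx := gramS_unit hD S0 uA0.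
Local Notation I := (fj_haar om).
Local Notation omc := (conj_act om).
Local Notation af := (afun S A).
Local Notation e0 := (@base_col R D m).

Let lc_af (phi : S1m) : locally_const (phi \o af).
Proof. by apply: (lc_comp hL (schwartz_schv phi).1); exact: cts_afun. Qed.

Lemma smul_af (phi : S1m) (Phi : SM) x : smul (phi \o af) Phi x = Phi x * phi (af x).
Proof. by rewrite (smulE hL) // mulrC. Qed.

Definition pairB (Phi : SM) (phi : S1m) : S0m := Bi I (smul (phi \o af) Phi).

Lemma pairB_l phi : linear (pairB^~ phi).
Proof.
by move=> a u v; rewrite /pairB (smul_linear hL (lc_af phi)) (Bi_linear hD hI).
Qed.

Lemma pairB_r Phi : linear (pairB Phi).
Proof.
move=> a u v; rewrite /pairB -(Bi_linear hD hI); congr (Bi _ _); apply: schwartzP => x.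
by rewrite schwD schwZ !smul_af schwD schwZ mulrDr mulrCA.
Qed.

Lemma pairB_u X Y t Phi phi :
  pairB (Om (umx X Y t) Phi) (omc (umx X Y t) phi) = pairB Phi phi.
Proof.
rewrite /pairB -[RHS](Bi_um hD hI X); apply: (Bi_ext hD hI) => a y.
rewrite smul_af (umx_act hD hpsi S0 hom hA hOm) ?qform_zeta //.
by rewrite rmulE ?uni_m_unit // smul_af zeta_um !afun_zeta.
Qed.

Lemma pairB_heis X Y Phi phi :
  pairB (sheis A (emb0 X) (emb0 Y) Phi) phi = sheis A0 X Y (pairB Phi phi).
Proof.
rewrite /pairB -(Bi_heis hD hpsi S A0 hI); apply: (Bi_ext hD hI) => a y.
by rewrite smul_af !sheisE // smul_af zeta_emb0 !afun_zeta // mulrA.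
Qed.

Lemma pairB_col Y0 Phi phi : pairB (sheis A 0 (row_mx Y0 0) Phi) phi =
  psiE (\tr (A *m e0 *m hconj Y0)) *: pairB Phi phi.
Proof.
rewrite /pairB -(linZ (Bi_linear hD hI)); apply: (Bi_ext hD hI) => a y.
rewrite schwZ !smul_af sheis_r // mulrA; congr (psiE _ * _ * _).
rewrite hconj_row_mx // hconj0 // -mulmxA mul_row_col mulmx0 addr0.
by rewrite mulmxA.
Qed.

Lemma emb_heis (g : 'M[L]_(m + m)) (X Y X' Y' : 'M[L]_m) : row_mx X' Y' = row_mx X Y *m g ->
  row_mx (emb0 X') (emb0 Y') = row_mx (emb0 X) (emb0 Y) *m emb_mx g.
Proof.
rewrite -{1}[g]submxK mul_row_block => /eq_row_mx[-> ->].
by rewrite /emb_mx mul_row_block /emb0; block_simp.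
Qed.

Lemma emb_col (g : 'M[L]_(m + m)) (Y0 : 'M[L]_(1 + m, 1)) :
  row_mx 0 (row_mx Y0 0) *m emb_mx g = row_mx 0 (row_mx Y0 0).
Proof.
rewrite /emb_mx mul_row_block !mul_row_block.
by block_simp; rewrite row_mx0.
Qed.

Section Twisted.
Variable g : 'M[L]_(m + m).
Hypothesis hg : Ugrp D m g.
Let Eg : Ugrp D (1 + m) (emb_mx g) := Ugrp_emb hD hg.
Let Jg : jacobi_group D m (emb_mx g) := emb_jacobi hD hg.
Let hg' : Ugrp D m (invmx g) := Ugrp_inv hD hg.

(** The pairing conjugated by [g]: equivariance at [g] amounts to [pairBg] and [pairB] being
    equal. *)
Definition pairBg (Phi : SM) (phi : S1m) : S0m :=
  Om0 (invmx g) (pairB (Om (emb_mx g) Phi) (omc (emb_mx g) phi)).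

Lemma pairBg_l phi : linear (pairBg^~ phi).
Proof.
move=> a u v; rewrite /pairBg (weil_linear hOm Eg) pairB_l.
exact: (weil_linear hOm0 hg').
Qed.

Lemma pairBg_r Phi : linear (pairBg Phi).
Proof.
move=> a u v; rewrite /pairBg (omc_linear hom Jg) pairB_r.
exact: (weil_linear hOm0 hg').
Qed.

Lemma pairBg_u X Y t Phi phi :
  pairBg (Om (umx X Y t) Phi) (omc (umx X Y t) phi) = pairBg Phi phi.
Proof.
rewrite /pairBg; congr (Om0 _ _).
pose XY := row_mx X Y *m invmx g; pose X1 := lsubmx XY; pose Y1 := rsubmx XY.
have XYE : row_mx X Y = row_mx X1 Y1 *m g.
  by rewrite hsubmxK /XY mulmxKV // Ugrp_unit.
have [t' ht' _] := emb_umx hD 0 hg XYE.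
have [t1 ht1 comm] := emb_umx hD (t - t') hg XYE.
have tt : t1 = t.
  apply: (up_inj hD); move: ht1 ht'; rewrite (upD hD) (upN hD) (up0 hD) => ht1 ht'.
  have /matrixP /(_ 0 0) : (up t1)%:M = (up t)%:M :> 'M[L]_1.
    apply: (@addIr _ (X *m hconj Y)); rewrite ht1 raddfB /= -addrA; congr (_ + _).
    rewrite raddf0 add0r in ht'.
    by rewrite -ht' addrA addNr add0r.
  by rewrite !mxE eqxx !mulr1n.
have UX := Ugrp_umx hD; have JX := @umx_jacobi _ D hD m.
rewrite -(weilM hOm _ Eg (UX _ X Y t)) -(omcM hom _ Jg (JX X Y t)) -tt -comm.
by rewrite (weilM hOm _ (UX _ _ _ _) Eg) (omcM hom _ (JX _ _ _) Jg) pairB_u.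
Qed.

Lemma pairBg_heis X Y Phi phi :
  pairBg (sheis A (emb0 X) (emb0 Y) Phi) phi = sheis A0 X Y (pairBg Phi phi).
Proof.
rewrite /pairBg; pose XY := row_mx X Y *m invmx g.
have XYE : row_mx X Y = row_mx (lsubmx XY) (rsubmx XY) *m g.
  by rewrite hsubmxK /XY mulmxKV // Ugrp_unit.
rewrite (weil_heis hD hpsi hOm Phi Eg (emb_heis XYE)) pairB_heis.
by rewrite (weil_heis hD hpsi hOm0 _ hg' (X := X) (Y := Y)) // hsubmxK.
Qed.

Lemma pairBg_col Y0 Phi phi : pairBg (sheis A 0 (row_mx Y0 0) Phi) phi =
  psiE (\tr (A *m e0 *m hconj Y0)) *: pairBg Phi phi.
Proof.
rewrite /pairBg (weil_heis hD hpsi hOm Phi Eg (esym (emb_col g Y0))) pairB_col.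
by rewrite (linZ (weil_linear hOm0 hg')).
Qed.

(** [pairBg] keeps the U-invariance and both Heisenberg relations of [pairB]. Its value at y = 0 is
    therefore a distribution supported on x0 = e0, y = 0, where only the row [a] is free, and
    invariance in [a] makes it a multiple of [I]. *)
Lemma pairBg_scalar : exists c : C, forall Phi phi, pairBg Phi phi = c *: pairB Phi phi.
Proof.
pose beta (Phi : SM) (phi : S1m) : C^o := pairBg Phi phi 0.
have bl phi : linear (beta^~ phi) by move=> a u v; rewrite /beta pairBg_l schwD schwZ.
have br Phi : linear (beta Phi) by move=> a u v; rewrite /beta pairBg_r schwD schwZ.
have binv X Y t Phi phi : beta (Om (umx X Y t) Phi) (omc (umx X Y t) phi) = beta Phi phi.
  by rewrite /beta pairBg_u.
have [T [lT TE supT Tum TB]] := U_reduction hD hpsi S0 hom hA hOm bl br binv.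
(* The first condition is forced by Heisenberg elements whose second entry lives in the first
   column, the second one by those in the image of [emb0]: both kinds act by multipliers and change
   [beta] by known scalars. *)
pose Z : set 'M[L]_(1 + m) := [set x | lsubmx x = e0 /\ dsubmx (rsubmx x) = 0].
have Tmul (mm : 'M[L]_(1 + m) -> C) : (forall Phi phi, beta (smul mm Phi) phi = beta Phi phi) ->
    forall Phi, T (smul mm Phi) = T Phi.
  move=> h Phi; have [B1 B10 h1] := TB Phi; have [B2 B20 h2] := TB (smul mm Phi).
  rewrite (h1 (Num.max B1 B2)) ?le_max ?lexx //.
  by rewrite (h2 (Num.max B1 B2)) ?le_max ?lexx ?orbT.
have suppZ (Phi : SM) : (forall x, Z x -> Phi x = 0) -> T Phi = 0.
  apply: (linear_support hL lT) => x nZ.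
  have [x0|x0] := eqVneq (lsubmx x) e0; last first.
    have An : A *m (lsubmx x - e0) != 0.
      apply: contra_neq x0 => h; apply/eqP; rewrite -subr_eq0; apply/eqP.
      by rewrite -[LHS](mulKmx uA) h mulmx0.
    have [z hz] := psiE_trace_nd hD hpsi An.
    pose Y0 := hconj z; pose w := psiE (- \tr (A *m e0 *m hconj Y0)).
    pose mm (x : 'M[L]_(1 + m)) := psiE (\tr (A *m x *m hconj (row_mx Y0 0))) * w.
    have mlc : locally_const mm by exact: (lc_post hL (fun c => c * _) (lc_trace hD hpsi _ _)).
    have trc (u : 'M[L]_(1 + m)) : \tr (A *m u *m hconj (row_mx Y0 0)) =
        \tr (A *m lsubmx u *m hconj Y0).
      rewrite hconj_row_mx // hconj0 // -{1}[u]hsubmxK mul_mx_row mul_row_col.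
      by rewrite mulmx0 addr0.
    exists mm; split=> //.
      rewrite /mm /w trc -psiED // -raddfN -raddfD /= -mulNmx -mulmxDl -mulmxN -mulmxDr.
      by rewrite /Y0 hconjK.
    apply: Tmul => Psi phi.
    have -> : smul mm Psi = w *: sheis A 0 (row_mx Y0 0) Psi.
      by apply: schwartzP => u; rewrite (smulE hL) // schwZ sheis_r // /mm mulrAC mulrC.
    rewrite (linZ (bl phi)) /beta pairBg_col schwZ [w *: _]mulrA /w -psiED // addNr.
    by rewrite psiE0 // mul1r.
  have y0 : A0 *m dsubmx (rsubmx x) != 0.
    apply/eqP => h; apply: nZ; split=> //.
    by rewrite -[LHS](mulKmx uA0) h mulmx0.
  have [z hz] := psiE_trace_nd hD hpsi y0; pose Y := hconj z.
  pose mm (x : 'M[L]_(1 + m)) := psiE (\tr (A *m x *m hconj (emb0 Y))).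
  have mlc : locally_const mm by exact: (lc_trace hD hpsi _ _).
  exists mm; split=> //; first by rewrite /mm tr_gramS // /Y hconjK.
  apply: Tmul => Psi phi.
  have -> : smul mm Psi = sheis A (emb0 0) (emb0 Y) Psi.
    apply: schwartzP => u; rewrite (smulE hL) //.
    by rewrite (_ : emb0 0 = 0) ?sheis_r // /emb0 block_mx0.
  rewrite /beta pairBg_heis sheis_r // mulmx0 mul0mx raddf0 psiE0 // mul1r.
  by [].
have ZE x : Z x -> x = zeta (usubmx (rsubmx x)) 0.
  by case=> x0 y0; rewrite /zeta -x0 -y0 vsubmxK hsubmxK.
pose lift (phi : S1m) : SM := rtens (sbump e0 1) (ctens phi (sbump 0 1)).
have liftE phi a : lift phi (zeta a 0) = phi a.
  rewrite rtensE // lsub_zeta sbump_center // mul1r ctensE // row_mxKr col_mxKu col_mxKd.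
  by rewrite sbump_center // mulr1.
have lift_lin : linear lift.
  move=> a u v; apply: schwartzP => x; rewrite schwD schwZ !rtensE // !ctensE //.
  by rewrite schwD schwZ mulrDl mulrDr -mulrA mulrCA.
have lTl : linear (fun phi => T (lift phi)) by move=> a u v; rewrite lift_lin lT.
have Tl_inv a (phi : S1m) : T (lift (sshift a phi)) = T (lift phi).
  rewrite -[RHS](Tum a); apply/eqP; rewrite -subr_eq0 -(linB lT); apply/eqP/suppZ => x Zx.
  rewrite (ZE x Zx) schwD schwN rmulE ?uni_m_unit // zeta_um !liftE sshiftE // subrr //.
have b0 : I (sbump 0 1) != 0 by exact: haar_bump_neq0.
pose c := T (lift (sbump 0 1)) / I (sbump 0 1).
have main (Phi : SM) (phi : S1m) : beta Phi phi = c * pairB Phi phi 0.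
  rewrite TE /pairB BiE //; set Psi := smul _ _.
  have -> : T Psi = T (lift (scomp (fun a : 'M[L]_(1, m) => zeta a (0 : 'M[L]_m)) Psi)).
    apply/eqP; rewrite -subr_eq0 -(linB lT); apply/eqP/suppZ => x Zx.
    by rewrite (ZE x Zx) schwD schwN liftE sliceE // subrr.
  have h := haar_unique hL hI lTl Tl_inv (scomp (fun a : 'M[L]_(1, m) => zeta a (0 : 'M[L]_m)) Psi) (sbump 0 1).
  apply: (mulfI b0); rewrite [LHS]h /c mulrA [X in X * _]mulrC divfK //; exact: mulrC.
exists c => Phi phi; apply: schwartzP => y; rewrite schwZ.
(* So far only the value at 0 is known; a Heisenberg translation, with which both pairings are
   compatible, moves [y] to 0. *)
have e (Psi : S0m) : Psi y = sheis A0 y 0 Psi 0 by rewrite sheis_l // sshiftE // add0r.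
rewrite e [pairB _ _ _]e -pairBg_heis -pairB_heis; exact: main.
Qed.

End Twisted.

Lemma pairB_neq0 : exists Phi phi, pairB Phi phi != 0.
Proof.
exists (sbump (zeta 0 0) 1), (sbump 0 1).
have b0 : I (sbump 0 1) != 0 by exact: haar_bump_neq0.
apply: contra_neq b0 => h; have : pairB (sbump (zeta 0 0) 1) (sbump 0 1) 0 = 0 by rewrite h.
rewrite /pairB BiE // => <-; congr (I _); apply: schwartzP => a.
rewrite sliceE // smul_af afun_zeta // !sbumpE //.
have -> : zeta a 0 - zeta 0 0 = row_mx 0 (col_mx a 0) :> 'M[L]_(1 + m).
  rewrite /zeta opp_row_mx add_row_mx opp_col_mx add_col_mx !subrr; congr (row_mx _ _).
    by rewrite col_mx0.
  by rewrite opp_col_mx add_col_mx !subrr subr0.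
rewrite mnorm_row_mx // mnorm_col_mx // !mnorm0 // subr0.
by rewrite (max_l (mnorm_ge0 _)) (max_r (mnorm_ge0 _)) -natrM mulnb andbb.
Qed.

Lemma emb_siegel_m (B : 'M[L]_m) : B \in unitmx ->
  emb_mx (siegel_m B) = siegel_m (block_mx 1%:M 0 0 B : 'M[L]_(1 + m)).
Proof.
move=> uB; have uhB : hconj B \in unitmx by rewrite unitmx_hconj.
set P : 'M[L]_(1 + m) := block_mx _ _ _ _.
have uP : P \in unitmx by rewrite unitmxE det_ublock det1 mul1r -unitmxE.
have hP : hconj P = block_mx 1%:M 0 0 (hconj B) by rewrite hconj_block // hconj1 // !hconj0.
have uhP : hconj P \in unitmx by rewrite unitmx_hconj.
rewrite /emb_mx /siegel_m block_mxKul block_mxKur block_mxKdl block_mxKdr !block_mx0.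
congr block_mx; apply: (can_inj (mulKmx uhP)); rewrite mulmxV // hP mulmx_block.
by block_simp; rewrite mulmxV // -scalar_mx_block.
Qed.

(** Powers of s = |det B|^(1/2): m + 1 from [Om], 1 from the conjugate of [om] and -2 from the
    substitution a -> a B, which leaves m as required for [Om0]. The characters combine by
    [lambdaE]. *)
Let EQm (B : 'M[L]_m) : B \in unitmx -> forall Phi phi,
  pairB (Om (emb_mx (siegel_m B)) Phi) (omc (emb_mx (siegel_m B)) phi) =
  Om0 (siegel_m B) (pairB Phi phi).
Proof.
move=> uB Phi phi; have d0 : \det B != 0 by rewrite -unitfE -unitmxE.
set P : 'M[L]_(1 + m) := block_mx 1%:M 0 0 B.
have dP : \det P = \det B by rewrite det_ublock det1 mul1r.
have uP : P \in unitmx by rewrite unitmxE dP -unitmxE.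
apply: schwartzP => y; rewrite (weil_m hOm0) // !BiE //.
set f := scomp _ (smul (phi \o af) Phi).
have fE a : f a = Phi (zeta a (y *m B)) * phi a by rewrite sliceE // smul_af afun_zeta.
rewrite -(fj_haar_mod hD m0 chiM chi_unit chi_norm hom f uB) -lambdaE //.
set s := (Num.sqrt _)%:C; have -> : (Num.sqrt (nabs (\det B)) ^+ m)%:C = s ^+ m by rewrite rmorphXn.
rewrite -[RHS]mulrA [X in _ * X]mulrA -exprD mulrA.
have [lI _ _] := hI.
set c := _ * s ^+ _; rewrite -[RHS]/(c *: (I _ : C^o)) -(linZ lI); congr (I _).
apply: schwartzP => a; rewrite schwZ rmulE // fE sliceE // smul_af.
rewrite (omc_m hom) // afun_zeta // (emb_siegel_m uB) -/P (weil_m hOm) // dP.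
have -> : zeta a y *m P = zeta (a *m B) (y *m B).
  rewrite /zeta /P mul_row_block !(mul0mx, mulmx0, mul1mx, mulmx1, addr0, add0r).
  by rewrite mul_col_mx.
rewrite rmorphXn /= -/s /c addn2 (exprD s 1 m) expr1 !exprS; ring.
Qed.

Let qs g (c : C) := forall Phi phi,
  pairB (Om (emb_mx g) Phi) (omc (emb_mx g) phi) = c *: Om0 g (pairB Phi phi).

Let qs_ex g : Ugrp D m g -> exists c : C, qs g c.
Proof.
move=> hg; have [c hc] := pairBg_scalar hg; exists c => Phi phi.
by rewrite -(linZ (weil_linear hOm0 hg)) -hc /pairBg (weilVK hD hOm0).
Qed.

Let qsM g h c d : Ugrp D m g -> Ugrp D m h -> qs g c -> qs h d ->
  qs (g *m h) (c * d).
Proof.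
move=> hg hh Eg Eh Phi phi; rewrite (emb_mxM g h) (weilM hOm) ?(omcM hom); do ?exact: Ugrp_emb; do ?exact: emb_jacobi.
by rewrite Eg Eh (weilM hOm0) // (linZ (weil_linear hOm0 hg)) scalerA.
Qed.

Let qs_inj g c d : Ugrp D m g -> qs g c -> qs g d -> c = d.
Proof.
move=> hg h1 h2; have [Phi [phi /eqP nz]] := pairB_neq0.
apply/eqP; rewrite -subr_eq0; apply: contrapT => /negP cd; apply: nz.
have h : (c - d) *: Om0 g (pairB Phi phi) = 0 by rewrite scalerBl -h1 -h2 subrr.
rewrite -(weilK hD hOm0 (pairB Phi phi) hg); move/eqP: h; rewrite scaler_eq0 (negPf cd) => /eqP ->.
exact: (lin0 (weil_linear hOm0 (Ugrp_inv hD hg))).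
Qed.

Let qs_neq0 g c : Ugrp D m g -> qs g c -> c != 0.
Proof.
move=> hg hc; have hg' := Ugrp_inv hD hg; have [d hd] := qs_ex hg'.
have := qsM hg hg' hc hd; rewrite mulmxV ?Ugrp_unit // => h1.
have h2 : qs 1%:M 1.
  move=> Phi phi; rewrite (_ : emb_mx 1%:M = 1%:M) ?emb_mx1 // (weil1 hOm) scale1r (weil1 hOm0).
  by rewrite /conj_act (fj1 hom) sconjK.
have /eqP := qs_inj (Ugrp1 hD) h1 h2.
by apply: contraL => /eqP ->; rewrite mul0r eq_sym oner_eq0.
Qed.

Let qs_m (B : 'M[L]_m) : B \in unitmx -> qs (siegel_m B) 1.
Proof. by move=> uB Phi phi; rewrite EQm // scale1r. Qed.

(* The scalar of [n(Z)] is 1 because [m(2) n(Z/3) m(2)^-1 = n(4Z/3) = n(Z) n(Z/3)] *)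
Let qs_n (Z : 'M[L]_m) : hermitian Z -> qs (siegel_n Z) 1.
Proof.
move=> hZ; pose W : 'M[L]_m := 3%:R^-1 *: Z; pose B : 'M[L]_m := 2%:R%:M.
have c3 : 3%:R != 0 :> L by exact: (lchar0 hL).
have c2 : 2%:R != 0 :> L by exact: (lchar0 hL).
have hW : hermitian W.
  by rewrite /Defs.hermitian /W hconjZ // cjV // cj_nat // hZ.
have uB : B \in unitmx by rewrite unitmxE det_scalar unitfE expf_neq0.
have UW := Ugrp_siegel_n hD hW; have UZ := Ugrp_siegel_n hD hZ.
have UB := Ugrp_siegel_m hD uB.
have BW : B *m W *m hconj B = Z + W.
  rewrite hconj_scalar // cj_nat // mul_scalar_mx mul_mx_scalar scalerA.
  have -> : Z = 3%:R *: W by rewrite /W scalerA mulfV // scale1r.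
  by rewrite -[in RHS](scale1r W) [in RHS]scalerA mulr1 -scalerDl; congr (_ *: _); ring.
have comm := siegel_conj hD W uB; rewrite BW siegel_nD in comm.
have [c hc] := qs_ex UW; have [d hd] := qs_ex UZ.
have h1 := qsM UB UW (qs_m uB) hc.
have UZW := UgrpM hD UZ UW.
have h2 := qsM UZW UB (qsM UZ UW hd hc) (qs_m uB); rewrite -comm in h2.
have := qs_inj (UgrpM hD UB UW) h1 h2; rewrite mul1r mulr1 => h.
suff <- : d = 1 by [].
by apply: (mulIf (qs_neq0 UW hc)); rewrite mul1r -h.
Qed.

(* By the braid relation [J n(-1) J = n(1) J n(1)] the scalar of [J] is idempotent *)
Let qs_J : qs (Jmx D m) 1.
Proof.
have UJ : Ugrp D m (Jmx D m) := Ugrp_J hD; have [c hc] := qs_ex UJ.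
have h1 : hermitian (1%:M : 'M[L]_m) by exact: hermitian1.
have hm1 : hermitian (- 1%:M : 'M[L]_m) by rewrite /Defs.hermitian hconjN // h1.
have Un := Ugrp_siegel_n hD h1; have Unm := Ugrp_siegel_n hD hm1.
have e1 := qsM (UgrpM hD UJ Unm) UJ (qsM UJ Unm hc (qs_n hm1)) hc.
have e2 := qsM (UgrpM hD Un UJ) Un (qsM Un UJ (qs_n h1) hc) (qs_n h1).
rewrite -Jmx_siegel_braid in e2.
have := qs_inj (UgrpM hD (UgrpM hD UJ Unm) UJ) e1 e2; rewrite !mulr1 mul1r => h.
suff <- : c = 1 by [].
by apply: (mulIf (qs_neq0 UJ hc)); rewrite mul1r.
Qed.

Theorem pairB_equiv g Phi phi : Ugrp D m g ->
  pairB (Om (emb_mx g) Phi) (omc (emb_mx g) phi) = Om0 g (pairB Phi phi).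
Proof.
move=> hg; suff h : qs g 1 by rewrite h scale1r.
apply: (Ugrp_generated hD (E := qs^~ 1)) hg => // x y hx hy h1 h2.
by rewrite -[1]mulr1; exact: qsM.
Qed.

End Equivariance.

(** * Orbits of U(V) on the hyperboloid q = S *)

Section NearIdentity.
Context {R : realType} {K : vfield R} (hK : local_field K).
Implicit Types (n r k : nat).

Lemma near1_isometry n k (h : 'M[K]_n) (y : 'M[K]_(n, k)) :
  mnorm (h - 1%:M) < 1 -> mnorm (h *m y) = mnorm y.
Proof.
move=> h1; have [y0|/eqP y0] := eqVneq (mnorm y) 0.
  by rewrite (mnorm_eq0 hK y0) mulmx0.
apply: (mnorm_near_eq hK); rewrite -[X in _ - X]mul1mx -mulmxBl.
apply: le_lt_trans (mnormM hK _ _) _; rewrite -[X in _ < X]mul1r ltr_pM2r //.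
by rewrite lt0r mnorm_ge0 andbT; apply/eqP.
Qed.

Lemma near1_inv n (h : 'M[K]_n) : h \in unitmx -> mnorm (h - 1%:M) < 1 ->
  mnorm (invmx h - 1%:M) = mnorm (h - 1%:M).
Proof.
move=> uh h1; rewrite -(near1_isometry _ h1) mulmxBr mulmxV // mulmx1.
exact: mnormC.
Qed.

Lemma near1_mul n (g h : 'M[K]_n) (e : R) : e <= 1 ->
  mnorm (g - 1%:M) < e -> mnorm (h - 1%:M) < e -> mnorm (g *m h - 1%:M) < e.
Proof.
move=> e1 hg hh; rewrite -[g *m h](subrK g) -addrA -[X in _ - X + _]mulmx1 -mulmxBr.
apply: (mnormD_lt hK) => //; rewrite near1_isometry //; exact: lt_le_trans hg e1.
Qed.

(** Term by term in the Leibniz expansion: products of integral entries that are congruent modulo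
    [e] stay congruent. *)
Lemma det_near1 n (h : 'M[K]_n) (e : R) : 0 < e -> e <= 1 ->
  mnorm (h - 1%:M) < e -> vabs (\det h - 1) < e.
Proof.
move=> e0 e1 hh; rewrite -(det1 K n) /determinant -sumrB.
have h1 : mnorm h <= 1.
  rewrite -[h](subrK 1%:M); apply: le_trans (mnormD hK _ _) _.
  by rewrite ge_max (mnorm1 hK) andbT (le_trans (ltW hh)).
apply: (big_ind (fun x => vabs x < e)) => [|x y hx hy|s _]; first by rewrite (abs0 hK).
  by apply: le_lt_trans (labsD hK _ _) _; rewrite gt_max hx.
rewrite -mulrBr (labsM hK) (absX hK) (absN hK) (abs1 hK) expr1n mul1r.
pose P (x y : K) := [/\ vabs x <= 1, vabs y <= 1 & vabs (x - y) < e].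
have [] // : P (\prod_i h i (perm.fun_of_perm s i)) (\prod_i (1%:M : 'M[K]_n) i (perm.fun_of_perm s i)).
apply: (big_ind2 P) => [|x x' y y' [a1 a2 a3] [b1 b2 b3]|i _].
- by rewrite /P subrr (abs0 hK) (abs1 hK) lexx.
- split; first by rewrite (labsM hK) mulr_ile1 // labs_ge0.
    by rewrite (labsM hK) mulr_ile1 // labs_ge0.
  have -> : x * y - x' * y' = x * (y - y') + (x - x') * y' by ring.
  apply: le_lt_trans (labsD hK _ _) _; rewrite gt_max !(labsM hK); apply/andP; split.
    by apply: le_lt_trans b3; rewrite ler_piMl // labs_ge0.
  by apply: le_lt_trans a3; rewrite ler_piMr // labs_ge0.
split; [exact: le_trans (mnorm_entry _ _ _) h1|exact: le_trans (mnorm_entry _ _ _) (mnorm1 hK _)|].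
have := le_lt_trans (mnorm_entry (h - 1%:M) i (perm.fun_of_perm s i)) hh.
by rewrite !mxE.
Qed.

End NearIdentity.

Section Orbits.
Context {R : realType} (D : local_ext R).
Local Notation C := R[i].
Local Notation L := (ltop D).
Local Notation cj := (@lconj R D).
Local Notation hermitian := (@Defs.hermitian R D _).
Hypothesis hD : quad_ext D.
Let hL := qe_local hD.

Section Group.
Context {n : nat} (A : 'M[L]_n).
Hypotheses (hA : hermitian A) (uA : A \in unitmx).

Lemma VgrpP h : hconj h *m A *m h = A -> Vgrp A h.
Proof.
move=> hh; split=> //; move: uA; rewrite -{1}hh !unitmxE det_mulmx unitrM.
by case/andP.
Qed.

Lemma VgrpM g h : Vgrp A g -> Vgrp A h -> Vgrp A (g *m h).
Proof.
move=> [ug hg] [uh hh]; split; first by rewrite unitmx_mul ug.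
by rewrite hconjM // !mulmxA -[_ *m hconj g *m A]mulmxA -(mulmxA (hconj h)) hg.
Qed.

Lemma Vgrp1 : Vgrp A 1%:M.
Proof. by split; rewrite ?unitmx1 // hconj1 // mul1mx mulmx1. Qed.

Lemma VgrpN h : Vgrp A h -> Vgrp A (- h).
Proof.
by move=> [uh hh]; apply: VgrpP; rewrite hconjN // !mulNmx mulmxN opprK.
Qed.

Lemma Vgrp_det h : Vgrp A h -> \det h * cj (\det h) = 1.
Proof.
move=> [uh hh]; have dA : \det A != 0 by rewrite -unitfE -unitmxE.
apply: (mulIf dA); rewrite mul1r -[in RHS]hh !det_mulmx det_hconj //; ring.
Qed.

Definition hprod (x y : 'M[L]_(n, 1)) : L := (hconj x *m A *m y) 0 0.

Lemma hprodE x y : hconj x *m A *m y = (hprod x y)%:M.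
Proof. exact: mx11_scalar. Qed.

Lemma hprod_cj x y : cj (hprod x y) = hprod y x.
Proof.
have -> : cj (hprod x y) = (hconj (hconj x *m A *m y)) 0 0 by rewrite [RHS]mxE [in RHS]mxE.
by rewrite !hconjM // hconjK // hA mulmxA.
Qed.

Lemma hprodDl x y z : hprod (x + y) z = hprod x z + hprod y z.
Proof. by rewrite /hprod hconjD // !mulmxDl [LHS]mxE. Qed.

Lemma hprodDr x y z : hprod z (x + y) = hprod z x + hprod z y.
Proof. by rewrite /hprod mulmxDr [LHS]mxE. Qed.

Lemma hprodNl x z : hprod (- x) z = - hprod x z.
Proof. by rewrite /hprod hconjN // !mulNmx [LHS]mxE. Qed.

Lemma hprodNr x z : hprod z (- x) = - hprod z x.
Proof. by rewrite /hprod mulmxN [LHS]mxE. Qed.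

Lemma hprodV h x y : Vgrp A h -> hprod (h *m x) (h *m y) = hprod x y.
Proof.
by move=> [_ hh]; rewrite /hprod hconjM // -[in RHS]hh !mulmxA.
Qed.

(** The unitary quasi-reflection along [z]; over a quadratic extension the parameter [c] is
    constrained only through its trace. *)
Definition qrefl (z : 'M[L]_(n, 1)) (c : L) : 'M[L]_n :=
  1%:M + c^-1 *: (z *m hconj z *m A).

Lemma qrefl_Vgrp z c : c != 0 -> c + cj c = - hprod z z -> Vgrp A (qrefl z c).
Proof.
move=> c0 hc; have cc0 : cj c != 0 by rewrite cj_eq0.
apply: VgrpP; rewrite /qrefl hconjD // hconj1 // hconjZ // !hconjM // hconjK // hA cjV //.
pose W := A *m z *m hconj z *m A.
have e1 : A *m (z *m hconj z) *m A = W by rewrite mulmxA.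
have e2 : A *m (z *m hconj z *m A) = W by rewrite !mulmxA.
have e3 : W *m (z *m hconj z *m A) = hprod z z *: W.
  rewrite /W !mulmxA -(mulmxA (A *m z) (hconj z) A) -(mulmxA (A *m z) (hconj z *m A) z).
  by rewrite hprodE mul_mx_scalar -!scalemxAl !mulmxA.
rewrite mulmxDl mul1mx -scalemxAl e1 mulmxDr mulmx1 -scalemxAr mulmxDl e2 -scalemxAl e3.
rewrite !scalerDr !scalerA addrA -[RHS]addr0 -!addrA; congr (_ + _).
rewrite -!scalerDl; apply/eqP; rewrite scaler_eq0; apply/orP; left; apply/eqP.
have -> : hprod z z = - (c + cj c) by rewrite hc opprK.
by field; apply/andP.
Qed.

Lemma qrefl_move x x' : hprod x' x' = hprod x x -> hprod (x' - x) x != 0 ->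
  Vgrp A (qrefl (x' - x) (hprod (x' - x) x)) /\
  qrefl (x' - x) (hprod (x' - x) x) *m x = x'.
Proof.
move=> xx c0; split.
  apply: qrefl_Vgrp => //; rewrite hprod_cj !(hprodDl, hprodDr, hprodNl, hprodNr) xx.
  ring.
rewrite /qrefl mulmxDl mul1mx -scalemxAl -!mulmxA (mulmxA (hconj _)) hprodE.
by rewrite mul_mx_scalar scalerA mulVf // scale1r addrC subrK.
Qed.

(** If <x' - x, x> = 0, the reflection carrying x to x' is not defined; but then <-x' - x, x> = -2
    q(x) is nonzero, and the negative of the reflection carrying x to -x' serves. *)
Lemma orbit_trans x x' : hprod x x != 0 -> hprod x' x' = hprod x x ->
  exists2 k, Vgrp A k & k *m x = x'.
Proof.
move=> x0 xx; have [c0|c0] := eqVneq (hprod (x' - x) x) 0; last first.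
  by have [h1 h2] := qrefl_move xx c0; exists (qrefl (x' - x) (hprod (x' - x) x)).
have c' : hprod (- x' - x) x != 0.
  apply: contra_neq x0 => h; move: c0 h; rewrite !(hprodDl, hprodNl) => c0 h.
  move: h; rewrite (subr0_eq c0) -opprD => /eqP; rewrite oppr_eq0 -mulr2n -mulr_natr.
  by rewrite mulf_eq0 (negPf (lchar0 hL 1)) orbF => /eqP.
have [|h1 h2] := @qrefl_move x (- x') _ c'; first by rewrite hprodNl hprodNr opprK.
by exists (- qrefl (- x' - x) (hprod (- x' - x) x)); rewrite ?mulNmx ?h2 ?opprK //; exact: VgrpN.
Qed.

(** The reflection carrying x to a nearby x' has a parameter near 0 and is not close to 1. Instead r
    carries x to -x and g carries -x to x'; both parameters are near -2 q(x), so g is close to r,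
    and g r is close to r r = 1. *)
Lemma orbit_near x (e : R) : hprod x x != 0 -> 0 < e ->
  exists2 d : R, 0 < d & forall x', hprod x' x' = hprod x x -> mnorm (x' - x) < d ->
    exists h, [/\ Vgrp A h, mnorm (h - 1%:M) < e & h *m x = x'].
Proof.
set q := hprod x x => q0 e0.
have n2 : (2 : L) != 0 by exact: (lchar0 hL 1).
have q2 : 0 < vabs (2 * q) by rewrite (abs_gt0 hL) mulf_neq0.
have rc : hprod (- x - x) x != 0 by rewrite hprodDl hprodNl -opprD oppr_eq0 -/q -mulr2n -mulr_natl mulf_neq0.
have [|Vr rx] := @qrefl_move x (- x) _ rc; first by rewrite hprodNl hprodNr opprK.
set r := qrefl _ _ in Vr rx.
pose X : 'M[L]_n := x *m hconj x *m A.
have zX : (- x - x) *m hconj (- x - x) *m A = 4 *: X.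
  rewrite hconjD // hconjN // -!opprD mulNmx mulmxN opprK !mulmxDr !mulmxDl -/X.
  by apply/matrixP => i j; rewrite !mxE; ring.
have rE : r = 1%:M - (2 / q) *: X.
  rewrite /r /qrefl zX hprodDl hprodNl -/q scalerA; congr (_ + _).
  by rewrite -scaleNr; congr (_ *: _); field; rewrite q0 -opprD oppr_eq0 -mulr2n -mulr_natl mulf_neq0.
have XX : X *m X = q *: X.
  rewrite /X !mulmxA -(mulmxA x (hconj x) A) -(mulmxA x (hconj x *m A) x) hprodE.
  by rewrite mul_mx_scalar -!scalemxAl ?mulmxA.
have rr : r *m r = 1%:M.
  rewrite rE mulmxBl mul1mx mulmxBr mulmx1 -scalemxAl -scalemxAr XX !scalerA.
  by apply/matrixP => i j; rewrite !mxE; field.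
(* The exact difference g - r for u = x' - x and w = <u, x>: every term contains a factor u or w,
   hence vanishes at x' = x. *)
have key (u : 'M[L]_(n, 1)) (w : L) : 2 * q + w != 0 ->
    1%:M + (- (2 * q + w))^-1 *: ((2 *: x + u) *m hconj (2 *: x + u) *m A) - (1%:M - (2 / q) *: X)
    = (2 * q + w)^-1 *: ((2 / q * w) *: X - (2 *: x) *m hconj u *m A
       - u *m (2 *: hconj x *m A) - u *m (hconj u *m A)).
  move=> C0; rewrite hconjD // hconjZ // cj_nat // !(mulmxDl, mulmxDr) -!(scalemxAl, scalemxAr) -/X !mulmxA.
  generalize X (x *m hconj u *m A) (u *m hconj x *m A) (u *m hconj u *m A) => X1 X2 X3 X4.
  by apply/matrixP => i j; rewrite !mxE; field; rewrite oppr_eq0 C0 q0.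
pose G (x' : 'M[L]_(n, 1)) : 'M[L]_n := ((2 / q) *: x) *m hconj (x' - x) *m (A *m X)
  - (2 *: x) *m hconj (x' - x) *m A - (x' - x) *m (2 *: hconj x *m A)
  - (x' - x) *m (hconj (x' - x) *m A).
have cd : cts (fun x' : 'M[L]_(n, 1) => x' - x) by exact: cts_addr.
have chd : cts (fun x' : 'M[L]_(n, 1) => hconj (x' - x)) by apply: (cts_comp hL) cd; exact: cts_hconj.
have cG : cts G.
  by do !apply: (ctsD hL); do ?[apply: (ctsN hL)]; do ?[apply: (ctsM hL)] => //; exact: cts_cst.
pose E (x' : 'M[L]_(n, 1)) : 'M[L]_1 := hconj (x' - x) *m (A *m x).
have cE : cts E by apply: (ctsM hL) => //; exact: cts_cst.
pose M := Num.max 1 (mnorm r); have M0 : 0 < M by rewrite lt_max ltr01.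
have G0 : G x = 0 by rewrite /G subrr hconj0 // !(mulmx0, mul0mx, subr0).
have E0 : E x = 0 by rewrite /E subrr hconj0 // mul0mx.
have FF := nb_filter hL x.
have [|d d0 hd] := filterI (cG x (e * vabs (2 * q) / M) _) (cE x _ q2).
  by rewrite divr_gt0 // mulr_gt0.
exists d => // x' xx' /hd[]; rewrite G0 E0 !subr0 => hG hE.
pose C := 2 * q + hprod (x' - x) x.
have e'E : vabs (hprod (x' - x) x) < vabs (2 * q).
  by apply: le_lt_trans hE; rewrite /E mulmxA hprodE (mnorm_scalar hL).
have aC : vabs C = vabs (2 * q).
  by apply: (abs_near_eq hL); rewrite /C addrAC subrr add0r.
have C0 : C != 0 by rewrite -(abs_gt0 hL) aC.
have cC : hprod (x' - - x) (- x) = - C.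
  by rewrite opprK hprodNr /C !hprodDl hprodNl -/q; ring.
have [||Vg gx] := @qrefl_move (- x) x'; first by rewrite hprodNl hprodNr opprK.
  by rewrite cC oppr_eq0.
set g := qrefl _ _ in Vg gx.
have grG : g - r = C^-1 *: G x'.
  have XE : (2 / q) *: x *m hconj (x' - x) *m (A *m X) = (2 / q * hprod (x' - x) x) *: X.
    rewrite -!scalemxAl /X !mulmxA -(mulmxA x (hconj (x' - x)) A) -(mulmxA x (hconj (x' - x) *m A) x) hprodE.
    by rewrite mul_mx_scalar -!scalemxAl scalerA.
  rewrite /G XE rE /g /qrefl cC opprK.
  have -> : x' + x = (2 *: x) + (x' - x) by apply/matrixP => i j; rewrite !mxE; ring.
  rewrite key //.
exists (g *m r); split; first exact: VgrpM.
  rewrite -rr -mulmxBl grG -scalemxAl; apply: le_lt_trans (mnormZ hL _ _) _.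
  rewrite (absV hL) aC ltr_pdivrMl //; apply: le_lt_trans (mnormM hL _ _) _.
  apply: le_lt_trans (_ : _ <= mnorm (G x') * M) _.
    by rewrite ler_wpM2l ?mnorm_ge0 // le_max lexx orbT.
  by rewrite -ltr_pdivlMr // [vabs _ * e]mulrC.
by rewrite -mulmxA rx.
Qed.

End Group.
End Orbits.

Section Hyperboloid.
Context {R : realType} (D : local_ext R).
Local Notation C := R[i].
Local Notation K := (lbase D).
Local Notation L := (ltop D).
Local Notation up := (@lup R D).
Local Notation cj := (@lconj R D).
Local Notation hermitian := (@Defs.hermitian R D _).
Hypothesis hD : quad_ext D.
Let hL := qe_local hD.
Context {n : nat} (S : K) (A : 'M[L]_n).
Hypotheses (S0 : S != 0) (hA : hermitian A).
Local Notation V := 'M[L]_(n, 1).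
Local Notation q x := (hprod A x x).

Let uS : up S != 0. Proof. by rewrite up_eq0. Qed.
Let two0 := abs2_gt0 hL.

Definition thick (x : V) : bool := vabs (q x / up S - 1) < vabs (2 : L) ^+ 2.

Definition hroot (x : V) : L :=
  xget 1 [set t | t ^+ 2 = q x / up S /\ vabs (t - 1) < vabs (2 : L)].

Definition hat (x : V) : V := (hroot x)^-1 *: x.

Lemma hrootP x : thick x ->
  hroot x ^+ 2 = q x / up S /\ vabs (hroot x - 1) < vabs (2 : L).
Proof.
move=> tx; rewrite /hroot; case: xgetP => [t _ //|none].
by have [t t2 t1] := sqrt_near1 hL tx; have [] := none t.
Qed.

Lemma hroot_unique x t : thick x -> t ^+ 2 = q x / up S -> vabs (t - 1) < vabs (2 : L) ->
  hroot x = t.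
Proof.
move=> /hrootP[r2 r1] t2 t1; apply: (sqrt_near1_unique hL r1 t1).
by rewrite r2.
Qed.

Lemma hroot_abs x : thick x -> vabs (hroot x) = 1.
Proof.
move=> /hrootP[_ r1]; rewrite -(abs1 hL); apply: (abs_near_eq hL).
rewrite (abs1 hL); apply: lt_le_trans r1 _; exact: (abs_nat_le1 hL 2).
Qed.

Lemma hroot_neq0 x : thick x -> hroot x != 0.
Proof. by move=> tx; rewrite -(abs_gt0 hL) hroot_abs. Qed.

(** The conjugate is again a root near 1, and such a root is unique. Hence [hat] divides q(x) by the
    square of the root. *)
Lemma hroot_cj x : thick x -> cj (hroot x) = hroot x.
Proof.
move=> tx; have [r2 r1] := hrootP tx; symmetry; apply: hroot_unique => //.
  by rewrite -cjX // r2 (cjM hD) cjV // hprod_cj // cj_up.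
have -> : cj (hroot x) - 1 = cj (hroot x - 1) by rewrite (cjD hD) cjN // (cj1 hD).
by rewrite (cj_abs hD).
Qed.

Lemma hprodZ a x : q (a *: x) = cj a * a * q x.
Proof. by rewrite /hprod hconjZ // -scalemxAr -!scalemxAl !mxE mulrCA mulrA. Qed.

Lemma hat_q x : thick x -> q (hat x) = up S.
Proof.
move=> tx; have [r2 r1] := hrootP tx; have r0 := hroot_neq0 tx.
rewrite hprodZ cjV // hroot_cj // -expr2 exprVn r2 invf_div divfK //.
by apply: contraNneq r0 => q0; rewrite -sqrf_eq0 r2 q0 mul0r.
Qed.

Lemma thick_q x : q x = up S -> thick x.
Proof. by move=> qx; rewrite /thick qx divff // subrr (abs0 hL) exprn_gt0. Qed.

Lemma hat_id x : q x = up S -> hat x = x.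
Proof.
move=> qx; rewrite /hat (hroot_unique (t := 1)) ?invr1 ?scale1r //; first exact: thick_q.
  by rewrite expr1n qx divff.
by rewrite subrr (abs0 hL).
Qed.

Lemma thickV h x : Vgrp A h -> thick (h *m x) = thick x.
Proof. by move=> hh; rewrite /thick hprodV. Qed.

Lemma hatV h x : Vgrp A h -> hat (h *m x) = h *m hat x.
Proof. by move=> hh; rewrite /hat /hroot hprodV // -scalemxAr. Qed.

Lemma mnorm_hat x : thick x -> mnorm (hat x) = mnorm x.
Proof.
move=> tx; apply/eqP; rewrite eq_le; apply/andP; split.
  by apply: le_trans (mnormZ hL _ _) _; rewrite (absV hL) hroot_abs // invr1 mul1r.
rewrite -[X in mnorm X <= _](scalerKV (hroot_neq0 tx) x).
by apply: le_trans (mnormZ hL _ _) _; rewrite hroot_abs // mul1r.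
Qed.

Lemma near_hat x (e : R) : thick x -> 0 < e ->
  exists2 d : R, 0 < d & forall y, mnorm (y - x) < d ->
    thick y /\ mnorm (hat y - hat x) < e.
Proof.
move=> tx e0.
have cq : cts (fun y : V => hconj y *m A *m y).
  by apply: (ctsM hL); [apply: (ctsM hL); [exact: cts_hconj|exact: cts_cst]|exact: cts_id].
have aS : 0 < vabs (up S) by rewrite (abs_gt0 hL).
pose M := Num.max 1 (mnorm x); have M0 : 0 < M by rewrite lt_max ltr01.
(* The first bound keeps [y] thick; the second makes the two roots differ by less than [e / M], by
   [sqrt_near1_dist]. *)
pose e1 := Num.min (vabs (2 : L) ^+ 2 * vabs (up S)) (e * vabs (2 : L) * vabs (up S) / M).
have e10 : 0 < e1 by rewrite lt_min divr_gt0 ?mulr_gt0 // exprn_gt0.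
have [d d0 hd] := cq x e1 e10.
exists (Num.min d e) => [|y]; first by rewrite lt_min d0.
rewrite lt_min => /andP[yd ye]; have := hd y yd.
rewrite !hprodE -raddfB (mnorm_scalar hL) lt_min => /andP[h1 h2].
have ty : thick y.
  rewrite /thick -[_ - 1](subrKA (q x / up S)) -mulrBl.
  apply: le_lt_trans (labsD hL _ _) _; rewrite gt_max [X in _ && X]tx andbT.
  by rewrite (labsM hL) (absV hL) ltr_pdivrMr.
split=> //; have [x2 x1] := hrootP tx; have [y2 y1] := hrootP ty.
have -> : hat y - hat x = (hroot y)^-1 *: (y - x) + ((hroot y)^-1 - (hroot x)^-1) *: x.
  by rewrite /hat scalerBr scalerBl addrA subrK.
apply: (mnormD_lt hL).
  by apply: le_lt_trans (mnormZ hL _ _) _; rewrite (absV hL) hroot_abs // invr1 mul1r.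
apply: le_lt_trans (mnormZ hL _ _) _.
have -> : (hroot y)^-1 - (hroot x)^-1 = (hroot y * hroot x)^-1 * (hroot x - hroot y).
  by field; rewrite !hroot_neq0.
rewrite (labsM hL) (absV hL) (labsM hL) !hroot_abs // mulr1 invr1 mul1r.
rewrite (sqrt_near1_dist hL) // x2 y2 -mulrBl (labsM hL) (absV hL) (absC hL).
apply: le_lt_trans (_ : _ <= vabs (q y - q x) / vabs (up S) / vabs (2 : L) * M) _.
  by rewrite ler_wpM2l ?divr_ge0 ?labs_ge0 // le_max lexx orbT.
rewrite -ltr_pdivlMr // ltr_pdivrMr // ltr_pdivrMr //; apply: lt_le_trans h2 _.
by rewrite (_ : e / M * _ * _ = e * vabs (2 : L) * vabs (up S) / M) //; ring.
Qed.

Section Sheaf.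
Context (P : lmodType C).
Implicit Type g : V -> P.

Definition schX g : Prop :=
  (forall x, q x = up S -> exists2 d : R, 0 < d & forall x', q x' = up S ->
     mnorm (x' - x) < d -> g x' = g x) /\
  exists B : R, forall x, q x = up S -> g x != 0 -> mnorm x <= B.

Definition thicken g (x : V) : P := if thick x then g (hat x) else 0.

Lemma lc_thick : locally_const thick.
Proof.
move=> x; case tx : (thick x).
  by have [d d0 hd] := near_hat tx ltr01; exists d => // y /hd[].
have cq : cts (fun y : V => hconj y *m A *m y).
  by apply: (ctsM hL); [apply: (ctsM hL); [exact: cts_hconj|exact: cts_cst]|exact: cts_id].
have aS : 0 < vabs (up S) by rewrite (abs_gt0 hL).
have [|d d0 hd] := cq x (vabs (2 : L) ^+ 2 * vabs (up S)).
  by rewrite mulr_gt0 // exprn_gt0.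
exists d => // y yd; apply/negP => ty; move/negP: tx; apply; have := hd y yd.
rewrite !hprodE -raddfB (mnorm_scalar hL) => h.
rewrite /thick -[_ - 1](subrKA (q y / up S)) -mulrBl.
apply: le_lt_trans (labsD hL _ _) _; rewrite gt_max [X in _ && X]ty andbT.
by rewrite (labsM hL) (absV hL) (absC hL) ltr_pdivrMr.
Qed.

Lemma schv_thicken g : schX g -> schv (thicken g).
Proof.
move=> [gc [B gB]]; split.
  move=> x; case tx : (thick x); last first.
    have FF := nb_filter hL x.
    by apply: filterS (lc_thick x) => y; rewrite /thicken tx => ->.
  have [d d0 hd] := gc _ (hat_q tx); have [e e0 he] := near_hat tx d0.
  exists e => // y /he[ty hy]; rewrite /thicken tx ty; apply: hd => //; exact: hat_q.
exists B => x; rewrite /thicken; case: ifP => tx; last by rewrite eqxx.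
by move=> nz; rewrite -(mnorm_hat tx); apply: gB => //; exact: hat_q.
Qed.

End Sheaf.
End Hyperboloid.

(** * Fiber integration over the hyperboloid *)

Section SmoothAction.
Context {R : realType} (D : local_ext R).
Local Notation C := R[i].
Local Notation L := (ltop D).
Local Notation cj := (@lconj R D).
Hypothesis hD : quad_ext D.
Let hL := qe_local hD.

(** Within distance 1 of the identity [h] is an isometry, so it moves no point across the boundary
    of a ball containing the support; inside the ball uniform local constancy applies. *)
Lemma lmul_near1 r k (Phi : schwartz L r k) : exists e : R,
  [/\ 0 < e, e <= 1 & forall h, h \in unitmx -> mnorm (h - 1%:M) < e -> lmul h Phi = Phi].
Proof.
have [B B0 hB] := schv_supp (schwartz_schv Phi).
have [d d0 hd] := schv_unif hL (schwartz_schv Phi).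
exists (Num.min 1 (d / B)); split; first by rewrite lt_min ltr01 divr_gt0.
  by rewrite ge_min lexx.
move=> h uh; rewrite lt_min => /andP[h1 h2]; apply: schwartzP => y; rewrite lmulE //.
have [yB|yB] := leP (mnorm y) B; last first.
  have z (x : 'M[L]_(r, k)) : B < mnorm x -> Phi x = 0.
    by rewrite ltNge => /negP xB; apply/eqP; apply: contrapT => /negP /hB.
  by rewrite !z ?(near1_isometry hL) //.
apply: hd; rewrite -[X in _ - X]mul1mx -mulmxBl.
apply: le_lt_trans (mnormM hL _ _) _.
apply: le_lt_trans (_ : _ <= mnorm (h - 1%:M) * B) _; first by rewrite ler_wpM2l ?mnorm_ge0.
by rewrite -ltr_pdivlMr.
Qed.

(** Conditions on norm-one elements only: determinants of U(V) lie there, and [natural_char] takes a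
    default value elsewhere. *)
Record norm_one_char (nu : L -> C) : Prop := NormOneChar {
  nuM : forall x y, x * cj x = 1 -> y * cj y = 1 -> nu (x * y) = nu x * nu y;
  nu_neq0 : forall x, x * cj x = 1 -> nu x != 0;
  nu_near1 : exists2 e : R, 0 < e & forall x, x * cj x = 1 -> vabs (x - 1) < e -> nu x = 1 }.

Context {n : nat} (A : 'M[L]_n) (nu : L -> C).
Hypotheses (uA : A \in unitmx) (hnu : norm_one_char nu).

Lemma nu_det_near1 : exists e : R, [/\ 0 < e, e <= 1 &
  forall h, Vgrp A h -> mnorm (h - 1%:M) < e -> nu (\det h) = 1].
Proof.
have [e e0 he] := nu_near1 hnu.
have m0 : 0 < Num.min e 1 by rewrite lt_min e0 ltr01.
have m1 : Num.min e 1 <= 1 by rewrite ge_min lexx orbT.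
exists (Num.min e 1); split=> // h Vh h1; apply: he; first exact: (Vgrp_det hD uA).
by have := det_near1 hL m0 m1 h1; rewrite lt_min => /andP[].
Qed.

Lemma nu_detM g h : Vgrp A g -> Vgrp A h -> nu (\det (g *m h)) = nu (\det g) * nu (\det h).
Proof. by move=> Vg Vh; rewrite det_mulmx (nuM hnu) //; exact: (Vgrp_det hD uA). Qed.

Lemma nu_det_neq0 h : Vgrp A h -> nu (\det h) != 0.
Proof. by move=> Vh; apply: (nu_neq0 hnu); exact: (Vgrp_det hD uA). Qed.

End SmoothAction.

Section FiberIntegral.
Context {R : realType} (D : local_ext R).
Local Notation C := R[i].
Local Notation K := (lbase D).
Local Notation L := (ltop D).
Local Notation up := (@lup R D).
Local Notation hermitian := (@Defs.hermitian R D _).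
Hypothesis hD : quad_ext D.
Let hL := qe_local hD.
Context {m : nat} (S : K) (A0 : 'M[L]_m).
Hypotheses (S0 : S != 0) (hA0 : hermitian A0) (uA0 : A0 \in unitmx).
Local Notation S1m := (schwartz L 1 m).
Local Notation SM := (schwartz L (1 + m) (1 + m)).
Local Notation S0m := (schwartz L m m).
Local Notation A := (gramS S A0).
Local Notation e0 := (@base_col R D m).
Local Notation V := 'M[L]_(1 + m, 1).
Local Notation q x := (hprod A x x).
Let hA : hermitian A := gramS_herm hD S hA0.
Let uA : A \in unitmx := gramS_unit hD S0 uA0.
Let uS : up S != 0. Proof. by rewrite up_eq0. Qed.

Lemma q_e0 : q e0 = up S.
Proof.
rewrite /hprod hconj_e0 // mul_row_block mul_row_col.
by rewrite !(mul0mx, mulmx0, mul1mx, mulmx1, addr0, add0r) mxE eqxx.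
Qed.

Definition stab (h0 : 'M[L]_m) : 'M[L]_(1 + m) := block_mx 1%:M 0 0 h0.

Lemma stab_e0 h0 : stab h0 *m e0 = e0.
Proof. by rewrite /stab /base_col mul_block_col !(mul0mx, mulmx0, mul1mx, mulmx1, addr0). Qed.

Lemma stab_Vgrp h0 : Vgrp A0 h0 -> Vgrp A (stab h0).
Proof.
move=> [_ hh]; apply: (VgrpP uA); rewrite /stab /gramS hconj_block // hconj1 // !hconj0 //.
by rewrite !mulmx_block; block_simp; rewrite hh.
Qed.

Lemma det_stab h0 : \det (stab h0) = \det h0.
Proof. by rewrite det_ublock det1 mul1r. Qed.

(** Fixing e0 fixes the first block column; the Gram relation then says that [up S] times the
    remaining off-diagonal block is 0. *)
Lemma stabP h : Vgrp A h -> h *m e0 = e0 -> exists2 h0, Vgrp A0 h0 & h = stab h0.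
Proof.
move=> [_ hh] he.
have [h1 h2] : ulsubmx h = 1%:M /\ dlsubmx h = 0.
  move: he; rewrite -{1}[h]submxK /base_col mul_block_col !mulmx0 !mulmx1 !addr0.
  by move=> /eq_col_mx[].
pose b := ursubmx h; pose h0 := drsubmx h.
have hE : h = block_mx 1%:M b 0 h0 by rewrite -[h]submxK h1 h2.
move: hh; rewrite hE /gramS hconj_block // hconj1 // !hconj0 //.
rewrite !mulmx_block; block_simp => /eq_block_mx[_ hb _ hd].
have b0 : b = 0.
  move: hb; rewrite mul_scalar_mx => /eqP; rewrite scaler_eq0 (negPf uS) /=.
  by move/eqP.
exists h0; last by rewrite b0.
by apply: (VgrpP uA0); move: hd; rewrite b0 !mulmx0 add0r.
Qed.

Lemma frame_exists x : q x = up S -> exists k, Vgrp A k /\ k *m e0 = x.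
Proof.
move=> qx; have [||k Vk kx] := @orbit_trans _ _ hD _ A hA uA e0 x.
- by rewrite q_e0.
- by rewrite q_e0.
by exists k.
Qed.

Variable I : S1m -> C.
Hypothesis hI : haar I.
Context (Q0 : lmodType C) (p0 : S0m -> Q0) (nu : L -> C).
Hypotheses (hnu : norm_one_char nu) (lp0 : linear p0)
  (p0V : forall h Psi, Vgrp A0 h -> p0 (lmul h Psi) = (nu (\det h))^-1 *: p0 Psi).

Definition frame (x : V) : 'M[L]_(1 + m) := xget 1%:M [set k | Vgrp A k /\ k *m e0 = x].

Lemma frameP x : q x = up S -> Vgrp A (frame x) /\ frame x *m e0 = x.
Proof.
move=> qx; rewrite /frame; case: xgetP => [k _ //|none].
by have [k hk] := frame_exists qx; have := none k hk.
Qed.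

Lemma zeta_stab a y h0 : stab h0 *m zeta a y = zeta a (h0 *m y).
Proof.
by rewrite /zeta mul_mx_row stab_e0 /stab mul_block_col !(mul0mx, mul1mx) addr0 add0r.
Qed.

Lemma Bi_stab h0 Phi : h0 \in unitmx -> Bi I (lmul (stab h0) Phi) = lmul h0 (Bi I Phi).
Proof.
move=> u0; have us : stab h0 \in unitmx by rewrite unitmxE det_stab -unitmxE.
apply: schwartzP => y; rewrite lmulE // !BiE //; congr (I _); apply: schwartzP => a.
by rewrite !sliceE // lmulE // zeta_stab.
Qed.

Definition fib (Phi : SM) (x : V) : Q0 :=
  nu (\det (frame x)) *: p0 (Bi I (lmul (frame x) Phi)).

Lemma lmul_lmul r k (g h : 'M[L]_r) (Phi : schwartz L r k) : g \in unitmx -> h \in unitmx ->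
  lmul g (lmul h Phi) = lmul (h *m g) Phi.
Proof.
by move=> ug uh; apply: schwartzP => x; rewrite !lmulE ?unitmx_mul ?ug ?uh // mulmxA.
Qed.

(** Two elements carrying e0 to x differ by the stabilizer U(A0), on which the factor nu(det)
    cancels the transformation rule of [p0]; so the arbitrary choice made in [frame] is harmless. *)
Lemma fibE Phi k x : Vgrp A k -> k *m e0 = x ->
  fib Phi x = nu (\det k) *: p0 (Bi I (lmul k Phi)).
Proof.
move=> Vk kx; have qx : q x = up S by rewrite -kx hprodV // q_e0.
have [Vf fx] := frameP qx; rewrite /fib; set f := frame x in Vf fx *.
have Vi := Vgrp_inv hD Vk; have [uk _] := Vk; have [uf _] := Vf.
have [||h0 V0 hE] := @stabP (invmx k *m f); first exact: VgrpM.
  by rewrite -mulmxA fx -kx mulKmx.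
have fE : f = k *m stab h0 by rewrite -hE mulKVmx.
have [u0 _] := V0; have us : stab h0 \in unitmx by rewrite unitmxE det_stab -unitmxE.
rewrite fE -lmul_lmul // Bi_stab // p0V // scalerA; congr (_ *: _).
rewrite (nu_detM hD uA hnu) //; last exact: stab_Vgrp.
by rewrite det_stab mulfK // (nu_det_neq0 hD uA0 hnu).
Qed.

Lemma fib_lin a Phi Psi x : q x = up S -> fib (a *: Phi + Psi) x = a *: fib Phi x + fib Psi x.
Proof.
move=> qx; have [[uf _] _] := frameP qx.
rewrite /fib (lmul_linear hD uf) (Bi_linear hD hI) lp0 scalerDr !scalerA.
by rewrite [_ * a]mulrC.
Qed.

(** Near x the frame may be replaced by [h *m frame x] with h close to 1; such an h fixes [Phi] and
    has nu(det h) = 1, although [frame] itself need not be continuous. *)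
Lemma fib_schX Phi : schX S A (fib Phi).
Proof.
split=> [x qx|].
  have [e [e00 e1 he]] := lmul_near1 hD Phi.
  have [d [d0 d1 hd]] := nu_det_near1 hD uA hnu.
  have [||r r0 hr] := @orbit_near _ _ hD _ A hA uA x (Num.min e d).
  - by rewrite qx.
  - by rewrite lt_min e00.
  exists r => // x' qx' xx'; have [|h [Vh]] := hr x' _ xx'; first by rewrite qx' qx.
  rewrite lt_min => /andP[h1 h2] hx; have [Vf fx] := frameP qx.
  have [uf _] := Vf; have [uh _] := Vh.
  rewrite (@fibE Phi (h *m frame x) x') //; last by rewrite -mulmxA fx.
    by rewrite -lmul_lmul // he // (nu_detM hD uA hnu) // hd // mul1r.
  exact: VgrpM.
have [B hB] := (schwartz_schv Phi).2; exists B => x qx nz.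
have [[uf _] fx] := frameP qx.
have [y [a nz1]] : exists y a, Phi (frame x *m zeta a y) != 0.
  apply: contrapT => h; move: nz => /eqP; apply; rewrite /fib.
  rewrite (_ : Bi I _ = 0) ?(lin0 lp0) ?scaler0 //; apply: schwartzP => y; rewrite BiE //.
  have [lI _ _] := hI; rewrite schw0 -(lin0 lI); congr (I _); apply: schwartzP => a.
  rewrite sliceE // lmulE // schw0; apply/eqP; apply: contrapT => /negP nz.
  by apply: h; exists y, a.
apply: le_trans (hB _ nz1); rewrite /zeta mul_mx_row fx mnorm_row_mx // le_max lexx.
by [].
Qed.

Variable IV : schwartz L (1 + m) 1 -> C.
Hypotheses (hIV : haar IV) (IVinv : forall h phi, Vgrp A h -> IV (lmul h phi) = IV phi).

Definition fiber_int (Phi : SM) : Q0 := vint IV (thicken S A (fib Phi)).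

Let schf Phi := schv_thicken hD S0 hA (fib_schX Phi).

Lemma finf_linear : linear fiber_int.
Proof.
have [lIV _ _] := hIV.
move=> a Phi Psi; rewrite /fiber_int -(vint_lin hL lIV) //.
congr (vint IV _); apply: funext => x; rewrite /thicken; case: ifP => tx.
  by rewrite fib_lin // hat_q.
by rewrite scaler0 addr0.
Qed.

Lemma finf_supp (Phi : SM) : (forall x, qform A x = up S -> Phi x = 0) -> fiber_int Phi = 0.
Proof.
have [lIV _ _] := hIV.
move=> h; rewrite /fiber_int (_ : thicken _ _ _ = fun=> 0).
  by rewrite (vint_tensor lIV (phi := 0) (v := 0)) ?scaler0 // => x; rewrite scaler0.
apply: funext => x; rewrite /thicken; case: ifP => // tx.
have [[uf Vf] fx] := frameP (hat_q hD hA tx); rewrite /fib.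
rewrite (_ : Bi I _ = 0) ?(lin0 lp0) ?scaler0 //; apply: schwartzP => y; rewrite BiE //.
have [lI _ _] := hI; rewrite schw0 -(lin0 lI); congr (I _); apply: schwartzP => a.
rewrite sliceE // lmulE // schw0 h //; rewrite /qform /zeta mul_mx_row row_mxKl fx.
exact: (hat_q hD hA tx).
Qed.

Lemma finf_um X Phi : fiber_int (rmul (uni_m X) Phi) = fiber_int Phi.
Proof.
rewrite /fiber_int; congr (vint IV _); apply: funext => x; rewrite /thicken; case: ifP => // tx.
have [[uf Vf] fx] := frameP (hat_q hD hA tx); rewrite /fib; congr (_ *: p0 _).
rewrite -[RHS](Bi_um hD hI X); congr (Bi I _); apply: schwartzP => y.
by rewrite lmulE // !rmulE ?uni_m_unit // lmulE // mulmxA.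
Qed.

Lemma finf_V h Phi : Vgrp A h -> fiber_int (lmul h Phi) = (nu (\det h))^-1 *: fiber_int Phi.
Proof.
move=> Vh; have [uh _] := Vh; have n0 := nu_det_neq0 hD uA hnu Vh.
have [lIV _ _] := hIV.
have schT : schv (fun x => (nu (\det h))^-1 *: thicken S A (fib Phi) x).
  by apply: (schv_lcZ hL _ (schf Phi)) => x; have FF := nb_filter hL x; exact: nearW.
rewrite /fiber_int -[RHS](vint_post hL lIV (L := fun v => (nu (\det h))^-1 *: v)) //; last first.
  by move=> a u v; rewrite scalerDr !scalerA mulrC.
rewrite -[RHS]scale1r.
rewrite -(vint_comp hL lIV (c := 1) (f := fun x => h *m x)) //.
- congr (vint IV _); apply: funext => x /=; rewrite /thicken thickV //; case: ifP => tx; last by rewrite scaler0.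
  have [Vf fx] := frameP (hat_q hD hA tx).
  have [uf _] := Vf.
  rewrite hatV // (fibE Phi (k := h *m frame (hat S A x))) ?(VgrpM hD) // -?mulmxA ?fx //.
  rewrite /fib lmul_lmul // scalerA (nu_detM hD uA hnu) // mulKf //.
  exact: VgrpM.
- exact: cts_mull.
- exact: proper_mull.
by move=> phi; rewrite mul1r; exact: IVinv.
Qed.

End FiberIntegral.

Section BumpTensors.
Context {R : realType} {K : vfield R} (hK : local_field K).

Lemma sbump_rtens r k1 k2 (y : 'M[K]_(r, k1 + k2)) (s : R) : 0 < s ->
  sbump y s = rtens (sbump (lsubmx y) s) (sbump (rsubmx y) s).
Proof.
move=> s0; apply: schwartzP => x; rewrite rtensE // !(sbumpE hK) //.
rewrite -[in LHS](hsubmxK x) -[in LHS](hsubmxK y) opp_row_mx add_row_mx mnorm_row_mx.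
by rewrite gt_max -natrM mulnb.
Qed.

Lemma sbump_ctens r1 r2 k (y : 'M[K]_(r1 + r2, k)) (s : R) : 0 < s ->
  sbump y s = ctens (sbump (usubmx y) s) (sbump (dsubmx y) s).
Proof.
move=> s0; apply: schwartzP => x; rewrite ctensE // !(sbumpE hK) //.
rewrite -[in LHS](vsubmxK x) -[in LHS](vsubmxK y) opp_col_mx add_col_mx mnorm_col_mx.
by rewrite gt_max -natrM mulnb.
Qed.

(** For the sup norm the indicator of a ball is a pure tensor, so locality reduces everything to
    pure tensors. *)
Lemma rtens_ext r k1 k2 (P : lmodType R[i]) (T : schwartz K r (k1 + k2) -> P) :
  linear T -> (forall (a : schwartz K r k1) (w : schwartz K r k2), T (rtens a w) = 0) ->
  forall Phi, T Phi = 0.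
Proof.
move=> lT h Phi; apply: (linear_local hK lT) => x _; exists 1 => // y _ s s0 _.
by rewrite sbump_rtens.
Qed.

Lemma ctens_ext r1 r2 k (P : lmodType R[i]) (T : schwartz K (r1 + r2) k -> P) :
  linear T -> (forall (a : schwartz K r1 k) (w : schwartz K r2 k), T (ctens a w) = 0) ->
  forall Phi, T Phi = 0.
Proof.
move=> lT h Phi; apply: (linear_local hK lT) => x _; exists 1 => // y _ s s0 _.
by rewrite sbump_ctens.
Qed.

Lemma rtens_linl r k1 k2 (w : schwartz K r k2) :
  linear (fun a : schwartz K r k1 => rtens a w).
Proof.
move=> c u v; apply: schwartzP => x.
by rewrite schwD schwZ !(rtensE hK) schwD schwZ mulrDl mulrA.
Qed.

Lemma rtens_linr r k1 k2 (a : schwartz K r k1) :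
  linear (fun w : schwartz K r k2 => rtens a w).
Proof.
move=> c u v; apply: schwartzP => x.
by rewrite schwD schwZ !(rtensE hK) schwD schwZ mulrDr mulrCA.
Qed.

Lemma ctens_linl r1 r2 k (w : schwartz K r2 k) :
  linear (fun a : schwartz K r1 k => ctens a w).
Proof.
move=> c u v; apply: schwartzP => x.
by rewrite schwD schwZ !(ctensE hK) schwD schwZ mulrDl mulrA.
Qed.

Lemma ctens_linr r1 r2 k (a : schwartz K r1 k) :
  linear (fun w : schwartz K r2 k => ctens a w).
Proof.
move=> c u v; apply: schwartzP => x.
by rewrite schwD schwZ !(ctensE hK) schwD schwZ mulrDr mulrCA.
Qed.

End BumpTensors.

(** * Germs at the base point and descent to the coinvariants *)

Section Descent.
Context {R : realType} (D : local_ext R).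
Local Notation C := R[i].
Local Notation K := (lbase D).
Local Notation L := (ltop D).
Local Notation up := (@lup R D).
Local Notation hermitian := (@Defs.hermitian R D _).
Hypothesis hD : quad_ext D.
Let hL := qe_local hD.
Context {m : nat} (S : K) (A0 : 'M[L]_m).
Hypotheses (S0 : S != 0) (hA0 : hermitian A0) (uA0 : A0 \in unitmx).
Local Notation S1m := (schwartz L 1 m).
Local Notation SV := (schwartz L (1 + m) 1).
Local Notation SW := (schwartz L (1 + m) m).
Local Notation SM := (schwartz L (1 + m) (1 + m)).
Local Notation S0m := (schwartz L m m).
Local Notation A := (gramS S A0).
Local Notation e0 := (@base_col R D m).
Local Notation V := 'M[L]_(1 + m, 1).
Local Notation q x := (hprod A x x).
Let hA : hermitian A := gramS_herm hD S hA0.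
Let uA : A \in unitmx := gramS_unit hD S0 uA0.
Let uS : up S != 0. Proof. by rewrite up_eq0. Qed.
Let qe0 : q e0 = up S := q_e0 hD S A0.

Lemma lmul_rtens h (a : SV) (w : SW) : h \in unitmx ->
  lmul h (rtens a w) = rtens (lmul h a) (lmul h w).
Proof.
move=> uh; apply: schwartzP => x; rewrite lmulE // !rtensE // !lmulE //.
by rewrite -[in LHS](hsubmxK x) mul_mx_row row_mxKl row_mxKr.
Qed.

Lemma lmul_sbump h (x : V) (s : R) : h \in unitmx -> mnorm (h - 1%:M) < 1 -> 0 < s ->
  lmul h (sbump (h *m x) s) = sbump x s.
Proof.
move=> uh h1 s0; apply: schwartzP => y; rewrite lmulE // !sbumpE // -mulmxBr.
by rewrite (near1_isometry hL).
Qed.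

Variable I : S1m -> C.
Hypothesis hI : haar I.
Let lI : linear (I : S1m -> C^o) := let: And3 h _ _ := hI in h.
Variable IV : SV -> C.
Hypotheses (hIV : haar IV) (IVinv : forall h phi, Vgrp A h -> IV (lmul h phi) = IV phi).
Let lIV : linear (IV : SV -> C^o) := let: And3 h _ _ := hIV in h.

Let schX_schwartz (a : SV) : @schX _ D _ S A C^o a.
Proof.
have [ac [B aB]] := schwartz_schv a; split; last by exists B => x _; exact: aB.
by move=> x _; have [d d0 hd] := ac x; exists d => // x' _; exact: hd.
Qed.

Definition IX (a : SV) : C := IV (toS (@thicken _ D _ S A C^o a)).

Lemma thickE (a : SV) x : toS (@thicken _ D _ S A C^o a) x = if thick S A x then a (hat S A x) else 0.
Proof. by rewrite toSE //; exact: (schv_thicken hD S0 hA (schX_schwartz a)). Qed.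

Lemma IX_linear : linear (IX : SV -> C^o).
Proof.
move=> c a b; rewrite /IX -lIV; congr (IV _); apply: schwartzP => x.
rewrite schwD schwZ !thickE; case: ifP => _; first by rewrite schwD schwZ.
by rewrite mulr0 addr0.
Qed.

Lemma IX_supp (a : SV) : (forall x, q x = up S -> a x = 0) -> IX a = 0.
Proof.
move=> h; rewrite /IX -(lin0 lIV); congr (IV _); apply: schwartzP => x; rewrite thickE schw0.
by case: ifP => // tx; apply: h; exact: (hat_q hD hA tx).
Qed.

Lemma IX_V h a : Vgrp A h -> IX (lmul h a) = IX a.
Proof.
move=> Vh; have [uh _] := Vh; rewrite /IX -[RHS](IVinv _ Vh); congr (IV _).
by apply: schwartzP => x; rewrite lmulE // !thickE thickV // hatV // lmulE.
Qed.

Lemma IX_bump (d : R) : 0 < d -> IX (sbump e0 d) != 0.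
Proof.
move=> d0; pose f := toS (@thicken _ D _ S A C^o (sbump e0 d)).
have [] // := @haar_pos _ _ hL _ _ IV f f hIV.
- by move=> x; rewrite thickE; case: ifP => // _; exact: sbump_ge0.
- by move=> x; rewrite thickE; case: ifP => // _; exact: sbump_ge0.
- apply: contra_neq (oner_neq0 C) => z; have : f e0 = 0 by rewrite z.
  by rewrite /f thickE (thick_q hD S0 qe0) (hat_id hD S0 qe0) sbump_center.
- apply: contra_neq (oner_neq0 C) => z; have : f e0 = 0 by rewrite z.
  by rewrite /f thickE (thick_q hD S0 qe0) (hat_id hD S0 qe0) sbump_center.
Qed.

(* The factor [sbump e0 1] is [1] on the slice [x0 = e0]: [Ia w y] is the integral of
   [a |-> w (col_mx a y)] *)
Definition Ia (w : SW) : S0m := Bi I (rtens (sbump e0 1) w).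

Lemma Bi_rtens (a : SV) (w : SW) k : k \in unitmx ->
  Bi I (lmul k (rtens a w)) = a (k *m e0) *: Ia (lmul k w).
Proof.
move=> uk; rewrite -(linZ (Bi_linear hD hI)); apply: (Bi_ext hD hI) => x y.
rewrite schwZ lmul_rtens // !rtensE // lsub_zeta sbump_center // mul1r.
by rewrite !lmulE.
Qed.

Lemma Ia_linear : linear Ia.
Proof. by move=> c u v; rewrite /Ia rtens_linr // (Bi_linear hD hI). Qed.

Lemma Ia_ctens (phi : S1m) (Psi : S0m) : Ia (ctens phi Psi) = I phi *: Psi.
Proof.
apply: schwartzP => y; rewrite schwZ /Ia BiE // mulrC -[RHS]/(Psi y *: (I phi : C^o)) -(linZ lI).
congr (I _); apply: schwartzP => a; rewrite schwZ sliceE // rtensE // lsub_zeta sbump_center //.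
by rewrite mul1r ctensE // row_mxKr col_mxKu col_mxKd mulrC.
Qed.

Variable nu : L -> C.
Hypothesis hnu : norm_one_char nu.

Section Germs.
Context (P : lmodType C) (T : SM -> P).
Hypotheses (lT : linear T)
  (T1 : forall Phi : SM, (forall x, qform A x = up S -> Phi x = 0) -> T Phi = 0)
  (T3 : forall h Phi, Vgrp A h -> T (lmul h Phi) = (nu (\det h))^-1 *: T Phi).

Definition germ (w : SW) (v : P) : Prop := exists2 d : R, 0 < d &
  forall a : SV, (forall x, a x != 0 -> mnorm (x - e0) < d) -> T (rtens a w) = IX a *: v.

(** Points of the hyperboloid near e0 are moved to one another by elements so close to 1 that they
    fix [w], have nu(det) = 1 and map small balls to balls. Hence a -> T(a tensor w) and [IX] have
    the same invariance near e0, and uniqueness applies. *)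
Lemma germ_exists w : exists v, germ w v.
Proof.
have [e [e00 e1 he]] := lmul_near1 hD w.
have [f [f0 f1 hf]] := nu_det_near1 hD uA hnu.
pose g := Num.min e f; have g0 : 0 < g by rewrite lt_min e00.
have ge : g <= e by rewrite ge_min lexx.
have gf : g <= f by rewrite ge_min lexx orbT.
have g1 : g <= 1 by apply: le_trans ge e1.
have [||d d0 hd] := @orbit_near _ _ hD _ A hA uA e0 g; rewrite ?qe0 //.
have key (x x' : V) : q x = up S -> mnorm (x - e0) < d -> q x' = up S -> mnorm (x' - e0) < d ->
    exists h, [/\ Vgrp A h, mnorm (h - 1%:M) < g & h *m x = x'].
  move=> qx xd qx' x'd; have [|h1 [V1 n1 h1x]] := hd x _ xd; first by rewrite qe0.
  have [|h2 [V2 n2 h2x]] := hd x' _ x'd; first by rewrite qe0.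
  have [u1 _] := V1; exists (h2 *m invmx h1); split.
  - by apply: VgrpM => //; exact: Vgrp_inv.
  - by apply: (near1_mul hL) => //; rewrite (near1_inv hL) // (lt_le_trans n1).
  by rewrite -h1x -mulmxA mulKmx.
pose b := sbump e0 d : SV; have Ib := IX_bump d0.
exists ((IX b)^-1 *: T (rtens b w)); exists d => // a ad.
have bd x : b x != 0 -> mnorm (x - e0) < d by rewrite sbumpE //; case: ltP; rewrite ?eqxx.
have lTw : linear (fun a => T (rtens a w)) by move=> c u v; rewrite rtens_linl // lT.
have h := @invariant_dist_unique _ _ hL _ _ _ (fun a => T (rtens a w)) IX
  [set x | q x = up S] [set x | mnorm (x - e0) < d] 1 lTw IX_linear ltr01.
apply: (scalerI Ib); rewrite !scalerA mulrAC mulfV // mul1r.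
apply: h => // [a' a'0|x x' s /= qx xd qx' x'd s0 _].
  split; last exact: IX_supp.
  apply: T1 => x qx; rewrite rtensE // a'0 ?mul0r //.
have [h' [Vh n1 <-]] := key x x' qx xd qx' x'd; have [uh _] := Vh.
have hb := lmul_sbump x uh (lt_le_trans n1 g1) s0.
split; last by rewrite -hb IX_V.
have <- : lmul h' (rtens (sbump (h' *m x) s) w) = rtens (sbump x s) w.
  by rewrite lmul_rtens // hb he // (lt_le_trans n1).
by rewrite T3 // hf ?invr1 ?scale1r // (lt_le_trans n1).
Qed.

Lemma germ_unique w v v' : germ w v -> germ w v' -> v = v'.
Proof.
move=> [d d0 hd] [d' d'0 hd']; pose b := sbump e0 (Num.min d d') : SV.
have m0 : 0 < Num.min d d' by rewrite lt_min d0.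
apply: (scalerI (IX_bump m0)).
rewrite -hd => [|x]; last by rewrite sbumpE //; case: ltP => [|_]; rewrite ?lt_min ?eqxx // => /andP[].
rewrite -hd' // => x; by rewrite sbumpE //; case: ltP => [|_]; rewrite ?lt_min ?eqxx // => /andP[].
Qed.

Definition vT w : P := xget 0 [set v | germ w v].

Lemma vTP w : germ w (vT w).
Proof.
rewrite /vT; case: xgetP => [v _ //|none].
by have [v hv] := germ_exists w; have := none v hv.
Qed.

Lemma vTE w v : germ w v -> vT w = v.
Proof. exact: germ_unique (vTP w). Qed.

Lemma vT_linear : linear vT.
Proof.
move=> c w w'; apply: vTE; have [d d0 hd] := vTP w; have [d' d'0 hd'] := vTP w'.
exists (Num.min d d') => [|a ad]; first by rewrite lt_min d0.
rewrite rtens_linr // lT hd ?hd' => [|x /ad|x /ad]; try by rewrite lt_min => /andP[].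
by rewrite scalerDr !scalerA mulrC.
Qed.

Lemma vT_stab h0 w : Vgrp A0 h0 -> vT (lmul (stab h0) w) = (nu (\det h0))^-1 *: vT w.
Proof.
move=> V0; have Vh := stab_Vgrp hD S0 uA0 V0; apply: vTE.
set h := stab h0 in Vh *; have [uh _] := Vh; have [d d0 hd] := vTP w.
pose M := Num.max 1 (mnorm h); have M0 : 0 < M by rewrite lt_max ltr01.
exists (d / M) => [|a ad]; first exact: divr_gt0.
have uhi : invmx h \in unitmx by rewrite unitmx_inv.
have aE : a = lmul h (lmul (invmx h) a).
  by apply: schwartzP => x; rewrite !lmulE // mulKmx.
have -> : rtens a (lmul h w) = lmul h (rtens (lmul (invmx h) a) w).
  by rewrite lmul_rtens // -aE.
rewrite T3 // hd => [|x].
  by rewrite -[in RHS](IX_V _ (Vgrp_inv hD Vh)) !scalerA det_stab mulrC.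
rewrite lmulE // => /ad h1.
have -> : x - e0 = h *m (invmx h *m x - e0) by rewrite mulmxBr mulKVmx // stab_e0.
apply: le_lt_trans (mnormM hL _ _) _.
apply: le_lt_trans (_ : _ <= M * mnorm (invmx h *m x - e0)) _.
  by rewrite ler_wpM2r ?mnorm_ge0 // le_max lexx orbT.
by rewrite -ltr_pdivlMl // mulrC.
Qed.

Section Column.
Hypothesis T2 : forall X Phi, T (rmul (uni_m X) Phi) = T Phi.

(** [T2] translates x' by x0 X. For x0 close enough to e0 this has the same effect on [w] as the
    translation by e0 X, by uniform local constancy of [w]. *)
Lemma vT_shift (X : 'M[L]_(1, m)) w : vT (sshift (col_mx X 0) w) = vT w.
Proof.
apply: vTE; have [d d0 hd] := vTP w; have [e e00 he] := schv_unif hL (schwartz_schv w).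
pose M := Num.max 1 (mnorm X); have M0 : 0 < M by rewrite lt_max ltr01.
exists (Num.min d (e / M)) => [|a ad]; first by rewrite lt_min d0 divr_gt0.
rewrite -hd => [|x /ad]; last by rewrite lt_min => /andP[].
rewrite -[RHS](T2 X); congr (T _); apply: schwartzP => x.
rewrite rmulE ?uni_m_unit // !rtensE // sshiftE //.
have -> : x *m uni_m X = row_mx (lsubmx x) (lsubmx x *m X + rsubmx x).
  by rewrite -[in LHS](hsubmxK x) mul_row_block !(mulmx0, mulmx1) addr0.
rewrite row_mxKl row_mxKr; have [->|/ad] := eqVneq (a (lsubmx x)) 0; first by rewrite !mul0r.
rewrite lt_min => /andP[_ h]; congr (_ * _); apply: he.
have -> : rsubmx x + col_mx X 0 - (lsubmx x *m X + rsubmx x) = (e0 - lsubmx x) *m X.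
  have -> : col_mx X 0 = e0 *m X by rewrite /base_col mul_col_mx mul1mx mul0mx.
  by rewrite mulmxBl [X in _ - X]addrC opprD addrACA subrr add0r.
apply: le_lt_trans (mnormM hL _ _) _; rewrite (mnormC hL).
apply: le_lt_trans (_ : _ <= mnorm (lsubmx x - e0) * M) _.
  by rewrite ler_wpM2l ?mnorm_ge0 // le_max lexx orbT.
by rewrite -ltr_pdivlMr.
Qed.

(** A section of [Ia]: by [vT_shift] the value of [vT] depends on the row along e0 only through its
    integral, so one normalized test function in that row suffices. *)
Definition tau0 (Psi : S0m) : P := (I (sbump 0 1))^-1 *: vT (ctens (sbump 0 1) Psi).

Lemma vT_tau0 w : vT w = tau0 (Ia w).
Proof.
have b0 : I (sbump 0 1) != 0 by exact: haar_bump_neq0.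
apply/eqP; rewrite -subr_eq0; apply/eqP; move: w.
apply: (ctens_ext hL) => [c u v|phi Psi].
  rewrite vT_linear Ia_linear /tau0 ctens_linr // vT_linear scalerDr opprD addrACA.
  by rewrite scalerBr !scalerA mulrC.
apply/eqP; rewrite subr_eq0; apply/eqP; rewrite Ia_ctens /tau0 (linZ (ctens_linr hL _)) (linZ vT_linear).
apply: (scalerI b0); rewrite scalerA mulfV // scale1r.
apply: (haar_unique hL hI (T := fun phi => vT (ctens phi Psi))) => [c u v|X phi'].
  by rewrite ctens_linl // vT_linear.
rewrite -[RHS](vT_shift X); congr vT; apply: schwartzP => x.
by rewrite sshiftE // !ctensE // sshiftE // !linearD /= col_mxKu col_mxKd addr0.
Qed.

Lemma tau0_linear : linear tau0.
Proof. by move=> c u v; rewrite /tau0 ctens_linr // vT_linear scalerDr !scalerA mulrC. Qed.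

Lemma tau0_V h Psi : Vgrp A0 h -> tau0 (lmul h Psi) = (nu (\det h))^-1 *: tau0 Psi.
Proof.
move=> Vh; have [uh _] := Vh; rewrite /tau0 scalerA [_ * (I _)^-1]mulrC -scalerA -vT_stab //.
congr (_ *: vT _); apply: schwartzP => x.
have us : stab h \in unitmx by rewrite unitmxE det_stab -unitmxE.
rewrite lmulE // !ctensE // lmulE //.
by rewrite -[x in stab h *m x]vsubmxK /stab mul_block_col !(mul0mx, mul1mx) addr0 add0r col_mxKu col_mxKd.
Qed.

End Column.

(** By locality it is enough to test small balls. At a point of the hyperboloid equivariance moves
    the ball to e0, where the germ vanishes; off the hyperboloid a small ball misses the support of
    [T]. *)
Lemma germ0_eq0 : (forall w, germ w 0) -> forall Phi, T Phi = 0.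
Proof.
move=> g0; apply: (rtens_ext hL lT) => a w; move: a.
have lTw : linear (fun a => T (rtens a w)) by move=> c u v; rewrite rtens_linl // lT.
move=> a; apply: (linear_local hL lTw) => x _; have [qx|qx] := eqVneq (q x) (up S).
  have [k [Vk kx]] := frame_exists hD S0 hA0 uA0 qx; have [uk _] := Vk.
  have [d d0 hd] := g0 (lmul k w).
  pose M := Num.max 1 (mnorm (invmx k)); have M0 : 0 < M by rewrite lt_max ltr01.
  exists (d / M) => [|y yd s s0 sd]; first exact: divr_gt0.
  have n0 := nu_det_neq0 hD uA hnu Vk.
  suff : T (lmul k (rtens (sbump y s) w)) = 0.
    by rewrite T3 // => /eqP; rewrite scaler_eq0 invr_eq0 (negPf n0) => /eqP.
  rewrite lmul_rtens // hd ?scaler0 // => z; rewrite lmulE // sbumpE //.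
  case: ltP => [hz _|]; last by rewrite eqxx.
  have -> : z - e0 = invmx k *m (k *m z - x) by rewrite mulmxBr mulKmx // -kx mulKmx.
  apply: le_lt_trans (mnormM hL _ _) _.
  apply: le_lt_trans (_ : _ <= M * mnorm (k *m z - x)) _.
    by rewrite ler_wpM2r ?mnorm_ge0 // le_max lexx orbT.
  rewrite -ltr_pdivlMl // mulrC; apply: (mnorm_trans hL (y := y)) => //.
  exact: lt_le_trans hz sd.
have cq : cts (fun y : V => hconj y *m A *m y).
  by apply: (ctsM hL); [apply: (ctsM hL); [exact: cts_hconj|exact: cts_cst]|exact: cts_id].
have aq : 0 < vabs (up S - q x) by rewrite (abs_gt0 hL) subr_eq0 eq_sym.
have [d d0 hd] := cq x _ aq; exists d => // y yd s s0 sd; apply: T1 => z qz.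
rewrite rtensE // sbumpE //; case: ltP => [hz|]; last by rewrite mul0r.
have zx : mnorm (lsubmx z - x) < d by apply: (mnorm_trans hL (y := y)) => //; exact: lt_le_trans hz sd.
have := hd _ zx; rewrite !hprodE -raddfB (mnorm_scalar hL).
by rewrite (_ : hprod A (lsubmx z) (lsubmx z) = up S) ?ltxx.
Qed.

End Germs.

Context (Q0 : lmodType C) (p0 : S0m -> Q0).
Hypotheses (lp0 : linear p0) (sp0 : forall v, exists Psi, p0 Psi = v)
  (p0V : forall h Psi, Vgrp A0 h -> p0 (lmul h Psi) = (nu (\det h))^-1 *: p0 Psi)
  (p0U : forall (P : lmodType C) (t : S0m -> P), linear t ->
     (forall h Psi, Vgrp A0 h -> t (lmul h Psi) = (nu (\det h))^-1 *: t Psi) ->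
     exists2 tb : Q0 -> P, linear tb & forall Psi, tb (p0 Psi) = t Psi).
Local Notation finf := (fiber_int S A0 I p0 nu IV).

(** For x near e0 the frame can be taken near 1, so it leaves [w] unchanged and the fiber at x of a
    pure tensor is a(x) times the fixed vector [p0 (Ia w)]. *)
Lemma germ_finf w : germ finf w (p0 (Ia w)).
Proof.
have [e [e00 e1 he]] := lmul_near1 hD w.
have [f [f0 f1 hf]] := nu_det_near1 hD uA hnu.
have [||d d0 hd] := @orbit_near _ _ hD _ A hA uA e0 (Num.min e f); rewrite ?qe0 ?lt_min ?e00 //.
exists d => // a ad; rewrite /fiber_int; apply: (vint_tensor lIV) => x; rewrite thickE /thicken.
case: ifP => tx; last by rewrite scale0r.
have qx := hat_q hD hA tx.
have [a0|a0] := eqVneq (a (hat S A x)) 0.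
  have [[uk Vk] kx] := frameP hD S0 hA0 uA0 qx.
  by rewrite /fib Bi_rtens // kx a0 !scale0r (lin0 lp0) scaler0.
have [|h [Vh]] := hd _ _ (ad _ a0); first by rewrite qe0.
rewrite lt_min => /andP[h1 h2] hx; have [uh _] := Vh.
rewrite (fibE hD S0 hA0 uA0 hI hnu p0V _ Vh hx) hf // scale1r Bi_rtens // hx he //.
by rewrite (linZ lp0).
Qed.

Lemma finf_surj v : exists Phi, finf Phi = v.
Proof.
have [Psi <-] := sp0 v; have b0 : I (sbump 0 1) != 0 by exact: haar_bump_neq0.
have [d d0 hd] := germ_finf (ctens (sbump 0 1) Psi); have i0 := IX_bump d0.
have lf := finf_linear hD S0 hA0 uA0 hI hnu lp0 p0V hIV.
exists ((IX (sbump e0 d) * I (sbump 0 1))^-1 *: rtens (sbump e0 d) (ctens (sbump 0 1) Psi)).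
rewrite (linZ lf) hd => [|x]; last by rewrite sbumpE //; case: ltP; rewrite ?eqxx.
by rewrite Ia_ctens (linZ lp0) !scalerA -mulrA mulVf ?scale1r // mulf_neq0.
Qed.

Theorem orbit_factor (P : lmodType C) (T : SM -> P) : linear T ->
  (forall Phi : SM, (forall x, qform A x = up S -> Phi x = 0) -> T Phi = 0) ->
  (forall X Phi, T (rmul (uni_m X) Phi) = T Phi) ->
  (forall h Phi, Vgrp A h -> T (lmul h Phi) = (nu (\det h))^-1 *: T Phi) ->
  exists2 tb : Q0 -> P, linear tb & forall Phi, T Phi = tb (finf Phi).
Proof.
move=> lT T1 T2 T3; have [||tb ltb tbE] := @p0U P (tau0 T).
- exact: tau0_linear.
- by move=> h Psi; exact: tau0_V.
have lf := finf_linear hD S0 hA0 uA0 hI hnu lp0 p0V hIV.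
exists tb => // Phi; apply/eqP; rewrite -subr_eq0; apply/eqP; move: Phi.
(* The difference of both sides is again supported on the hyperboloid and equivariant, so only its
   germs at e0 have to be compared. *)
apply: germ0_eq0 => [c u v|Phi h0|h Phi Vh|w].
- by rewrite lT lf ltb scalerBr opprD addrACA.
- by rewrite T1 // (finf_supp hD S0 hA0 uA0 hI nu lp0 hIV h0) (lin0 ltb) subrr.
- rewrite T3 // (finf_V hD S0 hA0 uA0 hI hnu lp0 p0V hIV IVinv) //.
  by rewrite (linZ ltb) scalerBr.
have [d d0 hd] := vTP lT T1 T3 w; have [d' d'0 hd'] := germ_finf w.
exists (Num.min d d') => [|a ad]; first by rewrite lt_min d0.
rewrite hd ?hd' => [|x /ad|x /ad]; try by rewrite lt_min => /andP[].
by rewrite (linZ ltb) tbE vT_tau0 // subrr scaler0.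
Qed.

End Descent.

(** * The local theorem *)

Section Quotients.
Context {R : realType}.
Local Notation C := R[i].

Lemma lspan_sub (V : lmodType C) (B W : set V) : is_submodule W -> B `<=` W -> lspan B `<=` W.
Proof.
move=> [W0 WD WZ] BW v [k [a [u [Bu ->]]]].
by apply: (big_ind W) => // i _; apply/WZ/BW.
Qed.

Lemma quotient_univ (V Q P : lmodType C) (p : V -> Q) (t : V -> P) : linear p ->
  (forall w, exists v, p v = w) -> linear t -> (forall v, p v = 0 -> t v = 0) ->
  exists2 tb : Q -> P, linear tb & forall v, tb (p v) = t v.
Proof.
move=> lp sp lt h; have [s sE] : {s : Q -> V | forall w, p (s w) = w}.
  by exists (fun w => projT1 (cid (sp w))) => w; case: (cid (sp w)).
have tE v v' : p v = p v' -> t v = t v'.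
  move=> e; apply/eqP; rewrite -subr_eq0 -(linB lt); apply/eqP/h.
  by rewrite (linB lp) e subrr.
exists (t \o s) => [a u v|v] /=; last by apply: tE; rewrite sE.
by rewrite -lt; apply: tE; rewrite lp !sE.
Qed.

Lemma is_quotient_univ (V Q P : lmodType C) (B : set V) (p : V -> Q) (t : V -> P) :
  is_quotient B p -> linear t -> (forall v, B v -> t v = 0) ->
  exists2 tb : Q -> P, linear tb & forall v, tb (p v) = t v.
Proof.
move=> [lp sp kp] lt tB; apply: (quotient_univ lp sp lt) => v /kp.
apply: (lspan_sub (W := [set v | t v = 0])); last exact: tB.
by split=> /= [|u w u0 w0|a u u0]; rewrite ?(lin0 lt) ?(linD lt) ?(linZ lt) ?u0 ?w0 ?addr0 ?scaler0.
Qed.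

End Quotients.

Section ThetaQuotient.
Context {R : realType} (D : local_ext R).
Local Notation C := R[i].
Local Notation L := (ltop D).
Hypothesis hD : quad_ext D.
Variable nu : L -> C.
Hypothesis hnu : norm_one_char nu.

(** The coinvariants through their universal property; in this form they can be carried along a
    change of Gram matrix. *)
Definition covariants n (A : 'M[L]_n) (Q : lmodType C) (p : schwartz L n n -> Q) : Prop :=
  [/\ linear p, forall w, exists v, p v = w,
      forall h Psi, Vgrp A h -> p (lmul h Psi) = (nu (\det h))^-1 *: p Psi
    & forall (P : lmodType C) (t : schwartz L n n -> P), linear t ->
     (forall h Psi, Vgrp A h -> t (lmul h Psi) = (nu (\det h))^-1 *: t Psi) ->
     exists2 tb : Q -> P, linear tb & forall Psi, tb (p Psi) = t Psi].

Lemma theta_covariants n (A : 'M[L]_n) (Q : lmodType C) (p : schwartz L n n -> Q) :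
  A \in unitmx ->
  is_quotient [set Psi : schwartz L n n | exists h (Phi : schwartz L n n), Vgrp A h /\
    forall x, Psi x = (nu (\det h))^-1 * Phi (invmx h *m x) - Phi x] p ->
  covariants A p.
Proof.
move=> uA hq; have [lp sp kp] := hq.
have nuV h : Vgrp A h -> nu (\det (invmx h)) = (nu (\det h))^-1.
  move=> Vh; have Vi := Vgrp_inv hD Vh; have [uh _] := Vh.
  have e : nu (\det h) * nu (\det (invmx h)) = 1.
    rewrite -(nu_detM hD uA hnu) // mulmxV //.
    have V1 := Vgrp1 hD A; have n1 := nu_det_neq0 hD uA hnu V1.
    by apply: (mulfI n1); rewrite -(nu_detM hD uA hnu) // mulmx1 mulr1.
  by apply: (mulfI (nu_det_neq0 hD uA hnu Vh)); rewrite e mulfV // (nu_det_neq0 hD uA hnu).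
split=> // [h Psi Vh|P t lt tV].
  have Vi := Vgrp_inv hD Vh; have [uh _] := Vh; have n0 := nu_det_neq0 hD uA hnu Vh.
  (* This is the relation attached to [invmx h]: U(V) acts by Phi(h^-1 x), whereas [lmul h] is Phi(h
     x). *)
  have : p (nu (\det h) *: lmul h Psi - Psi) = 0.
    apply/kp; exists 1%N, (fun=> 1), (fun=> nu (\det h) *: lmul h Psi - Psi); split.
      move=> _; exists (invmx h), Psi; split=> // x.
      by rewrite nuV // invrK invmxK schwD schwN schwZ lmulE.
    by rewrite big_ord1 scale1r.
  rewrite (linB lp) (linZ lp) => /eqP; rewrite subr_eq0 => /eqP <-.
  by rewrite scalerA mulVf // scale1r.
apply: (is_quotient_univ hq lt) => v [h [Phi [Vh vE]]].
have Vi := Vgrp_inv hD Vh; have [uhi _] := Vi.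
have -> : v = (nu (\det h))^-1 *: lmul (invmx h) Phi - Phi.
  by apply: schwartzP => x; rewrite vE schwD schwN schwZ lmulE.
rewrite (linB lt) (linZ lt) tV // nuV // invrK scalerA mulVf ?scale1r ?subrr //.
exact: (nu_det_neq0 hD uA hnu).
Qed.

Lemma covariants_transport n (A : 'M[L]_n) (Q : lmodType C) (p : schwartz L n n -> Q) k :
  k \in unitmx -> covariants A p -> covariants (hconj k *m A *m k) (p \o lmul (invmx k)).
Proof.
move=> uk [lp sp pV pU]; have uki : invmx k \in unitmx by rewrite unitmx_inv.
have lk := @lmul_linear _ _ hD n n _ uk; have lki := @lmul_linear _ _ hD n n _ uki.
have kK (Phi : schwartz L n n) : lmul k (lmul (invmx k) Phi) = Phi.
  by apply: schwartzP => x; rewrite !lmulE // mulKmx.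
have kVK (Phi : schwartz L n n) : lmul (invmx k) (lmul k Phi) = Phi.
  by apply: schwartzP => x; rewrite !lmulE // mulKVmx.
have uhk : hconj k \in unitmx by rewrite unitmx_hconj.
split=> [a u v /=|w|h Psi [uh hh] /=|P t lt tV].
- by rewrite lki lp.
- by have [v <-] := sp w; exists (lmul k v) => /=; rewrite kVK.
- have V1 : Vgrp A (k *m h *m invmx k).
    split; first by rewrite !unitmx_mul uk uh.
    rewrite !hconjM // hconj_inv // -!mulmxA.
    apply: (can_inj (mulKmx uhk)); rewrite mulKVmx //.
    apply: (can_inj (mulmxK uk)); rewrite -!mulmxA mulVmx // mulmx1.
    by move: hh; rewrite !mulmxA.
  have -> : lmul (invmx k) (lmul h Psi) = lmul (k *m h *m invmx k) (lmul (invmx k) Psi).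
    apply: schwartzP => x; rewrite !lmulE ?unitmx_mul ?uk ?uh // !mulmxA mulVmx // mul1mx.
    by [].
  by rewrite pV // !det_mulmx det_inv mulrAC mulfV ?mul1r // -unitfE -unitmxE.
have [|h Psi Vh|tb ltb tbE] := pU P (t \o lmul k).
- by move=> a u v /=; rewrite lk lt.
- have [uh hh] := Vh; rewrite /=.
  have V1 : Vgrp (hconj k *m A *m k) (invmx k *m h *m k).
    split; first by rewrite !unitmx_mul uki uh.
    rewrite !hconjM // hconj_inv // -[in RHS]hh !mulmxA (mulmxKV uhk) (mulmxK uk).
    by [].
  have -> : lmul k (lmul h Psi) = lmul (invmx k *m h *m k) (lmul k Psi).
    apply: schwartzP => x; rewrite !lmulE ?unitmx_mul ?uki ?uh // !mulmxA mulmxV // mul1mx.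
    by [].
  by rewrite tV // !det_mulmx det_inv mulrAC mulVf ?mul1r // -unitfE -unitmxE.
by exists tb => // Psi; rewrite /= tbE /= kK.
Qed.

End ThetaQuotient.

Section LocalTheorem.
Context {R : realType} (D : local_ext R).
Local Notation C := R[i].
Local Notation K := (lbase D).
Local Notation L := (ltop D).
Local Notation cj := (@lconj R D).
Local Notation hermitian := (@Defs.hermitian R D _).
Hypothesis hD : quad_ext D.
Let hL := qe_local hD.
Hypothesis hpsi : good_char D.

Context {m : nat} (S : K) (A0 : 'M[L]_m) (chi lambda1 lambda0 nu : L -> C).
Hypotheses (m0 : (0 < m)%N) (S0 : S != 0) (hA0 : hermitian A0) (uA0 : A0 \in unitmx)
  (chiM : forall x y, x != 0 -> y != 0 -> chi (x * y) = chi x * chi y)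
  (chi_unit : forall x, x != 0 -> `|chi x| = 1)
  (chi_norm : forall x, x != 0 -> chi (x * cj x) = 1)
  (lambdaE : forall x, x != 0 -> lambda1 x * (chi x)^* = lambda0 x)
  (hnu : norm_one_char nu).
Local Notation S1m := (schwartz L 1 m).
Local Notation SM := (schwartz L (1 + m) (1 + m)).
Local Notation S0m := (schwartz L m m).
Local Notation A := (gramS S A0).
Local Notation mat := 'M[L]_((1 + m) + (1 + m)).
Local Notation af := (afun S A).
Let hA : hermitian A := gramS_herm hD S hA0.
Let uA : A \in unitmx := gramS_unit hD S0 uA0.
Variable om : mat -> S1m -> S1m.
Hypothesis hom : fj_weil_rep S chi om.
Variable Om : mat -> SM -> SM.
Hypothesis hOm : weil_rep A lambda1 Om.
Variable Om0 : 'M[L]_(m + m) -> S0m -> S0m.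
Hypothesis hOm0 : weil_rep A0 lambda0 Om0.
Context (Q0 : lmodType C) (p0 : S0m -> Q0) (Theta0 : 'M[L]_(m + m) -> Q0 -> Q0).
Hypotheses (hp0 : covariants nu A0 p0)
  (Theta0E : forall g Psi, Ugrp D m g -> Theta0 g (p0 Psi) = p0 (Om0 g Psi)).
Context (Q1 : lmodType C) (p1 : SM -> Q1) (Theta1 : mat -> Q1 -> Q1).
Hypotheses (hp1 : covariants nu A p1)
  (Theta1E : forall g Phi, Ugrp D (1 + m) g -> Theta1 g (p1 Phi) = p1 (Om g Phi)).
Local Notation omc := (conj_act om).
Local Notation I := (fj_haar om).
Let hI : haar I := fj_haar_haar hD hpsi hom.

Let lc_af (phi : S1m) : locally_const (phi \o af).
Proof. by apply: (lc_comp hL (schwartz_schv phi).1); exact: cts_afun. Qed.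

Lemma afunV h x : Vgrp A h -> af (h *m x) = af x.
Proof.
move=> [_ hh]; rewrite /afun -[x]hsubmxK mul_mx_row !row_mxKl !row_mxKr hconjM //.
by rewrite -[A in RHS]hh !mulmxA.
Qed.

Lemma smul_afV h (phi : S1m) (Phi : SM) : Vgrp A h ->
  smul (phi \o af) (lmul h Phi) = lmul h (smul (phi \o af) Phi).
Proof.
move=> Vh; have [uh _] := Vh; apply: schwartzP => x.
by rewrite lmulE // !smul_af // lmulE // afunV.
Qed.

Lemma smul_large (Phi : SM) : exists2 B0 : R, 0 < B0 & forall B, B0 <= B ->
  smul ((sbump 0 B : S1m) \o af) Phi = Phi.
Proof.
have [B1 B10 h1] := schv_supp (schwartz_schv Phi).
have [B2 h2] := bounded_afun hD S A B1.
exists (Num.max 1 (B2 + 1)) => [|B]; first by rewrite lt_max ltr01.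
rewrite ge_max => /andP[b1 b2]; have B0 : 0 < B by apply: lt_le_trans b1.
apply: schwartzP => x; rewrite smul_af // sbumpE // subr0.
have [->|nz] := eqVneq (Phi x) 0; first by rewrite mul0r.
by rewrite (le_lt_trans (h2 _ (h1 _ nz))) ?mulr1 // (lt_le_trans _ b2) // ltrDl ltr01.
Qed.

Variable IV : schwartz L (1 + m) 1 -> C.
Hypotheses (hIV : haar IV) (IVinv : forall h phi, Vgrp A h -> IV (lmul h phi) = IV phi).
Local Notation fi := (fiber_int S A0 I p0 nu IV).

Let lp0 : linear p0. Proof. by have [] := hp0. Qed.
Let sp0 : forall w, exists v, p0 v = w. Proof. by have [] := hp0. Qed.
Let p0V h Psi : Vgrp A0 h -> p0 (lmul h Psi) = (nu (\det h))^-1 *: p0 Psi.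
Proof. by have [_ _ h' _] := hp0; exact: h'. Qed.
Let lfi : linear fi := finf_linear hD S0 hA0 uA0 hI hnu lp0 p0V hIV.

Lemma finf_U X Y t (Phi : SM) (phi : S1m) :
  fi (smul (omc (umx X Y t) phi \o af) (Om (umx X Y t) Phi)) = fi (smul (phi \o af) Phi).
Proof.
rewrite -[RHS](finf_um hD S0 hA0 uA0 hI p0 nu IV X).
apply/eqP; rewrite -subr_eq0 -(linB lfi).
rewrite (finf_supp hD S0 hA0 uA0 hI nu lp0 hIV) // => x qx.
rewrite schwD schwN smul_af // (umx_act hD hpsi S0 hom hA hOm) //.
by rewrite rmulE ?uni_m_unit // smul_af // afun_um // subrr.
Qed.

Lemma Theta0_linear g : Ugrp D m g -> linear (Theta0 g).
Proof.
move=> hg a u v; have [Psi <-] := sp0 u; have [Psi' <-] := sp0 v.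
by rewrite -lp0 !Theta0E // (weil_linear hOm0 hg) lp0.
Qed.

(** At each x the frame k lies in U(V), so [Om] conjugated by k is a Weil representation for the
    same Gram matrix and [pairB_equiv] applies to it directly. In this way commutation of [Om] with
    U(V) is never invoked. *)
Lemma finf_equiv g (Phi : SM) (phi : S1m) : Ugrp D m g ->
  fi (smul (omc (emb_mx g) phi \o af) (Om (emb_mx g) Phi)) =
  Theta0 g (fi (smul (phi \o af) Phi)).
Proof.
move=> hg; have [lIV _ _] := hIV; have lT := Theta0_linear hg.
rewrite /fiber_int -(vint_post hL lIV lT); last first.
  exact: (schv_thicken hD S0 hA (fib_schX hD S0 hA0 uA0 hI hnu lp0 p0V _)).
congr (vint IV _); apply: funext => x /=; rewrite /thicken; case: ifP => tx; last by rewrite (lin0 lT).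
have [Vk _] := frameP hD S0 hA0 uA0 (hat_q hD hA tx).
set k := frame S A0 (hat S A x) in Vk; have [uk kA] := Vk.
rewrite /fib -/k (linZ lT) Theta0E //; congr (_ *: p0 _).
rewrite -(smul_afV phi Phi Vk) -(smul_afV (omc (emb_mx g) phi) (Om (emb_mx g) Phi) Vk).
have hOmk := weil_transport hD hpsi uk hA hOm; rewrite kA in hOmk.
have := pairB_equiv hD hpsi m0 S0 hA0 uA0 chiM chi_unit chi_norm lambdaE hom hOmk hOm0
  (lmul k Phi) phi hg.
rewrite /pairB (_ : lmul (invmx k) (lmul k Phi) = Phi) //.
by apply: schwartzP => z; rewrite !lmulE ?unitmx_inv // mulKVmx.
Qed.

Variables (Q T : lmodType C) (b : Q1 -> S1m -> T) (pq : T -> Q)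
  (FJ : 'M[L]_(m + m) -> Q -> Q).
Hypotheses (hb : is_tensor b)
  (hpq : is_quotient [set t | exists X Y s v Phi,
     t = b (Theta1 (umx X Y s) v) (omc (umx X Y s) Phi) - b v Phi] pq)
  (hFJ : is_rep (Ugrp D m) FJ)
  (FJE : forall g v Phi, Ugrp D m g ->
     FJ g (pq (b v Phi)) = pq (b (Theta1 (emb_mx g) v) (omc (emb_mx g) Phi))).

Let lp1 : linear p1. Proof. by have [] := hp1. Qed.
Let sp1 : forall w, exists v, p1 v = w. Proof. by have [] := hp1. Qed.

Lemma tensor_ext (P : lmodType C) (f g : T -> P) : linear f -> linear g ->
  (forall Phi phi, f (b (p1 Phi) phi) = g (b (p1 Phi) phi)) -> f =1 g.
Proof.
move=> lf lg fg; have [[bl br] univ] := hb.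
have bg : is_bilinear (fun v w => g (b v w)).
  by split=> [w a u v|v a u w]; rewrite ?bl ?br lg.
have [h _ uniq_h] := univ _ _ bg => t.
rewrite (uniq_h f) 1?(uniq_h g) //; split=> // v w.
by have [Phi <-] := sp1 v.
Qed.

Lemma graph_pairing : exists2 gb : Q -> Q0, linear gb &
  forall (Phi : SM) (phi : S1m), gb (pq (b (p1 Phi) phi)) = fi (smul (phi \o af) Phi).
Proof.
have [_ _ _ p1U] := hp1.
have exF (phi : S1m) : exists F : Q1 -> Q0, linear F /\ forall Phi, F (p1 Phi) = fi (smul (phi \o af) Phi).
  have [||F lF FE] := p1U Q0 (fun Phi => fi (smul (phi \o af) Phi)); last by exists F.
    by move=> a u v; rewrite (smul_linear hL (lc_af phi)) lfi.
  move=> h Phi Vh; rewrite smul_afV //.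
  exact: (finf_V hD S0 hA0 uA0 hI hnu lp0 p0V hIV IVinv).
have [F hF] := choice exF.
have bF : is_bilinear (fun v phi => F phi v).
  split=> [phi|v a phi psi]; first exact: (hF phi).1.
  have [Phi <-] := sp1 v; rewrite !(hF _).2 -lfi; congr (fi _); apply: schwartzP => x.
  by rewrite schwD schwZ !smul_af // schwD schwZ mulrDr mulrCA.
have [_ univ] := hb; have [g [lg gE] _] := univ _ _ bF.
have [|gb lgb gbE] := is_quotient_univ hpq lg.
  move=> _ [X [Y [s [v [phi ->]]]]]; have [Phi <-] := sp1 v.
  rewrite (linB lg) !gE Theta1E; last exact: Ugrp_umx.
  by rewrite !(hF _).2 finf_U subrr.
by exists gb => // Phi phi; rewrite gbE gE (hF _).2.
Qed.

Theorem local_iso : rep_iso (Ugrp D m) FJ Theta0.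
Proof.
have [[bl br] _] := hb; have [lpq spq _] := hpq; have [_ _ p1V _] := hp1.
have [_ _ _ p0U] := hp0.
have [gb lgb gbE] := graph_pairing.
pose beta (Phi : SM) (phi : S1m) := pq (b (p1 Phi) phi).
have betal phi : linear (beta^~ phi) by move=> a u v; rewrite /beta lp1 bl lpq.
have betar Phi : linear (beta Phi) by move=> a u v; rewrite /beta br lpq.
have betaU X Y t Phi phi : beta (Om (umx X Y t) Phi) (omc (umx X Y t) phi) = beta Phi phi.
  rewrite /beta -Theta1E; last exact: Ugrp_umx.
  have [_ _ kpq] := hpq; apply/eqP; rewrite -subr_eq0 -(linB lpq); apply/eqP/kpq.
  exists 1%N, (fun=> 1), (fun=> b (Theta1 (umx X Y t) (p1 Phi)) (omc (umx X Y t) phi) - b (p1 Phi) phi).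
  split; last by rewrite big_ord1 scale1r.
  by move=> _; exists X, Y, t, (p1 Phi), phi.
have [TT [lT TE T1 T2 TB]] := U_reduction hD hpsi S0 hom hA hOm betal betar betaU.
have T3 h Phi : Vgrp A h -> TT (lmul h Phi) = (nu (\det h))^-1 *: TT Phi.
  move=> Vh; have [B1 B10 h1] := TB Phi; have [B2 B20 h2] := TB (lmul h Phi).
  rewrite (h1 (Num.max B1 B2)) ?le_max ?lexx // (h2 (Num.max B1 B2)) ?le_max ?lexx ?orbT //.
  by rewrite /beta p1V // (linZ (bl _)) (linZ lpq).
have [tb ltb tbE] := orbit_factor hD S0 hA0 uA0 hI hIV IVinv hnu lp0 p0V p0U lT T1 T2 T3.
have gbK : cancel gb tb.
  move=> w; have [t <-] := spq w; move: t.
  apply: (tensor_ext (f := fun t => tb (gb (pq t)))) => // [a u v|Phi phi].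
    by rewrite lpq lgb ltb.
  by rewrite gbE -tbE -TE.
(* [fi] is onto, and every [Phi] is unchanged by [smul] with the indicator of a large ball composed
   with [af]. *)
have tbK : cancel tb gb.
  move=> v; have [Phi <-] := finf_surj hD S0 hA0 uA0 hI hIV hnu lp0 sp0 p0V v.
  have [B0 _ hB] := smul_large Phi.
  by rewrite -(hB _ (lexx _)) -tbE -TE /beta gbE.
exists gb; split=> //; first by exists tb.
move=> g w hg; have [t <-] := spq w; move: t; have lTh := Theta0_linear hg.
have [lFJ _ _] := hFJ.
apply: (tensor_ext (f := fun t => gb (FJ g (pq t))) (g := fun t => Theta0 g (gb (pq t)))).
- by move=> a u v; rewrite lpq (lFJ g hg) lgb.
- by move=> a u v; rewrite lpq lgb lTh.
move=> Phi phi; rewrite FJE // Theta1E; last exact: Ugrp_emb.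
by rewrite !gbE finf_equiv.
Qed.

End LocalTheorem.

Theorem fourier_jacobi_theta (R : realType) (D : local_ext R) (m : nat) (S : lbase D)
    (delta : R[i]) (A1 : 'M[ltop D]_(1 + m)) (A0 : 'M[ltop D]_m)
    (chi lambda1 lambda0 nu : ltop D -> R[i]) (Q1 Q0 Q : lmodType R[i])
    (Theta1 : 'M[ltop D]_((1 + m) + (1 + m)) -> Q1 -> Q1)
    (Theta0 : 'M[ltop D]_(m + m) -> Q0 -> Q0) (FJ : 'M[ltop D]_(m + m) -> Q -> Q) :
  quad_ext D -> (0 < m)%N -> ~~ odd m -> delta = 1 \/ delta = -1 -> S != 0 ->
  (forall x y, x != 0 -> y != 0 -> chi (x * y) = chi x * chi y) ->
  (forall x, x != 0 -> `|chi x| = 1) ->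
  (forall x, x != 0 -> chi (x * lconj (l := D) x) = 1) ->
  (forall x, x != 0 -> lambda1 x * (chi x)^* = lambda0 x) ->
  norm_one_char (D := D) nu ->
  gram_of_sign D delta A1 -> gram_of_sign D (delta * quad_char D S) A0 ->
  is_theta_lift D A1 lambda1 nu Theta1 -> is_theta_lift D A0 lambda0 nu Theta0 ->
  is_fourier_jacobi D S chi Theta1 FJ ->
  rep_iso (Ugrp D m) FJ Theta0.
Proof.
move=> hD m0 me hdelta S0 chiM chi_unit chi_norm lambdaE hnu hA1 hA0.
move=> [Om1 [p1 [hOm1 hq1 Th1]]] [Om0 [p0 [hOm0 hq0 Th0]]].
move=> [om [T [b [pq [hom hb hpq hFJ FJE]]]]].
have [h1 u1 _] := hA1; have [h0 u0 _] := hA0.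
have hpsi := weil_good_char hD m0 h0 u0 hOm0.
have [k uk kA] := gram_equiv hD me hdelta S0 hA1 hA0.
have hOm := weil_transport hD hpsi uk h1 hOm1; rewrite kA in hOm.
have hp1 := covariants_transport hD uk (theta_covariants hD hnu u1 hq1); rewrite kA in hp1.
have hp0 := theta_covariants hD hnu u0 hq0.
have uki : invmx k \in unitmx by rewrite unitmx_inv.
have hA := gramS_herm hD S h0.
(* The measure on V comes from the Weil representation: freezing all columns but one in [l] gives
   [IV], and the U(V)-invariance of [l] passes to [IV]. *)
pose l := weil_haar (fun g Phi => lmul k (Om1 g (lmul (invmx k) Phi))).
have hl : haar l by exact: (weil_haar_haar hD hpsi hOm).
have [IV hIV] := haar_exists_col hD hl.
have IVinv h phi : Vgrp (gramS S A0) h -> IV (lmul h phi) = IV phi.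
  move=> Vh; have [uh _] := Vh; apply: (column_haar_inv hD hl hIV uh) => // Phi.
  exact: (weil_haar_inv hD hpsi _ hA hOm Vh).
apply: (local_iso hD hpsi m0 S0 h0 u0 chiM chi_unit chi_norm lambdaE hnu hom hOm hOm0 hp0 Th0
  hp1 _ hIV IVinv hb hpq hFJ FJE).
move=> g Phi hg /=; rewrite Th1 //; congr p1.
by apply: schwartzP => x; rewrite !lmulE // mulKVmx.
Qed.

(** * Completions of number fields *)

Section Completions.
Context {R : realType} {M : fieldExtType rat} (w : finplace R M) (Mw : completion w).
Implicit Types (x y : Mw) (a n : nat) (r : rat).
Local Notation abs x := (@vabs R Mw x).

Let emb r : Mw := cinj Mw (r%:A).

Let emb_rmorph : {rmorphism rat -> Mw} := (cinj Mw \o in_alg M).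
Let embE r : emb r = emb_rmorph r. Proof. by []. Qed.

Lemma comp_abs0 : abs 0 = 0. Proof. exact/(cabs_eq0 (c := Mw)). Qed.

Lemma comp_abs_eq0 x : (abs x == 0) = (x == 0).
Proof. by apply/eqP/eqP => /(cabs_eq0 (c := Mw)). Qed.

Lemma comp_abs1 : abs 1 = 1.
Proof.
have n0 : abs 1 != 0 by rewrite comp_abs_eq0 oner_eq0.
by apply: (mulfI n0); rewrite -(cabsM (c := Mw)) !mulr1.
Qed.

Lemma comp_prime : exists2 p, prime p & abs p%:R = p%:R^-1.
Proof.
have [_ _ _ [p pp wp]] := finplaceP w; exists p => //.
by rewrite -(rmorph_nat (cinj Mw)) (cabs_inj Mw).
Qed.

(** The ultrametric inequality gives |p x| <= |x|. For negative |x| this contradicts |p x| = |x| /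
    p. *)
Lemma comp_abs_ge0 x : 0 <= abs x.
Proof.
have [p pp wp] := comp_prime; rewrite leNgt; apply/negP => x0.
have h n : abs (n.+1%:R * x) <= abs x.
  elim: n => [|n IH]; first by rewrite mul1r.
  rewrite -natr1 mulrDl mul1r; apply: le_trans (cabsD (c := Mw) _ _) _.
  by rewrite ge_max IH lexx.
have p1 : (1 < p)%N := prime_gt1 pp.
have := h p.-1; rewrite prednK ?prime_gt0 // (cabsM (c := Mw)) wp.
rewrite -{2}[abs x]mul1r ler_nM2r // leNgt invf_lt1 ?ltr1n ?p1 //.
by rewrite ltr0n prime_gt0.
Qed.

Lemma comp_absN x : abs (- x) = abs x.
Proof.
suff h : abs (-1) = 1 by rewrite -mulN1r (cabsM (c := Mw)) h mul1r.
have : abs (-1) ^+ 2 = 1 by rewrite expr2 -(cabsM (c := Mw)) mulrNN mulr1 comp_abs1.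
move/eqP; rewrite sqrf_eq1 => /orP[/eqP //|/eqP h].
by have := comp_abs_ge0 (-1); rewrite h lerNr oppr0 ler10.
Qed.

Lemma comp_absB x y : abs (x - y) <= Num.max (abs x) (abs y).
Proof. by rewrite -(comp_absN y); exact: cabsD. Qed.

Lemma comp_abs_nat a : abs a%:R <= 1.
Proof.
elim: a => [|a IH]; first by rewrite comp_abs0 ler01.
by rewrite -natr1; apply: le_trans (cabsD (c := Mw) _ _) _; rewrite ge_max IH comp_abs1 lexx.
Qed.

Lemma comp_char0 n : n.+1%:R != 0 :> Mw.
Proof.
rewrite -(rmorph_nat emb_rmorph) fmorph_eq0.
by rewrite pnatr_eq0.
Qed.

Lemma comp_absV x : abs x^-1 = (abs x)^-1.
Proof.
have [->|x0] := eqVneq x 0; first by rewrite invr0 comp_abs0 invr0.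
have a0 : abs x != 0 by rewrite comp_abs_eq0.
by apply: (mulfI a0); rewrite -(cabsM (c := Mw)) !mulfV // comp_abs1.
Qed.

Section Residue.
Variable p : nat.
Hypotheses (pp : prime p) (wp : abs p%:R = p%:R^-1).

Lemma comp_p_lt1 : abs p%:R < 1.
Proof. by rewrite wp invf_lt1 ?ltr1n ?prime_gt1 // ltr0n prime_gt0. Qed.

Lemma comp_coprime a : coprime a p -> abs a%:R = 1.
Proof.
move=> ap; apply/eqP; rewrite eq_le comp_abs_nat /= leNgt; apply/negP => a1.
have a0 : (0 < a)%N.
  by case: (a) ap => //; rewrite /coprime gcd0n => /eqP p1; have := prime_gt1 pp; rewrite p1.
case: (egcdnP p a0) => km kn; rewrite (eqP ap) => e _.
have : abs ((km * a)%:R - (kn * p)%:R) = 1 by rewrite e natrD addrC addKr comp_abs1.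
apply/eqP; rewrite lt_eqF //; apply: le_lt_trans (comp_absB _ _) _.
rewrite !natrM !(cabsM (c := Mw)) gt_max; apply/andP; split.
  by apply: le_lt_trans a1; rewrite ler_piMl ?comp_abs_ge0 ?comp_abs_nat.
by apply: le_lt_trans comp_p_lt1; rewrite ler_piMl ?comp_abs_ge0 ?comp_abs_nat.
Qed.

Lemma comp_abs_int (z : int) : abs z%:~R = abs (`|z|%N)%:R.
Proof. by case: z => n //; rewrite NegzE mulrNz comp_absN. Qed.

(** The denominator is prime to p, since otherwise the numerator would be a unit and |r| > 1; a
    Bezout relation inverts it modulo p. *)
Lemma comp_rat_res r : abs (emb r) <= 1 ->
  exists2 a, (a < p)%N & abs (emb r - a%:R) <= abs p%:R.
Proof.
move=> r1; pose nn := numq r; pose d := (`|denq r|)%N.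
have dE : denq r = d%:Z by rewrite /d absz_denq.
have rE : emb r * d%:R = nn%:~R.
  have -> : d%:R = emb d%:R by rewrite embE rmorph_nat.
  rewrite embE -rmorphM; have -> : r * d%:R = nn%:~R.
    by rewrite /nn -{1}(divq_num_den r) dE divfK // intr_eq0 -dE denq_neq0.
  exact: rmorph_int.
have dp : coprime d p.
  rewrite coprime_sym prime_coprime //; apply/negP => pd.
  have np : coprime `|nn|%N p.
    by have := coprime_num_den r; rewrite -/d -/nn; apply: coprime_dvdr.
  have := congr1 (@vabs R Mw) rE; rewrite (cabsM (c := Mw)) comp_abs_int (comp_coprime np) => e.
  have /dvdnP[k dk] := pd; move: e; rewrite dk natrM !(cabsM (c := Mw)) => /eqP.
  rewrite lt_eqF //; apply: le_lt_trans comp_p_lt1; rewrite mulrA ler_piMl ?comp_abs_ge0 //.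
  by rewrite mulr_ile1 ?comp_abs_ge0 ?comp_abs_nat.
have d0 : (0 < d)%N by rewrite -ltz_nat -dE denq_gt0.
case: (egcdnP p d0) => u k; rewrite (eqP dp) => e _.
pose z := (nn * u%:Z)%R; pose a := `|(z %% p%:Z)%Z|%N.
have p0 : (p%:Z != 0)%R by rewrite eqz_nat -lt0n prime_gt0.
have aE : a%:Z = (z %% p%:Z)%Z by rewrite /a gez0_abs // modz_ge0.
exists a; first by rewrite -ltz_nat aE ltz_mod.
have zE : (z%:~R : Mw) = ((z %/ p%:Z)%Z)%:~R * p%:R + a%:R.
  by rewrite {1}(divz_eq z p) rmorphD rmorphM /= -aE.
have int1 (y : int) : abs y%:~R <= 1 by rewrite comp_abs_int comp_abs_nat.
have -> : emb r - a%:R = (emb r - z%:~R) + ((z %/ p%:Z)%Z)%:~R * p%:R.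
  by rewrite zE; ring.
apply: le_trans (cabsD (c := Mw) _ _) _; rewrite ge_max; apply/andP; split; last first.
  by rewrite (cabsM (c := Mw)) ler_piMl ?comp_abs_ge0.
have -> : emb r - z%:~R = - (emb r * (k * p)%:R).
  have -> : (k * p)%:R = (u * d)%:R - 1 :> Mw by rewrite e natrD addrK.
  by rewrite /z rmorphM /= -rE natrM; ring.
rewrite comp_absN natrM !(cabsM (c := Mw)) mulrA ler_piMl ?comp_abs_ge0 //.
by rewrite mulr_ile1 ?comp_abs_ge0 ?comp_abs_nat.
Qed.

Lemma comp_rat_lt1 r : abs (emb r) < 1 -> abs (emb r) <= abs p%:R.
Proof.
move=> r1; have [a ap ha] := comp_rat_res (ltW r1).
have [a0|a0] := posnP a; first by move: ha; rewrite a0 subr0.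
have ac : abs a%:R = 1.
  apply: comp_coprime; rewrite coprime_sym prime_coprime //; apply/negP => /dvdn_leq.
  by move=> /(_ a0); rewrite leqNgt ap.
have : abs a%:R < 1; last by rewrite ac ltxx.
have -> : a%:R = emb r - (emb r - a%:R) by ring.
apply: le_lt_trans (comp_absB _ _) _; rewrite gt_max r1 /=; exact: le_lt_trans ha comp_p_lt1.
Qed.

(** Linear independence over F_p of the classes of the s_i modulo p, phrased with p-integral
    rational coefficients. *)
Definition rat_indep n (s : 'I_n -> Mw) : Prop := forall k : 'I_n -> rat,
  (forall i, abs (emb (k i)) <= 1) -> abs (\sum_i emb (k i) * s i) <= abs p%:R ->
  forall i, abs (emb (k i)) < 1.

Lemma max_norm n (k : 'I_n -> rat) (j : 'I_n) : exists i : 'I_n,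
  forall l, abs (emb (k l)) <= abs (emb (k i)).
Proof.
have [i _ h] := @arg_maxP _ R 'I_n j xpredT (fun l => abs (emb (k l))) isT.
by exists i => l; exact: h.
Qed.

(** Approximate the s_i modulo p by elements of M. A rational relation among these, divided by its
    largest coefficient, has p-integral coefficients one of which is 1, against independence. *)
Lemma rat_indep_bound n (s : 'I_n -> Mw) : (forall i, abs (s i) <= 1) -> rat_indep s ->
  (n <= \dim {:M})%N.
Proof.
move=> s1 ind; have p0 : 0 < abs p%:R by rewrite wp invr_gt0 ltr0n prime_gt0.
have fx i : {f : M | abs (cinj Mw f - s i) < abs p%:R}.
  by apply: cid; exact: cdense.
pose f := [tuple sval (fx i) | i < n].
rewrite leqNgt; apply/negP => nd.
have : ~~ free f.
  apply: contraL nd => /eqP fr; rewrite -leqNgt.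
  by have := dimvS (subvf <<f>>%VS); rewrite /= fr size_tuple.
move=> /freeP hf; apply: hf => k k0; apply/ (_ : forall i, k i = 0).
apply: contrapT => /existsNP[j kj].
have [i hi] := max_norm k j.
have ki : k i != 0.
  apply/eqP => ki; apply: kj; apply/eqP; rewrite -(fmorph_eq0 emb_rmorph) -comp_abs_eq0.
  by have := hi j; rewrite ki (rmorph0 emb_rmorph : emb 0 = 0) comp_abs0 eq_le comp_abs_ge0 andbT.
have ai : 0 < abs (emb (k i)) by rewrite lt0r comp_abs_ge0 andbT comp_abs_eq0 (fmorph_eq0 emb_rmorph).
have e1 l : abs (emb (k l / k i)) <= 1.
  by rewrite embE rmorphM fmorphV (cabsM (c := Mw)) comp_absV ler_pdivrMr // mul1r hi.
have : abs (emb (k i / k i)) < 1.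
  apply: (ind (fun l => k l / k i)) => //.
  have e0 : \sum_l emb (k l / k i) * cinj Mw (f`_l) = 0.
    have -> : \sum_l emb (k l / k i) * cinj Mw (f`_l) =
        cinj Mw ((k i)^-1 *: \sum_l k l *: f`_l).
      rewrite scaler_sumr rmorph_sum; apply: eq_bigr => l _.
      by rewrite /emb -rmorphM /= mulr_algl scalerA [(k i)^-1 * _]mulrC.
    by rewrite k0 scaler0 rmorph0.
  rewrite -[X in abs X <= _]subr0 -[X in _ - X]e0 -sumrB.
  apply: (big_ind (fun x => abs x <= abs p%:R)) => [|x y hx hy|l _].
  - by rewrite comp_abs0 ltW.
  - by apply: le_trans (cabsD (c := Mw) _ _) _; rewrite ge_max hx.
  rewrite -mulrBr (cabsM (c := Mw)); apply: le_trans (_ : _ <= 1 * abs p%:R) _; last by rewrite mul1r.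
  apply: ler_pM; rewrite ?comp_abs_ge0 //.
  rewrite -comp_absN opprB ltW //; have := svalP (fx l).
  by rewrite -(tnth_nth 0 f) tnth_mktuple.
by rewrite mulfV // embE rmorph1 comp_abs1 ltxx.
Qed.

(** A maximal family independent modulo p exists by the bound and spans the integers modulo p over
    F_p, so this quotient is finite. Here the finite degree over the rationals yields local
    compactness. *)
Lemma residue_cover : exists s : seq Mw, forall x, abs x <= 1 ->
  exists2 y, y \in s & abs (x - y) <= abs p%:R.
Proof.
pose P n := `[< exists2 s : 'I_n -> Mw, (forall i, abs (s i) <= 1) & rat_indep s >].
have [||n /asboolP[s s1 ind] nmax] := @ex_maxnP P (\dim {:M}).
- exists 0%N; apply/asboolP; exists (fun=> 0) => [i|k _ _ i]; first by rewrite comp_abs0.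
  by case: i.
- by move=> n /asboolP[s s1 ind]; exact: rat_indep_bound ind.
exists [seq \sum_i (nat_of_ord (f i))%:R * s i | f : {ffun 'I_n -> 'I_p}] => x x1.
pose s' := fun i : 'I_(1 + n) => if fintype.split i is inr j then s j else x.
have s'l : s' (lshift n ord0) = x by rewrite /s'; case: splitP => [j _ //|j] /=.
have s'r j : s' (rshift 1 j) = s j.
  rewrite /s'; case: splitP => [i /=|j' /=]; last by move/eqP; rewrite eqSS => /eqP /val_inj ->.
  by move=> e; have := ltn_ord i; rewrite -e.
have nind : ~ rat_indep s'.
  move=> h; have := nmax n.+1; rewrite ltnn => h'; suff : false by []; apply: h'.
  apply/asboolP; exists s' => // i; rewrite /s'.
  by case: (@fintype.split 1 n i).
move/existsNP: nind => [k /not_implyP[k1 /not_implyP[hk /existsNP[j hj]]]].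
pose b := k (lshift n ord0); pose k' i := k (rshift 1 i).
have sumE : \sum_i emb (k i) * s' i = emb b * x + \sum_i emb (k' i) * s i.
  rewrite big_split_ord /= big_ord1 s'l; congr (_ + _).
  by apply: eq_bigr => i _; rewrite s'r.
(* If the coefficient of [x] were not a unit, the relation would reduce modulo p to one among the
   independent s_i, and all its coefficients would be divisible by p. *)
have b1 : abs (emb b) = 1.
  apply/eqP; rewrite eq_le k1 /= leNgt; apply/negP => bl1.
  have hk' i : abs (emb (k' i)) < 1.
    apply: ind => [{}i|]; first exact: k1.
    have -> : \sum_i emb (k' i) * s i = (\sum_i emb (k i) * s' i) - emb b * x.
      by rewrite sumE addrC addKr.
    apply: le_trans (comp_absB _ _) _; rewrite ge_max hk (cabsM (c := Mw)) /=.
    apply: le_trans (_ : _ <= abs p%:R * 1) _; last by rewrite mulr1.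
    by apply: ler_pM; rewrite ?comp_abs_ge0 // comp_rat_lt1.
  apply: hj; case: (split_ordP j) => i ->; last exact: hk'.
  by rewrite (ord1 i).
have b0 : emb b != 0 by rewrite -comp_abs_eq0 b1 oner_eq0.
have kbE l : emb (- k' l / b) = - emb (k' l) / emb b.
  by rewrite [LHS](rmorphM emb_rmorph) (rmorphN emb_rmorph) (fmorphV emb_rmorph).
have hc l : abs (emb (- k' l / b)) <= 1.
  by rewrite kbE (cabsM (c := Mw)) comp_absN comp_absV b1 divr1; exact: k1.
have /choice[a ha] i : exists a : 'I_p, abs (emb (- k' i / b) - a%:R) <= abs p%:R.
  by have [a ap h] := comp_rat_res (hc i); exists (Ordinal ap).
exists (\sum_i (nat_of_ord (a i))%:R * s i).
  apply/codomP; exists [ffun i => a i] => /=.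
  by apply: eq_bigr => i _; rewrite ffunE.
have -> : x - \sum_i (nat_of_ord (a i))%:R * s i = (emb b)^-1 * (\sum_i emb (k i) * s' i) +
    \sum_i (emb (- k' i / b) - (nat_of_ord (a i))%:R) * s i.
  rewrite sumE mulrDr mulKf // -addrA; congr (_ + _); rewrite mulr_sumr -big_split /= -sumrN.
  apply: eq_bigr => i _; rewrite kbE; ring.
apply: le_trans (cabsD (c := Mw) _ _) _; rewrite ge_max (cabsM (c := Mw)) comp_absV b1 invr1 mul1r hk.
apply: (big_ind (fun x => abs x <= abs p%:R)) => [|y z hy hz|i _].
- by rewrite comp_abs0 comp_abs_ge0.
- by apply: le_trans (cabsD (c := Mw) _ _) _; rewrite ge_max hy.
rewrite (cabsM (c := Mw)); apply: le_trans (_ : _ <= abs p%:R * 1) _; last by rewrite mulr1.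
by apply: ler_pM; rewrite ?comp_abs_ge0 //; exact: ha.
Qed.

Lemma residue_cover_iter n : exists s : seq Mw, forall x, abs x <= 1 ->
  exists2 y, y \in s & abs (x - y) <= abs p%:R ^+ n.
Proof.
have [s0 h0] := residue_cover.
have p0 : 0 < abs p%:R by rewrite wp invr_gt0 ltr0n prime_gt0.
have pn : (p%:R : Mw) != 0 by rewrite -comp_abs_eq0 gt_eqF.
elim: n => [|n [s hs]].
  by exists [:: 0] => x x1; exists 0; rewrite ?inE // subr0 expr0.
exists [seq y + p%:R * z | y <- s0, z <- s] => x x1.
have [y ys xy] := h0 x x1.
have [|z zs hz] := hs ((x - y) / p%:R).
  by rewrite (cabsM (c := Mw)) comp_absV ler_pdivrMr // mul1r.
exists (y + p%:R * z); first by apply/allpairsP; exists (y, z).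
have -> : x - (y + p%:R * z) = p%:R * ((x - y) / p%:R - z) by field.
by rewrite (cabsM (c := Mw)) exprS ler_pM2l.
Qed.

End Residue.

Lemma completion_local : local_field Mw.
Proof.
have [p pp wp] := comp_prime.
split.
- exact: (cabs_eq0 (c := Mw)).
- exact: (cabsM (c := Mw)).
- exact: (cabsD (c := Mw)).
- exact: comp_abs_ge0.
- exact: (ccomplete (c := Mw)).
- move=> e e0; have [n hn] := expr_small (comp_abs_ge0 p%:R) (comp_p_lt1 pp wp) e0.
  have [s hs] := residue_cover_iter pp wp n; exists s => x /hs[y ys xy].
  by exists y => //; exact: le_lt_trans xy hn.
- exists p; split; last exact: comp_p_lt1.
  by rewrite wp invr_gt0 ltr0n prime_gt0.
exact: comp_char0.
Qed.

End Completions.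

(** * Continuous extension of field embeddings to completions *)

Section ExtMap.
Context {R : realType} {M N : fieldExtType rat} (j : {rmorphism M -> N}).
Context {v : finplace R M} {w : finplace R N} (Mv : completion v) (Nw : completion w).
Hypothesis hvw : forall f, w (j f) = v f.
Let hM := completion_local Mv.
Let hN := completion_local Nw.
Local Notation iM := (cinj Mv).
Local Notation iN := (cinj Nw).
Local Notation ext := (@ext_map R M N j v w Mv Nw).
Local Notation is_ext x y := (forall e : R, 0 < e -> exists f : M,
    vabs (iM f - x) < e /\ vabs (iN (j f) - y) < e).

Lemma ext_iso f g : vabs (iN (j f) - iN (j g)) = vabs (iM f - iM g).
Proof. by rewrite -!rmorphB !cabs_inj hvw. Qed.

Lemma small_eq (K : vfield R) (hK : local_field K) (x y : K) :
  (forall e : R, 0 < e -> vabs (x - y) < e) -> x = y.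
Proof.
move=> h; apply/eqP; rewrite -subr_eq0 -(abs_eq0 hK); apply/eqP.
by apply/eqP; rewrite eq_le labs_ge0 // andbT leNgt; apply/negP => /h; rewrite ltxx.
Qed.

Lemma is_ext_unique x y y' : is_ext x y -> is_ext x y' -> y = y'.
Proof.
move=> h h'; apply: (small_eq hN) => e e0; have [f [f1 f2]] := h e e0.
have [g [g1 g2]] := h' e e0.
have -> : y - y' = (iN (j f) - iN (j g)) - (iN (j f) - y) + (iN (j g) - y') by ring.
apply: le_lt_trans (labsD hN _ _) _; rewrite gt_max g2 andbT.
apply: le_lt_trans (absB hN _ _) _; rewrite gt_max f2 andbT ext_iso.
have -> : iM f - iM g = (iM f - x) - (iM g - x) by ring.
by apply: le_lt_trans (absB hM _ _) _; rewrite gt_max f1.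
Qed.

Lemma is_ext_exists x : exists y, is_ext x y.
Proof.
have [p [p1 /andP[p0 pl]]] := abs_small_ex hM.
have /choice[f hf] (n : nat) : exists g : M, vabs (iM g - x) < (vabs (p%:R : Mv)) ^+ n.
  by apply: cdense; rewrite exprn_gt0.
have small e : 0 < e -> exists n : nat, forall i, (n <= i)%N -> vabs (iM (f i) - x) < e.
  move=> e0; have [n hn] := expr_small (ltW p0) pl e0; exists n => i ni.
  apply: lt_trans (hf i) _; apply: le_lt_trans hn.
  by rewrite ler_wiXn2l // ltW.
have [e e0|y hy] := ccomplete (c := Nw) (u := fun n => iN (j (f n))).
  have [n hn] := small e e0; exists n => a b na nb; rewrite ext_iso.
  have -> : iM (f a) - iM (f b) = (iM (f a) - x) - (iM (f b) - x) by ring.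
  by apply: le_lt_trans (absB hM _ _) _; rewrite gt_max !hn.
exists y => e e0; have [n hn] := small e e0; have [n' hn'] := hy e e0.
by exists (f (maxn n n')); rewrite hn ?hn' ?leq_maxl ?leq_maxr.
Qed.

Lemma extP x : is_ext x (ext x).
Proof.
rewrite /ext_map; case: xgetP => [y _ //|none].
by have [y hy] := is_ext_exists x; have := none y hy.
Qed.

Lemma extE x y : is_ext x y -> ext x = y.
Proof. exact: is_ext_unique (extP x). Qed.

Lemma ext_inj f : ext (iM f) = iN (j f).
Proof.
by apply: extE => e e0; exists f; rewrite !subrr (abs0 hM) (abs0 hN).
Qed.

Lemma ext1 : ext 1 = 1.
Proof. by rewrite -(rmorph1 iM) ext_inj !rmorph1. Qed.

Lemma extD : {morph ext : x y / x + y}.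
Proof.
move=> x y; apply: extE => e e0; have [f [f1 f2]] := extP x e0; have [g [g1 g2]] := extP y e0.
exists (f + g); rewrite !rmorphD; split.
  have -> : iM f + iM g - (x + y) = (iM f - x) + (iM g - y) by ring.
  by apply: le_lt_trans (labsD hM _ _) _; rewrite gt_max f1.
have -> : iN (j f) + iN (j g) - (ext x + ext y) = (iN (j f) - ext x) + (iN (j g) - ext y) by ring.
by apply: le_lt_trans (labsD hN _ _) _; rewrite gt_max f2.
Qed.

Lemma near_mul (K : vfield R) (hK : local_field K) (a b x y : K) (B e : R) :
  1 <= B -> e <= 1 -> vabs x <= B -> vabs y <= B -> vabs (a - x) < e -> vabs (b - y) < e ->
  vabs (a * b - x * y) < B * e.
Proof.
move=> B1 e1 xB yB ax by'.
have -> : a * b - x * y = (a - x) * (b - y) + (a - x) * y + x * (b - y) by ring.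
have B0 : 0 < B by apply: lt_le_trans B1.
have e0 : 0 < e by apply: le_lt_trans ax; exact: labs_ge0.
apply: le_lt_trans (labsD hK _ _) _; rewrite gt_max; apply/andP; split.
  apply: le_lt_trans (labsD hK _ _) _; rewrite gt_max !(labsM hK); apply/andP; split.
    apply: ltr_pM; rewrite ?labs_ge0 //; first exact: lt_le_trans ax (le_trans e1 B1).
  rewrite mulrC; apply: le_lt_trans (_ : _ <= B * vabs (a - x)) _.
    by rewrite ler_wpM2r ?labs_ge0.
  by rewrite ltr_pM2l.
rewrite (labsM hK); apply: le_lt_trans (_ : _ <= B * vabs (b - y)) _.
  by rewrite ler_wpM2r ?labs_ge0.
by rewrite ltr_pM2l.
Qed.

Lemma extM : {morph ext : x y / x * y}.
Proof.
move=> x y; apply: extE => e e0.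
pose B := Num.max 1 (Num.max (Num.max (vabs x) (vabs y)) (Num.max (vabs (ext x)) (vabs (ext y)))).
have B1 : 1 <= B by rewrite le_max lexx.
have B0 : 0 < B by apply: lt_le_trans B1.
pose d := Num.min 1 (e / B); have d0 : 0 < d by rewrite lt_min ltr01 divr_gt0.
have d1 : d <= 1 by rewrite ge_min lexx.
have Bd : B * d <= e by rewrite mulrC -ler_pdivlMr // ge_min lexx orbT.
have [f [f1 f2]] := extP x d0; have [g [g1 g2]] := extP y d0.
exists (f * g); rewrite !rmorphM; split; apply: lt_le_trans Bd.
  by apply: (near_mul hM) => //; rewrite /B !le_max lexx ?orbT.
by apply: (near_mul hN) => //; rewrite /B !le_max lexx ?orbT.
Qed.

Lemma ext_abs x : vabs (ext x) = vabs x.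
Proof.
have [->|x0] := eqVneq x 0.
  by rewrite -(rmorph0 iM) ext_inj !rmorph0 (abs0 hM) (abs0 hN).
have y0 : ext x != 0.
  apply: contraNneq (oner_neq0 Nw) => y0.
  by rewrite -ext1 -(mulfV x0) extM y0 mul0r.
pose e := Num.min (vabs x) (vabs (ext x)).
have e0 : 0 < e by rewrite lt_min !(abs_gt0 hM, abs_gt0 hN) x0.
have [f [f1 f2]] := extP x e0.
have h1 : vabs (iM f) = vabs x by apply: (abs_near_eq hM); apply: lt_le_trans f1 _; rewrite ge_min lexx.
have h2 : vabs (iN (j f)) = vabs (ext x).
  by apply: (abs_near_eq hN); apply: lt_le_trans f2 _; rewrite ge_min lexx orbT.
by rewrite -h1 -h2 !cabs_inj hvw.
Qed.

(** The extension is an isometry from a complete field, so its image is closed. *)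
Lemma ext_range z : (forall e : R, 0 < e -> exists f, vabs (iN (j f) - z) < e) ->
  exists x, ext x = z.
Proof.
move=> hz; have [p [p1 /andP[p0 pl]]] := abs_small_ex hM.
have /choice[f hf] (n : nat) : exists g : M, vabs (iN (j g) - z) < (vabs (p%:R : Mv)) ^+ n.
  by apply: hz; rewrite exprn_gt0.
have small e : 0 < e -> exists n : nat, forall i, (n <= i)%N -> vabs (iN (j (f i)) - z) < e.
  move=> e0; have [n hn] := expr_small (ltW p0) pl e0; exists n => i ni.
  apply: lt_trans (hf i) _; apply: le_lt_trans hn.
  by rewrite ler_wiXn2l // ltW.
have [e e0|x hx] := ccomplete (c := Mv) (u := fun n => iM (f n)).
  have [n hn] := small e e0; exists n => a b na nb; rewrite -ext_iso.
  have -> : iN (j (f a)) - iN (j (f b)) = (iN (j (f a)) - z) - (iN (j (f b)) - z) by ring.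
  by apply: le_lt_trans (absB hN _ _) _; rewrite gt_max !hn.
exists x; apply: extE => e e0; have [n hn] := small e e0; have [n' hn'] := hx e e0.
by exists (f (maxn n n')); rewrite hn ?hn' ?leq_maxl ?leq_maxr.
Qed.

End ExtMap.

(** * The quadratic extension of number fields and its involution *)

Section QuadraticSubfield.
Context {F E : fieldExtType rat} (incl : {rmorphism F -> E}) (c : {rmorphism E -> E}).
Hypotheses (dimE : \dim {: E} = (2 * \dim {: F})%N) (cF : forall x, c (incl x) = incl x).

Lemma rmorph_in_alg (A B : fieldExtType rat) (f : {rmorphism A -> B}) (r : rat) :
  f (r%:A) = r%:A.
Proof.
have h (T : fieldExtType rat) : r%:A = (numq r)%:~R / (denq r)%:~R :> T.
  rewrite -[in LHS](divq_num_den r) -[_%:A]/(in_alg T _) rmorphM fmorphV /=.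
  by rewrite -!/(in_alg T _) !rmorph_int.
by rewrite !h rmorphM fmorphV !rmorph_int.
Qed.

(** The map (a, b) -> a + b x0 is linear over the rationals and injective, as otherwise x0 would lie
    in F and be fixed by [c]; the dimensions agree, so it is onto. *)
Lemma quad_decomp x0 : c x0 != x0 -> forall e, exists a b, e = incl a + incl b * x0.
Proof.
move=> cx0 e.
pose phi (ab : F * F) : E := incl ab.1 + incl ab.2 * x0.
have lphi : linear phi.
  have inclZ r a : incl (r *: a) = r *: incl a.
    by rewrite -mulr_algl rmorphM rmorph_in_alg mulr_algl.
  move=> r [a b] [a' b']; rewrite /phi /= !rmorphD !inclZ mulrDl -scalerAl addrACA.
  by rewrite -scalerDr.
pose phiL : {linear (F * F)%type -> E} := HB.pack phi (GRing.isLinear.Build _ _ _ _ phi lphi).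
have ker0 : lker (linfun phiL) == 0%VS.
  apply/eqP/vspaceP => -[a b]; rewrite memv_ker memv0 lfunE /= /phi /=.
  apply/idP/idP => [/eqP h|/eqP[-> ->]]; last by rewrite !rmorph0 mul0r addr0.
  have [b0|b0] := eqVneq b 0.
    move: h; rewrite b0 rmorph0 mul0r addr0 => /eqP; rewrite fmorph_eq0 => /eqP ->.
    by [].
  case/eqP: cx0; have ib : incl b != 0 by rewrite fmorph_eq0.
  have -> : x0 = incl (- a / b).
    apply: (mulfI ib); rewrite [in RHS]rmorphM rmorphN fmorphV mulrCA mulfV // mulr1.
    by apply/eqP; rewrite -addr_eq0 addrC h.
  exact: cF.
have : e \in limg (linfun phiL).
  suff -> : limg (linfun phiL) = fullv by exact: memvf.
  apply/eqP; rewrite eqEdim subvf /= dimE limg_dim_eq; last by rewrite (eqP ker0) capv0.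
  by rewrite !dimvf mul2n -addnn.
by move/memv_imgP => [[a b] _ ->]; exists a, b; rewrite lfunE.
Qed.

(** Both x0 and c x0 are roots of X^2 - b X - a with a, b in F. Subtracting and dividing by x0 - c
    x0 gives x0 + c x0 = b. *)
Lemma quad_trace x0 : c x0 != x0 -> exists t, x0 + c x0 = incl t.
Proof.
move=> cx0; have [a [b e]] := quad_decomp cx0 (x0 ^+ 2).
have ce : c x0 ^+ 2 = incl a + incl b * c x0.
  by rewrite -rmorphXn e rmorphD rmorphM !cF.
exists b; apply: (@mulfI _ (x0 - c x0)); first by rewrite subr_eq0 eq_sym.
by rewrite -subr_sqr e ce; ring.
Qed.

Lemma quad_trace_in x0 e : c x0 != x0 -> exists t, e + c e = incl t.
Proof.
move=> cx0; have [a [b ->]] := quad_decomp cx0 e; have [t ht] := quad_trace cx0.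
exists (a + a + b * t); rewrite !rmorphD !rmorphM !cF -ht; ring.
Qed.

Lemma quad_invol x0 : c x0 != x0 -> involutive c.
Proof.
move=> cx0 e; have [a [b ->]] := quad_decomp cx0 e; have [t ht] := quad_trace cx0.
have cE : c x0 = incl t - x0 by rewrite -ht addrC addKr.
by rewrite !rmorphD !rmorphM !cF cE rmorphB cF cE opprB; ring.
Qed.

End QuadraticSubfield.

(** * Local components of Hecke characters *)

Section NormOneCharacters.
Context {R : realType} (D : local_ext R).
Local Notation C := R[i].
Local Notation L := (ltop D).
Local Notation cj := (@lconj R D).
Hypothesis hD : quad_ext D.
Let hL := qe_local hD.
Variable theta : L -> C.
Hypothesis htheta : quasichar theta.
Local Notation gamma := (gamma_char D theta).
Local Notation nu := (natural_char D gamma).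

Let theta_neq0 x : x != 0 -> theta x != 0. Proof. by have [h _ _] := htheta; exact: h. Qed.
Let thetaM x y : x != 0 -> y != 0 -> theta (x * y) = theta x * theta y.
Proof. by have [_ h _] := htheta; exact: h. Qed.
Let cjn0 x : x != 0 -> cj x != 0. Proof. by rewrite cj_eq0. Qed.

Let gammaM x y : x != 0 -> y != 0 -> gamma (x * y) = gamma x * gamma y.
Proof.
move=> x0 y0; rewrite /gamma_char (cjM hD) !thetaM ?cjn0 // invfM; ring.
Qed.

(** Two representatives differ by a factor fixed by conjugation, on which gamma is trivial, so the
    choice in [natural_char] does not matter. *)
Lemma natural_charE x : x != 0 -> nu (x / cj x) = gamma x.
Proof.
move=> x0; rewrite /natural_char; case: xgetP => [z _ [x' x'0 [e ->]]|none].
  pose r := x / x'; have r0 : r != 0 by rewrite mulf_neq0 // invr_eq0.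
  have cr : cj r = r.
    have [c0 c0'] := (cjn0 x0, cjn0 x'0).
    have h : x = x' / cj x' * cj x by rewrite -e divfK.
    rewrite /r (cjM hD) cjV // [in RHS]h; field.
    by rewrite c0' x'0.
  have -> : x = r * x' by rewrite /r divfK.
  rewrite gammaM //; have -> : gamma r = 1 by rewrite /gamma_char cr mulfV // theta_neq0.
  by rewrite mul1r.
by have := none (gamma x); case; exists x.
Qed.

Lemma hilbert90 y : y * cj y = 1 -> exists2 x, x != 0 & y = x / cj x.
Proof.
move=> yy; have y0 : y != 0 by apply: contraNneq (oner_neq0 L) => y0; rewrite -yy y0 mul0r.
(* The representative 1 + y works unless y = -1; in that case any nonzero element of trace 0, such
   as z - cj z, does. *)
have [y1|y1] := eqVneq (1 + y) 0; last first.
  exists (1 + y) => //; have c1 := cjn0 y1; apply: (mulIf c1); rewrite divfK //.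
  by rewrite (cjD hD) (cj1 hD) mulrDr mulr1 yy addrC.
have [z hz] := cj_nontriv hD; pose x := z - cj z.
have x0 : x != 0 by rewrite subr_eq0 eq_sym.
exists x => //; have -> : cj x = - x by rewrite /x (cjD hD) cjN // (cjK hD) opprB.
by rewrite invrN mulrN mulfV //; apply/eqP; rewrite -addr_eq0 addrC y1.
Qed.

Lemma natural_char_norm_one : norm_one_char (D := D) nu.
Proof.
split=> [x y xx yy|x xx|].
- have [a a0 ->] := hilbert90 xx; have [b b0 ->] := hilbert90 yy.
  have -> : a / cj a * (b / cj b) = (a * b) / cj (a * b) by rewrite (cjM hD) invfM; ring.
  by rewrite !natural_charE ?mulf_neq0 // gammaM.
- have [a a0 ->] := hilbert90 xx; rewrite natural_charE // /gamma_char mulf_neq0 ?invr_eq0 //.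
    exact: theta_neq0.
  by apply: theta_neq0; exact: cjn0.
have [_ _ [e e0 he]] := htheta; have a2 := abs2_gt0 hL.
have n2 : (2 : L) != 0 by rewrite -(abs_gt0 hL).
exists (Num.min 1 e * vabs (2 : L)); first by rewrite mulr_gt0 // lt_min ltr01.
(* Halving the Hilbert 90 representative does not change x / cj x and makes x close to 1 when y
   is. *)
move=> y yy y1; pose x := (1 + y) / 2.
have x1 : vabs (x - 1) < Num.min 1 e.
  have -> : x - 1 = (y - 1) / 2 by rewrite /x; field.
  by rewrite (labsM hL) (absV hL) ltr_pdivrMr.
have x0 : x != 0.
  apply: contraTneq x1 => ->; rewrite sub0r (absN hL) (abs1 hL) -leNgt.
  by rewrite ge_min lexx.
have c0 := cjn0 x0; have cx1 : vabs (cj x - 1) < Num.min 1 e.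
  have -> : cj x - 1 = cj (x - 1) by rewrite (cjD hD) cjN // (cj1 hD).
  by rewrite (cj_abs hD).
have -> : y = x / cj x.
  apply: (mulIf c0); rewrite divfK // /x (cjM hD) (cjD hD) (cj1 hD) cjV // (cj_nat hD 2).
  by rewrite mulrA mulrDr mulr1 yy addrC.
move: x1 cx1; rewrite !lt_min => /andP[_ x1] /andP[_ cx1].
by rewrite natural_charE // /gamma_char !he // invr1 mulr1.
Qed.

End NormOneCharacters.

Lemma cis_norm (R : realType) (t : R) : `|cis t| = 1.
Proof. by rewrite /cis normc_def /= cos2Dsin2 sqrtr1. Qed.

Lemma std_char_norm (R : realType) (M : fieldType) (w : finplace R M) (K : completion w) (x : K) :
  `|std_char x| = 1.
Proof.
rewrite /std_char; case: xgetP => [z _ [t [r [p [k [_ _ _ _ ->]]]]]|_]; last exact: normr1.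
exact: cis_norm.
Qed.

(** Evaluate the intertwiner on d(x) d(y) = d(x y): the two resulting scalars agree on a vector that
    is not killed. For [quad_char] this supplies the index-two property of norms. *)
Lemma twist_iso_char (R : realType) (K : vfield R) (V : lmodType R[i])
    (pi : 'M[K]_2 -> V -> V) (chi : K -> R[i]) :
  smooth_irreducible pi -> rep_iso [set x : 'M[K]_2 | x \in unitmx] pi (twist_by pi chi) ->
  forall x y, x != 0 -> y != 0 -> chi (x * y) = chi x * chi y.
Proof.
move=> [hrep _ [v0 v0n] _] [f [lf [f' fK f'K] fpi]] x y x0 y0.
have [_ pi1 piM] := hrep; have [lpi _ _] := hrep.
pose d (t : K) : 'M[K]_2 := mx2 t 0 0 1.
have det_d t : \det (d t) = t.
  rewrite (expand_det_row _ 0) !big_ord_recl big_ord0 /cofactor !det_mx11 !mxE /=.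
  by rewrite !mul0r !addr0 expr0 !mul1r mulr1.
have ud t : t != 0 -> d t \in unitmx by move=> t0; rewrite unitmxE det_d unitfE.
have dM : d x *m d y = d (x * y).
  apply/matrixP => i j; rewrite !mxE !big_ord_recl big_ord0 !mxE /=.
  by case: eqP => _; case: eqP => _; rewrite ?(mulr0, mul0r, mulr1, addr0, add0r).
have [ux uy] := (ud x x0, ud y y0).
have uxy : d (x * y) \in unitmx by rewrite ud ?mulf_neq0.
have h1 v : chi (x * y) *: pi (d (x * y)) (f v) = (chi x * chi y) *: pi (d (x * y)) (f v).
  transitivity (f (pi (d (x * y)) v)); first by rewrite fpi // /twist_by det_d.
  rewrite -dM piM // fpi // fpi // /twist_by !det_d.
  by rewrite (linZ (lpi _ ux)) scalerA -piM.
have [v hv] : exists v, pi (d (x * y)) (f v) != 0.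
  exists (f' (pi (invmx (d (x * y))) v0)); rewrite f'K -piM //=; last by rewrite unitmx_inv.
  by rewrite mulmxV // pi1.
have := h1 v; move/eqP; rewrite -subr_eq0 -scalerBl scaler_eq0 (negPf hv) orbF subr_eq0.
by move/eqP.
Qed.

(** * The local quadratic extension at a nonsplit place *)

Section LocalExtension.
Context {R : realType} {F E : fieldExtType rat}.
Context (incl : {rmorphism F -> E}) (c : {rmorphism E -> E}).
Hypothesis hCM : CM_extension R incl c.
Context (Fv : completions R F) (Ew : completions R E) (w : finplace R E).
Hypothesis hnonsplit : forall w' : finplace R E, res incl w' =1 res incl w -> w' = w.
Local Notation v := (res incl w).
Local Notation D := (local_ext_at incl c Fv Ew v w).
Let dimE : \dim {: E} = (2 * \dim {: F})%N. Proof. by have [] := hCM. Qed.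
Let cF x : c (incl x) = incl x. Proof. by have [_ _ _ h _] := hCM. Qed.
Let cnt : exists x, c x != x. Proof. by have [] := hCM. Qed.

Let cK : involutive c.
Proof. by have [x0 cx0] := cnt; have := quad_invol dimE cF cx0. Qed.

Lemma res_conj : res c w = w.
Proof. by apply: hnonsplit => x /=; rewrite cF. Qed.

Let cw x : w (c x) = w x.
Proof. by rewrite -[in RHS]res_conj. Qed.

Let upv x : w (incl x) = v x. Proof. by []. Qed.
Let hE := completion_local (Ew w).
Local Notation cj := (ext_map c (Ew w) : Ew w -> Ew w).

(** A fixed [z] is half its own trace, so half the trace of an approximation in E, which lies in F,
    is close to it; thus the fixed field is the completion of F. *)
Lemma conj_trace (z : Ew w) (e : R) : cj z = z -> 0 < e ->
  exists f, vabs (cinj (Ew w) (incl f) - z) < e.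
Proof.
move=> cz e0; have [x0 cx0] := cnt; have a2 := abs2_gt0 hE.
have n2 : (2 : Ew w) != 0 by rewrite -(abs_gt0 hE).
have [g [g1 g2]] := extP (Ew w) cw z (mulr_gt0 e0 a2); rewrite cz in g2.
have [t ht] := quad_trace_in dimE cF g cx0.
exists (t / 2); rewrite !fmorph_div !rmorph_nat -ht rmorphD.
have -> : (cinj (Ew w) g + cinj (Ew w) (c g)) / 2 - z =
    ((cinj (Ew w) g - z) + (cinj (Ew w) (c g) - z)) / 2 by field.
rewrite (labsM hE) (absV hE) ltr_pdivrMr //.
by apply: le_lt_trans (labsD hE _ _) _; rewrite gt_max g1.
Qed.

Lemma local_ext_quad (V : lmodType R[i]) (pi : 'M[Fv v]_2 -> V -> V) :
  smooth_irreducible pi ->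
  rep_iso [set x : 'M[Fv v]_2 | x \in unitmx] pi (twist_by pi (quad_char D)) ->
  quad_ext D.
Proof.
move=> hirr hdih; split.
- exact: hE.
- exact: (extD _ cw).
- exact: (extM _ cw).
- exact: (ext1 _ _ cw).
- move=> x; apply: (extE cw) => e e0; have [f [f1 f2]] := extP (Ew w) cw x e0.
  by exists (c f); rewrite cK.
- exact: (ext_abs _ cw).
- have [x0 cx0] := cnt; exists (cinj (Ew w) x0).
  by rewrite [X in X != _](ext_inj _ _ cw) (inj_eq (fmorph_inj _)).
- exact: (extD _ upv).
- exact: (extM _ upv).
- exact: (ext1 _ _ upv).
- move=> y; split=> [cy|[x <-]]; last first.
    apply: (extE cw) => e e0; have [f [f1 f2]] := extP (Ew w) upv x e0.
    by exists (incl f); rewrite cF.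
  apply: (ext_range (Fv v) upv) => e e0; exact: conj_trace.
- exact: std_char_norm.
exact: twist_iso_char hirr hdih.
Qed.

End LocalExtension.

Lemma finplace_eq (R : realType) (M : fieldType) (w w' : finplace R M) : w =1 w' -> w = w'.
Proof.
case: w => a ha; case: w' => b hb /= /funext ab; move: ha hb; rewrite ab => ha hb.
by congr Finplace; exact: Prop_irrelevance.
Qed.

Section LocalComponents.
Context {R : realType} {M : fieldExtType rat} (Mv : completions R M) (w : finplace R M).
Implicit Types x y : Mv w.

Lemma idele_at_in x : (idele_at x).2 w = x. Proof. exact: eqtype.dfwith_in. Qed.

Lemma idele_at_out x w' : w != w' -> (idele_at x).2 w' = 1.
Proof. by move=> h; exact: eqtype.dfwith_out. Qed.

Lemma idele_at_is x : x != 0 -> is_idele (idele_at x).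
Proof.
move=> x0; split=> [s|s s' _|w'|] /=; [exact: oner_neq0|by rewrite rmorph1| |].
  have [<-|h] := eqVneq w w'; first by rewrite eqtype.dfwith_in.
  by rewrite eqtype.dfwith_out // oner_neq0.
apply: (sub_finite_set (B := [set w])) => // w' /=; have [e _|h] := eqVneq w w'; first by rewrite e.
by rewrite eqtype.dfwith_out // comp_abs1 eqxx.
Qed.

Lemma idele_atM x y : idele_at (x * y) = idele_mul (idele_at x) (idele_at y).
Proof.
rewrite /idele_mul /idele_at /=; congr pair; first by apply: funext => s; rewrite mulr1.
apply: functional_extensionality_dep => w'; have [<-|h] := eqVneq w w'; first by rewrite !eqtype.dfwith_in.
by rewrite !eqtype.dfwith_out // mulr1.
Qed.

Lemma loc_compM (chi : idele Mv -> R[i]) x y : hecke_char chi -> x != 0 -> y != 0 ->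
  loc_comp chi (x * y) = loc_comp chi x * loc_comp chi y.
Proof.
by move=> [_ hM _ _] x0 y0; rewrite /loc_comp idele_atM hM //; exact: idele_at_is.
Qed.

Lemma loc_comp_norm (chi : idele Mv -> R[i]) x : unitary_char chi -> x != 0 ->
  `|loc_comp chi x| = 1.
Proof. by move=> hu x0; apply: hu; exact: idele_at_is. Qed.

End LocalComponents.

Section NormTriviality.
Context {R : realType} {F E : fieldExtType rat}.
Context (incl : {rmorphism F -> E}) (c : {rmorphism E -> E}).
Hypothesis hCM : CM_extension R incl c.
Context (Fv : completions R F) (Ew : completions R E) (w : finplace R E).
Hypothesis hnonsplit : forall w' : finplace R E, res incl w' =1 res incl w -> w' = w.
Local Notation v := (res incl w).
Local Notation D := (local_ext_at incl c Fv Ew v w).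
Hypothesis hD : quad_ext D.
Variable chi : idele Ew -> R[i].
Hypothesis hres : forall x : idele Fv, is_idele x ->
  chi (idele_map incl Ew x) = quad_idele_char incl c Ew x.

Lemma ext_one (w' : finplace R E) : ext_map incl (Ew w') (1 : Fv (res incl w')) = 1.
Proof. exact: (ext1 (Fv (res incl w')) (Ew w')). Qed.

Lemma ext_conj_one (w' : finplace R E) : ext_map c (Ew w') (1 : Ew (res c w')) = 1.
Proof. exact: (ext1 (Ew (res c w')) (Ew w')). Qed.

(** As w is the only place above v, all other coordinates of the image are 1. *)
Lemma idele_map_at (t : Fv v) : idele_map incl Ew (idele_at t) =
  idele_at (ext_map incl (Ew w) t).
Proof.
rewrite /idele_map /idele_at /=; congr pair.
apply: functional_extensionality_dep => w'; have [<-|h] := eqVneq w w'; first by rewrite !eqtype.dfwith_in.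
rewrite !eqtype.dfwith_out //; first exact: ext_one.
by apply: contra_neq h => h; apply/esym/hnonsplit => x; rewrite h.
Qed.

Lemma conj_idele_at (x : Ew w) w' : (idele_map c Ew (idele_at x)).2 w' =
  (idele_at (ext_map c (Ew w) x)).2 w'.
Proof.
have rc := res_conj hCM hnonsplit.
have gen (w2 : finplace R E) : w2 = w -> ext_map c (Ew w) ((idele_at x).2 w2) = ext_map c (Ew w) x.
  by move=> ->; rewrite idele_at_in.
have [<-|h] := eqVneq w w'; first by rewrite idele_at_in; exact: gen.
rewrite idele_at_out //=; have -> : eqtype.dfwith (fun w'' : finplace R E => 1 : Ew w'') x (res c w') = 1.
  apply: eqtype.dfwith_out; apply: contra_neq h => h; apply: finplace_eq => e.
  have [_ dimE _ cF [x0 cx0]] := hCM.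
  by rewrite -{1}rc /= {1}h /= (quad_invol dimE cF cx0).
exact: ext_conj_one.
Qed.

(** The idele with the local norm at v and 1 elsewhere is the global norm of the idele with [x] at
    w, so the global quadratic character takes the value 1 on it. *)
Lemma loc_comp_norm_eq1 (x : Ew w) : x != 0 ->
  loc_comp chi (x * lconj (l := D) x) = 1.
Proof.
move=> x0; pose t := Defs.down (D := D) (x * lconj (l := D) x).
have ct : lconj (l := D) (x * lconj (l := D) x) = x * lconj (l := D) x.
  by rewrite (cjM hD) (cjK hD) mulrC.
have tE : ext_map incl (Ew w) t = x * lconj (l := D) x := up_down hD ct.
have n0 : x * lconj (l := D) x != 0.
  by rewrite mulf_neq0 // (cj_eq0 hD).
have t0 : t != 0.
  apply: contraNneq n0 => t0; rewrite -tE t0; apply/eqP; exact: (up0 hD).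
rewrite /loc_comp -tE -idele_map_at hres; last exact: idele_at_is.
rewrite /quad_idele_char; case: asboolP => // -[].
exists 1, (idele_at x); split; [exact: oner_neq0|exact: idele_at_is|].
rewrite idele_map_at tE.
rewrite [LHS]surjective_pairing [RHS]surjective_pairing; congr pair.
  by apply: funext => s; rewrite /= !rmorph1 !mul1r.
apply: functional_extensionality_dep => w'.
transitivity ((idele_at x).2 w' * (idele_map c Ew (idele_at x)).2 w').
  by rewrite conj_idele_at idele_atM.
by rewrite /= !rmorph1 mul1r.
Qed.

End NormTriviality.

Theorem theorem5p8 (R : realType)
  (F E : fieldExtType rat)
  (incl : {rmorphism F -> E}) (c : {rmorphism E -> E})
  (hCM : CM_extension R incl c)
  (Fv : completions R F) (Ew : completions R E)
  (d : nat) (emb : 'I_d -> {rmorphism F -> R})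
  (hemb : all_real_embeddings emb)
  (* the primitive Hilbert eigenform h, its central character *)
  (level : finplace R F -> nat) (wt : 'I_d -> nat)
  (omega_h : idele Fv -> R[i]) (h : gl2_ad Fv d -> R[i])
  (hh : primitive_eigenform emb level wt omega_h h)
  (* the unitary Hecke characters chi_- and vartheta^+ of E *)
  (chi_minus vartheta_plus : idele Ew -> R[i])
  (hchi : hecke_char chi_minus) (hchi_unitary : unitary_char chi_minus)
  (hchi_res : forall x : idele Fv, is_idele x ->
     chi_minus (idele_map incl Ew x) = quad_idele_char incl c Ew x)
  (hvth : hecke_char vartheta_plus) (hvth_unitary : unitary_char vartheta_plus)
  (hvth_res : forall x : idele Fv, is_idele x ->
     vartheta_plus (idele_map incl Ew x) = omega_h x)
  (* a nonsplit finite place v, and the place w of E above it *)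
  (v : finplace R F) (w : finplace R E)
  (hvw : res incl w =1 v)
  (hnonsplit : forall w' : finplace R E, res incl w' =1 v -> w' =1 w) :
  let D := local_ext_at incl c Fv Ew v w in
  let chi_v := quad_char D in
  forall
  (* the local component pi_{h,v} *)
  (V : lmodType R[i]) (pi : 'M[Fv v]_2 -> V -> V)
  (hpi : local_component Fv h v pi)
  (hsc : supercuspidal pi)
  (hdih : rep_iso [set x : 'M[Fv v]_2 | x \in unitmx] pi (twist_by pi chi_v))
  (* the character theta_v *)
  (theta : Ew w -> R[i])
  (htheta : quasichar theta)
  (htheta_reg : exists2 x : Ew w, x != 0 & theta x != theta (lconj (l := D) x))
  (hparam : parameter_is_induced D pi theta)
  (m : nat) (hm : (2 <= m)%N) (hm_even : ~~ odd m)
  (delta : R[i]) (hdelta : delta = 1 \/ delta = -1)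
  (S : Fv v) (hS : S != 0),
  let chi_minus_v := loc_comp chi_minus (w := w) in
  let vartheta_plus_v := loc_comp vartheta_plus (w := w) in
  let lambda n := lambda_char D n vartheta_plus_v chi_minus_v theta in
  let gamma_nat := natural_char D (gamma_char D theta) in
  forall
  (* the Hermitian spaces V_{m+1}^delta and V_m^(delta chi_v(S)) *)
  (A1 : 'M[Ew w]_(1 + m)) (hA1 : gram_of_sign D delta A1)
  (A0 : 'M[Ew w]_m) (hA0 : gram_of_sign D (delta * chi_v S) A0)
  (* the theta lifts *)
  (Q1 : lmodType R[i]) (Theta1 : 'M[Ew w]_((1 + m) + (1 + m)) -> Q1 -> Q1)
  (hTheta1 : is_theta_lift D A1 (lambda (1 + m)%N) gamma_nat Theta1)
  (Q0 : lmodType R[i]) (Theta0 : 'M[Ew w]_(m + m) -> Q0 -> Q0)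
  (hTheta0 : is_theta_lift D A0 (lambda m) gamma_nat Theta0)
  (* the Fourier-Jacobi module of the first one *)
  (Q : lmodType R[i]) (FJ : 'M[Ew w]_(m + m) -> Q -> Q)
  (hFJ : is_fourier_jacobi D S chi_minus_v Theta1 FJ),
  rep_iso (Ugrp D m) FJ Theta0.

Proof.
move=> D chi_v V pi hpi hsc hdih theta htheta htheta_reg hparam m hm hm_even delta hdelta S hS.
move=> chi_minus_v vartheta_plus_v lambda gamma_nat A1 hA1 A0 hA0 Q1 Theta1 hTheta1 Q0 Theta0 hTheta0.
move=> Q FJ hFJ.
have e : v = res incl w by apply/esym/finplace_eq.
subst v.
have hns (w' : finplace R E) : res incl w' =1 res incl w -> w' = w.
  by move=> /hnonsplit /finplace_eq.
have hD : quad_ext D by exact: (local_ext_quad hCM hns hsc.1 hdih).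
have chiM x y : x != 0 -> y != 0 -> chi_minus_v (x * y) = chi_minus_v x * chi_minus_v y.
  exact: loc_compM.
have chi_unit x : x != 0 -> `|chi_minus_v x| = 1 by exact: loc_comp_norm.
have chi_norm x : x != 0 -> chi_minus_v (x * lconj (l := D) x) = 1.
  exact: (loc_comp_norm_eq1 hCM hns hD hchi_res).
(* Since m is even, the two characters differ by the value of chi_- at the conjugate of x. This
   equals the complex conjugate of chi_-(x), because chi_- is unitary and trivial on norms. *)
have lambdaE x : x != 0 -> lambda (1 + m)%N x * (chi_minus_v x)^* = lambda m x.
  move=> x0; have cx0 : lconj (l := D) x != 0 by rewrite (cj_eq0 hD).
  have -> : (chi_minus_v x)^* = chi_minus_v (lconj (l := D) x).
    have n0 : chi_minus_v x != 0 by rewrite -normr_eq0 chi_unit // oner_neq0.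
    apply: (mulfI n0); rewrite -chiM // chi_norm // -normCK chi_unit //.
    by rewrite expr1n.
  rewrite /lambda /lambda_char /vartheta_char oddD !(negPf hm_even) /=.
  by rewrite invfM invrK; ring.
exact: (fourier_jacobi_theta hD (ltnW hm) hm_even hdelta hS chiM chi_unit chi_norm lambdaE
  (natural_char_norm_one hD htheta) hA1 hA0 hTheta1 hTheta0 hFJ).
Qed.
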